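(* Assume $\Sigma$ is reduced. Let $\alpha\in\Sigma$, let $\Omega\subseteq\mathbb{A}$ be non-empty and finite, $L=\langle(U_\alpha)_{\mathbb{F}},(U_{-\alpha})_{\mathbb{F}}\rangle$, $N=\operatorname{Nor}_{G_{\mathbb{F}}}(A_{\mathbb{F}})\cap L$ and $N_\Omega=\{n\in N:n.p=p\text{ for all }p\in\Omega\}$. Then the pointwise stabilizer of $\Omega$ in $L$ satisfies $$\operatorname{Stab}_L(\Omega)=\langle U_{\alpha,\Omega},U_{-\alpha,\Omega},N_\Omega\rangle=U_{\alpha,\Omega}\,U_{-\alpha,\Omega}\,N_\Omega.$$
   Context: Let $\mathbb{K},\mathbb{F}$ be real closed fields with $\mathbb{K}\subseteq\mathbb{R}\cap\mathbb{F}$. Let $O\subsetneq\mathbb{F}$ be an order convex subring ($a,b\in O$ and $a\le c\le b$ imply $c\in O$); it is a valuation ring. Let $\Lambda=\mathbb{F}^\times/O^\times$, written additively, and let $v:\mathbb{F}\to\Lambda\cup\{\infty\}$ be the associated valuation, with $\Lambda$ ordered so that $(-v)(a)\ge(-v)(b)$ whenever $a\ge b>0$; thus $O=\{a:(-v)(a)\le 0\}$. For a semialgebraic set $V$ defined over $\mathbb{K}$, $V_{\mathbb{F}}$ denotes its $\mathbb{F}$-extension. $G<\operatorname{SL}_n$ is a connected semisimple algebraic group over $\mathbb{K}$, self-adjoint ($g\in G$ implies $g^{\mathsf T}\in G$). $S<G$ is a maximal $\mathbb{K}$-split torus with $s=s^{\mathsf T}$ for all $s\in S$; $A_{\mathbb{F}}$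 is the $\mathbb{F}$-extension of the semialgebraic connected component of $S_{\mathbb{K}}$ containing $\operatorname{Id}$; $K_{\mathbb{F}}=G_{\mathbb{F}}\cap\operatorname{SO}_n(\mathbb{F})$. Let $\mathfrak{g}=\operatorname{Lie}(G_{\mathbb{R}})$, $\mathfrak{a}=\operatorname{Lie}(A_{\mathbb{R}})$; $\Sigma\subseteq\mathfrak{a}^\star$ is the root system of $\mathfrak{g}$ with respect to $\mathfrak{a}$, with root spaces $\mathfrak{g}_\alpha$; reduced means $\alpha\in\Sigma\Rightarrow2\alpha\notin\Sigma$. Root groups: $(U_\alpha)_{\mathbb{F}}=\exp((\mathfrak{g}_\alpha)_{\mathbb{F}}\oplus(\mathfrak{g}_{2\alpha})_{\mathbb{F}})$ (with $\mathfrak{g}_{2\alpha}=0$ in the reduced case). For $\alpha\in\Sigma$, $\chi_\alpha:A_{\mathbb{F}}\to\mathbb{F}_{>0}$ is the restriction of the algebraic character of $S$ over $\mathbb{K}$ which over $\mathbb{R}$ satisfies $\chi_\alpha(\exp H)=e^{\alpha(H)}$, $H\in\mathfrak{a}$. Fix a basis $\Delta$ of $\Sigma$; let $A^+_{\mathbb{F}}=\{a\in A_{\mathbb{F}}:\chi_\alpha(a)\ge1\ \forall\alpha\in\Delta\}$. $G_{\mathbb{F}}$ acts on symmetric positive definite matrices of determinant $1$ over $\mathbb{F}$ by $g.x=gxg^{\mathsf T}$, and $\mathcal{X}_{\mathbb{F}}=G_{\mathbb{F}}.\operatorname{Id}$. For $x=g.\operatorname{Id}$, $y=h.\operatorname{Id}$,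 $\delta_{\mathbb{F}}(x,y)$ is the unique $a\in A^+_{\mathbb{F}}$ with $g^{-1}h\in K_{\mathbb{F}}aK_{\mathbb{F}}$. For $a\in A_{\mathbb{F}}$, $N_{\mathbb{F}}(a)=\prod_{\alpha\in\Sigma}\max\{\chi_\alpha(a),\chi_\alpha(a)^{-1}\}$, and $d(x,y)=(-v)(N_{\mathbb{F}}(\delta_{\mathbb{F}}(x,y)))\in\Lambda$, a $G_{\mathbb{F}}$-invariant pseudo-distance. $\mathcal{B}=\mathcal{X}_{\mathbb{F}}/\!\sim$ with $x\sim y$ iff $d(x,y)=0$, with the induced $G_{\mathbb{F}}$-action; $o\in\mathcal{B}$ is the class of $\operatorname{Id}$; $\mathbb{A}=A_{\mathbb{F}}.o\subseteq\mathcal{B}$. For $\beta\in\Sigma$ and $\Omega\subseteq\mathbb{A}$, $U_{\beta,\Omega}=\{u\in(U_\beta)_{\mathbb{F}}:u.p=p\text{ for all }p\in\Omega\}$. *)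

(* Defs.v *)
From HB Require Import structures.
From mathcomp Require Import all_boot all_order all_algebra.
From mathcomp Require Import all_classical all_reals all_analysis.
(* The notations of mpoly clash with those of analysis. *)
From mathcomp Require mpoly.
Import (canonicals) mpoly.
From mathcomp Require Import complex.

Set Implicit Arguments.
Unset Strict Implicit.
Unset Printing Implicit Defensive.

Import Order.TTheory GRing.Theory Num.Theory.
Import numFieldNormedType.Exports.

Local Open Scope classical_set_scope.
Local Open Scope ring_scope.

(* Polynomials over k in the n * n entries of a matrix (ordered by [mxvec]). *)
Notation entry_poly k n := (mpoly.mpoly (n * n)%N k).

(* Value at A of p, whose coefficients are pushed into L along i. *)
Definition pval (k L : fieldType) (i : k -> L) n (p : entry_poly k n)
    (A : 'M[L]_n) : L :=
  mpoly.mmap i (fun j => mxvec A 0 j) p.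

(* The L-points of the algebraic set cut out by the equations P over k. *)
Definition zeros (k L : fieldType) (i : k -> L) n (P : seq (entry_poly k n)) :
    set 'M[L]_n :=
  [set A | forall p, p \in P -> pval i p A = 0].

Section MatrixGroups.
Variables (L : fieldType) (n : nat).
Implicit Types (A B G H : set 'M[L]_n).

Definition mx_group H : Prop :=
  [/\ H `<=` [set g | g \in unitmx], H 1%:M,
      forall g h, H g -> H h -> H (g *m h)
    & forall g, H g -> H (invmx g)].

Definition generated_mx A : set 'M[L]_n :=
  [set g | forall H, mx_group H -> A `<=` H -> H g].

Definition mulset A B : set 'M[L]_n := [set a *m b | a in A & b in B].

Definition derived_mx H : set 'M[L]_n :=
  generated_mx [set invmx g *m invmx h *m g *m h | g in H & h in H].

Definition mx_solvable H : Prop := exists m, iter m derived_mx H = [set 1%:M].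

Definition mx_normal H G : Prop :=
  H `<=` G /\ forall g h, G g -> H h -> H (g *m h *m invmx g).

Definition normalizer_mx G A : set 'M[L]_n :=
  [set g | G g /\ [set g *m a *m invmx g | a in A] = A].

Definition zariski_closed A : Prop :=
  exists P : seq (entry_poly L n), A = zeros idfun P.

Definition zariski_connected A : Prop :=
  forall B C, zariski_closed B -> zariski_closed C ->
    B `|` C = A -> B `&` C = set0 -> B = set0 \/ C = set0.

End MatrixGroups.

Section AlgebraicGroups.
Variables (K : rcfType) (n : nat).
Implicit Types (P Q : seq (entry_poly K n)).

(* An algebraic set over K is identified with its points over the algebraic
   closure K[i] of K. *)
Definition geom P : set 'M[K[i]]_n := zeros (real_complex K) P.

Definition algebraic_subgroup_SL P : Prop :=
  mx_group (geom P) /\ geom P `<=` [set g | \det g = 1].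

(* Triviality of the radical. *)
Definition semisimple_mx P : Prop :=
  forall H : set 'M[K[i]]_n,
    zariski_closed H -> zariski_connected H -> mx_group H ->
    mx_normal H (geom P) -> mx_solvable H -> H = [set 1%:M].

Definition self_adjoint P : Prop := forall g, geom P g -> geom P g^T.

(* The matrix with entries the Laurent polynomials phi at t: the variables of
   phi are the coordinates of t followed by their inverses. *)
Definition laurent_val r (phi : 'M[mpoly.mpoly (r + r)%N K]_n)
    (t : 'rV[K[i]]_r) : 'M[K[i]]_n :=
  map_mx (mpoly.mmap (real_complex K)
            (fun j => row_mx t (map_mx GRing.inv t) 0 j)) phi.

Definition coords_val r (psi : 'I_r -> entry_poly K n) (s : 'M[K[i]]_n) :
    'rV[K[i]]_r :=
  \row_j pval (real_complex K) (psi j) s.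

(* A K-split torus in SL_n: an algebraic subgroup isomorphic over K to a power
   of the multiplicative group; phi and psi are the two mutually inverse
   isomorphisms. *)
Definition split_torus Q : Prop :=
  algebraic_subgroup_SL Q /\
  exists r (phi : 'M[mpoly.mpoly (r + r)%N K]_n)
           (psi : 'I_r -> entry_poly K n),
    [/\ forall t : 'rV[K[i]]_r, (forall j, t 0 j != 0) ->
          geom Q (laurent_val phi t) /\ coords_val psi (laurent_val phi t) = t,
        forall s, geom Q s ->
          (forall j, coords_val psi s 0 j != 0) /\
          laurent_val phi (coords_val psi s) = s
      & forall s s', geom Q s -> geom Q s' -> forall j,
          coords_val psi (s *m s') 0 j =
          coords_val psi s 0 j * coords_val psi s' 0 j].

Definition maximal_split_torus P Q : Prop :=
  [/\ split_torus Q, geom Q `<=` geom P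
    & forall Q', split_torus Q' -> geom Q' `<=` geom P ->
        geom Q `<=` geom Q' -> geom Q' = geom Q].

(* Regular functions on a closed subset of SL_n are polynomials in the
   entries. *)
Definition torus_character Q (p : entry_poly K n) : Prop :=
  (forall s, geom Q s -> pval (real_complex K) p s != 0) /\
  (forall s s', geom Q s -> geom Q s' ->
     pval (real_complex K) p (s *m s') =
     pval (real_complex K) p s * pval (real_complex K) p s').

End AlgebraicGroups.

(* A finite union of basic sets, each given by finitely many equations f = 0
   and finitely many strict inequalities g > 0. *)
Definition sa_data (k : fieldType) n :=
  seq (seq (entry_poly k n) * seq (entry_poly k n)).

Definition sa_set (k L : rcfType) (i : k -> L) n (phi : sa_data k n) :
    set 'M[L]_n :=
  [set A | exists2 b, b \in phi &
     (forall f, f \in b.1 -> pval i f A = 0) /\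
     (forall g, g \in b.2 -> 0 < pval i g A)].

Definition semialgebraic (k : rcfType) n (V : set 'M[k]_n) : Prop :=
  exists phi : sa_data k n, V = sa_set idfun phi.

(* The L2-extension of a semialgebraic set V over L1 that is defined over k;
   by Tarski-Seidenberg it does not depend on the description phi of V. *)
Definition sa_ext (k L1 L2 : rcfType) (i1 : k -> L1) (i2 : k -> L2) n
    (V : set 'M[L1]_n) : set 'M[L2]_n :=
  [set A | exists2 phi : sa_data k n, V = sa_set i1 phi & sa_set i2 phi A].

Section SemialgebraicConnectedness.
Variables (k : rcfType) (n : nat).
Implicit Types (U V : set 'M[k]_n).

Definition rel_open V U : Prop :=
  forall A, U A -> exists2 e : k, 0 < e &
    forall B, V B -> (forall i j, `|B i j - A i j| < e) -> U B.

Definition sa_connected V : Prop :=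
  forall U1 U2, semialgebraic U1 -> semialgebraic U2 ->
    rel_open V U1 -> rel_open V U2 ->
    U1 `|` U2 = V -> U1 `&` U2 = set0 -> U1 = set0 \/ U2 = set0.

Definition sa_component V (A : 'M[k]_n) : set 'M[k]_n :=
  [set B | exists D, [/\ semialgebraic D, sa_connected D, D `<=` V, D A & D B]].

End SemialgebraicConnectedness.

Section RealLieAlgebras.
Variables (R : realType) (n : nat).

Definition mexp (X : 'M[R]_n) : 'M[R]_n :=
  \matrix_(i, j) limn (series (fun k => (X ^+ k) i j / k`!%:R)).

Definition Lie (H : set 'M[R]_n) : set 'M[R]_n :=
  [set X | forall t : R, H (mexp (t *: X))].

End RealLieAlgebras.

(* Exponential of a nilpotent n x n matrix X, for which X ^+ n = 0. *)
Definition nexp (F : fieldType) n (X : 'M[F]_n) : 'M[F]_n :=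
  \sum_(k < n) (k`!%:R)^-1 *: X ^+ k.

Definition order_convex (F : rcfType) (O : {pred F}) : Prop :=
  forall a b c, a \in O -> b \in O -> a <= c <= b -> c \in O.

(* Elements of Lambda = F^x / O^x are cosets a O^x, so that the neutral element
   is O^x itself; the value of 0, which plays the role of infinity, is [set 0].
   The group law of Lambda being written additively, - v a is v a^-1. *)
Section Valuation.
Variables (F : rcfType) (O : {pred F}).

Definition unit_set : set F := [set u | [/\ u \in O, u^-1 \in O & u != 0]].
Definition val_O (a : F) : set F := [set a * u | u in unit_set].
Definition neg_val_O (a : F) : set F := val_O a^-1.
Definition Lambda0 : set F := val_O 1.

End Valuation.

(* K is a common subfield of R and F through iR and iF; the algebraic group G is
   given by equations P, the torus S by equations Q. *)
Section Building.
Variables (K F : rcfType) (R : realType).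
Variables (iR : {rmorphism K -> R}) (iF : {rmorphism K -> F}).
Variables (n : nat) (P Q : seq (entry_poly K n)).

(* A_L: L-extension of the component of the identity in S_K. *)
Definition A_points (L : rcfType) (i : K -> L) : set 'M[L]_n :=
  sa_ext idfun i (sa_component (zeros idfun Q) 1%:M).

Definition lie_g : set 'M[R]_n := Lie (zeros iR P).

(* Lie(A_R), as a subspace so as to have its dual at hand. *)
Definition lie_a : {vspace 'M[R]_n} :=
  xget 0%VS [set U : {vspace 'M[R]_n} | [set` U] = Lie (A_points iR)].

Definition dual_a := 'Hom(subvs_of lie_a, R^o).

Definition root_space (alpha : dual_a) : set 'M[R]_n :=
  [set X | lie_g X /\ forall H, H \in lie_a ->
     H *m X - X *m H = alpha (vsproj lie_a H) *: X].

Definition root_system : set dual_a :=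
  [set alpha | alpha != 0 /\ root_space alpha != [set 0]].

Definition reduced_roots : Prop :=
  forall alpha, root_system alpha -> ~ root_system (alpha *+ 2).

Definition root_basis (Delta : seq dual_a) : Prop :=
  [/\ free Delta, forall beta, beta \in Delta -> root_system beta
    & forall beta, root_system beta -> exists c : 'I_(size Delta) -> nat,
        beta = \sum_(i < size Delta) Delta`_i *+ c i \/
        beta = - \sum_(i < size Delta) Delta`_i *+ c i].

Definition root_group (alpha : dual_a) : set 'M[F]_n :=
  [set nexp (X + Y) | X in sa_ext iR iF (root_space alpha)
                    & Y in sa_ext iR iF (root_space (alpha *+ 2))].

Definition root_character (alpha : dual_a) (p : entry_poly K n) : Prop :=
  torus_character Q p /\
  forall H, H \in lie_a ->
    pval iR p (mexp H) = expR (alpha (vsproj lie_a H)).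

(* chi_alpha(a); the value does not depend on the polynomial p representing the
   character. *)
Definition chi (alpha : dual_a) (a : 'M[F]_n) : F :=
  xget 0 [set c | exists2 p, root_character alpha p & c = pval iF p a].

Definition G_F : set 'M[F]_n := zeros iF P.
Definition A_F : set 'M[F]_n := A_points iF.
Definition K_F : set 'M[F]_n :=
  G_F `&` [set k | k *m k^T = 1%:M /\ \det k = 1].

Definition A_plus (Delta : seq dual_a) : set 'M[F]_n :=
  [set a | A_F a /\ forall beta, beta \in Delta -> 1 <= chi beta a].

Definition X_F : set 'M[F]_n := [set g *m g^T | g in G_F].

(* The Weyl chamber valued distance, as a definite description. *)
Definition delta_F (Delta : seq dual_a) (x y : 'M[F]_n) : 'M[F]_n :=
  xget 1%:M [set a | A_plus Delta a /\ exists g h,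
    [/\ G_F g, G_F h, x = g *m g^T, y = h *m h^T
      & mulset (mulset K_F [set a]) K_F (invmx g *m h)]].

Definition N_F (a : 'M[F]_n) : F :=
  \big[*%R/1]_(beta \in root_system) Num.max (chi beta a) (chi beta a)^-1.

Definition dist_F (O : {pred F}) (Delta : seq dual_a) (x y : 'M[F]_n) : set F :=
  neg_val_O O (N_F (delta_F Delta x y)).

(* Points of the building are the equivalence classes themselves, as subsets of
   X_F; [bact] is the action on classes induced by g.x = g x g^T. *)
Definition bclass (O : {pred F}) (Delta : seq dual_a) (x : 'M[F]_n) :
    set 'M[F]_n :=
  [set y | X_F y /\ dist_F O Delta x y = Lambda0 O].

Definition bact (g : 'M[F]_n) (p : set 'M[F]_n) : set 'M[F]_n :=
  [set g *m x *m g^T | x in p].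

Definition base_point (O : {pred F}) (Delta : seq dual_a) : set 'M[F]_n :=
  bclass O Delta 1%:M.

Definition std_apartment (O : {pred F}) (Delta : seq dual_a) :
    set (set 'M[F]_n) :=
  [set bact a (base_point O Delta) | a in A_F].

Definition pointwise_stab (H : set 'M[F]_n) (Omega : set (set 'M[F]_n)) :
    set 'M[F]_n :=
  [set g | H g /\ forall p, Omega p -> bact g p = p].

Definition rank_one_group (alpha : dual_a) : set 'M[F]_n :=
  generated_mx (root_group alpha `|` root_group (- alpha)).

End Building.

(* Main.v *)
(* Over R, the torus S is c^T diag(x^W) c with c orthogonal and W an integer
   matrix, roots are integer vectors b for which the space g_b of matrices of
   weight b with exponential in G is not zero, and maximality of S, with the
   compactness of K_R, gives the Cartan decomposition and the relation
   [X, X^T] = q(X) h for X in g_b.  These facts are first order statements over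
   K, so they hold over F by the Tarski-Seidenberg principle.
   By the Cartan decomposition, g in G_F fixes the base point o if and only if
   Ad(g) preserves the integral points of the Lie algebra: both conditions say
   that all the roots take unit values on the torus part of g.  Hence exp(X) n
   fixes o, where n n^T is the square of a coroot element a(t), only if t is a
   unit, as seen on a root vector that exp(X) centralizes; then exp(X) and n fix
   o separately.
   Finally L has the Bruhat decomposition U N0 U^- u U N1, with N1 the reflecting
   elements.  For g = u n exp(Y^T) compare q(Y) with the values of the root at
   the points of Omega with smallest and largest root value: either exp(Y^T)
   fixes Omega, or exp(Y^T) = exp(Z) w exp(Z) with exp(Z) fixing Omega, and
   otherwise g cannot fix both extreme points. *)
Require Import Defs.
From HB Require Import structures.
From mathcomp Require Import all_boot all_order all_algebra.
From mathcomp Require Import all_classical all_reals all_analysis.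
From mathcomp Require mpoly.
Import (canonicals) mpoly.
Import (coercions) mpoly.
From mathcomp Require Import complex.
From mathcomp Require qe_rcf qe_rcf_th polyrcf.
From mathcomp Require Import ring lra zify.

Set Implicit Arguments.
Unset Strict Implicit.
Unset Printing Implicit Defensive.

Import Order.TTheory GRing.Theory Num.Theory.
Import numFieldNormedType.Exports.

Local Open Scope classical_set_scope.
Local Open Scope ring_scope.

(** * Transfer between real closed fields *)

(** Maximality of [S] concerns points over [K[i]], roots are defined by exponentials over [R], and
    the conclusion lives over [F], where no analytic argument applies. The three fields share only
    [K], so every fact that travels is written with coefficients in [K]: roots become integer
    vectors, characters become polynomials in the matrix entries, and root spaces are cut out by
    weights and finite exponentials, polynomial because root vectors are nilpotent. The relation
    [X, X^T] = q(X) h holds since the bracket is symmetric and commutes with [A]: its exponentials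
    have the form g g^T and cannot leave a maximal torus. The trace form fixes its direction, that
    of the coroot, and the scale q(X) = 2 |X|^2 / |h|^2. The coroot is integral because exp(tX)
    exp(-X^T/t) exp(tX), in an eigenbasis of h, has monomials in t as entries, with the eigenvalues
    of h as exponents. The Cartan decomposition comes from maximizing a trace over K_R: criticality
    gives commutation with a regular element, and the maximum gives dominance. *)

Module QE.
Import qe_rcf.

Section MapFormula.
Variables (K L : rcfType) (i : {rmorphism K -> L}).

(** Base change of terms and formulas along [K -> L]. The elimination procedure is a program on
    formulas over one field; the lemmas on [mapf] show that it commutes with base change, so that
    its output over [K] serves all extensions at once. *)
Fixpoint mapt (t : term K) : term L :=
  match t with
  | Var x => Var _ x
  | Const x => Const (i x)
  | NatConst n => NatConst _ n
  | Add u v => Add (mapt u) (mapt v)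
  | Opp u => Opp (mapt u)
  | NatMul u n => NatMul (mapt u) n
  | Mul u v => Mul (mapt u) (mapt v)
  | Exp u n => Exp (mapt u) n
  end.

Fixpoint mapf (f : formula K) : formula L :=
  match f with
  | Bool b => Bool b
  | Equal x y => Equal (mapt x) (mapt y)
  | Lt x y => Lt (mapt x) (mapt y)
  | Le x y => Le (mapt x) (mapt y)
  | And f g => And (mapf f) (mapf g)
  | Or f g => Or (mapf f) (mapf g)
  | Implies f g => Implies (mapf f) (mapf g)
  | Not f => Not (mapf f)
  end.

Notation mapp := (map mapt).
Notation mapps := (map (map mapt)).

(** The procedure is in continuation-passing style, so commutation is stated for a continuation [k]
    over [K] and its counterpart [k'] over [L]. The same pattern serves every subroutine below. *)
Lemma mapf_Size p k k' : (forall x, mapf (k x) = k' x) ->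
  mapf (Size p k) = Size (mapp p) k'.
Proof.
elim: p k k' => [|c p IHp] k k' Hk /=; first exact: Hk.
by apply: IHp => -[|m]; rewrite /= ?Hk.
Qed.

Lemma mapf_Isnull p k k' : (forall x, mapf (k x) = k' x) ->
  mapf (Isnull p k) = Isnull (mapp p) k'.
Proof. by move=> Hk; apply: mapf_Size. Qed.

Lemma mapf_LtSize p q k k' : (forall x, mapf (k x) = k' x) ->
  mapf (LtSize p q k) = LtSize (mapp p) (mapp q) k'.
Proof. by move=> Hk; apply: mapf_Size => x; apply: mapf_Size. Qed.

Lemma mapf_LeadCoef p k k' : (forall x, mapf (k x) = k' (mapt x)) ->
  mapf (LeadCoef p k) = LeadCoef (mapp p) k'.
Proof.
elim: p k k' => [|c p IHp] k k' Hk /=; first by rewrite Hk /= rmorph0.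
by apply: IHp => x; rewrite /= !Hk.
Qed.

Lemma mapp_AmulXn a n : mapp (AmulXn a n) = AmulXn (mapt a) n.
Proof. by elim: n => //= n ->; rewrite rmorph0. Qed.

Lemma mapp_AddPoly p q : mapp (AddPoly p q) = AddPoly (mapp p) (mapp q).
Proof. by elim: p q => //= a p IHp [|b q] //=; rewrite IHp. Qed.

Lemma mapp_ScalPoly c p : mapp (ScalPoly c p) = ScalPoly (mapt c) (mapp p).
Proof. by rewrite /ScalPoly -!map_comp; apply: eq_map. Qed.

Lemma mapp_MulPoly p q : mapp (MulPoly p q) = MulPoly (mapp p) (mapp q).
Proof.
by elim: p => //= a p IHp; rewrite mapp_AddPoly mapp_ScalPoly /= IHp.
Qed.

Lemma mapp_ExpPoly p n : mapp (ExpPoly p n) = ExpPoly (mapp p) n.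
Proof.
rewrite /ExpPoly; case: n => //= n.
by elim: n => //= n IHn; rewrite mapp_MulPoly IHn.
Qed.

Lemma mapp_OppPoly p : mapp (OppPoly p) = OppPoly (mapp p).
Proof. by rewrite /OppPoly mapp_ScalPoly /= rmorphN1. Qed.

Lemma mapp_NatMulPoly n p : mapp (NatMulPoly n p) = NatMulPoly n (mapp p).
Proof. by rewrite /NatMulPoly mapp_ScalPoly. Qed.

Lemma mapp_Deriv p : mapp (Deriv p) = Deriv (mapp p).
Proof. by elim: p => //= a p IHp; rewrite mapp_AddPoly /= IHp. Qed.

Definition mapd (d : nat * polyF K * polyF K) := (d.1.1, mapp d.1.2, mapp d.2).

Lemma mapf_Rediv_rec_loop q sq cq c qq r n k k' :
  (forall d, mapf (k d) = k' (mapd d)) ->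
  mapf (Rediv_rec_loop q sq cq c qq r n k) =
  Rediv_rec_loop (mapp q) sq (mapt cq) c (mapp qq) (mapp r) n k'.
Proof.
elim: n c qq r k k' => [|n IHn] c qq r k k' Hk /=;
  apply: mapf_Size => x; case: ifP => _; rewrite ?Hk //;
  apply: mapf_LeadCoef => y /=; rewrite ?Hk /mapd /= ?(IHn _ _ _ _ _ Hk);
  by rewrite !(mapp_AddPoly, mapp_OppPoly, mapp_MulPoly, mapp_AmulXn).
Qed.

Lemma mapf_Rediv p q k k' : (forall d, mapf (k d) = k' (mapd d)) ->
  mapf (Rediv p q k) = Rediv (mapp p) (mapp q) k'.
Proof.
move=> Hk; apply: mapf_Isnull => -[]; first by rewrite Hk /mapd /= rmorph0.
apply: mapf_Size => x; apply: mapf_Size => y; apply: mapf_LeadCoef => z.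
by rewrite (mapf_Rediv_rec_loop _ _ _ _ _ _ _ Hk) /= rmorph0.
Qed.

Lemma mapf_Rmod p q k k' : (forall d, mapf (k d) = k' (mapp d)) ->
  mapf (Rmod p q k) = Rmod (mapp p) (mapp q) k'.
Proof. by move=> Hk; apply: mapf_Rediv => d; rewrite Hk. Qed.

Lemma mapf_Rscal p q k k' : (forall d, mapf (k d) = k' d) ->
  mapf (Rscal p q k) = Rscal (mapp p) (mapp q) k'.
Proof. by move=> Hk; apply: mapf_Rediv => d; rewrite Hk. Qed.

Lemma mapf_Rgcd_loop n p q k k' : (forall d, mapf (k d) = k' (mapp d)) ->
  mapf (Rgcd_loop n p q k) = Rgcd_loop n (mapp p) (mapp q) k'.
Proof.
elim: n p q k k' => [|n IHn] p q k k' Hk /=; apply: mapf_Rmod => r;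
  by apply: mapf_Isnull => -[]; rewrite ?Hk // (IHn _ _ _ _ Hk).
Qed.

Lemma mapf_Rgcd p q k k' : (forall d, mapf (k d) = k' (mapp d)) ->
  mapf (Rgcd p q k) = Rgcd (mapp p) (mapp q) k'.
Proof.
move=> Hk; apply: mapf_LtSize => -[]; apply: mapf_Isnull => -[]; rewrite ?Hk //;
  by apply: mapf_Size => x; apply: mapf_Rgcd_loop.
Qed.

Lemma mapf_BigRgcd ps k k' : (forall d, mapf (k d) = k' (mapp d)) ->
  mapf (BigRgcd ps k) = BigRgcd (mapps ps) k'.
Proof.
elim: ps k k' => [|p ps IHps] k k' Hk /=; first by rewrite Hk /= rmorph0.
by apply: IHps => r; apply: mapf_Rgcd.
Qed.

Lemma mapf_Changes s k k' : (forall x, mapf (k x) = k' x) ->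
  mapf (Changes s k) = Changes (mapp s) k'.
Proof.
elim: s k k' => [|a s IHs] k k' Hk /=; first exact: Hk.
have E : mapt (head (NatConst K 0) s) = head (NatConst L 0) (map mapt s) by case: (s).
by apply: IHs => v /=; rewrite !Hk E.
Qed.

Lemma mapf_SeqPInfty ps k k' : (forall d, mapf (k d) = k' (mapp d)) ->
  mapf (SeqPInfty ps k) = SeqPInfty (mapps ps) k'.
Proof.
elim: ps k k' => [|p ps IHps] k k' Hk /=; first by rewrite Hk.
by apply: mapf_LeadCoef => x; apply: IHps => y; rewrite Hk.
Qed.

Lemma mapf_SeqMInfty ps k k' : (forall d, mapf (k d) = k' (mapp d)) ->
  mapf (SeqMInfty ps k) = SeqMInfty (mapps ps) k'.
Proof.
elim: ps k k' => [|p ps IHps] k k' Hk /=; first by rewrite Hk.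
apply: mapf_LeadCoef => x; apply: mapf_Size => z; apply: IHps => y.
by rewrite Hk /= rmorphN1.
Qed.

Lemma mapf_ChangesPoly ps k k' : (forall x, mapf (k x) = k' x) ->
  mapf (ChangesPoly ps k) = ChangesPoly (mapps ps) k'.
Proof.
move=> Hk; apply: mapf_SeqMInfty => x; apply: mapf_SeqPInfty => y.
by apply: mapf_Changes => z; apply: mapf_Changes.
Qed.

Lemma mapf_NextMod p q k k' : (forall d, mapf (k d) = k' (mapp d)) ->
  mapf (NextMod p q k) = NextMod (mapp p) (mapp q) k'.
Proof.
move=> Hk; apply: mapf_LeadCoef => x; apply: mapf_Rscal => y.
by apply: mapf_Rmod => z; rewrite Hk mapp_ScalPoly.
Qed.

Lemma mapf_ModsAux p q n k k' : (forall d, mapf (k d) = k' (mapps d)) ->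
  mapf (ModsAux p q n k) = ModsAux (mapp p) (mapp q) n k'.
Proof.
elim: n p q k k' => [|n IHn] p q k k' Hk /=; first by rewrite Hk.
apply: mapf_Isnull => -[]; first by rewrite Hk.
by apply: mapf_NextMod => x; apply: IHn => y; rewrite Hk.
Qed.

Lemma mapf_Mods p q k k' : (forall d, mapf (k d) = k' (mapps d)) ->
  mapf (Mods p q k) = Mods (mapp p) (mapp q) k'.
Proof.
by move=> Hk; apply: mapf_Size => x; apply: mapf_Size => y; apply: mapf_ModsAux.
Qed.

Lemma mapp_bigMul (I : Type) (s : seq I) (F : I -> polyF K) (G : I -> polyF L) :
  (forall x, mapp (F x) = G x) ->
  mapp (reducebig [:: NatConst K 1] s (fun x => BigBody x (@MulPoly K) true (F x)))
  = reducebig [:: NatConst L 1] s (fun x => BigBody x (@MulPoly L) true (G x)).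
Proof. by move=> FG; elim: s => //= x s IHs; rewrite mapp_MulPoly FG IHs. Qed.

Lemma mapp_nth s n : mapp (nth [::] s n) = nth [::] (mapps s) n.
Proof. by elim: s n => [|x s IHs] [|n] //=. Qed.

Lemma mapp_PolyComb sq sc : mapp (PolyComb sq sc) = PolyComb (mapps sq) sc.
Proof.
rewrite /PolyComb size_map; apply: mapp_bigMul => x.
by rewrite mapp_ExpPoly mapp_nth.
Qed.

Lemma mapp_Pcq sq n : mapp (Pcq sq n) = Pcq (mapps sq) n.
Proof.
rewrite /Pcq size_map mapp_nth -map_comp; congr nth.
by apply: eq_map => x /=; rewrite mapp_PolyComb.
Qed.

Lemma mapf_TaqR p q k k' : (forall x, mapf (k x) = k' x) ->
  mapf (TaqR p q k) = TaqR (mapp p) (mapp q) k'.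
Proof.
move=> Hk; rewrite /TaqR -mapp_Deriv -mapp_MulPoly.
by apply: mapf_Mods => x; apply: mapf_ChangesPoly.
Qed.

Lemma mapf_TaqsR p sq n k k' : (forall x, mapf (k x) = k' (mapt x)) ->
  mapf (TaqsR p sq n k) = TaqsR (mapp p) (mapps sq) n k'.
Proof.
move=> Hk; rewrite /TaqsR -mapp_Pcq.
by apply: mapf_TaqR => x; rewrite Hk /= rmorph_int.
Qed.

(** The coefficients are entries of the inverse of an integer matrix, hence rational numbers, which
    every morphism preserves. *)
Lemma mapt_Coefs n m : mapt (Coefs K n m) = Coefs L n m.
Proof.
rewrite /Coefs /=; congr Const.
case: n => [|[|n]]; first exact: rmorph_nat.
  rewrite /=; case: m => [|[|[|m]]] /=; rewrite ?nth_nil ?rmorph0 //;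
  by rewrite fmorphV rmorph_nat.
rewrite /qe_rcf_th.coefs.
have [lt|le] := ltnP m (3 ^ n.+2).
  have lt' : (m < size (enum 'I_(3 ^ n.+2)))%N by rewrite size_enum_ord.
  have nthE (T : rcfType) (G : 'I_(3 ^ n.+2) -> T) :
      [seq G j | j <- enum 'I_(3 ^ n.+2)]`_m =
      G (nth (Ordinal lt) (enum 'I_(3 ^ n.+2)) m) by exact: nth_map.
  rewrite !nthE.
  set A := qe_rcf_th.ctmat n.+2; set x := nth _ _ _.
  have -> : map_mx (intr : int -> L) A = map_mx i (map_mx (intr : int -> K) A).
    by apply/matrixP => a b; rewrite !mxE rmorph_int.
  by rewrite -map_invmx !castmxE [in RHS]mxE.
have le' : (size (enum 'I_(3 ^ n.+2)) <= m)%N by rewrite size_enum_ord.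
by rewrite !(nth_default 0) ?rmorph0 // size_map.
Qed.

Lemma mapf_CcountWeak p sq k k' : (forall x, mapf (k x) = k' (mapt x)) ->
  mapf (CcountWeak p sq k) = CcountWeak (mapp p) (mapps sq) k'.
Proof.
rewrite /CcountWeak !size_map; set N := (3 ^ _)%N.
(* The initial value 0 of the accumulator is generalized, so that the induction covers all partial
   sums. *)
rewrite -[X in _ -> _ = _ X _ _]/(mapt (NatConst K 0)).
move: (NatConst K 0) => s.
elim: N s k k' => [|N IHN] s k k' Hk /=; first exact: Hk.
apply: mapf_TaqsR => x.
by rewrite (IHN _ _ _ Hk) /= -mapt_Coefs.
Qed.

Lemma mapp_BoundingPoly sq : mapp (BoundingPoly sq) = BoundingPoly (mapps sq).
Proof.
rewrite /BoundingPoly mapp_Deriv; congr Deriv.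
by elim: sq => //= q sq IHsq; rewrite mapp_MulPoly IHsq.
Qed.

Lemma mapf_bigAnd (I J : Type) (g : I -> J) (s : seq I) F G :
  (forall x, mapf (F x) = G (g x)) ->
  mapf (reducebig (Bool true) s (fun q => BigBody q (@And K) true (F q)))
  = reducebig (Bool true) (map g s) (fun q => BigBody q (@And L) true (G q)).
Proof. by move=> FG; elim: s => //= x s ->; rewrite FG. Qed.

Lemma mapf_CcountGt0 sp sq :
  mapf (CcountGt0 sp sq) = CcountGt0 (mapps sp) (mapps sq).
Proof.
apply: mapf_BigRgcd => p; apply: mapf_Isnull => -[]; last exact: mapf_CcountWeak.
rewrite /= -mapp_BoundingPoly; apply: mapf_CcountWeak => c /=.
congr (Or _ (Or _ _)); apply: mapf_bigAnd => q.
  exact: mapf_LeadCoef.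
by apply: mapf_Size => n; apply: mapf_LeadCoef => y.
Qed.

Lemma mapp_abstrX n t : mapp (abstrX n t) = abstrX n (mapt t).
Proof.
elim: t => //=.
- by move=> m; case: (m == n).
- by move=> a IHa b IHb; rewrite mapp_AddPoly IHa IHb.
- by move=> a IHa; rewrite mapp_OppPoly IHa.
- by move=> a IHa m; rewrite mapp_NatMulPoly IHa.
- by move=> a IHa b IHb; rewrite mapp_MulPoly IHa IHb.
- by move=> a IHa m; rewrite mapp_ExpPoly IHa.
Qed.

End MapFormula.

(** * Formulas that define a set uniformly in all real closed extensions *)

Section Uniform.
Variable K : rcfType.

Definition ev (L : rcfType) (i : {rmorphism K -> L}) (e : seq L) (t : term K) : L :=
  eval e (mapt i t).

Definition clause := (seq (term K) * seq (term K))%type.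

Definition chold (L : rcfType) (i : {rmorphism K -> L}) (e : seq L) (c : clause) :=
  all (fun t => ev i e t == 0) c.1 && all (fun t => 0 < ev i e t) c.2.

Definition family := forall (L : rcfType), {rmorphism K -> L} -> seq L -> Prop.

(* Quantifier-free definability by one formula over [K] for all real closed
   extensions [L] of [K] at once. *)
Definition uniform (S : family) :=
  exists D : seq clause, forall L i e, S L i e <-> has (chold i e) D.

Definition uniform_val (T : forall (L : rcfType), {rmorphism K -> L} -> seq L -> L) :=
  exists t, forall L i e, T L i e = ev i e t.

Lemma uniform_iff (S S' : family) : (forall L i e, S' L i e <-> S L i e) ->
  uniform S -> uniform S'.
Proof. by move=> SS' [D HD]; exists D => L i e; rewrite SS'. Qed.

Lemma uniform_or (S S' : family) : uniform S -> uniform S' ->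
  uniform (fun L i e => S L i e \/ S' L i e).
Proof.
move=> [D HD] [D' HD']; exists (D ++ D') => L i e.
by rewrite has_cat HD HD'; split=> /orP.
Qed.

Lemma uniform_and (S S' : family) : uniform S -> uniform S' ->
  uniform (fun L i e => S L i e /\ S' L i e).
Proof.
move=> [D HD] [D' HD'].
exists (flatten [seq [seq (c.1 ++ d.1, c.2 ++ d.2) | d <- D'] | c <- D]) => L i e.
rewrite HD HD' {S S' HD HD'}; elim: D => [|c D IHD] /=; first by split=> // -[].
have E : has (chold i e) [seq (c.1 ++ d.1, c.2 ++ d.2) | d <- D'] =
    chold i e c && has (chold i e) D'.
  rewrite has_map; elim: D' {IHD} => /= [|d D' ->]; first by rewrite andbF.
  rewrite {1}/chold /= !all_cat andb_orr; congr (_ || _).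
  by rewrite /chold; do 4!case: all.
rewrite has_cat E; split.
  move=> [/orP[->|cD] D'e]; first by rewrite D'e.
  by apply/orP; right; apply/IHD.
by move=> /orP[/andP[-> ->]|/IHD[-> ->]]; rewrite ?orbT.
Qed.

Lemma uniform_atom0 t : uniform (fun L i e => ev i e t = 0).
Proof.
exists [:: ([:: t], [::])] => L i e; rewrite /= /chold /= !andbT orbF.
by split=> [->|/eqP].
Qed.

Lemma uniform_atom_pos t : uniform (fun L i e => 0 < ev i e t).
Proof. by exists [:: ([::], [:: t])] => L i e; rewrite /= /chold /= !andbT orbF. Qed.

Lemma uniform_bool (b : bool) : uniform (fun L i e => b).
Proof.
exists (if b then [:: ([::], [::])] else [::]) => L i e.
by case: b; rewrite //= /chold.
Qed.

(** Trichotomy keeps complements in disjunctive form: a nonzero value is positive or has a positive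
    opposite, and a value that is not positive is zero or has a positive opposite. *)
Lemma uniform_not (S : family) : uniform S -> uniform (fun L i e => ~ S L i e).
Proof.
move=> [D HD]; apply: (@uniform_iff (fun L i e => ~~ has (chold i e) D)).
  by move=> L i e; rewrite HD; split=> /negP.
elim: D {S HD} => [|c D IHD]; first exact: (uniform_bool true).
apply: (@uniform_iff (fun L i e => ~~ chold i e c /\ ~~ has (chold i e) D)).
  by move=> L i e; rewrite negb_or; split=> /andP.
apply: uniform_and => //; case: c => c d.
apply: (@uniform_iff (fun L i e => ~~ all (fun t => ev i e t == 0) c \/
    ~~ all (fun t => 0 < ev i e t) d)).
  by move=> L i e; rewrite /chold negb_and; split=> /orP.
apply: uniform_or.
- elim: c => [|t c IHc]; first exact: (uniform_bool false).
  apply: (@uniform_iff (fun L i e => (0 < ev i e t \/ 0 < ev i e (Opp t)) \/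
    ~~ all (fun t => ev i e t == 0) c)).
    move=> L i e; rewrite /= negb_and neq_lt [ev i e (Opp t)]/= oppr_gt0.
    split; first by case/orP => [/orP[]|] ->; [left; right|left; left|right].
    by case=> [[] ->|->]; rewrite ?orbT.
  by apply: uniform_or IHc; apply: uniform_or; apply: uniform_atom_pos.
- elim: d => [|t d IHd]; first exact: (uniform_bool false).
  apply: (@uniform_iff (fun L i e => (ev i e t = 0 \/ 0 < ev i e (Opp t)) \/
    ~~ all (fun t => 0 < ev i e t) d)).
    move=> L i e; rewrite /= negb_and -leNgt le_eqVlt [ev i e (Opp t)]/= oppr_gt0.
    split; first by case/orP => [/orP[/eqP|]|] ->; [left; left|left; right|right].
    by case=> [[/eqP ->|->]|->]; rewrite ?orbT.
  apply: uniform_or IHd; apply: uniform_or; first exact: uniform_atom0.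
  exact: uniform_atom_pos.
Qed.

Lemma uniform_imp (S S' : family) : uniform S -> uniform S' ->
  uniform (fun L i e => S L i e -> S' L i e).
Proof.
move=> US US'; apply: uniform_iff (uniform_or (uniform_not US) US') => L i e.
by split=> [H|[]//]; case: (pselect (S L i e)) => [/H|]; [right|left].
Qed.

Lemma uniform_qf (f : formula K) : uniform (fun L i e => qf_eval e (mapf i f)).
Proof.
elim: f => [b|t u|t u|t u|f Hf g Hg|f Hf g Hg|f Hf g Hg|f Hf].
- exact: uniform_bool.
- apply: uniform_iff (uniform_atom0 (Add t (Opp u))) => L i e /=.
  by rewrite /ev /= -subr_eq0; split=> /eqP.
- apply: uniform_iff (uniform_atom_pos (Add u (Opp t))) => L i e /=.
  by rewrite /ev /= subr_gt0.
- apply: uniform_iff (uniform_not (uniform_atom_pos (Add t (Opp u)))) => L i e /=.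
  rewrite -subr_le0 /ev /=; split; first by rewrite leNgt => /negP.
  by move/negP; rewrite -leNgt.
- by apply: uniform_iff (uniform_and Hf Hg) => L i e /=; split=> /andP.
- by apply: uniform_iff (uniform_or Hf Hg) => L i e /=; split=> /orP.
- by apply: uniform_iff (uniform_imp Hf Hg) => L i e /=; split=> /implyP.
- by apply: uniform_iff (uniform_not Hf) => L i e /=; split=> /negP.
Qed.

(** The quantifier distributes over the clauses, and for a single clause the root-counting formula
    [CcountGt0] decides solvability. As it commutes with base change, one formula works for every
    [L]. *)
Lemma uniform_ex (S : family) k : uniform S ->
  uniform (fun L i e => exists x : L, S L i (set_nth 0 e k x)).
Proof.
move=> [D HD]; apply: (@uniform_iff (fun L (i : {rmorphism K -> L}) e =>
    exists x : L, has (chold i (set_nth 0 e k x)) D)).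
  by move=> L i e; split=> -[x /HD Hx]; exists x.
elim: D {S HD} => [|c D IHD].
  by apply: uniform_iff (uniform_bool false) => L i e; split=> // -[].
pose f := CcountGt0 (map (abstrX k) c.1) (map (abstrX k) c.2).
apply: uniform_iff (uniform_or (uniform_qf f) IHD) => L i e.
have -> : qf_eval e (mapf i f) <-> exists x, chold i (set_nth 0 e k x) c.
  rewrite mapf_CcountGt0 eval_CcountGt0 -!map_comp.
  have E x t : (eval_poly e (map (mapt i) (abstrX k t))).[x] =
      ev i (set_nth 0 e k x) t by rewrite mapp_abstrX abstrXP.
  split=> [/qe_rcf_th.ccount_gt0P[x]|[x Hx]].
    rewrite !big_map => Hx; exists x; rewrite /chold -!big_all.
    by under eq_bigr do rewrite -E; under [X in _ && X]eq_bigr do rewrite -E.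
  apply/qe_rcf_th.ccount_gt0P; exists x; rewrite !big_map /=.
  under eq_bigr do rewrite E; under [X in _ && X]eq_bigr do rewrite E.
  by rewrite !big_all.
split=> [[x /= /orP[cx|Dx]]|[[x cx]|[x Dx]]].
- by left; exists x.
- by right; exists x.
- by exists x; rewrite /= cx.
- by exists x; rewrite /= Dx orbT.
Qed.

Lemma uniform_val_const x : uniform_val (fun L i e => i x).
Proof. by exists (Const x). Qed.

Lemma uniform_val_add T U : uniform_val T -> uniform_val U ->
  uniform_val (fun L i e => T L i e + U L i e).
Proof. by move=> [t Ht] [u Hu]; exists (Add t u) => L i e; rewrite Ht Hu. Qed.

Lemma uniform_val_mul T U : uniform_val T -> uniform_val U ->
  uniform_val (fun L i e => T L i e * U L i e).
Proof. by move=> [t Ht] [u Hu]; exists (Mul t u) => L i e; rewrite Ht Hu. Qed.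

Lemma uniform_val_opp T : uniform_val T -> uniform_val (fun L i e => - T L i e).
Proof. by move=> [t Ht]; exists (Opp t) => L i e; rewrite Ht. Qed.

Lemma uniform_val_eq T U : (forall L i e, U L i e = T L i e) ->
  uniform_val T -> uniform_val U.
Proof. by move=> TU [t Ht]; exists t => L i e; rewrite TU. Qed.

Lemma uniform_val_sum (I : Type) (s : seq I)
    (T : I -> forall (L : rcfType), {rmorphism K -> L} -> seq L -> L) :
  (forall j, uniform_val (T j)) ->
  uniform_val (fun L i e => \sum_(j <- s) T j L i e).
Proof.
move=> HT; elim: s => [|j s IHs].
  apply: uniform_val_eq (uniform_val_const 0) => L i e.
  by rewrite big_nil rmorph0.
apply: uniform_val_eq (uniform_val_add (HT j) IHs) => L i e.
by rewrite big_cons.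
Qed.

Lemma uniform_val_prod (I : Type) (s : seq I)
    (T : I -> forall (L : rcfType), {rmorphism K -> L} -> seq L -> L) :
  (forall j, uniform_val (T j)) ->
  uniform_val (fun L i e => \prod_(j <- s) T j L i e).
Proof.
move=> HT; elim: s => [|j s IHs].
  apply: uniform_val_eq (uniform_val_const 1) => L i e.
  by rewrite big_nil rmorph1.
apply: uniform_val_eq (uniform_val_mul (HT j) IHs) => L i e.
by rewrite big_cons.
Qed.

Lemma uniform_val_exp T m : uniform_val T -> uniform_val (fun L i e => T L i e ^+ m).
Proof. by move=> [t Ht]; exists (Exp t m) => L i e; rewrite Ht. Qed.

End Uniform.

(** Positive elements are squares, and squares are preserved. *)
Lemma rmorph_gt0 (K L : rcfType) (i : {rmorphism K -> L}) x : (0 < i x) = (0 < x).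
Proof.
have pos y : 0 < y -> 0 < i y.
  move=> y0; rewrite lt_def fmorph_eq0 gt_eqF //= -(sqr_sqrtr (ltW y0)) rmorphXn.
  exact: sqr_ge0.
case: (ltrgtP 0 x) => [/pos ->//|x0|<-]; last by rewrite rmorph0 ltxx.
by apply/negbTE; rewrite -leNgt ltW // -oppr_gt0 -rmorphN pos // oppr_gt0.
Qed.

(** * First order formulas in matrix variables *)

Section MatrixFormulas.
Variables (K : rcfType) (n : nat).

(** [MPol] turns the value of a polynomial into a scalar matrix, so that scalar factors can occur in
    matrix equations. *)
Inductive mterm :=
| MVar of nat
| MConst of 'M[K]_n
| MMul of mterm & mterm
| MAdd of mterm & mterm
| MOpp of mterm
| MTr of mterm
| MPol of entry_poly K n & mterm.

Inductive mform :=
| FEq of mterm & mterm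
| FPos of entry_poly K n & mterm
| FNot of mform
| FAnd of mform & mform
| FOr of mform & mform
| FImp of mform & mform
| FEx of nat & mform
| FAll of nat & mform.

Section Semantics.
Variables (L : rcfType) (i : {rmorphism K -> L}).

Definition upd (rho : nat -> 'M[L]_n) (j : nat) (X : 'M[L]_n) :=
  fun k => if k == j then X else rho k.

Fixpoint mval (rho : nat -> 'M[L]_n) (t : mterm) : 'M[L]_n :=
  match t with
  | MVar j => rho j
  | MConst A => map_mx i A
  | MMul t u => mval rho t *m mval rho u
  | MAdd t u => mval rho t + mval rho u
  | MOpp t => - mval rho t
  | MTr t => (mval rho t)^T
  | MPol p t => (pval i p (mval rho t))%:M
  end.

Fixpoint mhold (rho : nat -> 'M[L]_n) (f : mform) : Prop :=
  match f with
  | FEq t u => mval rho t = mval rho u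
  | FPos p t => 0 < pval i p (mval rho t)
  | FNot f => ~ mhold rho f
  | FAnd f g => mhold rho f /\ mhold rho g
  | FOr f g => mhold rho f \/ mhold rho g
  | FImp f g => mhold rho f -> mhold rho g
  | FEx j f => exists X, mhold (upd rho j X) f
  | FAll j f => forall X, mhold (upd rho j X) f
  end.

(* The entries of the [j]-th matrix variable are the scalar variables with
   indices from [j * n ^ 2] on. *)
Definition enc (j : nat) (a b : 'I_n) : nat := (j * (n * n) + mxvec_index a b)%N.

Definition menv (s : nat -> L) (j : nat) : 'M[L]_n := \matrix_(a, b) s (enc j a b).

End Semantics.

Lemma uniform_pval (p : entry_poly K n)
    (A : forall L : rcfType, {rmorphism K -> L} -> seq L -> 'M[L]_n) :
  (forall j, uniform_val (fun L i e => mxvec (A L i e) 0 j)) ->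
  uniform_val (fun L i e => pval i p (A L i e)).
Proof.
move=> H; rewrite /pval /mpoly.mmap; apply: uniform_val_sum => m.
apply: uniform_val_mul; first exact: uniform_val_const.
by rewrite /mpoly.mmap1; apply: uniform_val_prod => j; apply: uniform_val_exp.
Qed.

Lemma uniform_mval t a b :
  uniform_val (fun L i e => mval i (menv (fun k => e`_k)) t a b).
Proof.
elim: t a b => [j|A|t IHt u IHu|t IHt u IHu|t IHt|t IHt|p t IHt] a b.
- by exists (Var _ (enc j a b)) => L i e; rewrite mxE.
- by apply: uniform_val_eq (uniform_val_const (A a b)) => L i e; rewrite mxE.
- apply: uniform_val_eq (@uniform_val_sum K _ (index_enum 'I_n) _
    (fun c => uniform_val_mul (IHt a c) (IHu c b))) => L i e.
  by rewrite mxE.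
- by apply: uniform_val_eq (uniform_val_add (IHt a b) (IHu a b)) => L i e; rewrite mxE.
- by apply: uniform_val_eq (uniform_val_opp (IHt a b)) => L i e; rewrite mxE.
- by apply: uniform_val_eq (IHt b a) => L i e; rewrite mxE.
- case: (eqVneq a b) => [->|nab]; last first.
    apply: uniform_val_eq (uniform_val_const 0) => L i e.
    by rewrite mxE (negbTE nab) rmorph0.
  have H j : uniform_val (fun L i e => mxvec (mval i (menv (fun k => e`_k)) t) 0 j).
    case: (mxvec_indexP j) => c d.
    by apply: uniform_val_eq (IHt c d) => L i e; rewrite mxvecE.
  have := uniform_pval p H; apply: uniform_val_eq => L i e.
  by rewrite mxE eqxx mulr1n.
Qed.

Lemma uniform_exs (T : forall L : rcfType, {rmorphism K -> L} -> (nat -> L) -> Prop)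
    (ks : seq nat) :
  uniform (fun L i e => T L i (fun k => e`_k)) ->
  uniform (fun L i e => exists g : nat -> L,
     T L i (fun k => if k \in ks then g k else e`_k)).
Proof.
move=> UT; elim: ks => [|k ks IHks].
  by apply: uniform_iff UT => L i e; split=> [[g]|] //; exists (fun=> 0).
apply: uniform_iff (uniform_ex k IHks) => L i e; split.
  move=> [g Hg]; exists (g k), g; move: Hg; congr (T L i _).
  apply/funext => m; rewrite inE nth_set_nth /=.
  by case: eqVneq => [->|] //=; case: ifP.
move=> [x [g Hg]]; exists (fun m => if m \in ks then g m else x); move: Hg.
congr (T L i _); apply/funext => m; rewrite inE nth_set_nth /=.
by case: eqVneq => [->|] //=; case: ifP.
Qed.

Lemma uniform_matrix_ex j f :
  uniform (fun L i e => mhold i (menv (fun k => e`_k)) f) ->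
  uniform (fun L i e => mhold i (menv (fun k => e`_k)) (FEx j f)).
Proof.
pose ks := [seq (j * (n * n) + k)%N | k <- iota 0 (n * n)].
have in_ks k a b : (enc k a b \in ks) = (k == j).
  apply/mapP/eqP => [[m Hm]|->]; last first.
    by exists (nat_of_ord (mxvec_index a b)) => //; rewrite mem_iota ltn_ord.
  rewrite mem_iota add0n /= in Hm => /(congr1 (fun x => x %/ (n * n))%N).
  have nn : (0 < n * n)%N by case: (n * n)%N Hm.
  by rewrite !divnMDl // !divn_small ?ltn_ord // !addn0.
move=> /(@uniform_exs (fun L i s => mhold i (menv s) f) ks).
apply: uniform_iff => L i e /=; split.
  move=> [X HX].
  exists (fun k => if [pick c : 'I_n * 'I_n | enc j c.1 c.2 == k] is Some c then
      X c.1 c.2 else 0); move: HX.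
  congr (mhold i _ f); apply/funext => k; apply/matrixP => a b.
  rewrite /upd [RHS]mxE in_ks; case: eqVneq => [->|]; last by rewrite mxE.
  case: pickP => [[c d] /= /eqP|/(_ (a, b))]; last by rewrite /= eqxx.
  rewrite /enc => /addnI /val_inj E.
  by have := congr1 (fun k => mxvec X 0 k) E; rewrite !mxvecE.
move=> [g Hg]; exists (\matrix_(a, b) g (enc j a b)); move: Hg.
congr (mhold i _ f); apply/funext => k; apply/matrixP => a b.
by rewrite /upd [LHS]mxE in_ks; case: eqVneq => [->|]; rewrite mxE.
Qed.

Lemma uniform_mhold f : uniform (fun L i e => mhold i (menv (fun k => e`_k)) f).
Proof.
elim: f => [t u|p t|f Hf|f Hf g Hg|f Hf g Hg|f Hf g Hg|j f Hf|j f Hf].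
- have H (s : seq ('I_n * 'I_n)) : uniform (fun L i e => forall c, c \in s ->
      mval i (menv (fun k => e`_k)) t c.1 c.2 = mval i (menv (fun k => e`_k)) u c.1 c.2).
    elim: s => [|[a b] s IHs].
      by apply: uniform_iff (uniform_bool _ true).
    have [x Hx] := uniform_mval t a b; have [y Hy] := uniform_mval u a b.
    apply: uniform_iff (uniform_and (uniform_atom0 (Add x (Opp y))) IHs) => L i e.
    have -> : ev i e (Add x (Opp y)) = ev i e x - ev i e y by [].
    rewrite -Hx -Hy; split.
      move=> H; split; first by rewrite (H (a, b)) ?mem_head ?subrr.
      by move=> c cs; apply: H; rewrite inE cs orbT.
    move=> [/eqP + H] c; rewrite subr_eq0 inE => /eqP E /orP[/eqP->//|].
    exact: H.
  apply: uniform_iff (H (enum predT)) => L i e /=; split=> [->//|H'].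
  by apply/matrixP => a b; apply: (H' (a, b)); rewrite mem_enum.
- have H j : uniform_val (fun L i e => mxvec (mval i (menv (fun k => e`_k)) t) 0 j).
    case: (mxvec_indexP j) => c d.
    by apply: uniform_val_eq (uniform_mval t c d) => L i e; rewrite mxvecE.
  have [x Hx] := uniform_pval p H.
  by apply: uniform_iff (uniform_atom_pos x) => L i e; rewrite -Hx.
- exact: uniform_not.
- exact: uniform_and.
- exact: uniform_or.
- exact: uniform_imp.
- exact: uniform_matrix_ex.
- apply: uniform_iff (uniform_not (@uniform_matrix_ex j (FNot f) (uniform_not Hf)))
    => L i e /=.
  by split=> [H [X]|H X]; [apply|apply: contrapT => HX; apply: H; exists X].
Qed.

(** After elimination only signs of closed terms remain. These terms have values in [K], whose order
    every embedding preserves, so truth does not depend on the extension. Free variables are read as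
    0, the default in an empty environment. *)
Lemma transfer_rcf (L L' : rcfType) (i : {rmorphism K -> L}) (i' : {rmorphism K -> L'})
    (f : mform) : mhold i (fun=> 0) f -> mhold i' (fun=> 0) f.
Proof.
have [D HD] := uniform_mhold f.
have E (M : rcfType) : menv (fun k => ([::] : seq M)`_k) = (fun=> 0).
  by apply/funext => k; apply/matrixP => a b; rewrite !mxE nth_nil.
rewrite -!E !HD; apply: etrans; apply: eq_has => c.
have evE (M : rcfType) (j : {rmorphism K -> M}) t : ev j [::] t = j (eval [::] t).
  elim: t => /=; rewrite /ev /=.
  - by move=> k; rewrite !nth_nil rmorph0.
  - by [].
  - by move=> m; rewrite rmorph_nat.
  - by move=> t -> u ->; rewrite rmorphD.
  - by move=> t ->; rewrite rmorphN.
  - by move=> t -> m; rewrite rmorphMn.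
  - by move=> t -> u ->; rewrite rmorphM.
  - by move=> t -> m; rewrite rmorphXn.
rewrite /chold; congr andb; apply: eq_all => t; rewrite !evE ?fmorph_eq0 //.
by rewrite !rmorph_gt0.
Qed.

End MatrixFormulas.

End QE.

(** * Independence of characters, symmetric matrices, integer matrices *)

Section Independence.

(** Dedekind's argument: multiply by the value at an element that separates two characters and
    subtract; one character disappears and the number of nonzero coefficients drops. The law [op] is
    that of a semigroup, in view of positive points and natural exponents. *)
Lemma characters_independent (T : Type) (op : T -> T -> T) (L : fieldType)
    (I : finType) (chi : I -> T -> L) (c : I -> L) :
  (forall i x y, chi i (op x y) = chi i x * chi i y) ->
  (forall i, exists x, chi i x != 0) ->
  (forall i j, chi i = chi j -> i = j) ->
  (forall x, \sum_i c i * chi i x = 0) -> forall i, c i = 0.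
Proof.
move=> chiM chi_neq0 chi_inj.
have [m] := ubnP #|[pred i | c i != 0]|.
elim: m c => // m IHm c lecm sum0 i; apply/eqP/negPn/negP => ci.
have [j /andP[ji cj]|nj] := pickP (fun j => (j != i) && (c j != 0)); last first.
  have [x xi] := chi_neq0 i; move: (sum0 x); rewrite (bigD1 i) //= big1 => [|j ji].
    by move/eqP; rewrite addr0 mulf_eq0 (negbTE ci) (negbTE xi).
  by have := nj j; rewrite ji /= => /negbFE/eqP->; rewrite mul0r.
have [y yij] : exists y, chi i y != chi j y.
  apply: contrapT => H; case/eqP: ji; apply/esym/chi_inj/funext => y.
  by apply/eqP/negPn/negP => E; apply: H; exists y.
pose c' k := c k * (chi k y - chi j y).
have c'0 : c' i = 0.
  apply: (IHm c') => [|x].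
    rewrite -ltnS (leq_trans _ lecm) // ltnS; apply/proper_card/properP; split.
      by apply/fintype.subsetP => k; rewrite !inE; apply: contraNneq => ck; rewrite /c' ck mul0r.
    by exists j; rewrite !inE ?cj // /c' subrr mulr0 eqxx.
  have := sum0 (op y x); have := congr1 (fun z => chi j y * z) (sum0 x).
  rewrite mulr0 mulr_sumr => E1 E2.
  rewrite -[RHS](subr0 0) -[X in X - _]E2 -[X in _ - X]E1 -sumrB.
  by apply: eq_bigr => k _; rewrite /c' chiM; ring.
by move/eqP: c'0; rewrite mulf_eq0 (negbTE ci) subr_eq0 (negbTE yij).
Qed.

Lemma sum_by_key (V : nmodType) (I : eqType) (s : seq I) (T : choiceType) (key : I -> T)
    (F : I -> V) :
  \sum_(i <- s) F i =
  \sum_(k : seq_sub (map key s)) \sum_(i <- s | key i == val k) F i.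
Proof.
rewrite (exchange_big_dep xpredT) //= big_seq [RHS]big_seq; apply: eq_bigr => i si.
have ki : key i \in map key s by apply: map_f.
by rewrite (big_pred1 (SeqSub ki)) // => k; rewrite /= eq_sym -val_eqE.
Qed.

(** Version for families with repetitions: indices with the same [key] carry the same character, and
    it is the sum of their coefficients that vanishes. *)
Lemma characters_independent_key (T : Type) (op : T -> T -> T) (L : fieldType)
    (I : eqType) (s : seq I) (Ky : choiceType) (key : I -> Ky)
    (chi : Ky -> T -> L) (c : I -> L) :
  (forall k x y, chi k (op x y) = chi k x * chi k y) ->
  (forall k, exists x, chi k x != 0) ->
  {in map key s &, forall k k', chi k = chi k' -> k = k'} ->
  (forall x, \sum_(i <- s) c i * chi (key i) x = 0) ->
  forall k, \sum_(i <- s | key i == k) c i = 0.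
Proof.
move=> chiM chi_neq0 chi_inj sum0 k.
have [ks|nks] := boolP (k \in map key s); last first.
  rewrite big_seq_cond big1 // => i /andP[si /eqP ki].
  by case/negP: nks; rewrite -ki map_f.
pose c' (k : seq_sub (map key s)) := \sum_(i <- s | key i == val k) c i.
apply: (@characters_independent _ op L _ (fun k => chi (val k)) c' _ _ _ _ (SeqSub ks)).
- by move=> i x y; apply: chiM.
- by move=> i; apply: chi_neq0.
- by move=> i j /chi_inj E; apply/val_inj/E; apply: valP.
move=> x; rewrite -[RHS](sum0 x) (sum_by_key _ key); apply: eq_bigr => i _.
by rewrite /c' mulr_suml; apply: eq_bigr => j /eqP->.
Qed.

End Independence.

(** * Simultaneous diagonalization of symmetric matrices over a real closed field *)

Section RealSpectral.
Variable K : rcfType.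
Local Notation C := K[i].
Local Notation toC := (real_complex K).

Lemma conjc_real_fixed (z : C) : conjc z = z -> z = toC (complex.Re z).
Proof.
case: z => a b [] /= /eqP; rewrite eq_sym -subr_eq0 opprK -mulr2n mulrn_eq0 /=.
by move/eqP->.
Qed.

(** On a row basis of [V] there is an eigenvalue in [K[i]]. Pairing an eigenvector with its
    conjugate shows that the eigenvalue is its own conjugate, hence in [K]. *)
Lemma sym_stable_eigenvalue n (s V : 'M[K]_n) : s = s^T -> V != 0 ->
  (V *m s <= V)%MS -> exists a, (V :&: eigenspace s a)%MS != 0.
Proof.
move=> sT V0 Vs; set m := \rank V; pose B := row_base V.
have m_gt0 : (0 < m)%N by rewrite lt0n mxrank_eq0.
have /submxP[S' BS] : (B *m s <= B)%MS.
  by rewrite (eqmxMr s (eq_row_base V)) (submx_trans Vs) // eq_row_base.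
have [a] : exists a, eigenvalue (map_mx toC S') a by apply: eigenvalue_closed.
move=> /[dup] /eigenvalueP[z zS z0] eiga.
have [y yE] : {y | y = z *m map_mx toC B} by exists (z *m map_mx toC B).
have y0 : y != 0.
  rewrite yE mulmx_free_eq0 // /row_free mxrank_map; exact: (row_base_free V).
have ys : y *m map_mx toC s = a *: y.
  by rewrite yE -mulmxA -map_mxM BS map_mxM mulmxA zS scalemxAl.
have ycs : map_mx conjc y *m map_mx toC s = conjc a *: map_mx conjc y.
  rewrite -map_mxZ -ys map_mxM; congr mulmx.
  by apply/matrixP => j k; rewrite !mxE /= oppr0.
have aa : conjc a = a.
  have E : y *m map_mx toC s *m (map_mx conjc y)^T =
      y *m (map_mx conjc y *m map_mx toC s)^T.
    by rewrite trmx_mul mulmxA (map_trmx toC s) -sT.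
  move: E; rewrite ys ycs linearZ /= -scalemxAl -scalemxAr => /matrixP/(_ 0 0).
  rewrite !mxE => /eqP; rewrite -subr_eq0 -mulrBl mulf_eq0 subr_eq0.
  case/orP=> [/eqP<-//|]; rewrite psumr_eq0 => [/allP H|j _]; last first.
    by rewrite !mxE; exact: mul_conjC_ge0.
  case/eqP: y0; apply/rowP => j; have := H j (mem_index_enum j).
  rewrite !mxE /= -[conjc _]/((y 0 j)^*) -normCK expf_eq0 normr_eq0 /=.
  by move/eqP.
have {}eiga : eigenvalue S' (complex.Re a).
  move: eiga; rewrite (conjc_real_fixed aa) !eigenvalue_root_char.
  by rewrite -map_char_poly fmorph_root.
have {z zS z0 y yE y0 ys ycs} [z zS z0] := eigenvalueP eiga.
exists (complex.Re a); apply/rowV0Pn; exists (z *m B).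
  rewrite sub_capmx (submx_trans (submxMl z B)) ?eq_row_base //=; apply/eigenspaceP.
  by rewrite -mulmxA BS mulmxA zS scalemxAl.
by rewrite mulmx_free_eq0 // row_base_free.
Qed.

(** A nonzero stable subspace of least dimension lies in an eigenspace of every member, because its
    intersection with such an eigenspace is stable by commutation. The family may be infinite. *)
Lemma sym_common_eigenvector n (S : set 'M[K]_n) : (0 < n)%N ->
  (forall s, S s -> s = s^T) -> (forall s t, S s -> S t -> s *m t = t *m s) ->
  exists2 v : 'rV[K]_n, v != 0 & forall s, S s -> exists a, v *m s = a *: v.
Proof.
move=> n0 symS comS.
pose P r := `[< exists V : 'M[K]_n, [/\ V != 0, \rank V = r &
   forall s, S s -> (V *m s <= V)%MS] >].
have exP : exists r, P r.
  exists (\rank (1%:M : 'M[K]_n)); apply/asboolP; exists 1%:M; split=> //.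
    by rewrite -mxrank_eq0 mxrank1 -lt0n.
  by move=> s _; rewrite submx1.
have [r /asboolP[V [V0 rV stV]] minr] := ex_minnP exP.
have /rowV0Pn[v vV v0] := V0.
exists v => // s Ss; have [a cap0] := sym_stable_eigenvalue (symS s Ss) V0 (stV s Ss).
exists a; apply/eigenspaceP; apply: submx_trans vV _.
set E := eigenspace s a in cap0 *.
have /minr : P (\rank (V :&: E)%MS).
  apply/asboolP; exists (V :&: E)%MS; split=> // t St.
  rewrite sub_capmx (submx_trans (submxMr t (capmxSl V E))) ?stV //=.
  apply/eigenspaceP; rewrite -mulmxA (comS t s) // mulmxA.
  have /eigenspaceP-> := capmxSr V E; by rewrite scalemxAl.
rewrite -rV => le; have := mxrank_leqif_sup (capmxSl V E).
case=> _; rewrite eqn_leq mxrankS ?capmxSl //= le => /esym.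
by rewrite sub_capmx => /andP[].
Qed.

(** The Householder reflection in the hyperplane orthogonal to [v - e] exchanges [e] and [v]. *)
Lemma unit_vector_first_row n (v : 'rV[K]_(1 + n)) : v *m v^T = 1%:M ->
  exists2 H : 'M[K]_(1 + n), H *m H^T = 1%:M & delta_mx 0 0 *m H = v.
Proof.
move=> vv; pose e : 'rV[K]_(1 + n) := delta_mx 0 0.
have ee : e *m e^T = 1%:M.
  by rewrite /e trmx_delta mul_delta_mx; apply/matrixP => i j; rewrite !ord1 !mxE.
have [->|ve] := eqVneq v e; first by exists 1%:M; rewrite ?trmx1 mulmx1.
pose u := v - e; pose q := (u *m u^T) 0 0.
have uu : u *m u^T = q%:M by rewrite [LHS]mx11_scalar.
have q0 : q != 0.
  apply: contraNneq ve; rewrite /q mxE => /eqP.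
  rewrite psumr_eq0 => [/allP H|j _]; last by rewrite [_^T _ _]mxE -expr2 sqr_ge0.
  rewrite -subr_eq0; apply/eqP/rowP => j; have := H j (mem_index_enum j).
  by rewrite ![_^T _ _]mxE mulf_eq0 orbb => /eqP; rewrite !mxE.
pose H := 1%:M - (2 / q) *: (u^T *m u).
have HT : H^T = H by rewrite /H linearB linearZ /= trmx1 trmx_mul trmxK.
exists H.
  rewrite HT /H; set M := u^T *m u.
  have MM : M *m M = q *: M.
    by rewrite /M -mulmxA [u *m _]mulmxA uu mul_scalar_mx -scalemxAr.
  rewrite mulmxBl mul1mx mulmxBr mulmx1 -scalemxAl -!scalemxAr MM !scalerA.
  by apply/matrixP => i j; rewrite !mxE; field.
have -> : delta_mx 0 0 *m H = e - (2 / q) *: (e *m u^T *m u).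
  by rewrite -mulmxA scalemxAr -[X in X - _](mulmx1 e) -mulmxBr.
have uT : u^T = v^T - e^T by rewrite /u linearB.
have ve1 : v *m e^T = e *m v^T.
  by rewrite -[LHS]trmxK trmx_mul trmxK [e *m v^T]mx11_scalar tr_scalar_mx.
have qE : q = - 2 * (e *m u^T) 0 0.
  rewrite /q {1}/u uT mulmxBl !mulmxBr vv ee ve1.
  by rewrite !mxE; ring.
rewrite [e *m _]mx11_scalar mul_scalar_mx scalerA.
have -> : 2 / q * (e *m u^T) 0 0 = -1.
  have q0' := q0; rewrite qE mulf_eq0 negb_or in q0'; case/andP: q0' => _ e0.
  by rewrite qE; field.
by rewrite scaleN1r opprK /u addrC subrK.
Qed.

(** Move a common eigenvector to the first basis vector; by symmetry all matrices become block
    diagonal, and the lower blocks satisfy the hypotheses again. *)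
Lemma sym_simultaneous_diag n (S : set 'M[K]_n) :
  (forall s, S s -> s = s^T) -> (forall s t, S s -> S t -> s *m t = t *m s) ->
  exists2 c : 'M[K]_n, c *m c^T = 1%:M &
    forall s, S s -> exists d, s = c^T *m diag_mx d *m c.
Proof.
elim: n S => [|n IHn] S symS comS.
  by exists 1%:M => [|s _]; [apply/matrixP => -[]|exists 0; apply/matrixP => -[]].
have [w w0 wS] := sym_common_eigenvector (ltn0Sn n) symS comS.
pose q := (w *m w^T) 0 0.
have q_gt0 : 0 < q.
  rewrite lt_def; apply/andP; split; last first.
    by rewrite /q mxE sumr_ge0 // => j _; rewrite [_^T _ _]mxE -expr2 sqr_ge0.
  apply: contraNneq w0; rewrite /q mxE => /eqP.
  rewrite psumr_eq0 => [/allP H|j _]; last by rewrite [_^T _ _]mxE -expr2 sqr_ge0.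
  apply/eqP/rowP => j; have := H j (mem_index_enum j).
  by rewrite ![_^T _ _]mxE mulf_eq0 orbb => /eqP; rewrite !mxE.
pose v := (Num.sqrt q)^-1 *: w.
have vv : v *m v^T = 1%:M.
  rewrite /v linearZ /= -scalemxAl -scalemxAr scalerA [w *m _]mx11_scalar -/q.
  by rewrite -invfM -expr2 sqr_sqrtr ?ltW // scale_scalar_mx mulVf // gt_eqF.
have vS s : S s -> exists a, v *m s = a *: v.
  move=> /wS[a E]; exists a.
  by rewrite -scalemxAl E !scalerA mulrC.
have [H HH eH] := unit_vector_first_row vv.
have HTH : H^T *m H = 1%:M by apply: mulmx1C.
pose conj s := H *m s *m H^T.
have conjK s : H^T *m conj s *m H = s.
  by rewrite /conj !mulmxA HTH mul1mx -mulmxA HTH mulmx1.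
have blk s : S s -> exists a, conj s = block_mx (a%:M : 'M[K]_1) 0 0 (drsubmx (conj s)).
  move=> Ss; have [a va] := vS s Ss; exists a.
  have rowE' : delta_mx 0 0 *m conj s = a *: delta_mx 0 0 :> 'rV_(1 + n).
    rewrite /conj !mulmxA eH va -scalemxAl; congr (_ *: _).
    by rewrite -eH -mulmxA HH mulmx1.
  have symc : conj s = (conj s)^T by rewrite /conj !trmx_mul trmxK -(symS s Ss) mulmxA.
  have e0 j : conj s 0 j = a *+ (j == 0).
    have <- : (delta_mx 0 0 *m conj s : 'rV_(1 + n)) 0 j = conj s 0 j.
      by rewrite -rowE mxE.
    by rewrite rowE' !mxE /= mulr_natr.
  move: (conj s) symc e0 => M symc e0.
  have l0 : lshift n (0 : 'I_1) = 0 by apply/val_inj.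
  rewrite -{1}[M]submxK; congr block_mx.
  - by apply/matrixP => i j; rewrite !ord1 !mxE l0 e0.
  - by apply/matrixP => i j; rewrite !ord1 !mxE l0 e0.
  - by apply/matrixP => i j; rewrite !ord1 !mxE l0 symc mxE e0.
pose S' := [set drsubmx (conj s) | s in S].
have [c' cc' dc'] : exists2 c : 'M[K]_n, c *m c^T = 1%:M &
    forall s, S' s -> exists d, s = c^T *m diag_mx d *m c.
  apply: IHn => [_ [s Ss <-]|_ _ [s Ss <-] [t St <-]].
    rewrite trmx_drsub; congr drsubmx.
    by rewrite /conj !trmx_mul trmxK -(symS s Ss) mulmxA.
  have E : conj s *m conj t = conj t *m conj s.
    rewrite /conj -!mulmxA ![H^T *m (H *m _)]mulmxA HTH !mul1mx.
    by rewrite ![s *m (t *m _)]mulmxA ![t *m (s *m _)]mulmxA comS.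
  have [a Ea] := blk s Ss; have [b Eb] := blk t St.
  move: E; rewrite Ea Eb !mulmx_block !mul0mx !mulmx0 !addr0 !add0r.
  by case/eq_block_mx => _ _ _; rewrite !block_mxKdr.
pose B : 'M[K]_(1 + n) := block_mx 1%:M 0 0 c'.
have BB : B *m B^T = 1%:M.
  rewrite /B tr_block_mx !trmx0 trmx1 mulmx_block !mul0mx !mulmx0 !addr0 !add0r.
  by rewrite mulmx1 cc' -scalar_mx_block.
exists (B *m H : 'M[K]_(1 + n)).
  by rewrite trmx_mul mulmxA -(mulmxA B) HH mulmx1.
move=> s Ss; have [a Ea] := blk s Ss.
have [d Ed] := dc' _ (ex_intro2 _ _ s Ss erefl).
exists (row_mx (a%:M) d : 'rV[K]_(1 + n)).
have -> : diag_mx (row_mx a%:M d) = block_mx (a%:M) 0 0 (diag_mx d) :> 'M[K]_(1 + n).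
  by rewrite diag_mx_row; congr block_mx; apply/matrixP => i j; rewrite !ord1 !mxE.
rewrite -{1}(conjK s) Ea Ed trmx_mul.
have -> : block_mx a%:M 0 0 (c'^T *m diag_mx d *m c') =
   B^T *m (block_mx (a%:M : 'M[K]_1) 0 0 (diag_mx d)) *m B.
  rewrite /B tr_block_mx !trmx0 trmx1 !mulmx_block.
  by rewrite !(mul0mx, mulmx0, addr0, add0r, mul1mx, mulmx1).
by rewrite !mulmxA.
Qed.

End RealSpectral.

(** * Saturation and separation of integer lattices *)

Section IntegerMatrices.

(** By the Smith normal form the columns of [W'] are a basis of the saturation of the column lattice
    of [W]. The identity for [D *m E] says that the index is finite; over an algebraically closed
    field both matrices then parametrize the same torus. *)
Lemma int_saturation n k (W : 'M[int]_(n, k)) :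
  exists d (W' : 'M[int]_(n, d)) (B : 'M[int]_(d, n)) (D : 'M[int]_(d, k))
    (E : 'M[int]_(k, d)) (delta : nat),
  [/\ B *m W' = 1%:M, W = W' *m D, D *m E = (delta%:Z)%:M & (0 < delta)%N].
Proof.
have [L uL [R uR [s _ WE]]] := int_Smith_normal_form W.
pose J := [pred i : 'I_n | (i < k)%N && (s`_i != 0)].
pose f (j : 'I_#|J|) : 'I_n := enum_val j.
have fJ j : (f j < k)%N && (s`_(f j) != 0) by have := enum_valP j.
have fk j : (f j < k)%N by case/andP: (fJ j).
have f0 j : s`_(f j) != 0 by case/andP: (fJ j).
pose g j : 'I_k := Ordinal (fk j).
have f_inj : injective f by apply: enum_val_inj.
have g_inj : injective g by move=> i j /(congr1 val) /= /val_inj /f_inj.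
pose del := (\prod_j absz (s`_(f j))%R)%N.
(* Chosen so that its product with the invariant factor of index [f j] is [del] for every [j]; [sgz]
   corrects the sign. *)
pose e j : int := sgz s`_(f j) * (\prod_(l | l != j) absz (s`_(f l))%R)%N%:Z.
exists #|J|, (colsub f L), (rowsub f (invmx L)),
  (diag_mx (\row_j s`_(f j)) *m rowsub g R),
  (colsub g (invmx R) *m diag_mx (\row_j e j)), del; split.
- rewrite mul_rowsub_mx mulmx_colsub mulVmx //.
  by apply/matrixP => i j; rewrite !mxE (inj_eq f_inj).
- rewrite {1}WE mul_diag_mx; apply/matrixP => a b; rewrite !mxE.
  transitivity (\sum_(j < k) \sum_(i < n) L a i * (s`_i *+ (i == j :> nat)) * R j b).
    by apply: eq_bigr => j _; rewrite mxE mulr_suml; apply: eq_bigr => i _; rewrite !mxE.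
  rewrite exchange_big /= (bigID (mem J)) /= [X in _ + X]big1 ?addr0; last first.
    move=> i; rewrite inE negb_and -leqNgt => /orP[ki|/negPn/eqP si]; apply: big1 => j _.
      by rewrite gtn_eqF ?mulr0n ?mulr0 ?mul0r // (leq_trans (ltn_ord j)).
    by rewrite si mul0rn mulr0 mul0r.
  rewrite big_enum_val; apply: eq_bigr => j _ /=.
  rewrite -/(f j) (bigD1 (g j)) //= big1 ?addr0.
    by rewrite eqxx mulr1n !mxE mulrA.
  move=> i /eqP ij; case: eqP => [E|_]; last by rewrite mulr0n mulr0 mul0r.
  by case: ij; apply/val_inj.
- rewrite -mulmxA [rowsub g R *m _]mulmxA mul_rowsub_mx mulmx_colsub mulmxV //.
  have -> : rowsub g (colsub g (1%:M : 'M[int]_k)) = 1%:M.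
    by apply/matrixP => i j; rewrite !mxE (inj_eq g_inj).
  rewrite mul1mx; apply/matrixP => i j; rewrite mul_diag_mx !mxE.
  case: eqVneq => [->|_]; last by rewrite !mulr0n mulr0.
  rewrite !mulr1n /e mulrA [_ * sgz _]mulrC -abszEsg -PoszM /del; congr Posz.
  by rewrite [RHS](bigD1 j).
- by rewrite /del prodn_gt0 // => j; rewrite absz_gt0.
Qed.

Local Notation toQ := (map_mx (intr : int -> rat)).

Lemma col_mulmx (L : nzRingType) m n p (A : 'M[L]_(m, n)) (B : 'M[L]_(n, p)) j :
  col j (A *m B) = A *m col j B.
Proof. by rewrite !colE mulmxA. Qed.

Lemma toQ_inj m n : injective (map_mx (intr : int -> rat) : 'M[int]_(m, n) -> 'M[rat]_(m, n)).
Proof.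
move=> A B /matrixP H; apply/matrixP => i j.
by apply: (@intr_inj rat); have := H i j; rewrite !mxE.
Qed.

Lemma rat_mx_denominator m n (A : 'M[rat]_(m, n)) :
  exists2 N : nat, (0 < N)%N & exists A' : 'M[int]_(m, n), N%:R *: A = toQ A'.
Proof.
pose D := \prod_(ij : 'I_m * 'I_n) denq (A ij.1 ij.2).
have D_gt0 : 0 < D by apply: prodr_gt0 => ij _; apply: denq_gt0.
exists (absz D); first by rewrite absz_gt0 gt_eqF.
pose d (ij : 'I_m * 'I_n) := \prod_(kl | kl != ij) denq (A kl.1 kl.2).
exists (\matrix_(i, j) (numq (A i j) * d (i, j))); apply/matrixP => i j.
have q0 : (denq (A i j))%:~R != 0 :> rat by rewrite intr_eq0 denq_neq0.
have DE : D = denq (A i j) * d (i, j) by rewrite /D (bigD1 (i, j)).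
rewrite !mxE pmulrn gez0_abs ?ltW // DE !intrM -{2}(divq_num_den (A i j)).
by field.
Qed.

(** A family of maximal rank in [M] spans it over the rationals. Saturation keeps [x] out of this
    span, so a column of the cokernel detects [x]; clearing denominators makes it integral. *)
Lemma int_separation n (M : set 'rV[int]_n) (x : 'rV[int]_n) :
  M 0 -> (forall y z, M y -> M z -> M (y - z)) ->
  (forall y N, (0 < N)%N -> M (y *+ N) -> M y) -> ~ M x ->
  exists v : 'cV[int]_n, (forall y, M y -> y *m v = 0) /\ x *m v != 0.
Proof.
move=> M0 MB Msat Mx.
pose P r := `[< exists k (B : 'M[int]_(k, n)),
   (forall i, M (row i B)) /\ \rank (toQ B) = r >].
have exP : exists r, P r.
  by exists (\rank (toQ (0 : 'M[int]_(0, n)))); apply/asboolP; exists 0%N, 0; split=> // -[].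
have ubP r : P r -> (r <= n)%N by move=> /asboolP[k [B [_ <-]]]; apply: rank_leq_col.
have [r /asboolP[k [B [MrowB rB]]] maxr] := ex_maxnP exP ubP.
have MN y : M y -> M (- y) by move=> My; rewrite -sub0r; apply: MB.
have MD y z : M y -> M z -> M (y + z) by move=> My Mz; rewrite -[z]opprK; apply/MB/MN.
have MZ y (c : int) : M y -> M (c *: y).
  move=> My; have Mn (m : nat) : M (m%:Z *: y).
    elim: m => [|m IHm]; first by rewrite scale0r.
    by rewrite intS scalerDl scale1r; apply: MD.
  by case: c => m //; rewrite NegzE scaleNr; apply: MN.
have MB' (a : 'rV[int]_k) : M (a *m B).
  rewrite mulmx_sum_row; elim/big_ind: _ => // i _; exact: MZ.
have sub y : M y -> (toQ y <= toQ B)%MS.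
  move=> My; have /maxr : P (\rank (toQ (col_mx B y))).
    apply/asboolP; exists (k + 1)%N, (col_mx B y); split=> // h.
    rewrite -[h]fintype.splitK; case: (fintype.split h) => j /=.
      by rewrite rowKu.
    by rewrite rowKd ord1 row_id.
  rewrite -rB map_col_mx => le.
  have [_ ] := mxrank_leqif_sup (submx_trans (addsmxSl (toQ B) (toQ y)) (submx_refl _)).
  rewrite -(addsmxE (toQ B) (toQ y)) in le.
  rewrite eqn_leq le mxrankS ?addsmxSl //= => /esym; exact: submx_trans (addsmxSr _ _).
have nsub : ~~ (toQ x <= toQ B)%MS.
  apply/negP => /submxP[a xa]; apply: Mx.
  have [N N0 [a' Ea]] := rat_mx_denominator a.
  apply: (Msat _ N N0).
  have -> : x *+ N = a' *m B; last exact: MB'.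
  apply: toQ_inj.
  rewrite map_mxM -Ea -scalemxAl -xa.
  by apply/matrixP => i j; rewrite !mxE mulmxnE rmorphMn /= mulr_natl.
have [j xj] : exists j, toQ x *m col j (cokermx (toQ B)) != 0.
  apply: contrapT => H; case/negP: nsub; rewrite submxE; apply/eqP/matrixP => i j.
  have /eqP : toQ x *m col j (cokermx (toQ B)) == 0.
    by apply/negPn/negP => E; apply: H; exists j.
  by rewrite -col_mulmx => /matrixP/(_ i 0); rewrite !mxE.
have [N N0 [v Ev]] := rat_mx_denominator (col j (cokermx (toQ B))).
have N0' : N%:R != 0 :> rat by rewrite pnatr_eq0 -lt0n.
exists v; split=> [y /sub|].
  rewrite submxE => /eqP E; apply: toQ_inj.
  by rewrite map_mxM -Ev -scalemxAr -col_mulmx E map_mx0 col0 scaler0.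
apply: contraNneq xj => E; rewrite -(inj_eq (scalerI N0')) scaler0 scalemxAr Ev.
by rewrite -map_mxM E map_mx0.
Qed.

End IntegerMatrices.

(** * Split tori *)

Notation mX k j := (mpoly.mpolyX k (mpoly.mnm1 j)).

Lemma mpoly_alg_ind (k : nzRingType) m (P : mpoly.mpoly m k -> Prop) :
  (forall a, P (mpoly.mpolyC m a)) -> (forall j, P (mX k j)) ->
  (forall p q, P p -> P q -> P (p + q)) -> (forall p q, P p -> P q -> P (p * q)) ->
  forall p, P p.
Proof.
move=> PC PX PD PM p; elim/mpoly.mpolyind: p => [|a M p _ _ Pp].
  by rewrite -mpoly.mpolyC0; apply: PC.
apply: (PD) => //; rewrite -mpoly.mul_mpolyC; apply: (PM); first exact: PC.
rewrite mpoly.mpolyXE_id; apply: (big_ind P) => [|f g|j _]; [exact: (PC 1)|exact: PM|].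
elim: (M j) => [|e IHe]; first by rewrite expr0; exact: (PC 1).
by rewrite exprS; apply: PM.
Qed.

Section MatrixPolynomials.
Variables (k : fieldType) (n : nat).

(* [pev i A] is [pval i ^~ A] as a ring morphism. *)
Definition pev (L : fieldType) (i : {rmorphism k -> L}) (A : 'M[L]_n) :
    {rmorphism entry_poly k n -> L} := mpoly.mmap i (fun j => mxvec A 0 j).

Definition genmx : 'M[entry_poly k n]_n := \matrix_(a, b) mX k (mxvec_index a b).

Definition constmx m m' (c : 'M[k]_(m, m')) : 'M[entry_poly k n]_(m, m') :=
  map_mx (@mpoly.mpolyC (n * n) k) c.

Definition pcomp (p : entry_poly k n) (M : 'M[entry_poly k n]_n) : entry_poly k n :=
  mpoly.mmap (@mpoly.mpolyC (n * n) k) (fun j => mxvec M 0 j) p.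

Section Evaluation.
Variables (L : fieldType) (i : {rmorphism k -> L}).
Implicit Types (A : 'M[L]_n).

Lemma pevE A p : pev i A p = pval i p A. Proof. by []. Qed.

Lemma pev_const A a : pev i A (mpoly.mpolyC _ a) = i a.
Proof. exact: mpoly.mmapC. Qed.

Lemma pev_var A j : pev i A (mX k j) = mxvec A 0 j.
Proof. by rewrite /pev /= mpoly.mmapX mpoly.mmap1U. Qed.

Lemma pev_genmx A : map_mx (pev i A) genmx = A.
Proof. by apply/matrixP => a b; rewrite !mxE pev_var mxvecE. Qed.

Lemma pev_constmx A m m' (c : 'M[k]_(m, m')) : map_mx (pev i A) (constmx c) = map_mx i c.
Proof. by apply/matrixP => a b; rewrite !mxE pev_const. Qed.

Lemma pev_comp A p M : pev i A (pcomp p M) = pev i (map_mx (pev i A) M) p.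
Proof.
elim/mpoly_alg_ind: p => [a|j|p q Hp Hq|p q Hp Hq].
- by rewrite /pcomp mpoly.mmapC !pev_const.
- rewrite /pcomp mpoly.mmapX mpoly.mmap1U pev_var.
  by case: (mxvec_indexP j) => a b; rewrite !mxvecE mxE.
- by rewrite /pcomp !rmorphD /= -!/(pcomp _ _) Hp Hq.
- by rewrite /pcomp !rmorphM /= -!/(pcomp _ _) Hp Hq.
Qed.

End Evaluation.

Lemma pev_map (L L' : fieldType) (i : {rmorphism k -> L}) (j : {rmorphism L -> L'})
    (i' : {rmorphism k -> L'}) (A : 'M[L]_n) p :
  (forall x, i' x = j (i x)) -> pev i' (map_mx j A) p = j (pev i A p).
Proof.
move=> i'E; elim/mpoly_alg_ind: p => [a|l|p q Hp Hq|p q Hp Hq].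
- by rewrite !pev_const i'E.
- by rewrite !pev_var; case: (mxvec_indexP l) => a b; rewrite !mxvecE mxE.
- by rewrite !rmorphD /= Hp Hq.
- by rewrite !rmorphM /= Hp Hq.
Qed.

End MatrixPolynomials.

(** * Characters and homomorphisms of tori given by integer exponents *)

Section Monomials.
Variable L : fieldType.

Definition nz d (x : 'rV[L]_d) := forall j, x 0 j != 0.

Definition mon d (x : 'rV[L]_d) (e : 'rV[int]_d) : L := \prod_j x 0 j ^ e 0 j.

(** The homomorphism of tori whose coordinates are the characters in the rows of [W]; composition
    corresponds to the product of integer matrices. *)
Definition tw n d (W : 'M[int]_(n, d)) (x : 'rV[L]_d) : 'rV[L]_n :=
  \row_a mon x (row a W).

Definition hmul d (x y : 'rV[L]_d) : 'rV[L]_d := \row_j (x 0 j * y 0 j).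

Lemma mon_neq0 d (x : 'rV[L]_d) e : nz x -> mon x e != 0.
Proof. by move=> nzx; apply/prodf_neq0 => j _; rewrite expfz_neq0. Qed.

Lemma tw_nz n d (W : 'M[int]_(n, d)) x : nz x -> nz (tw W x).
Proof. by move=> nzx j; rewrite mxE mon_neq0. Qed.

Lemma mon0 d (x : 'rV[L]_d) : mon x 0 = 1.
Proof. by rewrite /mon big1 // => j _; rewrite mxE expr0z. Qed.

Lemma monD d (x : 'rV[L]_d) e f : nz x -> mon x (e + f) = mon x e * mon x f.
Proof.
by move=> nzx; rewrite -big_split; apply: eq_bigr => j _; rewrite mxE expfzDr.
Qed.

Lemma monN d (x : 'rV[L]_d) e : mon x (- e) = (mon x e)^-1.
Proof.
by rewrite -prodfV; apply: eq_bigr => j _; rewrite mxE invr_expz.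
Qed.

Lemma monB d (x : 'rV[L]_d) e f : nz x -> mon x (e - f) = mon x e / mon x f.
Proof. by move=> nzx; rewrite monD // monN. Qed.

Lemma monZ d (x : 'rV[L]_d) (c : int) e : mon x (c *: e) = mon x e ^ c.
Proof.
rewrite /mon; transitivity (\prod_j (x 0 j ^ e 0 j) ^ c).
  by apply: eq_bigr => j _; rewrite mxE exprz_exp mulrC.
exact/esym/(big_morph (fun z => z ^ c) (fun x y => expfzMl x y c) (exp1rz L c)).
Qed.

Lemma monMn d (x : 'rV[L]_d) e N : mon x (e *+ N) = mon x e ^+ N.
Proof. by rewrite -scaler_nat -[RHS]/(_ ^ N%:Z) -monZ pmulrn intz. Qed.

Lemma mon_sum d (x : 'rV[L]_d) (I : Type) (s : seq I) (F : I -> 'rV[int]_d) :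
  nz x -> mon x (\sum_(j <- s) F j) = \prod_(j <- s) mon x (F j).
Proof.
move=> nzx; elim: s => [|j s IHs]; first by rewrite !big_nil mon0.
by rewrite !big_cons monD // IHs.
Qed.

Lemma mon_tw n d (W : 'M[int]_(n, d)) (x : 'rV[L]_d) e : nz x ->
  mon (tw W x) e = mon x (e *m W).
Proof.
move=> nzx; rewrite mulmx_sum_row mon_sum // /mon; apply: eq_bigr => j _.
by rewrite mxE -monZ.
Qed.

Lemma tw_tw m n d (V : 'M[int]_(m, n)) (W : 'M[int]_(n, d)) (x : 'rV[L]_d) : nz x ->
  tw V (tw W x) = tw (V *m W) x.
Proof. by move=> nzx; apply/rowP => a; rewrite !mxE mon_tw // row_mul. Qed.

Lemma mon_delta d (x : 'rV[L]_d) j : mon x (delta_mx 0 j) = x 0 j.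
Proof.
rewrite /mon (bigD1 j) //= big1 ?mulr1 => [|l lj]; rewrite mxE eqxx.
  by rewrite eqxx expr1z.
by rewrite eq_sym in lj; rewrite eq_sym (negbTE lj) expr0z.
Qed.

Lemma tw_scalar d (N : int) (x : 'rV[L]_d) : tw N%:M x = \row_j (x 0 j ^ N).
Proof.
apply/rowP => j; rewrite !mxE -[X in X ^ _]mon_delta -monZ; congr mon.
by apply/rowP => l; rewrite !mxE eqxx mulr_natr eq_sym.
Qed.

Lemma mon_hmul d (x y : 'rV[L]_d) e : mon (hmul x y) e = mon x e * mon y e.
Proof. by rewrite -big_split; apply: eq_bigr => j _; rewrite mxE expfzMl. Qed.

Lemma tw_hmul n d (W : 'M[int]_(n, d)) x y : tw W (hmul x y) = hmul (tw W x) (tw W y).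
Proof. by apply/rowP => a; rewrite !mxE mon_hmul. Qed.

Lemma nz_hmul d (x y : 'rV[L]_d) : nz x -> nz y -> nz (hmul x y).
Proof. by move=> nzx nzy j; rewrite mxE mulf_neq0. Qed.

Lemma diag_hmul d (x y : 'rV[L]_d) : diag_mx (hmul x y) = diag_mx x *m diag_mx y.
Proof.
rewrite mul_diag_mx; apply/matrixP => a b; rewrite !mxE.
by case: eqVneq => [->|_]; rewrite ?mulr1n // !mulr0n mulr0.
Qed.

Lemma nz1 d : nz (const_mx 1 : 'rV[L]_d).
Proof. by move=> j; rewrite mxE oner_eq0. Qed.

Lemma mon_const1 d e : mon (const_mx 1 : 'rV[L]_d) e = 1.
Proof. by rewrite /mon big1 // => j _; rewrite mxE exp1rz. Qed.

End Monomials.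

Lemma mon_map (L L' : fieldType) (i : {rmorphism L -> L'}) d (x : 'rV[L]_d) e :
  mon (map_mx i x) e = i (mon x e).
Proof. by rewrite rmorph_prod; apply: eq_bigr => j _; rewrite mxE fmorphXz. Qed.

Lemma tw_map (L L' : fieldType) (i : {rmorphism L -> L'}) n d (W : 'M[int]_(n, d)) x :
  tw W (map_mx i x) = map_mx i (tw W x).
Proof. by apply/rowP => a; rewrite !mxE mon_map. Qed.

Lemma mon_gt0 (L : numFieldType) d (x : 'rV[L]_d) e :
  (forall j, 0 < x 0 j) -> 0 < mon x e.
Proof. by move=> x0; apply: prodr_gt0 => j _; rewrite exprz_gt0. Qed.

Lemma tw_gt0 (L : numFieldType) n d (W : 'M[int]_(n, d)) (x : 'rV[L]_d) :
  (forall j, 0 < x 0 j) -> forall j, 0 < tw W x 0 j.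
Proof. by move=> x0 j; rewrite mxE mon_gt0. Qed.

Lemma gt0_nz (L : numFieldType) d (x : 'rV[L]_d) : (forall j, 0 < x 0 j) -> nz x.
Proof. by move=> x0 j; rewrite gt_eqF. Qed.

(** * Equations of a diagonalized torus *)

Section TorusEquations.
Variables (k : fieldType) (n d : nat) (c : 'M[k]_n) (W : 'M[int]_(n, d))
  (B : 'M[int]_(d, n)).
Hypothesis cc : c *m c^T = 1%:M.
Hypothesis BW : B *m W = 1%:M.
Hypothesis W0 : forall j, \sum_a W a j = 0.

Definition tmat (L : fieldType) (i : k -> L) (z : 'rV[L]_n) : 'M[L]_n :=
  (map_mx i c)^T *m diag_mx z *m map_mx i c.

(** [zi] plays the role of the inverse of [z]: an entry built from the adjugate below, and an
    inverse variable for Laurent polynomials. *)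
Definition zpow (R : nzRingType) (z zi : R) (e : int) : R :=
  match e with Posz m => z ^+ m | Negz m => zi ^+ m.+1 end.

Let zmx := constmx n c *m genmx k n *m (constmx n c)^T.
Let zimx := constmx n c *m \adj (genmx k n) *m (constmx n c)^T.

Definition torus_mon (e : 'rV[int]_n) : entry_poly k n :=
  \prod_a zpow (zmx a a) (zimx a a) (e 0 a).

(** Determinant 1, diagonal form in the basis [c], and a diagonal that is fixed by [tw (W *m B)]. As
    [B *m W] is the identity, the last condition describes the image of [tw W]. *)
Definition torus_eqs : seq (entry_poly k n) :=
  (\det (genmx k n) - 1) ::
  [seq zmx ab.1 ab.2 | ab in [pred ab : 'I_n * 'I_n | ab.1 != ab.2]] ++
  [seq zmx a a - torus_mon (row a (W *m B)) | a : 'I_n].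

Definition torus_coord (j : 'I_d) : entry_poly k n := torus_mon (row j B).

Section Points.
Variables (L : fieldType) (i : {rmorphism k -> L}).

Let cL := map_mx i c.
Lemma tmat_orth : cL *m cL^T = 1%:M.
Proof. by rewrite /cL map_trmx -map_mxM cc map_mx1. Qed.
Let cc' : cL^T *m cL = 1%:M. Proof. exact: mulmx1C tmat_orth. Qed.

Lemma tmatK z : cL *m tmat i z *m cL^T = diag_mx z.
Proof. by rewrite /tmat -/cL !mulmxA tmat_orth mul1mx -mulmxA tmat_orth mulmx1. Qed.

Lemma tmat_inj : injective (tmat i).
Proof.
move=> y z /(congr1 (fun M => cL *m M *m cL^T)); rewrite !tmatK => /matrixP H.
by apply/rowP => a; have := H a a; rewrite !mxE eqxx !mulr1n.
Qed.

Lemma tmatM y z : tmat i y *m tmat i z = tmat i (hmul y z).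
Proof.
rewrite /tmat -/cL diag_hmul -!mulmxA; congr (_ *m (_ *m _)).
by rewrite mulmxA tmat_orth mul1mx.
Qed.

Lemma tmat1 : tmat i (const_mx 1) = 1%:M.
Proof. by rewrite /tmat -/cL diag_const_mx mulmx1 cc'. Qed.

Lemma tmat_sym z : (tmat i z)^T = tmat i z.
Proof. by rewrite /tmat !trmx_mul trmxK tr_diag_mx mulmxA. Qed.

Lemma tmat_comm y z : tmat i y *m tmat i z = tmat i z *m tmat i y.
Proof. by rewrite !tmatM; congr tmat; apply/rowP => j; rewrite !mxE mulrC. Qed.

Lemma tmatV z : nz z -> invmx (tmat i z) = tmat i (\row_a (z 0 a)^-1).
Proof.
move=> nzz; have E : tmat i z *m tmat i (\row_a (z 0 a)^-1) = 1%:M.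
  rewrite tmatM -tmat1; congr tmat; apply/rowP => a.
  by rewrite !mxE mulfV.
have [u _] := mulmx1_unit E.
by rewrite -[LHS]mulmx1 -E mulKmx.
Qed.

Lemma tmat_unit z : nz z -> tmat i z \in unitmx.
Proof.
move=> nzz; have E : tmat i z *m tmat i (\row_a (z 0 a)^-1) = 1%:M.
  rewrite tmatM -tmat1; congr tmat; apply/rowP => a.
  by rewrite !mxE mulfV.
by case/mulmx1_unit: E.
Qed.

Lemma tmat_det z : \det (tmat i z) = \prod_a z 0 a.
Proof.
rewrite /tmat -/cL !det_mulmx mulrC mulrA -det_mulmx tmat_orth det1 mul1r.
by rewrite det_diag.
Qed.

Lemma zpowE (z : L) e : zpow z z^-1 e = z ^ e.
Proof. by case: e => m //=; rewrite exprVn. Qed.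

Lemma rmorph_zpow (R1 R2 : nzRingType) (f : {rmorphism R1 -> R2}) z zi e :
  f (zpow z zi e) = zpow (f z) (f zi) e.
Proof. by case: e => m /=; rewrite rmorphXn. Qed.

Lemma zmxE A a b : pev i A (zmx a b) = (cL *m A *m cL^T) a b.
Proof.
have -> : cL *m A *m cL^T = map_mx (pev i A) zmx.
  by rewrite !map_mxM -map_trmx !pev_constmx pev_genmx.
by rewrite [RHS]mxE.
Qed.

Lemma zimxE A a b : \det A = 1 ->
  pev i A (zimx a b) = (cL *m invmx A *m cL^T) a b.
Proof.
move=> dA; have -> : cL *m invmx A *m cL^T = map_mx (pev i A) zimx.
  rewrite !map_mxM -map_trmx !pev_constmx map_mx_adj pev_genmx.
  by rewrite /invmx unitmxE dA unitr1 invr1 scale1r.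
by rewrite [RHS]mxE.
Qed.

Lemma pev_torus_mon z e : nz z -> \prod_a z 0 a = 1 ->
  pev i (tmat i z) (torus_mon e) = mon z e.
Proof.
move=> nzz z1; rewrite rmorph_prod; apply: eq_bigr => a _.
have E1 : pev i (tmat i z) (zmx a a) = z 0 a.
  by rewrite zmxE tmatK mxE eqxx mulr1n.
have E2 : pev i (tmat i z) (zimx a a) = (z 0 a)^-1.
  by rewrite zimxE ?tmat_det // tmatV // tmatK mxE eqxx mulr1n mxE.
rewrite (rmorph_zpow (pev i (tmat i z))) E1 E2; exact: zpowE.
Qed.

Lemma prod_tw (x : 'rV[L]_d) : nz x -> \prod_a tw W x 0 a = 1.
Proof.
move=> nzx; transitivity (mon (tw W x) (const_mx 1)).
  by apply: eq_bigr => a _; rewrite [const_mx _ _ _]mxE expr1z.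
rewrite mon_tw //; have -> : (const_mx 1 : 'rV[int]_n) *m W = 0; last exact: mon0.
apply/rowP => j; rewrite !mxE -[RHS](W0 j); apply: eq_bigr => a _.
by rewrite mxE mul1r.
Qed.

(** The parameter of a point is [tw B z], where z is its diagonal. No extraction of roots is
    involved, so this holds over every extension field. *)
Lemma torus_zeros A :
  zeros i torus_eqs A <-> exists2 x, nz x & A = tmat i (tw W x).
Proof.
split=> [H|[x nzx ->]].
  have dA : \det A = 1.
    have := H _ (mem_head _ _); rewrite -pevE rmorphB rmorph1.
    rewrite -det_map_mx pev_genmx => /eqP.
    by rewrite subr_eq0 => /eqP.
  have diagA : cL *m A *m cL^T = diag_mx (\row_a (cL *m A *m cL^T) a a).
    apply/matrixP => a b; rewrite [RHS]mxE [in RHS]mxE.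
    case: (eqVneq a b) => [->|ab]; first by rewrite mulr1n.
    rewrite mulr0n -zmxE; apply: H.
    rewrite inE mem_cat; apply/orP; right; apply/orP; left.
    by apply/fintype.imageP; exists (a, b).
  set z := \row_a _ in diagA.
  have Az : A = tmat i z.
    by rewrite /tmat -diagA !mulmxA cc' mul1mx -mulmxA cc' mulmx1.
  have z1 : \prod_a z 0 a = 1 by rewrite -tmat_det -Az.
  have nzz : nz z by move=> a; move/eqP: z1; apply: contraTneq => za; rewrite (bigD1 a) //= za mul0r eq_sym oner_eq0.
  exists (tw B z); first exact: tw_nz.
  rewrite tw_tw // {1}Az; congr tmat; apply/rowP => a.
  have /H : zmx a a - torus_mon (row a (W *m B)) \in torus_eqs.
    rewrite inE mem_cat; apply/orP; right; apply/orP; right.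
    by apply/fintype.imageP; exists a.
  rewrite -pevE rmorphB {2}Az pev_torus_mon // zmxE Az tmatK => /eqP.
  by rewrite subr_eq0 !mxE eqxx mulr1n => /eqP.
have x1 := prod_tw nzx.
move=> p; rewrite inE mem_cat => /or3P[/eqP->|/fintype.imageP[[a b] + ->]|/fintype.imageP[a _ ->]].
- by rewrite -pevE rmorphB rmorph1 -det_map_mx pev_genmx tmat_det x1 subrr.
- by rewrite inE => /= ab; rewrite -pevE zmxE tmatK mxE (negbTE ab).
- rewrite -pevE rmorphB pev_torus_mon //; last exact: tw_nz.
  rewrite zmxE tmatK mxE eqxx mulr1n mon_tw // -row_mul -mulmxA BW mulmx1.
  by rewrite mxE subrr.
Qed.

Lemma torus_coordE x j : nz x -> pval i (torus_coord j) (tmat i (tw W x)) = x 0 j.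
Proof.
move=> nzx; rewrite -pevE pev_torus_mon ?prod_tw //; last exact: tw_nz.
by rewrite mon_tw // -row_mul BW row1 mon_delta.
Qed.

End Points.
End TorusEquations.

Lemma monE (L : fieldType) d (x : 'rV[L]_d) e : mon x e = \prod_j x 0 j ^ e 0 j.
Proof. by []. Qed.

Lemma twE (L : fieldType) n d (W : 'M[int]_(n, d)) (x : 'rV[L]_d) a :
  tw W x 0 a = mon x (row a W).
Proof. exact: mxE. Qed.

Lemma hmulE (L : fieldType) d (x y : 'rV[L]_d) j : hmul x y 0 j = x 0 j * y 0 j.
Proof. exact: mxE. Qed.

Lemma tmatE (k L : fieldType) n (c : 'M[k]_n) (i : k -> L) (z : 'rV[L]_n) :
  tmat c i z = (map_mx i c)^T *m diag_mx z *m map_mx i c.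
Proof. by []. Qed.

Definition mxEE := (twE, hmulE, @mxE).

Definition pos_row (K : rcfType) d (x : 'rV[K]_d) := forall j, 0 < x 0 j.

Lemma fmap_mx_inj (L L' : fieldType) (f : {rmorphism L -> L'}) m n :
  injective (map_mx f : 'M[L]_(m, n) -> 'M[L']_(m, n)).
Proof.
move=> A B /matrixP H; apply/matrixP => a b.
by apply: (fmorph_inj f); have := H a b; rewrite !mxEE.
Qed.

(** * Laurent polynomials on positive points *)

Section Laurent.
Variables (K : rcfType) (r : nat).
Notation lpoly := (mpoly.mpoly (r + r)%N K).

Definition lev (L : fieldType) (i : {rmorphism K -> L}) (t : 'rV[L]_r) :
    {rmorphism lpoly -> L} :=
  mpoly.mmap i (fun j => row_mx t (map_mx GRing.inv t) 0 j).

Definition lkey (m : mpoly.multinom (r + r)) : 'rV[int]_r :=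
  \row_j ((m (lshift r j))%:Z - (m (rshift r j))%:Z).

Definition lmon (e : 'rV[int]_r) : lpoly :=
  \prod_j zpow (mX K (lshift r j)) (mX K (rshift r j)) (e 0 j).

Lemma lev_sum (L : fieldType) (i : {rmorphism K -> L}) t p : nz t ->
  lev i t p = \sum_(m <- mpoly.msupp p) i (mpoly.mcoeff m p) * mon t (lkey m).
Proof.
move=> nzt; apply: eq_bigr => m _; congr (_ * _).
rewrite /mpoly.mmap1 big_split_ord monE /= -big_split; apply: eq_bigr => j _ /=.
rewrite row_mxEl row_mxEr !mxEE expfzDr // -exprnP exprVn; congr (_ * _).
by rewrite -exprnN.
Qed.

Lemma lev_const (L : fieldType) (i : {rmorphism K -> L}) t a :
  lev i t (mpoly.mpolyC _ a) = i a.
Proof. exact: mpoly.mmapC. Qed.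

Lemma lev_var (L : fieldType) (i : {rmorphism K -> L}) t j :
  lev i t (mX K j) = row_mx t (map_mx GRing.inv t) 0 j.
Proof. by rewrite /lev /= mpoly.mmapX mpoly.mmap1U. Qed.

Lemma lev_lmon (L : fieldType) (i : {rmorphism K -> L}) t e :
  lev i t (lmon e) = mon t e.
Proof.
rewrite rmorph_prod; apply: eq_bigr => j _.
by rewrite rmorph_zpow !lev_var row_mxEl row_mxEr mxEE zpowE.
Qed.

Lemma lev_map (L L' : fieldType) (i : {rmorphism K -> L}) (j : {rmorphism L -> L'})
    (i' : {rmorphism K -> L'}) t p :
  (forall x, i' x = j (i x)) -> lev i' (map_mx j t) p = j (lev i t p).
Proof.
move=> i'E; elim/mpoly_alg_ind: p => [a|l|p q Hp Hq|p q Hp Hq].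
- by rewrite !lev_const i'E.
- rewrite !lev_var -(fintype.splitK l); case: (fintype.split l) => m /=.
    by rewrite !row_mxEl mxEE.
  by rewrite !row_mxEr !mxEE fmorphV.
- by rewrite !rmorphD /= Hp Hq.
- by rewrite !rmorphM /= Hp Hq.
Qed.

Lemma pos_hmul (x y : 'rV[K]_r) : pos_row x -> pos_row y -> pos_row (hmul x y).
Proof. by move=> x0 y0 j; rewrite mxEE mulr_gt0. Qed.

Lemma pos1 : pos_row (const_mx 1 : 'rV[K]_r).
Proof. by move=> j; rewrite mxEE. Qed.

(** Tested at the point with entry 2 at [j] and 1 elsewhere, as 2 has infinite order. *)
Lemma mon_inj (e f : 'rV[int]_r) :
  (forall t : 'rV[K]_r, pos_row t -> mon t e = mon t f) -> e = f.
Proof.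
move=> H; apply/rowP => j.
pose t : 'rV[K]_r := \row_l (if l == j then 2 else 1).
have t0 : pos_row t by move=> l; rewrite mxEE; case: ifP.
have E g : mon t g = 2 ^ g 0 j.
  rewrite monE (bigD1 j) //= big1 ?mulr1 => [|l lj]; rewrite mxEE ?eqxx //.
  by rewrite (negbTE lj) exp1rz.
have := H t t0; rewrite !E => /ieexprIz; apply=> //.
by rewrite -subr_eq0 (_ : 2 - 1 = 1 :> K) ?oner_eq0 //; ring.
Qed.

Lemma mon_independent (I : eqType) (s : seq I) (key : I -> 'rV[int]_r) (a : I -> K) :
  (forall t, pos_row t -> \sum_(i <- s) a i * mon t (key i) = 0) ->
  forall e, \sum_(i <- s | key i == e) a i = 0.
Proof.
move=> H; pose T := {t : 'rV[K]_r | pos_row t}.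
pose op (x y : T) : T := exist _ _ (pos_hmul (svalP x) (svalP y)).
apply: (@characters_independent_key T op K I s _ key (fun e x => mon (sval x) e) a).
- by move=> e x y; rewrite /= mon_hmul.
- by move=> e; exists (exist _ _ pos1); rewrite /= mon_const1 oner_eq0.
- move=> e f _ _ E; apply: mon_inj => t t0.
  by have := congr1 (fun u => u (exist _ t t0)) E.
- by move=> [t t0]; apply: H.
Qed.

(** Independence of the monomials on positive points over [K] kills the total coefficient of each
    exponent, and this persists in every extension field. *)
Lemma lev_vanish p : (forall t, pos_row t -> lev idfun t p = 0) ->
  forall (L : fieldType) (i : {rmorphism K -> L}) t, nz t -> lev i t p = 0.
Proof.
move=> H L i t nzt; rewrite lev_sum // (sum_by_key _ lkey) big1 // => e _.
rewrite (eq_bigr (fun m => i (mpoly.mcoeff m p) * mon t (val e))); last first.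
  by move=> m /eqP->.
rewrite -mulr_suml -rmorph_sum /=.
rewrite (@mon_independent _ (mpoly.msupp p) lkey (fun m => mpoly.mcoeff m p)) ?rmorph0 ?mul0r //.
by move=> u u0; rewrite -[RHS](H u u0) lev_sum //; apply: gt0_nz.
Qed.

End Laurent.

(* The notions of Defs over an arbitrary algebraically closed extension [C] of
   [K]; those of Defs are the case [C = K[i]]. *)
Section ClosedPoints.
Variables (K : rcfType) (C : numClosedFieldType) (toC : {rmorphism K -> C}) (n : nat).
Implicit Types (P Q : seq (entry_poly K n)).

Definition lmx r (phi : 'M[mpoly.mpoly (r + r)%N K]_n) (L : fieldType)
    (i : {rmorphism K -> L}) (t : 'rV[L]_r) : 'M[L]_n := map_mx (lev i t) phi.

Definition pcoords r (psi : 'I_r -> entry_poly K n) (L : fieldType)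
    (i : {rmorphism K -> L}) (s : 'M[L]_n) : 'rV[L]_r := \row_j pval i (psi j) s.

Definition cgroup P : Prop :=
  mx_group (zeros toC P) /\ zeros toC P `<=` [set g | \det g = 1].

Definition csplit_by Q r (phi : 'M[mpoly.mpoly (r + r)%N K]_n)
    (psi : 'I_r -> entry_poly K n) : Prop :=
  [/\ forall t : 'rV[C]_r, nz t ->
        zeros toC Q (lmx phi toC t) /\ pcoords psi toC (lmx phi toC t) = t,
      forall s, zeros toC Q s ->
        nz (pcoords psi toC s) /\ lmx phi toC (pcoords psi toC s) = s
    & forall s s', zeros toC Q s -> zeros toC Q s' -> forall j,
        pcoords psi toC (s *m s') 0 j = pcoords psi toC s 0 j * pcoords psi toC s' 0 j].

Definition csplit Q : Prop :=
  cgroup Q /\ exists r (phi : 'M[mpoly.mpoly (r + r)%N K]_n)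
    (psi : 'I_r -> entry_poly K n), csplit_by Q phi psi.

Definition cmaximal P Q : Prop :=
  [/\ csplit Q, zeros toC Q `<=` zeros toC P
    & forall Q', csplit Q' -> zeros toC Q' `<=` zeros toC P ->
        zeros toC Q `<=` zeros toC Q' -> zeros toC Q' = zeros toC Q].

End ClosedPoints.

(** * Split tori in coordinates *)

Section TorusData.
Variables (K : rcfType) (C : numClosedFieldType) (toC : {rmorphism K -> C}) (n : nat).

(** [W] lists the weights of the torus in the orthonormal basis [c]; its left inverse [B] makes the
    parametrization an embedding, and vanishing column sums express determinant 1. *)
Definition torus_data d (c : 'M[K]_n) (W : 'M[int]_(n, d)) (B : 'M[int]_(d, n)) :=
  [/\ c *m c^T = 1%:M, B *m W = 1%:M & forall j, \sum_a W a j = 0].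

Lemma two_expz_eq1 (e : int) : (2 : K) ^ e = 1 -> e = 0.
Proof.
rewrite -[1](expr0z (2 : K)) => /ieexprIz; apply=> //.
by rewrite -subr_eq0 (_ : 2 - 1 = 1 :> K) ?oner_eq0 //; ring.
Qed.

Lemma prod_tw_colsum d (W : 'M[int]_(n, d)) :
  (forall x : 'rV[C]_d, nz x -> \prod_a tw W x 0 a = 1) ->
  forall j, \sum_a W a j = 0.
Proof.
move=> H j; pose x : 'rV[C]_d := \row_l (if l == j then toC 2 else 1).
have nzx : nz x.
  by move=> l; rewrite mxEE; case: ifP; rewrite ?oner_eq0 // fmorph_eq0 pnatr_eq0.
have := H x nzx.
have -> : \prod_a tw W x 0 a = mon (tw W x) (const_mx 1).
  by apply: eq_bigr => a _; rewrite [const_mx _ _ _]mxEE expr1z.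
rewrite mon_tw // monE (bigD1 j) //= big1 ?mulr1 => [|l lj]; last first.
  by rewrite mxEE (negbTE lj) exp1rz.
rewrite [x 0 j]mxEE eqxx mxEE -fmorphXz => E.
have /fmorph_inj/two_expz_eq1 E0 : toC (2 ^ \sum_i (const_mx 1 : 'rV[int]_n) 0 i * W i j) = toC 1.
  by rewrite E rmorph1.
by rewrite -[RHS]E0; apply: eq_bigr => a _; rewrite mxEE mul1r.
Qed.

Definition constl d m m' (c : 'M[K]_(m, m')) : 'M[mpoly.mpoly (d + d)%N K]_(m, m') :=
  map_mx (@mpoly.mpolyC (d + d) K) c.

Lemma lev_constl d (L : fieldType) (i : {rmorphism K -> L}) (t : 'rV[L]_d) m m'
    (c : 'M[K]_(m, m')) : map_mx (lev i t) (constl d c) = map_mx i c.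
Proof. by apply/matrixP => a b; rewrite !mxEE lev_const. Qed.

Definition torus_laurent d (c : 'M[K]_n) (W : 'M[int]_(n, d)) :
    'M[mpoly.mpoly (d + d)%N K]_n :=
  (constl d c)^T *m diag_mx (\row_a lmon K (row a W)) *m constl d c.

Lemma torus_laurentE d c (W : 'M[int]_(n, d)) (L : fieldType) (i : {rmorphism K -> L}) t :
  map_mx (lev i t) (torus_laurent c W) = tmat c i (tw W t).
Proof.
rewrite /torus_laurent !map_mxM -map_trmx !lev_constl tmatE; congr (_ *m _ *m _).
apply/matrixP => a b; rewrite !mxEE rmorphMn /= lev_lmon.
by [].
Qed.

Lemma tw_const1 d (L : fieldType) (W : 'M[int]_(n, d)) :
  tw W (const_mx 1 : 'rV[L]_d) = const_mx 1.
Proof. by apply/rowP => a; rewrite !mxEE mon_const1. Qed.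

Lemma geom_torus d c (W : 'M[int]_(n, d)) B : torus_data c W B ->
  forall s, zeros toC (torus_eqs c W B) s <-> exists2 x, nz x & s = tmat c toC (tw W x).
Proof. by move=> [cc BW W0] s; apply: torus_zeros. Qed.

Lemma torus_split_by d c (W : 'M[int]_(n, d)) B : torus_data c W B ->
  cgroup toC (torus_eqs c W B) /\
  csplit_by toC (torus_eqs c W B) (torus_laurent c W) (torus_coord c B).
Proof.
move=> /[dup] D [cc BW W0]; set Q := torus_eqs c W B; have gQ := geom_torus D.
pose lv := lmx (torus_laurent c W) toC; pose cv := pcoords (torus_coord c B) toC.
have lvE t : lv t = tmat c toC (tw W t) by exact: torus_laurentE.
have cvE x : nz x -> cv (tmat c toC (tw W x)) = x.
  by move=> nzx; apply/rowP => j; rewrite mxE torus_coordE.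
split; last split; rewrite -?/lv -?/cv; move: lv lvE cv cvE => lv lvE cv cvE.
- split; last first.
    by move=> s /gQ[x nzx ->]; rewrite /= (tmat_det cc) prod_tw.
  split.
  + by move=> s /gQ[x nzx ->]; apply: (tmat_unit cc); apply: tw_nz.
  + by apply/gQ; exists (const_mx 1); [exact: nz1|rewrite tw_const1 (tmat1 cc)].
  + move=> s s' /gQ[x nzx ->] /gQ[y nzy ->]; apply/gQ.
    by exists (hmul x y); [exact: nz_hmul|rewrite (tmatM cc) tw_hmul].
  + move=> s /gQ[x nzx ->]; apply/gQ; exists (\row_j (x 0 j)^-1).
      by move=> j; rewrite mxE invr_eq0.
    rewrite (tmatV cc toC (tw_nz W nzx)); congr tmat; apply/rowP => a.
    rewrite mxE !twE !monE -prodfV; apply: eq_bigr => j _.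
    by rewrite [in RHS]mxE exprz_inv invr_expz.
- by move=> t nzt; rewrite lvE (cvE t nzt); split; [apply/gQ; exists t|].
- by move=> s /gQ[x nzx ->]; rewrite (cvE x nzx) lvE.
- move=> s s' /gQ[x nzx ->] /gQ[y nzy ->] j.
  by rewrite (tmatM cc) -tw_hmul (cvE _ (nz_hmul nzx nzy)) (cvE x nzx) (cvE y nzy) hmulE.
Qed.

Lemma torus_split d c (W : 'M[int]_(n, d)) B : torus_data c W B ->
  csplit toC (torus_eqs c W B).
Proof.
move=> /torus_split_by[H0 H1]; split; first exact: H0.
by exists d, (torus_laurent c W), (torus_coord c B).
Qed.

Section FromSplit.
Variables (Q : seq (entry_poly K n)) (r : nat)
  (phi : 'M[mpoly.mpoly (r + r)%N K]_n) (psi : 'I_r -> entry_poly K n).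
Hypothesis Qgroup : cgroup toC Q.
Hypothesis Qsplit : csplit_by toC Q phi psi.
Hypothesis Qsym : forall s, zeros toC Q s -> s = s^T.

Local Notation lphi := (lmx phi).
Let phiQ := let: And3 H _ _ := Qsplit in H.
Let psiQ := let: And3 _ H _ := Qsplit in H.
Let psiM := let: And3 _ _ H := Qsplit in H.

Lemma lphi_toC t : lphi toC (map_mx toC t) = map_mx toC (lphi idfun t).
Proof. by apply/matrixP => a b; rewrite !mxE; apply: lev_map. Qed.

Lemma lphiM t s : nz t -> nz s ->
  lphi idfun (hmul t s) = lphi idfun t *m lphi idfun s.
Proof.
move=> nzt nzs; apply: (@fmap_mx_inj _ _ toC).
have nzC (u : 'rV[K]_r) : nz u -> forall j, map_mx toC u 0 j != 0.
  by move=> nzu j; rewrite mxEE fmorph_eq0.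
rewrite map_mxM -!lphi_toC.
have [gt ct] := phiQ (nzC _ nzt); have [gs cs] := phiQ (nzC _ nzs).
have gts : zeros toC Q (lphi toC (map_mx toC t) *m lphi toC (map_mx toC s)).
  by case: Qgroup => -[_ _ + _] _; apply.
have [_ <-] := psiQ gts; congr (lmx _ _ _).
by apply/rowP => j; rewrite psiM // ct cs !mxEE rmorphM.
Qed.

(** The matrices with positive parameters and the extra matrix [g] are symmetric and commute, so one
    basis diagonalizes all of them. Each diagonal entry is then a multiplicative Laurent polynomial,
    hence a monomial. The matrix [g] is carried along because maximality will be tested on a
    symmetric element that commutes with the torus. *)
Lemma split_torus_weights (g : 'M[K]_n) : g = g^T ->
  (forall t, pos_row t -> g *m lphi idfun t = lphi idfun t *m g) ->
  exists (c : 'M[K]_n) (W : 'M[int]_(n, r)), [/\ c *m c^T = 1%:M,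
    forall (L : fieldType) (i : {rmorphism K -> L}) t, nz t ->
      lphi i t = tmat c i (tw W t)
    & exists lam, g = tmat c idfun lam].
Proof.
move=> gT gcom.
pose S := [set lphi idfun t | t in @pos_row K r] `|` [set g].
have nzC (u : 'rV[K]_r) : nz u -> forall j, map_mx toC u 0 j != 0.
  by move=> nzu j; rewrite mxEE fmorph_eq0.
have [||c cc Sc] := @sym_simultaneous_diag K n S.
- move=> _ [[t t0 <-]|-> //].
  apply: (@fmap_mx_inj _ _ toC).
  rewrite -map_trmx -lphi_toC; apply: Qsym.
  by have [] := phiQ (nzC _ (gt0_nz t0)).
- have com t u : pos_row t -> pos_row u ->
      lphi idfun t *m lphi idfun u = lphi idfun u *m lphi idfun t.
    move=> t0 u0; rewrite -!lphiM; do ?exact: gt0_nz.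
    by congr lphi; apply/rowP => j; rewrite !mxEE mulrC.
  move=> _ _ [[t t0 <-]|->] [[u u0 <-]|->] //; first exact: com.
    by rewrite gcom.
  exact: gcom.
pose pc := constl r c *m phi *m (constl r c)^T.
have pcE (L : fieldType) (i : {rmorphism K -> L}) t :
    map_mx (lev i t) pc = map_mx i c *m lphi i t *m (map_mx i c)^T.
  by rewrite !map_mxM -map_trmx !lev_constl.
have pcEab (L : fieldType) (i : {rmorphism K -> L}) t a b :
    lev i t (pc a b) = (map_mx i c *m lphi i t *m (map_mx i c)^T) a b.
  by rewrite -pcE [RHS]mxEE.
have c1 : map_mx (idfun : {rmorphism K -> K}) c = c.
  by apply/matrixP => a b; rewrite mxEE.
have diagP t : pos_row t ->
    exists d, lphi idfun t = c^T *m diag_mx d *m c.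
  by move=> t0; apply: Sc; left; exists t.
have pcd t : pos_row t -> forall a b,
    lev idfun t (pc a b) = lev idfun t (pc a a) *+ (a == b).
  move=> /diagP[d E] a b; rewrite !pcEab E c1 !mulmxA cc mul1mx -!mulmxA cc !mulmx1.
  by rewrite !mxEE eqxx mulr1n; case: eqVneq => // _; rewrite !mulr0n.
have wt a : exists e : 'rV[int]_r, forall t, pos_row t ->
    lev idfun t (pc a a) = mon t e.
  pose p := pc a a; pose f t := lev idfun t p.
  have fM t s : pos_row t -> pos_row s -> f (hmul t s) = f t * f s.
    move=> t0 s0.
    have : map_mx (lev idfun (hmul t s)) pc =
        map_mx (lev idfun t) pc *m map_mx (lev idfun s) pc.
      rewrite !pcE c1 lphiM; do ?exact: gt0_nz.
      by rewrite !mulmxA -(mulmxA _ c^T c) (mulmx1C cc) mulmx1.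
    move=> /matrixP/(_ a a); rewrite [in LHS]mxE => E; rewrite /f {}E mxE (bigD1 a) //=.
    rewrite big1 ?addr0 => [|b ba]; first by rewrite ![map_mx _ _ _ _]mxE.
    by rewrite ![map_mx _ _ _ _]mxE (pcd t t0 a b) eq_sym (negbTE ba) mulr0n mul0r.
  have f0 t : pos_row t -> f t != 0.
    move=> t0; have := pcE K idfun t; have [d E] := diagP t t0.
    rewrite c1 E !mulmxA cc mul1mx -mulmxA cc mulmx1 => /matrixP/(_ a a).
    rewrite [map_mx _ _ _ _]mxE [diag_mx _ _ _]mxE eqxx mulr1n -/p -/(f t) => ->.
    have [gt _] := phiQ (nzC _ (gt0_nz t0)).
    have : lphi idfun t \in unitmx.
      case: Qgroup => -[/(_ _ gt)] + _ _ _ _.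
      by rewrite lphi_toC /= map_unitmx.
    rewrite E !unitmx_mul => /andP[/andP[_ +] _].
    rewrite unitmxE det_diag unitfE => /prodf_neq0; exact.
  (* Some exponent has a nonzero total coefficient, otherwise f would vanish at 1. Comparing the
     coefficients of this exponent in f(ts) = f(t) f(s), with s fixed, gives f(s) = s^e. *)
  have [e Ce] : exists e, \sum_(m <- mpoly.msupp p | lkey m == e) mpoly.mcoeff m p != 0.
    apply: contrapT => H; have /eqP := f0 _ (@pos1 K r); apply.
    rewrite /f lev_sum ?(sum_by_key _ (@lkey r)); last exact: nz1.
    apply: big1 => e _; apply/eqP/negPn/negP => He; apply: H; exists (val e).
    apply: contraNneq He => He; apply/eqP.
    rewrite (eq_bigr (fun m => mpoly.mcoeff m p)) ?He //.
    by move=> m _; rewrite mon_const1 mulr1.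
  exists e => s s0; apply/eqP; rewrite eq_sym -subr_eq0 -/p -/(f s).
  have := @mon_independent K r _ (mpoly.msupp p) (@lkey r)
    (fun m => mpoly.mcoeff m p * (mon s (lkey m) - f s)).
  move=> /(_ _ e)-/(_ _)/eqP.
  rewrite (eq_bigr (fun m => mpoly.mcoeff m p * (mon s e - f s))); last first.
    by move=> m /eqP->.
  rewrite -mulr_suml mulf_eq0 (negbTE Ce) /=; apply.
  move=> t t0; have nzt := gt0_nz t0; have nzs := gt0_nz s0.
  have := fM t s t0 s0; rewrite /f !lev_sum //; last exact: nz_hmul.
  move/eqP; rewrite -subr_eq0 => /eqP E; rewrite -[RHS]E mulr_suml -sumrB.
  by apply: eq_bigr => m _; rewrite mon_hmul /=; ring.
have [w Hw] := choice wt.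
pose W := \matrix_(a, j) w a 0 j.
have rowW a : row a W = w a by apply/rowP => j; rewrite !mxEE.
exists c, W; split=> // [L i t nzt|]; last first.
  have [d E] := Sc g (or_intror erefl); exists d.
  by rewrite tmatE c1.
have cc' : (map_mx i c)^T *m map_mx i c = 1%:M.
  by rewrite map_trmx -map_mxM (mulmx1C cc) map_mx1.
have E a b : lev i t (pc a b) = mon t (w a) *+ (a == b).
  apply/eqP; rewrite -subr_eq0; apply/eqP.
  have <- : lev i t (pc a b - lmon K (w a) *+ (a == b)) =
     lev i t (pc a b) - mon t (w a) *+ (a == b).
    by rewrite rmorphB rmorphMn /= lev_lmon.
  apply: lev_vanish => // u u0.
  by rewrite rmorphB rmorphMn /= lev_lmon pcd // Hw // subrr.
rewrite tmatE; have <- : map_mx (lev i t) pc = diag_mx (tw W t).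
  by apply/matrixP => a b; rewrite mxEE E !mxEE rowW.
by rewrite pcE !mulmxA cc' mul1mx -mulmxA cc' mulmx1.
Qed.

(** The weights are replaced by their saturation, which has an integral left inverse. The set of
    points does not change: those of the saturated torus are reached by taking [del]-th roots in
    [C]. *)
Lemma split_torus_data (g : 'M[K]_n) : g = g^T ->
  (forall t, pos_row t -> g *m lphi idfun t = lphi idfun t *m g) ->
  exists d (c : 'M[K]_n) (W : 'M[int]_(n, d)) (B : 'M[int]_(d, n)),
    [/\ torus_data c W B, zeros toC Q = zeros toC (torus_eqs c W B)
      & exists lam, g = tmat c idfun lam].
Proof.
move=> gT gcom; have [c [W0 [cc Hphi Hg]]] := split_torus_weights gT gcom.
have [d [W [B [D [E [del [BW W0E DE del0]]]]]]] := int_saturation W0.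
have gQ s : zeros toC Q s <-> exists2 x, nz x & s = tmat c toC (tw W x).
  split=> [gs|[x nzx ->]].
    have [nzp <-] := psiQ gs; exists (tw D (pcoords psi toC s)); first exact: tw_nz.
    by rewrite (tw_tw W D nzp) -W0E -(Hphi _ toC _ nzp).
  pose y := \row_j del.-root (x 0 j).
  have yx : \row_j (y 0 j ^ del%:Z) = x.
    by apply/rowP => j; rewrite !mxEE -exprnP rootCK.
  have nzy : nz y.
    move=> j; have := nzx j; rewrite -{1}yx mxEE; apply: contraNneq => ->.
    by rewrite -exprnP expr0n eqn0Ngt del0.
  have nzEy := tw_nz E nzy.
  have [+ _] := phiQ nzEy; congr zeros.
  rewrite (Hphi _ toC _ nzEy) (tw_tw _ _ nzy) W0E -mulmxA DE.
  by rewrite -(tw_tw _ _ nzy) tw_scalar yx.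
have W1 : forall j, \sum_a W a j = 0.
  apply: prod_tw_colsum => x nzx.
  have /gQ gx : exists2 x', nz x' & tmat c toC (tw W x) = tmat c toC (tw W x') by exists x.
  by have := (proj2 Qgroup) _ gx; rewrite /= tmat_det.
exists d, c, W, B; split=> //.
by apply/seteqP; split=> s; rewrite (geom_torus (And3 cc BW W1)) gQ.
Qed.

End FromSplit.

Lemma split_torus_exists (Q : seq (entry_poly K n)) :
  csplit toC Q -> (forall s, zeros toC Q s -> s = s^T) ->
  exists d (c : 'M[K]_n) (W : 'M[int]_(n, d)) (B : 'M[int]_(d, n)),
    torus_data c W B /\ zeros toC Q = zeros toC (torus_eqs c W B).
Proof.
move=> [Qg [r [phi [psi H]]]] Qsym.
have [||d [c [W [B [D E _]]]]] := split_torus_data Qg H Qsym (g := 1%:M).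
- by rewrite trmx1.
- by move=> t _; rewrite mul1mx mulmx1.
by exists d, c, W, B.
Qed.

End TorusData.

(** * Maximality of the torus *)

Section Maximality.
Variables (K : rcfType) (C : numClosedFieldType) (toC : {rmorphism K -> C}).
Variables (n : nat) (P Q : seq (entry_poly K n)).
Local Notation geom := (zeros toC).
Hypothesis G_group : cgroup toC P.
Hypothesis G_self_adjoint : forall g, geom P g -> geom P g^T.
Hypothesis S_torus : cmaximal toC P Q.
Hypothesis S_symmetric : forall s, geom Q s -> s = s^T.

Lemma zeros_toC (P' : seq (entry_poly K n)) (A : 'M[K]_n) :
  zeros idfun P' A <-> geom P' (map_mx toC A).
Proof.
have E p : pval toC p (map_mx toC A) = toC (pval idfun p A).
  by rewrite -!pevE; apply: pev_map.
split=> H p pP; first by rewrite E H ?rmorph0.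
by apply: (fmorph_inj toC); rewrite -E H // rmorph0.
Qed.

Lemma tw_row_mx (L : fieldType) d1 d2 (W1 : 'M[int]_(n, d1)) (W2 : 'M[int]_(n, d2))
    (x : 'rV[L]_d1) (y : 'rV[L]_d2) :
  tw (row_mx W1 W2) (row_mx x y) = hmul (tw W1 x) (tw W2 y).
Proof.
apply/rowP => a; rewrite hmulE !twE !monE big_split_ord /=; congr (_ * _);
  by apply: eq_bigr => j _; rewrite ![row _ _ _ _]mxE ?row_mxEl ?row_mxEr.
Qed.

(* The polynomial function [z |-> p (c^T diag(z) c)]. *)
Definition diag_restr (c : 'M[K]_n) (p : entry_poly K n) : mpoly.mpoly n K :=
  mpoly.mmap (@mpoly.mpolyC n K) (fun j => mxvec (map_mx (@mpoly.mpolyC n K) c^T *m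
    diag_mx (\row_a mX K a) *m map_mx (@mpoly.mpolyC n K) c) 0 j) p.

Definition mrow m (e : mpoly.multinom m) : 'rV[int]_m := \row_a (e a)%:Z.

Lemma pev_diag_restr c p (L : fieldType) (i : {rmorphism K -> L}) z :
  pev i (tmat c i z) p = \sum_(m <- mpoly.msupp (diag_restr c p))
     i (mpoly.mcoeff m (diag_restr c p)) * mon z (mrow m).
Proof.
have -> : \sum_(m <- mpoly.msupp (diag_restr c p))
     i (mpoly.mcoeff m (diag_restr c p)) * mon z (mrow m) =
     mpoly.mmap i (fun a => z 0 a) (diag_restr c p).
  apply: eq_bigr => m _; congr (_ * _); apply: eq_bigr => a _.
  by rewrite mxEE -exprnP.
have ME : map_mx (mpoly.mmap i (fun a => z 0 a)) (map_mx (@mpoly.mpolyC n K) c^T *m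
    diag_mx (\row_a mX K a) *m map_mx (@mpoly.mpolyC n K) c) = tmat c i z.
  rewrite !map_mxM tmatE -!map_trmx; congr (_^T *m _ *m _).
  - by apply/matrixP => a b; rewrite !mxEE; apply: mpoly.mmapC.
  - apply/matrixP => a b; rewrite !mxEE rmorphMn /= mpoly.mmapX mpoly.mmap1U.
    by [].
  - by apply/matrixP => a b; rewrite !mxEE; apply: mpoly.mmapC.
rewrite /diag_restr; elim/mpoly_alg_ind: p => [x|j|p q Hp Hq|p q Hp Hq].
- by rewrite pev_const mpoly.mmapC; apply/esym/mpoly.mmapC.
- rewrite pev_var mpoly.mmapX mpoly.mmap1U -ME.
  by case: (mxvec_indexP j) => a b; rewrite !mxvecE [LHS]mxEE.
- by rewrite !rmorphD /= Hp Hq.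
- by rewrite !rmorphM /= Hp Hq.
Qed.

Lemma geom_mul g h : geom P g -> geom P h -> geom P (g *m h).
Proof. by case: G_group => -[_ _ + _] _; apply. Qed.

Lemma geom_unit g : geom P g -> g \in unitmx.
Proof. by case: G_group => -[H _ _ _] _; apply: H. Qed.

Lemma zeros_mul g h : zeros idfun P g -> zeros idfun P h -> zeros idfun P (g *m h).
Proof. by move=> /zeros_toC Gg /zeros_toC Gh; apply/zeros_toC; rewrite map_mxM; apply: geom_mul. Qed.

Lemma zeros_one : zeros idfun P 1%:M.
Proof. by apply/zeros_toC; rewrite map_mx1; case: G_group => -[]. Qed.

Lemma zeros_tr g : zeros idfun P g -> zeros idfun P g^T.
Proof. by move=> /zeros_toC Gg; apply/zeros_toC; rewrite -map_trmx; apply: G_self_adjoint. Qed.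

Variables (d : nat) (c : 'M[K]_n) (W : 'M[int]_(n, d)) (B : 'M[int]_(d, n)).
Hypothesis D : torus_data c W B.
Hypothesis QE : geom Q = geom (torus_eqs c W B).

Section LargerTorus.
Variables (d' : nat) (c' : 'M[K]_n) (W' : 'M[int]_(n, d')) (B' : 'M[int]_(d', n)).
Hypothesis D' : torus_data c' W' B'.
Hypothesis QE' : geom Q = geom (torus_eqs c' W' B').
Variable lam : 'rV[K]_n.
Hypothesis lam_pos : pos_row lam.
Hypothesis Glam : zeros idfun P (tmat c' idfun lam).

Let cc' : c' *m c'^T = 1%:M. Proof. by case: D'. Qed.

Lemma torus_in_G : forall x : 'rV[C]_d', nz x -> geom P (tmat c' toC (tw W' x)).
Proof.
move=> x nzx; case: S_torus => _ QP _; apply: QP.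
by rewrite QE'; apply/(geom_torus toC D'); exists x.
Qed.

(** A polynomial in [P] vanishes at the products of torus points with powers of [lam], so its
    monomials cancel in groups of equal weight on the torus and equal value at [lam]. By hypothesis
    the monomials of one group also agree on the torus enlarged by [v]. *)
Lemma larger_torus_points (v : 'cV[int]_n) :
  (forall e : 'rV[int]_n, e *m W' = 0 -> mon lam e = 1 -> e *m v = 0) ->
  forall u : 'rV[C]_(d' + 1), nz u -> geom P (tmat c' toC (tw (row_mx W' v) u)).
Proof.
move=> Hv u nzu p pP; rewrite -pevE pev_diag_restr.
set q := diag_restr c' p; pose key m := (mrow m *m W', mon lam (mrow m)).
rewrite (sum_by_key _ key) big1 // => -[k ks] _ /=.
have [m0 m0s k0] := mapP ks.
rewrite (eq_bigr (fun m => toC (mpoly.mcoeff m q) * mon u (mrow m0 *m row_mx W' v))).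
  rewrite -mulr_suml -rmorph_sum /=.
  pose T := ({t : 'rV[K]_d' | pos_row t} * nat)%type.
  pose op (x y : T) : T := (exist _ _ (pos_hmul (svalP x.1) (svalP y.1)), (x.2 + y.2)%N).
  pose chi (k : 'rV[int]_d' * K) (x : T) := mon (sval x.1) k.1 * k.2 ^+ x.2.
  have := @characters_independent_key T op K _ (mpoly.msupp q) _ key
    (fun k x => if k.2 == 0 then 1 else chi k x) (fun m => mpoly.mcoeff m q).
  move=> /(_ _ _ _ _ k) ->; rewrite ?rmorph0 ?mul0r //.
  - move=> k' x y; case: ifP; rewrite ?mul1r //.
    by rewrite /chi /= mon_hmul exprD mulrACA.
  - move=> k'; exists (exist _ _ (@pos1 K d'), 0%N); case: ifP; rewrite ?oner_eq0 //.
    by rewrite /chi /= mon_const1 expr0 mulr1 oner_eq0.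
  - move=> _ _ /mapP[m1 _ ->] /mapP[m2 _ ->] /=.
    have l0 m : mon lam (mrow m) == 0 = false.
      by apply/negbTE/mon_neq0/gt0_nz.
    move=> E; congr pair.
      apply: (@mon_inj K) => t t0; have := congr1 (fun f => f (exist _ t t0, 0%N)) E.
      by rewrite /= !l0 /chi /= !expr0 !mulr1.
    have := congr1 (fun f => f (exist _ _ (@pos1 K d'), 1%N)) E.
    by rewrite /= !l0 /chi /= !expr1 !mon_const1 !mul1r.
  - move=> -[[t t0] j]; have Gt : zeros idfun P (tmat c' idfun (tw W' t)).
      apply/zeros_toC.
      have -> : map_mx toC (tmat c' idfun (tw W' t)) = tmat c' toC (tw W' (map_mx toC t)).
        rewrite tmatE !map_mxM map_diag_mx tw_map -map_trmx; congr (_^T *m _ *m _);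
        by rewrite -map_mx_comp.
      by apply: torus_in_G => l; rewrite mxEE fmorph_eq0 gt_eqF.
    have Gj : zeros idfun P (tmat c' idfun (hmul (tw W' t) (\row_a lam 0 a ^+ j))).
      rewrite -(tmatM cc'); apply: zeros_mul => //.
      elim: j => [|j IHj].
        rewrite (_ : \row_a _ = const_mx 1); last by apply/rowP => a; rewrite !mxEE.
        by rewrite tmat1 //; apply: zeros_one.
      rewrite (_ : \row_a _ = hmul lam (\row_a lam 0 a ^+ j)).
        by rewrite -(tmatM cc'); apply: zeros_mul.
      by apply/rowP => a; rewrite !mxEE exprS.
    rewrite -[RHS](Gj p pP) -pevE pev_diag_restr; apply: eq_bigr => m _.
    congr (_ * _); rewrite ifF /=; last by apply/negbTE/mon_neq0/gt0_nz.
    rewrite mon_hmul mon_tw; last exact: gt0_nz.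
    rewrite /chi /=; congr (_ * _); rewrite monE -prodrXl; apply: eq_bigr => a _.
    by rewrite [in RHS]mxEE exprnP [in RHS]exprnP exprzAC.
move=> m /eqP; rewrite k0 => -[E1 E2]; rewrite mon_tw //; congr (_ * mon u _).
apply/eqP; rewrite -subr_eq0 -mulmxBl mul_mx_row.
have -> : (mrow m - mrow m0) *m W' = 0 by rewrite mulmxBl E1 subrr.
rewrite Hv ?row_mx0 //; first by rewrite mulmxBl E1 subrr.
rewrite monB; last exact: gt0_nz.
by rewrite E2 divff // mon_neq0 //; apply: gt0_nz.
Qed.

(** The exponents that are trivial on the torus and at [lam] form a saturated lattice, because a
    positive element with a power equal to 1 is 1. An exponent trivial on the torus but not at [lam]
    would be separated from this lattice by a cocharacter [v], and adding [v] would give a larger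
    split torus in [G]. *)
Lemma no_larger_torus : forall a, mon lam (row a (1%:M - W' *m B')) = 1.
Proof.
move=> a0; apply: contrapT => ne1.
have [_ BW' _] := D'.
pose M := [set e : 'rV[int]_n | e *m W' = 0 /\ mon lam e = 1].
have nzl := gt0_nz lam_pos.
have [||||v [vM va0]] := @int_separation n M (row a0 (1%:M - W' *m B')).
- by split; rewrite ?mul0mx ?mon0.
- move=> y z [y1 y2] [z1 z2]; split; first by rewrite mulmxBl y1 z1 subrr.
  by rewrite monB // y2 z2 divr1.
- move=> y N N0 [y1]; have {}y1 : y *m W' = 0.
    apply/rowP => j; rewrite [RHS]mxE; move: y1; rewrite -scaler_nat -scalemxAl => /rowP/(_ j)/eqP.
    have -> : (N%:R *: (y *m W')) 0 j = N%:R * (y *m W') 0 j by rewrite [LHS]mxE.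
    by rewrite [(0 : 'rV[int]_d') _ _]mxE mulf_eq0 pnatr_eq0 eqn0Ngt N0 /= => /eqP.
  rewrite monMn => /eqP; rewrite pexpr_eq1 ?ltW ?mon_gt0 // => /eqP y2.
  by split.
- by move=> [].
have Gu : forall u : 'rV[C]_(d' + 1), nz u -> geom P (tmat c' toC (tw (row_mx W' v) u)).
  by apply: larger_torus_points => e e1 e2; apply: vM.
have [d2 [W2 [B2 [D2 [E2 [del [BW2 W2E DE2 del0]]]]]]] := int_saturation (row_mx W' v).
have GW2 (x : 'rV[C]_d2) : nz x -> geom P (tmat c' toC (tw W2 x)).
  move=> nzx; pose y := \row_j del.-root (x 0 j).
  have yx : \row_j (y 0 j ^ del%:Z) = x.
    by apply/rowP => j; rewrite !mxEE -exprnP rootCK.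
  have nzy : nz y.
    move=> j; have := nzx j; rewrite -{1}yx mxEE; apply: contraNneq => ->.
    by rewrite -exprnP expr0n eqn0Ngt del0.
  rewrite -yx -tw_scalar tw_tw // -DE2 mulmxA -W2E -tw_tw //.
  by apply/Gu/tw_nz.
have data2 : torus_data c' W2 B2.
  split=> //; apply: (@prod_tw_colsum K C toC) => x /GW2 GW.
  by have := (proj2 G_group) _ GW; rewrite /= (tmat_det cc').
case: S_torus => _ _ /(_ _ (torus_split toC data2)) max.
have {max} Q2 : geom (torus_eqs c' W2 B2) = geom Q.
  apply: max => s; first by move=> /(geom_torus toC data2)[x nzx ->]; apply: GW2.
  rewrite QE' => /(geom_torus toC D')[x nzx ->]; apply/(geom_torus toC data2).
  have nzr : nz (row_mx x (const_mx 1 : 'rV[C]_1)).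
    move=> j; rewrite -(fintype.splitK j); case: (fintype.split j) => l /=.
      by rewrite row_mxEl.
    by rewrite row_mxEr mxEE oner_eq0.
  exists (tw D2 (row_mx x (const_mx 1))); first exact: tw_nz.
  rewrite tw_tw // -W2E tw_row_mx tw_const1; congr tmat.
  by apply/rowP => a; rewrite !mxEE mulr1.
(* The point of parameter 2 on the new one-parameter subgroup. If it were in the old torus, the
   exponent [row a0 (1%:M - W' *m B')] would have value 1 there, against [va0]. *)
pose u2 : 'rV[C]_1 := const_mx (toC 2).
have nz2 : nz u2 by move=> j; rewrite mxEE fmorph_eq0 pnatr_eq0.
have nzr : nz (row_mx (const_mx 1 : 'rV[C]_d') u2).
  move=> j; rewrite -(fintype.splitK j); case: (fintype.split j) => l /=.
    by rewrite row_mxEl mxEE oner_eq0.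
  by rewrite row_mxEr.
have : geom (torus_eqs c' W2 B2) (tmat c' toC (tw v u2)).
  apply/(geom_torus toC data2); exists (tw D2 (row_mx (const_mx 1) u2)); first exact: tw_nz.
  rewrite tw_tw // -W2E tw_row_mx tw_const1; congr tmat.
  by apply/rowP => a; rewrite !mxEE mul1r.
rewrite Q2 QE' => /(geom_torus toC D')[t nzt] /(tmat_inj cc') E.
have := congr1 (fun z => mon z (row a0 (1%:M - W' *m B'))) E.
have C0 : (1%:M - W' *m B') *m W' = 0.
  by rewrite mulmxBl mul1mx -mulmxA BW' mulmx1 subrr.
rewrite !mon_tw // -!row_mul C0 row0 mon0.
rewrite monE big_ord1 [u2 0 0]mxE -fmorphXz -(rmorph1 toC) => /fmorph_inj/two_expz_eq1 E0.
by case/eqP: va0; apply/matrixP => i j; rewrite !ord1 -row_mul E0 mxE.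
Qed.

End LargerTorus.

Lemma sqrt_row_sq m (x : 'rV[K]_m) : pos_row x ->
  x = hmul (\row_j Num.sqrt (x 0 j)) (\row_j Num.sqrt (x 0 j)).
Proof. by move=> x0; apply/rowP => j; rewrite !mxEE -expr2 sqr_sqrtr // ltW. Qed.

(** [h *m h^T] is diagonalized together with the torus; its eigenvalues are positive, so
    [no_larger_torus] puts it in the torus. *)
Lemma torus_maximality (h : 'M[K]_n) : zeros idfun P h ->
  (forall x, pos_row x ->
     tmat c idfun (tw W x) *m (h *m h^T) = h *m h^T *m tmat c idfun (tw W x)) ->
  exists2 x, pos_row x & h *m h^T = tmat c idfun (tw W x).
Proof.
move=> Gh hcom; set g := h *m h^T.
have gT : g = g^T by rewrite /g trmx_mul trmxK.
have Gg : zeros idfun P g by apply: zeros_mul => //; apply: zeros_tr.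
have [H0 H1] := torus_split_by toC D.
have symQ1 s : geom (torus_eqs c W B) s -> s = s^T by rewrite -QE; apply: S_symmetric.
have [t t0|d' [c' [W' [B' [D' E' [lam glam]]]]]] :=
    split_torus_data H0 H1 symQ1 gT.
  by rewrite /lmx torus_laurentE hcom.
have [cc' BW' W0'] := D'; have [cc BW W0] := D.
have hu : h \in unitmx.
  by have := geom_unit (proj1 (zeros_toC P h) Gh); rewrite map_unitmx.
have lam_pos : pos_row lam.
  move=> a; have c1 : map_mx (idfun : {rmorphism K -> K}) c' = c'.
    by apply/matrixP => i j; rewrite mxEE.
  have := tmatK cc' idfun lam; rewrite -glam c1 => /matrixP/(_ a a).
  rewrite [RHS]mxE eqxx mulr1n => <-.
  have -> : c' *m g *m c'^T = (c' *m h) *m (c' *m h)^T by rewrite trmx_mul !mulmxA.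
  have ge0 b : 0 <= (c' *m h) a b * (c' *m h)^T b a by rewrite [_^T _ _]mxE -expr2 sqr_ge0.
  rewrite mxE lt_def; apply/andP; split; last by apply: sumr_ge0 => b _; apply: ge0.
  rewrite psumr_eq0 => [|b _]; last exact: ge0.
  apply/negP => /allP H; have : row a (c' *m h) = 0.
    apply/rowP => b; have := H b (mem_index_enum b).
    by rewrite /= [_^T _ _]mxE mulf_eq0 orbb => /eqP E; rewrite [LHS]mxE E mxE.
  rewrite rowE => /eqP; rewrite mulmx_free_eq0; last first.
    rewrite row_free_unit unitmx_mul hu andbT.
    by case: (mulmx1_unit cc').
  move=> /eqP/matrixP/(_ 0 a)/eqP; by rewrite !mxE !eqxx oner_eq0.
have Glam : zeros idfun P (tmat c' idfun lam) by rewrite -glam.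
have QE2 : geom Q = geom (torus_eqs c' W' B') by exact: (etrans QE E').
have one := no_larger_torus D' QE2 lam_pos Glam.
pose x := tw B' lam.
have lamE : lam = tw W' x.
  rewrite /x tw_tw; last exact: gt0_nz.
  apply/rowP => a; have /eqP := one a; rewrite linearB /= row1 monB; last exact: gt0_nz.
  rewrite mon_delta mxEE => /eqP E.
  have m0 : mon lam (row a (W' *m B')) != 0 by apply/mon_neq0/gt0_nz.
  by rewrite -[LHS](divfK m0) E mul1r.
have x_pos : pos_row x by apply: tw_gt0.
pose y := \row_j Num.sqrt (x 0 j).
have nzy : nz y by move=> j; rewrite mxEE sqrtr_eq0 -ltNge.
pose s := tmat c' idfun (tw W' y).
have gs : g = s *m s by rewrite glam lamE /s (tmatM cc') -tw_hmul -sqrt_row_sq.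
have sQ : zeros idfun (torus_eqs c W B) s.
  apply/zeros_toC; rewrite E'; apply/zeros_toC.
  by apply/(torus_zeros cc' BW' W0' idfun s); exists y; [exact: nzy|].
(* The square root [s] is in [S], but its parameter in the original coordinates may have negative
   entries; squaring makes the parameter of [g] positive. *)
have [z nzz sz] := proj1 (torus_zeros cc BW W0 idfun s) sQ.
exists (hmul z z); last by rewrite -/g gs sz (tmatM cc) tw_hmul.
by move=> j; rewrite mxEE -expr2 exprn_even_gt0 //= nzz.
Qed.

End Maximality.

(** * The identity component of the torus *)

Section OneVariable.
Variable K : rcfType.

Lemma poly_sign_change (p : {poly K}) a b : a < b -> p.[a] * p.[b] < 0 ->
  exists2 x, a < x < b & p.[x] = 0.
Proof.
move=> ab pab; have [x + /rootP px] := polyrcf.poly_ivtoo (ltW ab) pab.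
by rewrite in_itv /=; exists x.
Qed.

Lemma poly_sign_const (p : {poly K}) a b : (forall x, a < x < b -> p.[x] != 0) ->
  forall s t, a < s < b -> a < t < b -> Num.sg p.[s] = Num.sg p.[t].
Proof.
move=> nr s t; wlog st : s t / s < t => [H sab tab|].
  by have [/H-> //|/H-> //|->] := ltgtP s t.
move=> /andP[as_ sb] /andP[at_ tb]; have [lt0|] := ltP (p.[s] * p.[t]) 0.
  have [x /andP[sx xt] px] := poly_sign_change st lt0.
  by have := nr x; rewrite px eqxx (lt_trans as_ sx) (lt_trans xt tb) => /(_ isT).
have s0 := nr s; have t0 := nr t; rewrite as_ sb in s0; rewrite at_ tb in t0.
move: (s0 isT) (t0 isT); have [ps|ps|->] := ltrgtP p.[s] 0 => // _;
  have [pt|pt|->] := ltrgtP p.[t] 0 => // _;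
  rewrite ?(gtr0_sg ps) ?(gtr0_sg pt) ?(ltr0_sg ps) ?(ltr0_sg pt) //.
  by rewrite leNgt nmulr_rlt0 // pt.
by rewrite leNgt pmulr_rlt0 // pt.
Qed.

(* By induction on the number of roots inside the interval of the polynomials
   describing [m]. *)
Lemma interval_sa_connected (fs : seq {poly K}) (m : K -> bool) :
  (forall s t : K, 0 <= s <= 1 -> 0 <= t <= 1 ->
     (forall f, f \in fs -> Num.sg f.[s] = Num.sg f.[t]) -> m s = m t) ->
  (forall s : K, 0 <= s <= 1 -> exists2 e : K, 0 < e &
     forall t : K, 0 <= t <= 1 -> `|t - s| < e -> m t = m s) ->
  m 0 = m 1.
Proof.
move=> msgn mloc; pose p := \prod_(f <- fs | f != 0) f.
have p0 : p != 0 by rewrite prodf_seq_neq0; apply/allP => f _; apply/implyP.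
have fp f x : f \in fs -> f != 0 -> f.[x] = 0 -> p.[x] = 0.
  move=> ffs f0 fx; rewrite /p (big_rem f) //= f0 hornerM fx mul0r //.
pose R := polyrcf.rootsR p.
have inR x : p.[x] = 0 -> x \in R.
  by move=> px; have := polyrcf.roots_on_rootsR p0 x; rewrite in_itv /= => <-; apply/rootP.
suff H (N : nat) (a b : K) : 0 <= a -> a < b -> b <= 1 ->
    (count (fun x : K => a < x < b)%R R <= N)%N -> m a = m b.
  exact: (H (size R) 0 1 (lexx (0:K)) ltr01 (lexx (1:K)) (count_size _ _)).
elim: N a b => [|N IHN] a b a0 ab b1 cnt; last first.
  have [/hasP[r rR /andP[ar rb]]|nr] := boolP (has (fun x : K => a < x < b)%R R); last first.
    by rewrite has_count -leqNgt leqn0 in nr; apply: IHN; rewrite ?(eqP nr).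
  have lt (q : pred K) : (forall x, q x -> a < x < b) -> ~~ q r -> (count q R <= N)%N.
    move=> qab qr; rewrite -ltnS (leq_trans _ cnt) //.
    have rc : (0 < count (pred1 r) R)%N by rewrite -has_count has_pred1.
    rewrite -addn1 (@leq_trans (count q R + count (pred1 r) R)%N) ?leq_add2l //.
    rewrite -count_predUI [X in (_ + X)%N](eq_count (a2 := pred0)) ?count_pred0 ?addn0.
      by apply: sub_count => x /= /orP[/qab //|/eqP->]; rewrite ar rb.
    by move=> x /=; apply/negP => /andP[qx /eqP xr]; rewrite -xr qx in qr.
  rewrite (IHN a r) //; first rewrite (IHN r b) //; rewrite ?(ltW (lt_le_trans rb b1)) ?(ltW (le_lt_trans a0 ar)) //.
    by apply: lt => [x /andP[rx ->]|]; rewrite ?(lt_trans ar rx) // ltxx.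
  by apply: lt => [x /andP[-> xr]|]; rewrite ?(lt_trans xr rb) // ltxx andbF.
have nr x : a < x < b -> p.[x] != 0.
  move=> xab; apply/negP => /eqP/inR xR; move: cnt; rewrite leqn0 => /eqP/eqP.
  by rewrite -leqn0 leqNgt -has_count => /hasPn/(_ x xR); rewrite xab.
have in01 x : a < x < b -> 0 <= x <= 1.
  by move=> /andP[ax xb]; rewrite (ltW (le_lt_trans a0 ax)) (ltW (lt_le_trans xb b1)).
have mc s t : a < s < b -> a < t < b -> m s = m t.
  move=> sab tab; apply: msgn; [exact: in01|exact: in01|move=> f ffs].
  have [->|f0] := eqVneq f 0; first by rewrite !horner0.
  apply: (@poly_sign_const f a b) => // x xab.
  by apply: contraNneq (nr x xab) => fx; rewrite (fp f).
have a01 : 0 <= a <= 1 by rewrite a0 (le_trans (ltW ab)).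
have b01 : 0 <= b <= 1 by rewrite b1 (le_trans a0 (ltW ab)).
have [e e0 ea] := mloc a a01; have [e' e'0 eb] := mloc b b01.
(* Distances from the ends that are small enough for local constancy at a and b, and that stay
   inside the interval, where no root occurs and [m] is constant. *)
pose u := Num.min (e / 2) ((b - a) / 2); pose v := Num.min (e' / 2) ((b - a) / 2).
have half (x : K) : 0 < x -> 0 < x / 2 < x by move=> x0; apply/andP; split; lra.
have ba0 : 0 < b - a by rewrite subr_gt0.
have [u1 u2 u3] : [/\ 0 < u, u < e & u < b - a].
  case/andP: (half _ e0) => h1 h2; case/andP: (half _ ba0) => h3 h4.
  by split; rewrite /u ?lt_min ?gt_min ?h1 ?h2 ?h3 ?h4 ?orbT.
have [v1 v2 v3] : [/\ 0 < v, v < e' & v < b - a].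
  case/andP: (half _ e'0) => h1 h2; case/andP: (half _ ba0) => h3 h4.
  by split; rewrite /v ?lt_min ?gt_min ?h1 ?h2 ?h3 ?h4 ?orbT.
have au : a < a + u < b by apply/andP; split; lra.
have bv : a < b - v < b by apply/andP; split; lra.
rewrite -(ea (a + u)) ?in01 //; last by rewrite addrAC subrr add0r gtr0_norm.
rewrite -(eb (b - v)) ?in01 //; first exact: mc.
by rewrite addrAC subrr add0r normrN gtr0_norm.
Qed.

End OneVariable.

Section Component.
Variables (K : rcfType) (n : nat).

Lemma pval_continuous (p : entry_poly K n) (A : 'M[K]_n) e : 0 < e ->
  exists2 dl, 0 < dl & forall B : 'M[K]_n, (forall a b, `|B a b - A a b| < dl) ->
    `|pval idfun p B - pval idfun p A| < e.
Proof.
rewrite -!pevE; elim/mpoly_alg_ind: p e => [x|j|p q Hp Hq|p q Hp Hq] e e0.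
- exists 1 => // B _; rewrite -!pevE !pev_const /= subrr normr0; exact: e0.
- exists e => // B HB; rewrite -!pevE !pev_var; case: (mxvec_indexP j) => a b.
  by rewrite !mxvecE.
- have e2 : 0 < e / 2 by rewrite divr_gt0.
  have [d1 d10 H1] := Hp _ e2; have [d2 d20 H2] := Hq _ e2.
  exists (Num.min d1 d2); first by rewrite lt_min d10.
  move=> B HB; have B1 a b : `|B a b - A a b| < d1 by have := HB a b; rewrite lt_min => /andP[].
  have B2 a b : `|B a b - A a b| < d2 by have := HB a b; rewrite lt_min => /andP[].
  rewrite -!pevE !rmorphD /= !pevE opprD addrACA [e]splitr.
  by rewrite (le_lt_trans (ler_normD _ _)) // ltrD ?H1 ?H2.
- set x := pval idfun p A in Hp *; set y := pval idfun q A in Hq *.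
  pose M := 1 + `|x| + `|y|; have M0 : 0 < M by rewrite /M -addrA ltr_pwDl // addr_ge0.
  (* In x'y' - xy = (x' - x) y' + x (y' - y), the bound 1 keeps |y'| below 1 + |y|, and the other
     bound makes the total at most [e1 * M], hence at most e / 2. *)
  pose e1 := Num.min 1 (e / (2 * M)).
  have e10 : 0 < e1 by rewrite lt_min ltr01 divr_gt0 // mulr_gt0.
  have [d1 d10 H1] := Hp _ e10; have [d2 d20 H2] := Hq _ e10.
  exists (Num.min d1 d2); first by rewrite lt_min d10.
  move=> B HB; have B1 a b : `|B a b - A a b| < d1 by have := HB a b; rewrite lt_min => /andP[].
  have B2 a b : `|B a b - A a b| < d2 by have := HB a b; rewrite lt_min => /andP[].
  rewrite -!pevE !rmorphM /= !pevE -/x -/y.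
  have Hx := H1 _ B1; have Hy := H2 _ B2.
  set x' := pval idfun p B in Hx *; set y' := pval idfun q B in Hy *.
  have -> : x' * y' - x * y = (x' - x) * y' + x * (y' - y) by ring.
  have y'M : `|y'| <= 1 + `|y|.
    rewrite -[y'](subrK y) (le_trans (ler_normD _ _)) // lerD2r ltW //.
    by apply: lt_le_trans Hy _; rewrite /e1 ge_min lexx.
  rewrite (le_lt_trans (ler_normD _ _)) // !normrM.
  have e1M : e1 * M <= e / 2.
    have : e1 <= e / (2 * M) by rewrite /e1 ge_min lexx orbT.
    by rewrite ler_pdivlMr ?mulr_gt0 // => h; lra.
  apply: (@le_lt_trans _ _ (e1 * (1 + `|y|) + `|x| * e1)).
    by apply: lerD; [apply: ler_pM => //; exact: ltW|apply: ler_wpM2l => //; exact: ltW].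
  by apply: (@le_lt_trans _ _ (e1 * M)); [rewrite /M; lra|lra].
Qed.

Variables (d : nat) (c : 'M[K]_n) (W : 'M[int]_(n, d)) (B : 'M[int]_(d, n)).
Hypothesis D : torus_data c W B.

(** The identity component as semialgebraic data: the torus equations together with positivity of
    the coordinates. The same data give the positive part of the torus over every extension. *)
Definition torus_pos : sa_data K n :=
  [:: (torus_eqs c W B, [seq torus_coord c B j | j <- enum 'I_d])].

Lemma torus_posE (L : rcfType) (i : {rmorphism K -> L}) A :
  sa_set i torus_pos A <-> exists2 x, pos_row x & A = tmat c i (tw W x).
Proof.
case: D => cc BW W0; split=> [[b]|[x x0 ->]].
  rewrite inE => /eqP-> [/= /(torus_zeros cc BW W0 i A)[x nzx ->] pos].
  exists x => // j; rewrite -(torus_coordE cc BW W0 i j nzx); apply: pos.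
  by apply: map_f; rewrite mem_enum.
exists (torus_eqs c W B, [seq torus_coord c B j | j <- enum 'I_d]); first by rewrite inE.
split; first by apply/(torus_zeros cc BW W0 i); exists x; [exact: gt0_nz|].
move=> _ /mapP[j _ ->]; rewrite (torus_coordE cc BW W0 i j); first exact: x0.
exact: gt0_nz.
Qed.

(** * Joining positive torus points by a segment in the parameters *)

Section Path.
Variables (x y : 'rV[K]_d).
Hypotheses (x0 : pos_row x) (y0 : pos_row y).

Let X j : {poly K} := (x 0 j)%:P + (y 0 j - x 0 j) *: 'X.
Let Dp : {poly K} := \prod_j X j.
Let pt (s : K) : 'rV[K]_d := \row_j (X j).[s].

Lemma path_pos s : 0 <= s <= 1 -> pos_row (pt s).
Proof.
move=> /andP[s0 s1] j; rewrite mxE !hornerE.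
have -> : x 0 j + (y 0 j - x 0 j) * s = (1 - s) * x 0 j + s * y 0 j by ring.
have [->|s0'] := eqVneq s 0; first by rewrite subr0 mul1r mul0r addr0.
rewrite ltr_wpDl // ?mulr_gt0 // ?lt_def ?s0' //.
by rewrite mulr_ge0 ?subr_ge0 // ltW.
Qed.

(* Functions that become polynomial after multiplication by a power of [Dp]. *)
Let rat (F : K -> K) := exists N (q : {poly K}),
  forall s, Dp.[s] != 0 -> q.[s] = Dp.[s] ^+ N * F s.

Let rat_const a : rat (fun=> a).
Proof. by exists 0%N, a%:P => s _; rewrite hornerC expr0 mul1r. Qed.

Let rat_add F G : rat F -> rat G -> rat (fun s => F s + G s).
Proof.
move=> [N [q Hq]] [M [r Hr]]; exists (N + M)%N, (q * Dp ^+ M + r * Dp ^+ N) => s D0.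
by rewrite ?(hornerD, hornerM, horner_exp) Hq // Hr // exprD; ring.
Qed.

Let rat_mul F G : rat F -> rat G -> rat (fun s => F s * G s).
Proof.
move=> [N [q Hq]] [M [r Hr]]; exists (N + M)%N, (q * r) => s D0.
by rewrite ?(hornerD, hornerM, horner_exp) Hq // Hr // exprD; ring.
Qed.

Let rat_ext F G : F =1 G -> rat F -> rat G.
Proof. by move=> FG [N [q Hq]]; exists N, q => s D0; rewrite -FG Hq. Qed.

Let rat_sum (I : Type) (s : seq I) (F : I -> K -> K) :
  (forall j, rat (F j)) -> rat (fun u => \sum_(j <- s) F j u).
Proof.
move=> HF; elim: s => [|j s IHs].
  by apply: rat_ext (rat_const 0) => u; rewrite big_nil.
by apply: rat_ext (rat_add (HF j) IHs) => u; rewrite big_cons.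
Qed.

Let rat_exp F m : rat F -> rat (fun s => F s ^+ m).
Proof.
move=> HF; elim: m => [|m IHm]; first by apply: rat_ext (rat_const 1) => s.
by apply: rat_ext (rat_mul HF IHm) => s; rewrite exprS.
Qed.

Let rat_pt j (e : int) : rat (fun s => pt s 0 j ^ e).
Proof.
have rX : rat (fun s => pt s 0 j).
  by exists 0%N, (X j) => s _; rewrite mxE expr0 mul1r.
case: e => m; first exact: rat_exp.
have rV : rat (fun s => (pt s 0 j)^-1).
  exists 1%N, (\prod_(l | l != j) X l) => s D0; rewrite mxE expr1.
  move: D0; rewrite /Dp (bigD1 j) //= hornerM mulf_eq0 negb_or => /andP[Xj _].
  by rewrite mulrAC mulfV // mul1r.
by apply: rat_ext (rat_exp m.+1 rV) => s; rewrite exprVn.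
Qed.

Let rat_mon (e : 'rV[int]_d) : rat (fun s => mon (pt s) e).
Proof.
apply: (@rat_ext (fun s => \prod_j pt s 0 j ^ e 0 j)) => [s|]; first by rewrite monE.
elim: (index_enum _) => [|j s IHs].
  by apply: rat_ext (rat_const 1) => u; rewrite big_nil.
by apply: rat_ext (rat_mul (rat_pt j (e 0 j)) IHs) => u; rewrite big_cons.
Qed.

Let gam s : 'M[K]_n := tmat c idfun (tw W (pt s)).

Let rat_gam a b : rat (fun s => gam s a b).
Proof.
apply: (@rat_ext (fun s => \sum_l c l a * mon (pt s) (row l W) * c l b)) => [s|].
  rewrite /gam tmatE mxE; apply: eq_bigr => l _.
  by rewrite mul_mx_diag !mxE.
apply: rat_sum => l; apply: rat_mul; last exact: rat_const.
by apply: rat_mul; [exact: rat_const|exact: rat_mon].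
Qed.

Let rat_pval p : rat (fun s => pval idfun p (gam s)).
Proof.
elim/mpoly_alg_ind: p => [a|j|p q Hp Hq|p q Hp Hq].
- by apply: rat_ext (rat_const a) => s; rewrite -pevE pev_const.
- case: (mxvec_indexP j) => a b; apply: rat_ext (rat_gam a b) => s.
  by rewrite -pevE pev_var mxvecE.
- by apply: rat_ext (rat_add Hp Hq) => s; rewrite -!pevE rmorphD.
- by apply: rat_ext (rat_mul Hp Hq) => s; rewrite -!pevE rmorphM.
Qed.

Let rat_sign F : rat F -> exists q : {poly K}, forall s, 0 <= s <= 1 ->
  Num.sg q.[s] = Num.sg (F s).
Proof.
move=> [N [q Hq]]; exists q => s s01.
have D0 : 0 < Dp.[s].
  rewrite /Dp horner_prod; apply: prodr_gt0 => j _.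
  by have := path_pos s01 j; rewrite mxE.
by rewrite Hq ?gt_eqF // sgrM gtr0_sg ?mul1r // exprn_gt0.
Qed.

(** That an entry moves by less than e is the positivity of e^2 minus a square, whose sign is that
    of a polynomial in the parameter. Continuity of this polynomial concludes. *)
Lemma path_continuous s e : 0 <= s <= 1 -> 0 < e -> exists2 dl, 0 < dl &
  forall t, 0 <= t <= 1 -> `|t - s| < dl -> forall a b, `|gam t a b - gam s a b| < e.
Proof.
move=> s01 e0.
have one ab : exists2 dl, 0 < dl & forall t, 0 <= t <= 1 -> `|t - s| < dl ->
    `|gam t ab.1 ab.2 - gam s ab.1 ab.2| < e.
  case: ab => a b /=.
  have [q Hq] : exists q : {poly K}, forall t, 0 <= t <= 1 ->
      Num.sg q.[t] = Num.sg (e ^+ 2 - (gam t a b - gam s a b) ^+ 2).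
    apply: rat_sign; apply: (@rat_ext (fun t => e ^+ 2 + (-1) *
        (gam t a b + (- gam s a b)) ^+ 2)) => [t|]; first by rewrite mulN1r.
    by do ?[apply: rat_add|apply: rat_mul|apply: rat_exp|apply: rat_const|apply: rat_gam].
  have qs : 0 < q.[s].
    by rewrite -sgr_gt0 Hq // sgr_gt0 subrr expr0n subr0 exprn_gt0.
  have [dl dl0 Hdl] := polyrcf.poly_cont s q qs; exists dl => // t t01 /Hdl qt.
  have : 0 < q.[t].
    by move: qt; rewrite ltr_norml => /andP[]; rewrite ltrBrDl subrr.
  rewrite -sgr_gt0 Hq // sgr_gt0 subr_gt0 -(real_normK (num_real (_ - _))).
  by rewrite ltr_pXn2r ?nnegrE // ltW.
have H (l : seq ('I_n * 'I_n)) : exists2 dl, 0 < dl & forall t, 0 <= t <= 1 ->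
    `|t - s| < dl -> forall ab, ab \in l -> `|gam t ab.1 ab.2 - gam s ab.1 ab.2| < e.
  elim: l => [|ab l [d1 d10 H1]]; first by exists 1.
  have [d2 d20 H2] := one ab; exists (Num.min d1 d2); first by rewrite lt_min d10.
  move=> t t01; rewrite lt_min => /andP[t1 t2] ab'; rewrite inE => /orP[/eqP->|].
    exact: H2.
  exact: H1.
have [dl dl0 Hdl] := H (enum predT); exists dl => // t t01 ts a b.
by apply: (Hdl t t01 ts (a, b)); rewrite mem_enum.
Qed.

(** Along the path, membership depends on the signs of finitely many one-variable polynomials, as
    required by [interval_sa_connected]. *)
Lemma path_semialgebraic (phi : sa_data K n) : exists fs : seq {poly K},
  forall s t, 0 <= s <= 1 -> 0 <= t <= 1 ->
  (forall f, f \in fs -> Num.sg f.[s] = Num.sg f.[t]) ->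
  sa_set idfun phi (gam s) -> sa_set idfun phi (gam t).
Proof.
have one (l : seq (entry_poly K n)) : exists fs : seq {poly K},
    forall s t, 0 <= s <= 1 -> 0 <= t <= 1 ->
    (forall f, f \in fs -> Num.sg f.[s] = Num.sg f.[t]) ->
    forall p, p \in l -> Num.sg (pval idfun p (gam s)) = Num.sg (pval idfun p (gam t)).
  elim: l => [|p l [fs Hfs]].
    by exists [::] => s t _ _ _ p; rewrite in_nil => H; case: (notF H).
  have [q Hq] := rat_sign (rat_pval p); exists (q :: fs) => s t s01 t01 H p'.
  rewrite inE => /orP[/eqP->|]; first by rewrite -!Hq // H ?mem_head.
  by apply: Hfs => // f ffs; apply: H; rewrite inE ffs orbT.
pose l := flatten [seq b.1 ++ b.2 | b <- phi].
have [fs Hfs] := one l; exists fs => s t s01 t01 H [b bphi [b1 b2]].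
have inl p : p \in b.1 ++ b.2 -> p \in l.
  by move=> pb; apply/flattenP; exists (b.1 ++ b.2) => //; apply/mapP; exists b.
exists b; [exact: bphi|split=> p pb].
  apply/eqP; rewrite -sgr_eq0 -(Hfs s t) ?b1 ?sgr0 //.
  by apply: inl; rewrite mem_cat pb.
rewrite -sgr_gt0 -(Hfs s t) ?sgr_gt0 ?b2 //.
by apply: inl; rewrite mem_cat pb orbT.
Qed.

Lemma path0 : gam 0 = tmat c idfun (tw W x).
Proof. by congr (tmat _ _ (tw _ _)); apply/rowP => j; rewrite mxE !hornerE. Qed.

Lemma path1 : gam 1 = tmat c idfun (tw W y).
Proof. by congr (tmat _ _ (tw _ _)); apply/rowP => j; rewrite mxE /X hornerD hornerC hornerZ hornerX mulr1 addrC subrK. Qed.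

Lemma path_connected (V U1 U2 : set 'M[K]_n) :
  (forall s, 0 <= s <= 1 -> V (gam s)) ->
  semialgebraic U1 -> rel_open V U1 -> rel_open V U2 ->
  U1 `|` U2 = V -> U1 `&` U2 = set0 -> U1 (gam 0) -> U1 (gam 1).
Proof.
move=> HV [phi U1E] op1 op2 U12 U120 U1x.
have [fs Hfs] := path_semialgebraic phi.
pose m s := `[< U1 (gam s) >].
suff mm : m 0 = m 1 by apply/asboolP; rewrite -/(m 1) -mm; apply/asboolP.
apply: (@interval_sa_connected K fs) => [s t s01 t01 H|s s01].
  apply/asboolP/asboolP; rewrite U1E; apply: Hfs => // f ffs; exact/esym/H.
have NU2 A : V A -> ~ U1 A -> U2 A by rewrite -U12 => -[].
have U2N A : U2 A -> ~ U1 A.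
  by move=> U2A U1A; have : (U1 `&` U2) A by []; rewrite U120.
have [U1s|NU1s] := pselect (U1 (gam s)).
  have [e e0 He] := op1 _ U1s; have [dl dl0 Hdl] := path_continuous s01 e0.
  exists dl => // t t01 ts; rewrite /m (asboolT U1s); apply/asboolT.
  by apply: He; [exact: HV|move=> a b; apply: Hdl].
have U2s := NU2 _ (HV s s01) NU1s.
have [e e0 He] := op2 _ U2s; have [dl dl0 Hdl] := path_continuous s01 e0.
exists dl => // t t01 ts; rewrite /m (asboolF NU1s); apply/asboolF/U2N.
by apply: He; [exact: HV|move=> a b; apply: Hdl].
Qed.

End Path.

Lemma pos_torus_connected : sa_connected (sa_set idfun torus_pos).
Proof.
move=> U1 U2 sa1 sa2 op1 op2 U12 U120.
have [->|/set0P[A U1A]] := eqVneq U1 set0; [by left|right].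
apply/seteqP; split=> // A' U2A'.
have /torus_posE[x x0 Ax] : sa_set idfun torus_pos A by rewrite -U12; left.
have /torus_posE[y y0 Ay] : sa_set idfun torus_pos A' by rewrite -U12; right.
have HV s : 0 <= s <= 1 -> sa_set idfun torus_pos
    (tmat c idfun (tw W (\row_j ((x 0 j)%:P + (y 0 j - x 0 j) *: 'X).[s]))).
  by move=> s01; apply/torus_posE; eexists; [exact: (path_pos x0 y0 s01)|].
rewrite -U120; split=> //; rewrite Ay -(path1 x y).
by apply: (path_connected x0 y0 HV sa1 op1 op2 U12 U120); rewrite path0 -Ax.
Qed.

Lemma sa_refine (phi : sa_data K n) (q : entry_poly K n) :
  semialgebraic (sa_set idfun phi `&` [set A | 0 < pval idfun q A]).
Proof.
exists [seq (b.1, q :: b.2) | b <- phi]; apply/seteqP; split=> A.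
  move=> [[b bphi [b1 b2]] /= q0]; exists (b.1, q :: b.2); first by apply: map_f.
  by split=> // g; rewrite inE => /orP[/eqP->|/b2].
move=> [_ /mapP[b bphi ->] [/= b1 b2]]; split; last by apply: b2; rewrite mem_head.
by exists b => //; split=> // g gb; apply: b2; rewrite inE gb orbT.
Qed.

(** A torus coordinate is a polynomial without zeros on the torus, so its sign cuts a connected
    semialgebraic set into two relatively open pieces. The piece of the identity is the positive
    one. *)
Lemma sa_component_torus (Q : seq (entry_poly K n)) :
  zeros idfun Q = zeros idfun (torus_eqs c W B) ->
  sa_component (zeros idfun Q) 1%:M = sa_set idfun torus_pos.
Proof.
move=> QE; case: (D) => cc BW W0; apply/seteqP; split=> A; last first.
  move=> pA; exists (sa_set idfun torus_pos); split=> //.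
  - by exists torus_pos.
  - exact: pos_torus_connected.
  - rewrite QE => X /torus_posE[x x0 ->]; apply/(torus_zeros cc BW W0 idfun).
    by exists x; [exact: gt0_nz|].
  - apply/torus_posE; exists (const_mx 1); first by move=> j; rewrite mxE.
    by rewrite tw_const1 (tmat1 cc).
move=> [V [[phi VE] Vconn VQ V1 VA]].
have [x nzx Ax] : exists2 x, nz x & A = tmat c idfun (tw W x).
  by apply/(torus_zeros cc BW W0 idfun); rewrite -QE; apply: VQ.
apply/torus_posE; exists x => // j; rewrite lt_def nzx /= leNgt; apply/negP => xj.
pose q := torus_coord c B j.
have nz_q X : V X -> pval idfun q X != 0.
  move=> /VQ; rewrite QE => /(torus_zeros cc BW W0 idfun)[z nzz ->].
  by rewrite (torus_coordE cc BW W0 idfun j nzz).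
pose U1 := V `&` [set X | 0 < pval idfun q X].
pose U2 := V `&` [set X | 0 < pval idfun (- q) X].
have op r : rel_open V (V `&` [set X | 0 < pval idfun r X]).
  move=> X [VX /= rX]; have [e e0 He] := pval_continuous r X rX.
  exists e => // Y VY XY; split=> //=; have := He Y XY.
  by rewrite ltr_norml => /andP[]; rewrite ltrBrDl subrr.
have Nq X : pval idfun (- q) X = - pval idfun q X by rewrite -!pevE rmorphN.
have := Vconn U1 U2; rewrite /U1 /U2 {1 2}VE => /(_ (sa_refine _ _) (sa_refine _ _)).
move=> /(_ (op _) (op _)) [].
- apply/seteqP; split=> [X [[]|[]] //|X VX].
  have := nz_q X VX; rewrite neq_lt => /orP[q0|q0]; [right|left]; split=> //=.
  by rewrite Nq oppr_gt0.
- apply/seteqP; split=> // X [[_ /= q1] [_ /=]]; rewrite Nq oppr_gt0 => q2.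
  by have := lt_trans q1 q2; rewrite ltxx.
- move=> E; have : (V `&` [set X | 0 < pval idfun q X]) 1%:M.
    split=> //=; rewrite -(tmat1 cc idfun) -(tw_const1 _ W).
    by rewrite (torus_coordE cc BW W0 idfun j (@nz1 _ _)) mxE.
  by rewrite E.
- move=> E; have : (V `&` [set X | 0 < pval idfun (- q) X]) A.
    by split=> //=; rewrite Nq Ax (torus_coordE cc BW W0 idfun j nzx) oppr_gt0.
  by rewrite E.
Qed.
End Component.

(** * Groups over an extension *)

Section TransferConsequences.
Variables (K : rcfType) (n : nat).
Local Notation mform := (QE.mform K n).
Local Notation mterm := (QE.mterm K n).

Definition Ftrue : mform := QE.FEq (QE.MVar K n 0) (QE.MVar K n 0).
Definition Fall (T : Type) (s : seq T) (f : T -> mform) : mform :=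
  foldr (fun x g => QE.FAnd (f x) g) Ftrue s.
Definition Fex (T : Type) (s : seq T) (f : T -> mform) : mform :=
  foldr (fun x g => QE.FOr (f x) g) (QE.FNot Ftrue) s.
Definition Fzero (p : entry_poly K n) (t : mterm) : mform :=
  QE.FAnd (QE.FNot (QE.FPos p t)) (QE.FNot (QE.FPos (- p) t)).
Definition Fzeros (P : seq (entry_poly K n)) (t : mterm) : mform :=
  Fall P (fun p => Fzero p t).
Definition Fsa (phi : sa_data K n) (t : mterm) : mform :=
  Fex phi (fun b => QE.FAnd (Fzeros b.1 t) (Fall b.2 (fun g => QE.FPos g t))).

Section Semantics.
Variables (L : rcfType) (i : {rmorphism K -> L}).
Local Notation hold := (QE.mhold i).

Lemma Fimp_hold (f g : mform) (rho : nat -> 'M[L]_n) : hold rho (QE.FImp f g) = (hold rho f -> hold rho g).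
Proof. by []. Qed.

Lemma Fall_hold (T : eqType) (s : seq T) (f : T -> mform) rho :
  hold rho (Fall s f) <-> forall x, x \in s -> hold rho (f x).
Proof.
elim: s => [|x s IHs] //=; split=> [[fx /IHs H] y|H].
  by rewrite inE => /orP[/eqP->|/H].
split; first by apply: H; rewrite mem_head.
by apply/IHs => y ys; apply: H; rewrite inE ys orbT.
Qed.

Lemma Fex_hold (T : eqType) (s : seq T) (f : T -> mform) rho :
  hold rho (Fex s f) <-> exists2 x, x \in s & hold rho (f x).
Proof.
elim: s => [|x s IHs] /=; first by split=> [[]//|[]].
split=> [[fx|/IHs[y ys fy]]|[y]]; first by exists x; rewrite ?mem_head.
  by exists y; rewrite // inE ys orbT.
rewrite inE => /orP[/eqP->|ys] fy; [by left|by right; apply/IHs; exists y].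
Qed.

Lemma Fzero_hold p t rho : hold rho (Fzero p t) <-> pval i p (QE.mval i rho t) = 0.
Proof.
rewrite /= -!pevE rmorphN /= oppr_gt0; split=> [[/negP + /negP]|->].
  by rewrite -!leNgt => h1 h2; apply/eqP; rewrite eq_le h1 h2.
by rewrite ltxx.
Qed.

Lemma Fzeros_hold P t rho : hold rho (Fzeros P t) <-> zeros i P (QE.mval i rho t).
Proof. by split=> [/Fall_hold H p /H/Fzero_hold|H]; [|apply/Fall_hold => p /H/Fzero_hold]. Qed.

Lemma Fsa_hold phi t rho : hold rho (Fsa phi t) <-> sa_set i phi (QE.mval i rho t).
Proof.
split=> [/Fex_hold[b bphi [/Fzeros_hold b1 /Fall_hold b2]]|[b bphi [b1 b2]]]; first by exists b.
by apply/Fex_hold; exists b => //; split; [apply/Fzeros_hold|apply/Fall_hold].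
Qed.

End Semantics.

Section TwoFields.
Variables (L L' : rcfType) (i : {rmorphism K -> L}) (i' : {rmorphism K -> L'}).

Lemma transfer1 (f : mform) : (forall X, QE.mhold i (QE.upd (fun=> 0) 0 X) f) ->
  forall X, QE.mhold i' (QE.upd (fun=> 0) 0 X) f.
Proof. by move=> H; apply: (@QE.transfer_rcf _ _ _ _ i i' (QE.FAll 0 f)). Qed.

Lemma transfer2 (f : mform) :
  (forall X Y, QE.mhold i (QE.upd (QE.upd (fun=> 0) 0 X) 1 Y) f) ->
  forall X Y, QE.mhold i' (QE.upd (QE.upd (fun=> 0) 0 X) 1 Y) f.
Proof. by move=> H; apply: (@QE.transfer_rcf _ _ _ _ i i' (QE.FAll 0 (QE.FAll 1 f))). Qed.

(** Equality of two sets given by data over [K] is a sentence over [K]; hence the extension does not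
    depend on the description. *)
Lemma sa_set_transfer (phi psi : sa_data K n) :
  sa_set i phi = sa_set i psi -> sa_set i' phi = sa_set i' psi.
Proof.
move=> E; pose x := QE.MVar K n 0.
pose f := QE.FAnd (QE.FImp (Fsa phi x) (Fsa psi x)) (QE.FImp (Fsa psi x) (Fsa phi x)).
have /transfer1 H : forall X, QE.mhold i (QE.upd (fun=> 0) 0 X) f.
  by move=> X; split=> /Fsa_hold H; apply/Fsa_hold; rewrite E in H *.
apply/seteqP; split=> X HX; have [H1 H2] := H X.
  by have /Fsa_hold : QE.mhold i' (QE.upd (fun=> 0) 0 X) (Fsa psi x) by apply/H1/Fsa_hold.
by have /Fsa_hold : QE.mhold i' (QE.upd (fun=> 0) 0 X) (Fsa phi x) by apply/H2/Fsa_hold.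
Qed.

Lemma sa_extE (phi : sa_data K n) : sa_ext i i' (sa_set i phi) = sa_set i' phi.
Proof.
apply/seteqP; split=> X; last by exists phi.
by move=> [psi /sa_set_transfer ->].
Qed.

End TwoFields.

Section Groups.
Variables (C : numClosedFieldType) (toC : {rmorphism K -> C}).
Variables (P Q : seq (entry_poly K n)).
Hypothesis G_group : cgroup toC P.
Hypothesis G_self_adjoint : forall g, zeros toC P g -> zeros toC P g^T.
Hypothesis S_torus : cmaximal toC P Q.
Hypothesis S_symmetric : forall s, zeros toC Q s -> s = s^T.
Variables (d : nat) (c : 'M[K]_n) (W : 'M[int]_(n, d)) (B : 'M[int]_(d, n)).
Hypothesis D : torus_data c W B.
Hypothesis QT : zeros toC Q = zeros toC (torus_eqs c W B).

Lemma zerosK_Q : zeros idfun Q = zeros idfun (torus_eqs c W B).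
Proof. by apply/seteqP; split=> A /(zeros_toC toC) H; apply/(zeros_toC toC); rewrite QT in H *. Qed.

Variables (L : rcfType) (i : {rmorphism K -> L}).
Let iK : {rmorphism K -> K} := idfun.

Lemma A_pointsE : A_points Q i = sa_set i (torus_pos c W B).
Proof.
rewrite /A_points (sa_component_torus D zerosK_Q).
exact: (sa_extE iK i).
Qed.

Lemma A_pointsP A : A_points Q i A <-> exists2 x, pos_row x & A = tmat c i (tw W x).
Proof. by rewrite A_pointsE; apply: torus_posE. Qed.

(** The property holds for points over [C], hence over [K], and as a sentence over [K] it passes to
    [L]. The lemmas on products, transposes and inverses follow the same pattern. *)
Lemma G_det g : zeros i P g -> \det g = 1.
Proof.
pose x := QE.MVar K n 0.
pose f := QE.FImp (Fzeros P x) (Fzero (\det (genmx K n) - 1) x).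
have dE (L' : rcfType) (j : {rmorphism K -> L'}) A :
    pval j (\det (genmx K n) - 1) A = \det A - 1.
  by rewrite -pevE rmorphB rmorph1 -det_map_mx pev_genmx.
have /(transfer1 i) H : forall X, QE.mhold iK (QE.upd (fun=> 0) 0 X) f.
  move=> X /Fzeros_hold GX; apply/Fzero_hold; rewrite dE.
  have {}GX : zeros toC P (map_mx toC X) by apply/zeros_toC.
  apply: (fmorph_inj toC); rewrite rmorphB rmorph1 rmorph0 -det_map_mx.
  by case: G_group => _ /(_ _ GX) /= ->; rewrite subrr.
move=> Gg; have /Fzero_hold : QE.mhold i (QE.upd (fun=> 0) 0 g) (Fzero (\det (genmx K n) - 1) x).
  by apply/H/Fzeros_hold.
by rewrite dE /= => /eqP; rewrite subr_eq0 => /eqP.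
Qed.

Lemma G_mul g h : zeros i P g -> zeros i P h -> zeros i P (g *m h).
Proof.
pose x := QE.MVar K n 0; pose y := QE.MVar K n 1.
pose f := QE.FImp (Fzeros P x) (QE.FImp (Fzeros P y) (Fzeros P (QE.MMul x y))).
have /(transfer2 i) H : forall X Y, QE.mhold iK (QE.upd (QE.upd (fun=> 0) 0 X) 1 Y) f.
  move=> X Y /Fzeros_hold /= GX /Fzeros_hold /= GY; apply/Fzeros_hold => /=.
  exact: (zeros_mul G_group).
move=> Gg Gh; have /Fzeros_hold : QE.mhold i (QE.upd (QE.upd (fun=> 0) 0 g) 1 h)
    (Fzeros P (QE.MMul x y)) by apply: H; apply/Fzeros_hold.
by [].
Qed.

Lemma G_tr g : zeros i P g -> zeros i P g^T.
Proof.
pose x := QE.MVar K n 0.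
pose f := QE.FImp (Fzeros P x) (Fzeros P (QE.MTr x)).
have /(transfer1 i) H : forall X, QE.mhold iK (QE.upd (fun=> 0) 0 X) f.
  move=> X /Fzeros_hold /= GX; apply/Fzeros_hold => /=.
  exact: (zeros_tr G_self_adjoint).
move=> Gg; have /Fzeros_hold : QE.mhold i (QE.upd (fun=> 0) 0 g)
    (Fzeros P (QE.MTr x)) by apply: H; apply/Fzeros_hold.
by [].
Qed.

Lemma G_unit g : zeros i P g -> g \in unitmx.
Proof. by move=> /G_det dg; rewrite unitmxE dg unitr1. Qed.

Lemma G_one : zeros i P 1%:M.
Proof.
move=> p pP; have := zeros_one G_group pP; rewrite -!pevE => p1.
have -> : (1%:M : 'M[L]_n) = map_mx i 1%:M by rewrite map_mx1.
rewrite (pev_map (i := iK) (j := i)) //=.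
by rewrite p1 rmorph0.
Qed.

Lemma G_inv g : zeros i P g -> zeros i P (invmx g).
Proof.
pose x := QE.MVar K n 0; pose y := QE.MVar K n 1.
pose f := QE.FImp (Fzeros P x) (QE.FImp (QE.FEq (QE.MMul x y) (QE.MConst 1%:M)) (Fzeros P y)).
have /(transfer2 i) H : forall X Y, QE.mhold iK (QE.upd (QE.upd (fun=> 0) 0 X) 1 Y) f.
  move=> X Y /Fzeros_hold /= /(zeros_toC toC) GX; rewrite map_mx1 => XY.
  apply/Fzeros_hold => /=; apply/(zeros_toC toC).
  have -> : Y = invmx X by have [_ Xu] := mulmx1_unit XY; rewrite -[RHS]mulmx1 -XY mulKmx //; case: (mulmx1_unit XY).
  by rewrite map_invmx; case: G_group => -[_ _ _ + _]; apply.
move=> Gg; have /Fzeros_hold : QE.mhold i (QE.upd (QE.upd (fun=> 0) 0 g) 1 (invmx g))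
    (Fzeros P y); last by [].
apply: H; first exact/Fzeros_hold.
by rewrite /= map_mx1 mulmxV // G_unit.
Qed.

Lemma A_sub_G x : nz x -> zeros i P (tmat c i (tw W x)).
Proof.
move=> nzx; pose X := QE.MVar K n 0.
pose f := QE.FImp (Fzeros (torus_eqs c W B) X) (Fzeros P X).
case: (D) => cc BW W0.
have /(transfer1 i) H : forall X, QE.mhold iK (QE.upd (fun=> 0) 0 X) f.
  move=> Y; rewrite /f Fimp_hold => /Fzeros_hold GY; apply/Fzeros_hold.
  have {}GY : zeros toC (torus_eqs c W B) (map_mx toC Y) by apply/zeros_toC.
  suff : zeros idfun P Y by [].
  apply/(zeros_toC toC).
  by case: S_torus => _ QP _; apply: QP; rewrite QT.
have /Fzeros_hold : QE.mhold i (QE.upd (fun=> 0) 0 (tmat c i (tw W x))) (Fzeros P X); last by [].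
move: (H (tmat c i (tw W x))); rewrite /f Fimp_hold; apply; apply/Fzeros_hold.
by apply/(torus_zeros cc BW W0 i); exists x.
Qed.

(** Maximality quantifies over tori and is not first order, but this consequence of it is, the
    positive torus being semialgebraic. *)
Lemma torus_maximality_ext (h : 'M[L]_n) : zeros i P h ->
  (forall x, pos_row x -> h *m h^T *m tmat c i (tw W x) = tmat c i (tw W x) *m (h *m h^T)) ->
  exists2 x, pos_row x & h *m h^T = tmat c i (tw W x).
Proof.
pose x := QE.MVar K n 0; pose y := QE.MVar K n 1; pose s := QE.MMul x (QE.MTr x).
pose f := QE.FImp (Fzeros P x) (QE.FImp (QE.FAll 1 (QE.FImp (Fsa (torus_pos c W B) y)
  (QE.FEq (QE.MMul s y) (QE.MMul y s)))) (Fsa (torus_pos c W B) s)).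
have /(transfer1 i) H : forall X, QE.mhold iK (QE.upd (fun=> 0) 0 X) f.
  move=> X; rewrite /f !Fimp_hold => /Fzeros_hold GX HX; apply/Fsa_hold/(torus_posE D iK).
  apply: (torus_maximality G_group G_self_adjoint S_torus S_symmetric D QT) => // z z0.
  have HXz : QE.mhold iK (QE.upd (QE.upd (fun=> 0) 0 X) 1 (tmat c iK (tw W z)))
      (QE.FImp (Fsa (torus_pos c W B) y) (QE.FEq (QE.MMul s y) (QE.MMul y s))) := HX _.
  move: HXz; rewrite Fimp_hold => HXz; apply/esym/HXz/Fsa_hold/(torus_posE D iK).
  by exists z.
move=> Gh hc; apply/(torus_posE D i).
move: (H h); rewrite /f !Fimp_hold => HH.
suff /Fsa_hold : QE.mhold i (QE.upd (fun=> 0) 0 h) (Fsa (torus_pos c W B) s) by [].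
apply: HH; first exact/Fzeros_hold.
suff HY Y : QE.mhold i (QE.upd (QE.upd (fun=> 0) 0 h) 1 Y)
    (QE.FImp (Fsa (torus_pos c W B) y) (QE.FEq (QE.MMul s y) (QE.MMul y s))) by exact: HY.
rewrite Fimp_hold => /Fsa_hold /(torus_posE D i)[z z0 Yz].
change (h *m h^T *m Y = Y *m (h *m h^T)).
by have -> : Y = tmat c i (tw W z) := Yz; apply: hc.
Qed.

End Groups.
End TransferConsequences.

(** * Nilpotent exponentials *)

Section PolynomialMatrices.
Variables (L : numFieldType) (n : nat).
Implicit Types (A X Y : 'M[L]_n) (U V : 'M[{poly L}]_n) (p : {poly L}).

Definition cmx A : 'M[{poly L}]_n := map_mx polyC A.
Definition dmx V : 'M[{poly L}]_n := map_mx (@deriv L) V.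
Definition emx (t : L) V : 'M[L]_n := map_mx (horner_eval t) V.

Lemma dmxD U V : dmx (U + V) = dmx U + dmx V.
Proof. by apply/matrixP => a b; rewrite !mxE derivD. Qed.

Lemma dmxN U : dmx (- U) = - dmx U.
Proof. by apply/matrixP => a b; rewrite !mxE derivN. Qed.

Lemma dmxM U V : dmx (U *m V) = dmx U *m V + U *m dmx V.
Proof.
apply/matrixP => a b; rewrite !mxE raddf_sum -big_split /=; apply: eq_bigr => l _.
by rewrite derivM !mxE.
Qed.

Lemma dmx_cmx A : dmx (cmx A) = 0.
Proof. by apply/matrixP => a b; rewrite !mxE derivC. Qed.

Lemma dmxZ p V : dmx (p *: V) = p^`() *: V + p *: dmx V.
Proof. by apply/matrixP => a b; rewrite !mxE derivM. Qed.

Lemma cmxM A X : cmx (A *m X) = cmx A *m cmx X.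
Proof. exact: map_mxM. Qed.

Lemma cmxD A X : cmx (A + X) = cmx A + cmx X.
Proof. exact: map_mxD. Qed.

Lemma emx_cmx t A : emx t (cmx A) = A.
Proof. by apply/matrixP => a b; rewrite !mxE /horner_eval hornerC. Qed.

Lemma emxM t U V : emx t (U *m V) = emx t U *m emx t V.
Proof. exact: map_mxM. Qed.

Lemma emxD t U V : emx t (U + V) = emx t U + emx t V.
Proof. exact: map_mxD. Qed.

Lemma emxN t U : emx t (- U) = - emx t U.
Proof. exact: map_mxN. Qed.

Lemma emxZ t p V : emx t (p *: V) = p.[t] *: emx t V.
Proof. by apply/matrixP => a b; rewrite !mxE /horner_eval hornerM. Qed.

(** In characteristic zero the value at 0 determines a polynomial solution of U' = A U, coefficient
    by coefficient. Identities between exponentials are obtained by checking that both sides solve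
    one such equation. *)
Lemma mx_ode_uniq A U V : dmx U = cmx A *m U -> dmx V = cmx A *m V ->
  emx 0 U = emx 0 V -> U = V.
Proof.
move=> HU HV UV0; apply/eqP; rewrite -subr_eq0; apply/eqP.
have HD : dmx (U - V) = cmx A *m (U - V) by rewrite dmxD dmxN HU HV mulmxBr.
have D0 : emx 0 (U - V) = 0 by rewrite emxD emxN UV0 subrr.
move: (U - V) HD D0 => D HD D0.
suff H k : forall i j, (D i j)`_k = 0.
  by apply/matrixP => i j; apply/polyP => k; rewrite H mxE coef0.
elim: k => [|k IHk] i j.
  by have := congr1 (fun M : 'M[L]_n => M i j) D0; rewrite !mxE /horner_eval horner_coef0.
have := congr1 (fun M : 'M[{poly L}]_n => (M i j)`_k) HD.
rewrite !mxE coef_deriv coef_sum big1 => [/eqP|l _].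
  by rewrite mulrn_eq0 /= => /eqP.
by rewrite mxE coefCM IHk mulr0.
Qed.

End PolynomialMatrices.

Section NilpotentExponential.
Variables (L : numFieldType) (n : nat).
Implicit Types (A X Y : 'M[L]_n).

Lemma expmx0n (k : nat) : (0 < k)%N -> (0 : 'M[L]_n) ^+ k = 0.
Proof. by case: k => // k _; rewrite exprS mul0r. Qed.

Lemma mx_dim0 (T : Type) (A B : 'M[T]_n) : n = 0%N -> A = B.
Proof. by move=> n0; apply/matrixP => -[a lta]; exfalso; move: (lta); rewrite n0. Qed.

Lemma expmxZ t X k : (t *: X) ^+ k = t ^+ k *: X ^+ k.
Proof.
elim: k => [|k IHk]; first by rewrite !expr0 scale1r.
by rewrite !exprS IHk -!mulmxE -scalemxAl -scalemxAr scalerA.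
Qed.

Lemma expmxN X k : X ^+ k = 0 -> (- X) ^+ k = 0.
Proof. by move=> Xk; rewrite -scaleN1r expmxZ Xk scaler0. Qed.

Lemma expmx_tr X k : (X ^+ k)^T = X^T ^+ k.
Proof.
elim: k => [|k IHk]; first by rewrite !expr0 trmx1.
by rewrite exprS exprSr -!mulmxE trmx_mul IHk.
Qed.

Lemma expmx_conj g X k : g \in unitmx ->
  (g *m X *m invmx g) ^+ k = g *m X ^+ k *m invmx g.
Proof.
move=> gu; elim: k => [|k IHk]; first by rewrite !expr0 -[1]/(1%:M) mulmx1 mulmxV.
by rewrite !exprS IHk -!mulmxE !mulmxA mulmxKV.
Qed.

Definition pterm X k : 'M[{poly L}]_n := ((k`!%:R)^-1 *: 'X^k) *: cmx (X ^+ k).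
(** The exponential of tX as a matrix of polynomials in t; the truncation is exact when [X ^+ n] is
    0. *)
Definition pexp X : 'M[{poly L}]_n := \sum_(k < n) pterm X k.

Lemma emx_pexp t X : emx t (pexp X) = nexp (t *: X).
Proof.
rewrite /emx raddf_sum; apply: eq_bigr => k _; rewrite -[LHS]/(emx t _) emxZ emx_cmx.
by rewrite expmxZ hornerZ hornerXn scalerA.
Qed.

Lemma emx1_pexp X : emx 1 (pexp X) = nexp X.
Proof. by rewrite emx_pexp scale1r. Qed.

Lemma nexp0 : nexp (0 : 'M[L]_n) = 1%:M.
Proof.
case: (posnP n) => [/mx_dim0|n0]; first exact.
rewrite /nexp (bigD1 (Ordinal n0)) //= big1 ?addr0 => [|k k0].
  by rewrite expr0 fact0 invr1 scale1r.
by rewrite expmx0n ?scaler0 // lt0n.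
Qed.

Lemma emx0_pexp X : emx 0 (pexp X) = 1%:M.
Proof. by rewrite emx_pexp scale0r nexp0. Qed.

Lemma dmx_pexp X : X ^+ n = 0 -> dmx (pexp X) = cmx X *m pexp X.
Proof.
move=> Xn; pose S N := \sum_(k < N) pterm X k.
have dt k : dmx (pterm X k.+1) = cmx X *m pterm X k.
  rewrite /pterm dmxZ dmx_cmx scaler0 addr0 (exprS X) -mulmxE cmxM scalemxAr.
  congr (_ *m (_ *: _)); apply/polyP => m; rewrite derivZ derivXn /= !coefZ coefMn.
  rewrite -[_`_m *+ k.+1]mulr_natl mulrA; congr (_ * _).
  by rewrite factS natrM invfM mulrAC mulVf ?mul1r // pnatr_eq0.
have dS N : dmx (S N.+1) = cmx X *m S N.
  elim: N => [|N IHN]; rewrite /S big_ord_recr /=.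
    rewrite !big_ord0 mulmx0 add0r /pterm expr0 fact0 invr1 scale1r dmxZ.
    by rewrite derivC scale0r dmx_cmx scaler0 addr0.
  by rewrite dmxD -/(S N.+1) IHN dt /S big_ord_recr /= mulmxDr.
have -> : pexp X = S n.+1 by rewrite /S big_ord_recr /= /pterm Xn /cmx map_mx0 scaler0 addr0.
by rewrite dS /S big_ord_recr /= /pterm Xn /cmx map_mx0 scaler0 addr0.
Qed.

Lemma pexp_comm X Y : X *m Y = Y *m X -> pexp X *m cmx Y = cmx Y *m pexp X.
Proof.
move=> XY; rewrite mulmx_suml mulmx_sumr; apply: eq_bigr => k _.
rewrite /pterm -scalemxAl -scalemxAr -!cmxM; congr (_ *: cmx _).
elim: (val k) => [|m IHm]; first by rewrite expr0 mul1mx mulmx1.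
by rewrite exprS -!mulmxE -mulmxA IHm !mulmxA XY.
Qed.

Lemma nexpD X Y : X ^+ n = 0 -> Y ^+ n = 0 -> (X + Y) ^+ n = 0 -> X *m Y = Y *m X ->
  nexp (X + Y) = nexp X *m nexp Y.
Proof.
move=> Xn Yn XYn XY; rewrite -!emx1_pexp -emxM; congr (emx 1 _).
apply: (@mx_ode_uniq _ _ (X + Y)); first exact: dmx_pexp.
  rewrite dmxM !dmx_pexp // cmxD mulmxDl !mulmxA; congr (_ + _ *m _).
  exact: pexp_comm.
by rewrite emxM !emx0_pexp mulmx1.
Qed.

Lemma nexpV X : X ^+ n = 0 -> nexp X *m nexp (- X) = 1%:M.
Proof.
move=> Xn; case: (posnP n) => [/mx_dim0|n0]; first exact.
rewrite -nexpD ?subrr ?nexp0 // ?expmx0n // ?expmxN //.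
by rewrite mulmxN mulNmx.
Qed.

Lemma nexp_unit X : X ^+ n = 0 -> nexp X \in unitmx.
Proof. by move=> /nexpV /mulmx1_unit[]. Qed.

Lemma nexp_inv X : X ^+ n = 0 -> invmx (nexp X) = nexp (- X).
Proof. by move=> Xn; rewrite -[RHS]mul1mx -(mulVmx (nexp_unit Xn)) -mulmxA nexpV // mulmx1. Qed.

Lemma nexp_tr X : (nexp X)^T = nexp X^T.
Proof. by rewrite /nexp raddf_sum; apply: eq_bigr => k _; rewrite /= linearZ /= expmx_tr. Qed.

Lemma nexp_conj g X : g \in unitmx -> g *m nexp X *m invmx g = nexp (g *m X *m invmx g).
Proof.
move=> gu; rewrite /nexp mulmx_sumr mulmx_suml; apply: eq_bigr => k _.
by rewrite expmx_conj // -scalemxAr -scalemxAl.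
Qed.

Lemma nexp_comm A X : A *m X = X *m A -> nexp X *m A = A *m nexp X.
Proof.
by move=> AX; rewrite -!emx1_pexp -{1}(emx_cmx 1 A) -emxM pexp_comm // emxM emx_cmx.
Qed.

(** Conjugation by exp(tX) is exp(t ad X), and the series stops at degree two because ad X kills
    [T]. *)
Lemma nexp_Ad X Y Z T t : X ^+ n = 0 -> X *m Y - Y *m X = Z -> X *m Z - Z *m X = T ->
  X *m T = T *m X ->
  nexp (t *: X) *m Y = (Y + t *: Z + (t ^+ 2 / 2) *: T) *m nexp (t *: X).
Proof.
move=> Xn defZ defT XT.
pose V : 'M[{poly L}]_n := cmx Y + 'X *: cmx Z + ((2^-1) *: 'X^2) *: cmx T.
have : pexp X *m cmx Y = V *m pexp X.
  apply: (@mx_ode_uniq _ _ X).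
  - by rewrite dmxM dmx_cmx mulmx0 addr0 dmx_pexp // mulmxA.
  - rewrite dmxM dmx_pexp // !mulmxA -mulmxDl; congr (_ *m _).
    rewrite /V !dmxD !dmxZ !dmx_cmx !scaler0 !addr0 add0r derivX scale1r.
    rewrite derivZ derivXn /= expr1 !mulmxDl !mulmxDr -!scalemxAl -!scalemxAr -!cmxM XT.
    have -> : 2^-1 *: ('X *+ 2) = 'X :> {poly L}.
      by apply/polyP => m; rewrite coefZ coefMn -[_`_m *+ 2]mulr_natl mulKf ?pnatr_eq0.
    have ZE : cmx (X *m Y) = cmx Z + cmx (Y *m X) by rewrite -cmxD -defZ subrK.
    have TE : cmx (X *m Z) = cmx T + cmx (Z *m X) by rewrite -cmxD -defT subrK.
    rewrite ZE TE scalerDr !addrA; congr (_ + _ + _).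
    by rewrite [RHS]addrAC [cmx Z + _]addrC -!addrA; congr (_ + _); rewrite addrC.
  - rewrite !emxM emx0_pexp mul1mx mulmx1 emx_cmx /V !emxD !emxZ !emx_cmx.
    by rewrite hornerX hornerZ hornerXn expr0n mulr0 !scale0r !addr0.
move=> /(congr1 (emx t)); rewrite !emxM emx_pexp emx_cmx => ->.
by rewrite /V !emxD !emxZ !emx_cmx hornerX hornerZ hornerXn mulrC.
Qed.

Lemma ranked_nilpotent (r : 'I_n -> nat) X : (forall a, r a < n)%N ->
  (forall a b, X a b != 0 -> (r b < r a)%N) -> X ^+ n = 0.
Proof.
move=> rn rX; have H k : forall a b, (X ^+ k) a b != 0 -> (r b + k <= r a)%N.
  elim: k => [|k IHk] a b.
    by rewrite expr0 -[1]/(1%:M) mxE; case: (eqVneq a b) => [-> _|_]; rewrite ?addn0 // eqxx.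
  rewrite exprS -mulmxE mxE; have [//|bd] := boolP (r b + k.+1 <= r a)%N.
  rewrite big1 ?eqxx // => l _; apply/eqP; rewrite mulf_eq0; apply/norP => -[/rX h1 /IHk h2].
  by move/negP: bd; apply; rewrite addnS; apply: leq_ltn_trans h2 h1.
apply/matrixP => a b; rewrite mxE; apply/eqP; apply: contraT => /H h.
by have := leq_trans (leq_addl _ _) h; rewrite leqNgt rn.
Qed.

End NilpotentExponential.

(** * Lie algebras and weights *)

Lemma mpoly_subUU m (i : 'I_m) :
  mpoly.mnm_sub (mpoly.mnm1 i) (mpoly.mnm1 i) = mpoly.mnm0 :> mpoly.multinom m.
Proof. by apply/mpoly.mnmP => j; rewrite mpoly.mnmBE mpoly.mnm0E subnn. Qed.

Section Derivations.
Variables (L : numFieldType) (n : nat).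
Local Notation EP := (entry_poly L n).
Local Notation cstmx := (constmx n).
Let idL : {rmorphism L -> L} := idfun.
Implicit Types (X Y Z M y g : 'M[L]_n) (p q : EP).

(* The derivation [p |-> (y |-> d/dt p (y (1 + t X)) at t = 0)]. *)
Definition dop X p : EP :=
  \sum_j mpoly.mderiv j p * mxvec (genmx L n *m cstmx X) 0 j.

Lemma dopD X p q : dop X (p + q) = dop X p + dop X q.
Proof. by rewrite -big_split; apply: eq_bigr => j _; rewrite mpoly.mderivD mulrDl. Qed.

Lemma dopM X p q : dop X (p * q) = dop X p * q + p * dop X q.
Proof.
rewrite /dop mulr_suml mulr_sumr -big_split; apply: eq_bigr => j _ /=.
by rewrite mpoly.mderivM; ring.
Qed.

Lemma dop_const X a : dop X (mpoly.mpolyC _ a) = 0.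
Proof. by rewrite /dop big1 // => j _; rewrite mpoly.mderivC mul0r. Qed.

Lemma dop0 X : dop X 0 = 0.
Proof. by have := dop_const X 0; rewrite mpoly.mpolyC0. Qed.

Lemma dop_var X j : dop X (mX L j) = mxvec (genmx L n *m cstmx X) 0 j.
Proof.
rewrite /dop (bigD1 j) //= big1 ?addr0 => [|l lj].
  by rewrite mpoly.mderivX mpoly.mnm1E eqxx scale1r mpoly_subUU mpoly.mpolyX0 mul1r.
by rewrite mpoly.mderivX mpoly.mnm1E eq_sym (negPf lj) scale0r mul0r.
Qed.

Lemma dop_varE X a b :
  dop X (mX L (mxvec_index a b)) = (genmx L n *m cstmx X) a b.
Proof. by rewrite dop_var mxvecE. Qed.

Lemma dop_sum X (I : Type) (s : seq I) (f : I -> EP) :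
  dop X (\sum_(j <- s) f j) = \sum_(j <- s) dop X (f j).
Proof. exact: (big_morph (dop X) (dopD X) (dop0 X)). Qed.

Lemma dop_gen X a b : dop X (genmx L n a b) = (genmx L n *m cstmx X) a b.
Proof. by rewrite [X in dop _ X]mxE dop_varE. Qed.

Lemma dop_genC X Y a b :
  dop X ((genmx L n *m cstmx Y) a b) = (genmx L n *m cstmx (X *m Y)) a b.
Proof.
rewrite [X in dop _ X]mxE dop_sum /constmx map_mxM mulmxA [RHS]mxE; apply: eq_bigr => l _.
by rewrite dopM dop_gen [X in dop _ X]mxE dop_const mulr0 addr0.
Qed.

Lemma constmxD X Y : cstmx (X + Y) = cstmx X + cstmx Y.
Proof. exact: map_mxD. Qed.

Lemma constmxN X : cstmx (- X) = - cstmx X.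
Proof. exact: map_mxN. Qed.

Lemma dopDl X Y p : dop (X + Y) p = dop X p + dop Y p.
Proof.
rewrite -big_split; apply: eq_bigr => j _; rewrite constmxD mulmxDr linearD /= mxE.
by rewrite mulrDr.
Qed.

Lemma dopZl a X p : dop (a *: X) p = mpoly.mpolyC _ a * dop X p.
Proof.
rewrite mulr_sumr; apply: eq_bigr => j _.
have -> : cstmx (a *: X) = mpoly.mpolyC _ a *: cstmx X :> 'M[EP]_n by apply: map_mxZ.
by rewrite -scalemxAr linearZ /= mxE; ring.
Qed.

Opaque dop.

Lemma leibniz2 (T : comNzRingType) (xyp yxp xyq yxq xp yp xq yq p q : T) :
  xyp * q + yp * xq + (xp * yq + p * xyq) - (yxp * q + xp * yq + (yp * xq + p * yxq)) =
  (xyp - yxp) * q + p * (xyq - yxq).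
Proof. ring. Qed.

(** [dop] represents matrices by left-invariant vector fields; both sides are derivations, so the
    variables decide. *)
Lemma dop_comm X Y p :
  dop X (dop Y p) - dop Y (dop X p) = dop (X *m Y - Y *m X) p.
Proof.
elim/mpoly_alg_ind: p => [a|j|p q Hp Hq|p q Hp Hq].
- by rewrite !dop_const ?dop0 subrr.
- case: (mxvec_indexP j) => a b.
  rewrite (dop_varE Y a b) (dop_varE X a b) (dop_varE (_ - _) a b) (dop_genC X Y) (dop_genC Y X).
  by rewrite constmxD constmxN mulmxBr [RHS]mxE [X in _ = _ + X]mxE.
- by rewrite !dopD -Hp -Hq opprD addrACA.
- rewrite !dopM !dopD !dopM -Hp -Hq.
  exact: leibniz2.
Qed.

Lemma pev_genC y Z a b : pev idL y ((genmx L n *m cstmx Z) a b) = (y *m Z) a b.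
Proof.
have -> : pev idL y ((genmx L n *m cstmx Z) a b) =
    (map_mx (pev idL y) (genmx L n *m cstmx Z)) a b by rewrite [RHS]mxE.
by rewrite map_mxM pev_genmx pev_constmx map_mx_id.
Qed.

Lemma pcompC a (M : 'M[EP]_n) : pcomp (mpoly.mpolyC _ a : EP) M = mpoly.mpolyC _ a.
Proof. exact: mpoly.mmapC. Qed.

Lemma pcomp_var a b (M : 'M[EP]_n) : pcomp (mX L (mxvec_index a b) : EP) M = M a b.
Proof. by rewrite /pcomp mpoly.mmapX mpoly.mmap1U mxvecE. Qed.

Lemma pcompD p q (M : 'M[EP]_n) : pcomp (p + q) M = pcomp p M + pcomp q M.
Proof. exact: rmorphD. Qed.

Lemma pcompM p q (M : 'M[EP]_n) : pcomp (p * q) M = pcomp p M * pcomp q M.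
Proof. exact: rmorphM. Qed.

Opaque pcomp.

Definition rtrans g p : EP := pcomp p (genmx L n *m cstmx g).

Lemma pev_rtrans g y p : pev idL y (rtrans g p) = pev idL (y *m g) p.
Proof. by rewrite pev_comp map_mxM pev_genmx pev_constmx map_mx_id. Qed.

Lemma rtransC g a : rtrans g (mpoly.mpolyC _ a) = mpoly.mpolyC _ a.
Proof. exact: pcompC. Qed.

Lemma rtrans_var g a b : rtrans g (mX L (mxvec_index a b)) = (genmx L n *m cstmx g) a b.
Proof. exact: pcomp_var. Qed.

Lemma rtransD g p q : rtrans g (p + q) = rtrans g p + rtrans g q.
Proof. exact: pcompD. Qed.

Lemma rtransM g p q : rtrans g (p * q) = rtrans g p * rtrans g q.
Proof. exact: pcompM. Qed.

Definition ptr p : EP := pcomp p (genmx L n)^T.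

Lemma pev_ptr y p : pev idL y (ptr p) = pev idL y^T p.
Proof. by rewrite pev_comp -map_trmx pev_genmx. Qed.

Lemma pev_ptr_tr y p : pev idL y^T (ptr p) = pev idL y p.
Proof. by rewrite pev_ptr trmxK. Qed.

Lemma ptrC a : ptr (mpoly.mpolyC _ a) = mpoly.mpolyC _ a.
Proof. exact: pcompC. Qed.

Lemma ptr_var a b : ptr (mX L (mxvec_index a b)) = genmx L n b a.
Proof. by rewrite /ptr pcomp_var [LHS]mxE. Qed.

Lemma ptrD p q : ptr (p + q) = ptr p + ptr q.
Proof. exact: pcompD. Qed.

Lemma ptrM p q : ptr (p * q) = ptr p * ptr q.
Proof. exact: pcompM. Qed.

Opaque rtrans ptr pev.

Lemma pev_dopD X p q y : pev idL y (dop X (p + q)) = pev idL y (dop X p) + pev idL y (dop X q).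
Proof. by rewrite dopD rmorphD. Qed.

Lemma pev_dopM X p q y : pev idL y (dop X (p * q)) =
  pev idL y (dop X p) * pev idL y q + pev idL y p * pev idL y (dop X q).
Proof. by rewrite dopM rmorphD /= !rmorphM. Qed.

Lemma pev_dopDl X Y p y : pev idL y (dop (X + Y) p) = pev idL y (dop X p) + pev idL y (dop Y p).
Proof. by rewrite dopDl rmorphD. Qed.

Lemma pev_dopZl a X p y : pev idL y (dop (a *: X) p) = a * pev idL y (dop X p).
Proof. by rewrite dopZl rmorphM /= pev_const. Qed.

Lemma pev_dop_comm X Y p y : pev idL y (dop (X *m Y - Y *m X) p) =
  pev idL y (dop X (dop Y p)) - pev idL y (dop Y (dop X p)).
Proof. by rewrite -dop_comm rmorphB. Qed.

Lemma sub_zero (a b : L) : a = 0 -> b = 0 -> a - b = 0.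
Proof. by move=> -> ->; rewrite subrr. Qed.

Lemma pev_dop_var X y a b : pev idL y (dop X (mX L (mxvec_index a b))) = (y *m X) a b.
Proof. by rewrite dop_varE pev_genC. Qed.

Lemma pev_dop_const X y a : pev idL y (dop X (mpoly.mpolyC _ a)) = 0.
Proof. by rewrite dop_const rmorph0. Qed.

Lemma dop_rtrans X X' g p y : X *m g = g *m X' ->
  pev idL y (dop X (rtrans g p)) = pev idL (y *m g) (dop X' p).
Proof.
move=> Xg; elim/mpoly_alg_ind: p => [a|j|p q Hp Hq|p q Hp Hq].
- by rewrite rtransC (pev_dop_const X) (pev_dop_const X').
- case: (mxvec_indexP j) => a b; rewrite rtrans_var (dop_genC X g) pev_genC.
  by rewrite pev_dop_var Xg mulmxA.
- rewrite rtransD [LHS]pev_dopD [RHS]pev_dopD; exact: (f_equal2 +%R Hp Hq).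
- rewrite rtransM [LHS]pev_dopM [RHS]pev_dopM.
  exact: (f_equal2 +%R (f_equal2 *%R Hp (pev_rtrans g y q))
    (f_equal2 *%R (pev_rtrans g y p) Hq)).
Qed.

Lemma dop_ptr Z X y p : Z^T *m y = y *m X ->
  pev idL y^T (dop Z (ptr p)) = pev idL y (dop X p).
Proof.
move=> ZX; elim/mpoly_alg_ind: p => [a|j|p q Hp Hq|p q Hp Hq].
- by rewrite ptrC (pev_dop_const Z) (pev_dop_const X).
- case: (mxvec_indexP j) => a b; rewrite ptr_var (dop_gen Z) pev_genC.
  rewrite pev_dop_var -ZX.
  by rewrite -[Z]trmxK -trmx_mul trmxK [LHS]mxE.
- rewrite ptrD [LHS]pev_dopD [RHS]pev_dopD; exact: (f_equal2 +%R Hp Hq).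
- rewrite ptrM [LHS]pev_dopM [RHS]pev_dopM.
  exact: (f_equal2 +%R (f_equal2 *%R Hp (pev_ptr_tr y q))
    (f_equal2 *%R (pev_ptr_tr y p) Hq)).
Qed.

Section LieAlgebra.
Variable GG : set 'M[L]_n.

Definition vanish p := forall y, GG y -> pval idfun p y = 0.
(** The Lie algebra in algebraic form, as the invariant derivations that preserve the ideal of [GG];
    no exponential map enters, so it is available over [F]. *)
Definition dlie X := forall p, vanish p -> vanish (dop X p).

Lemma dlieP X p y : dlie X -> vanish p -> GG y -> pev idL y (dop X p) = 0.
Proof. by move=> HX Hp Gy; rewrite pevE; apply: HX. Qed.

Lemma dlieD X Y : dlie X -> dlie Y -> dlie (X + Y).
Proof.
move=> HX HY p Hp y Gy; rewrite -pevE pev_dopDl.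
exact: (etrans (f_equal2 +%R (dlieP HX Hp Gy) (dlieP HY Hp Gy)) (addr0 0)).
Qed.

Lemma dlieZ a X : dlie X -> dlie (a *: X).
Proof.
move=> HX p Hp y Gy; rewrite -pevE pev_dopZl.
exact: (etrans (f_equal2 *%R (erefl a) (dlieP HX Hp Gy)) (mulr0 a)).
Qed.

Lemma dlieN X : dlie X -> dlie (- X).
Proof. by move=> HX; rewrite -scaleN1r; exact: (dlieZ _ HX). Qed.

Lemma dlie_bracket X Y : dlie X -> dlie Y -> dlie (X *m Y - Y *m X).
Proof.
move=> HX HY p Hp y Gy; rewrite -pevE pev_dop_comm.
exact: (sub_zero (dlieP HX (HY p Hp) Gy) (dlieP HY (HX p Hp) Gy)).
Qed.

Hypothesis G_one : GG 1%:M.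
Hypothesis G_mul : forall g h, GG g -> GG h -> GG (g *m h).
Hypothesis G_unit : forall g, GG g -> g \in unitmx.
Hypothesis G_inv : forall g, GG g -> GG (invmx g).

(** Right translation by [g] preserves the ideal and carries the field of a matrix to the field of
    its conjugate. *)
Lemma dlie_Ad g X : GG g -> dlie X -> dlie (invmx g *m X *m g).
Proof.
move=> Gg HX p Hp y Gy; have gu := G_unit Gg.
have E : X *m g = g *m (invmx g *m X *m g) by rewrite !mulmxA mulmxV // mul1mx.
rewrite -pevE -{1}(mulmxKV gu y) -(dop_rtrans p (y *m invmx g) E) pevE; apply: HX; last by apply: G_mul => //; apply: G_inv.
by move=> z Gz; rewrite -pevE pev_rtrans pevE; apply: Hp; apply: G_mul.
Qed.

(** Transposition exchanges left- and right-invariant fields. At the point [y] this is corrected by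
    conjugating with [y^T], which stays in the Lie algebra by [dlie_Ad]. *)
Lemma dlie_tr (G_tr : forall g, GG g -> GG g^T) X : dlie X -> dlie X^T.
Proof.
move=> HX p Hp y Gy; have yTu := G_unit (G_tr _ Gy).
pose Z' := invmx y^T *m X *m y^T.
have HZ' : dlie Z' := dlie_Ad (G_tr _ Gy) HX.
have E : Z'^T *m y = y *m X^T.
  rewrite /Z' !trmx_mul trmxK -trmx_inv trmxK -!mulmxA mulVmx ?mulmx1 //.
  exact: G_unit.
rewrite -pevE -(dop_ptr p E) pevE; apply: HZ'; last exact: G_tr.
by move=> z Gz; rewrite -pevE pev_ptr pevE; apply: Hp; apply: G_tr.
Qed.

Definition pevp (V : 'M[{poly L}]_n) : {rmorphism EP -> {poly L}} :=
  mpoly.mmap (@polyC L) (fun j => mxvec V 0 j).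

Lemma pevp_const V a : pevp V (mpoly.mpolyC _ a) = a%:P.
Proof. exact: mpoly.mmapC. Qed.

Lemma pevp_var V a b : pevp V (mX L (mxvec_index a b)) = V a b.
Proof. by rewrite /pevp /= mpoly.mmapX mpoly.mmap1U mxvecE. Qed.

Lemma horner_pevp t V p : (pevp V p).[t] = pev idL (emx t V) p.
Proof.
elim/mpoly_alg_ind: p => [a|j|p q Hp Hq|p q Hp Hq].
- by rewrite pevp_const hornerC pev_const.
- by case: (mxvec_indexP j) => a b; rewrite pevp_var pev_var mxvecE mxE.
- by rewrite !rmorphD /= hornerD Hp Hq.
- by rewrite !rmorphM /= hornerM Hp Hq.
Qed.

Lemma deriv_pevp V X p : dmx V = V *m cmx X -> deriv (pevp V p) = pevp V (dop X p).
Proof.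
move=> VX; elim/mpoly_alg_ind: p => [a|j|p q Hp Hq|p q Hp Hq].
- by rewrite pevp_const dop_const derivC rmorph0.
- case: (mxvec_indexP j) => a b; rewrite pevp_var dop_varE.
  have -> : (V a b)^`() = dmx V a b by rewrite mxE.
  rewrite VX !mxE rmorph_sum; apply: eq_bigr => l _.
  by rewrite rmorphM /= ![genmx _ _ _ _]mxE ![cstmx _ _ _]mxE pevp_const pevp_var mxE.
- by rewrite dopD !rmorphD /= derivD Hp Hq.
- by rewrite dopM rmorphD !rmorphM /= derivM Hp Hq.
Qed.

Lemma dmx_pexpl y X : X ^+ n = 0 ->
  dmx (cmx y *m pexp X) = (cmx y *m pexp X) *m cmx X.
Proof.
by move=> Xn; rewrite dmxM dmx_cmx mul0mx add0r dmx_pexp // -mulmxA pexp_comm.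
Qed.

Lemma poly_nat_roots (f : {poly L}) : (forall k : nat, f.[k%:R] = 0) -> f = 0.
Proof.
move=> H; apply/eqP/negPn/negP => f0.
suff : (size [seq k%:R : L | k <- iota 0 (size f)] < size f)%N.
  by rewrite size_map size_iota ltnn.
apply: max_poly_roots => //.
  by apply/allP => _ /mapP[k _ ->]; apply/rootP.
by rewrite map_inj_uniq ?iota_uniq // => a b /eqP; rewrite eqr_nat => /eqP.
Qed.

(** Up to factorials, the coefficients of the polynomial t -> p(y exp(tX)) are the values at [y] of
    the iterated derivatives of [p], and these again belong to the ideal. *)
Lemma dlie_nexp X : X ^+ n = 0 -> dlie X -> forall t y p, vanish p -> GG y ->
  pval idfun p (y *m nexp (t *: X)) = 0.
Proof.
move=> Xn HX t y p Hp Gy.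
have H k : forall q, vanish q -> (pevp (cmx y *m pexp X) q)`_k = 0.
  elim: k => [|k IHk] q Hq.
    rewrite -horner_coef0 horner_pevp emxM emx_cmx emx0_pexp mulmx1.
    by rewrite pevE; apply: Hq.
  have := IHk _ (HX _ Hq); rewrite -(deriv_pevp q (dmx_pexpl y Xn)) coef_deriv => /eqP.
  by rewrite mulrn_eq0 /= => /eqP.
have E : pevp (cmx y *m pexp X) p = 0 by apply/polyP => k; rewrite H // coef0.
rewrite -pevE -emx_pexp -{1}(emx_cmx t y) -emxM -horner_pevp E; exact: horner0.
Qed.

(** All natural powers of exp(X) lie in [GG], so for [p] in the ideal the polynomial t -> p(y
    exp(tX)) has infinitely many roots; its derivative at 0 is therefore 0. *)
Lemma nexp_dlie X : X ^+ n = 0 -> GG (nexp X) -> dlie X.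
Proof.
move=> Xn GX p Hp y Gy.
have GXk (k : nat) : GG (nexp (k%:R *: X)).
  elim: k => [|k IHk]; first by rewrite scale0r nexp0.
  have E a : (a *: X) ^+ n = 0 by rewrite expmxZ Xn scaler0.
  rewrite mulrSr scalerDl scale1r nexpD ?E //; first exact: G_mul.
    by rewrite -{2}[X]scale1r -scalerDl E.
  by rewrite -scalemxAl -scalemxAr.
have E : pevp (cmx y *m pexp X) p = 0.
  apply: poly_nat_roots => k; rewrite horner_pevp emxM emx_cmx emx_pexp pevE.
  by apply: Hp; apply: G_mul.
have := horner_pevp 0 (cmx y *m pexp X) (dop X p).
rewrite -(deriv_pevp p (dmx_pexpl y Xn)) E deriv0 horner0 emxM emx_cmx emx0_pexp mulmx1 pevE => H0.
exact: (esym H0).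
Qed.

End LieAlgebra.

Lemma zeros_vanish (k : fieldType) (i : {rmorphism k -> L}) (P : seq (entry_poly k n)) z :
  (forall p, vanish (zeros i P) p -> pval idfun p z = 0) -> zeros i P z.
Proof.
move=> H p pP; pose q : EP := mpoly.map_mpoly i p.
have qE y : pval idfun q y = pval i p y.
  rewrite -!pevE /q; elim/mpoly_alg_ind: p {pP q} => [a|j|p q Hp Hq|p q Hp Hq].
  - by rewrite mpoly.map_mpolyC !pev_const.
  - by rewrite mpoly.map_mpolyX !pev_var.
  - by rewrite !rmorphD /= Hp Hq.
  - by rewrite !rmorphM /= Hp Hq.
by rewrite -qE; apply: H => y Gy; rewrite qE; apply: Gy.
Qed.

End Derivations.

(** * Weight decomposition of matrices under the torus *)

Section Weights.
Variables (K : rcfType) (L : numFieldType) (i : {rmorphism K -> L}).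
Variables (n d : nat) (c : 'M[K]_n) (W : 'M[int]_(n, d)).
Hypothesis cc : c *m c^T = 1%:M.
Local Notation cL := (map_mx i c).
Implicit Types (X Y : 'M[L]_n) (b : 'rV[int]_d).
Let ccL : cL *m cL^T = 1%:M. Proof. exact: tmat_orth. Qed.
Let ccL' : cL^T *m cL = 1%:M. Proof. exact: mulmx1C ccL. Qed.

(** The character by which conjugation by the torus scales the matrix unit at position [ab] in the
    basis [c]. *)
Definition dwt (ab : 'I_n * 'I_n) : 'rV[int]_d := row ab.1 W - row ab.2 W.

Definition has_weight b X :=
  forall ab, (cL *m X *m cL^T) ab.1 ab.2 != 0 -> dwt ab = b.

Definition wcomp b X : 'M[L]_n :=
  cL^T *m (\matrix_(a, a') (if dwt (a, a') == b then (cL *m X *m cL^T) a a' else 0)) *m cL.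

Lemma conjcK X : cL *m (cL^T *m X *m cL) *m cL^T = X.
Proof. by rewrite !mulmxA ccL mul1mx -mulmxA ccL mulmx1. Qed.

Lemma conjcKV X : cL^T *m (cL *m X *m cL^T) *m cL = X.
Proof. by rewrite !mulmxA ccL' mul1mx -mulmxA ccL' mulmx1. Qed.

Lemma wcomp_weight b X : has_weight b (wcomp b X).
Proof.
move=> [a a'] /=; rewrite conjcK mxE.
by case: (eqVneq (dwt (a, a')) b) => [//|_]; rewrite eqxx.
Qed.

Lemma has_weight0 b : has_weight b 0.
Proof. by move=> ab; rewrite mulmx0 mul0mx mxE eqxx. Qed.

Lemma has_weightD b X Y : has_weight b X -> has_weight b Y -> has_weight b (X + Y).
Proof.
move=> HX HY ab; rewrite mulmxDr mulmxDl mxE => H; have [/eqP X0|/HX//] := boolP ((cL *m X *m cL^T) ab.1 ab.2 == 0).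
by apply: HY; rewrite X0 add0r in H.
Qed.

Lemma has_weightZ b t X : has_weight b X -> has_weight b (t *: X).
Proof.
move=> HX ab; rewrite -scalemxAr -scalemxAl mxE mulf_eq0 negb_or => /andP[_].
exact: HX.
Qed.

Lemma has_weightN b X : has_weight b X -> has_weight b (- X).
Proof. by move=> HX; rewrite -scaleN1r; apply: has_weightZ. Qed.

Lemma has_weightM b b' X Y : has_weight b X -> has_weight b' Y -> has_weight (b + b') (X *m Y).
Proof.
move=> HX HY [a a'] /=.
have -> : cL *m (X *m Y) *m cL^T = (cL *m X *m cL^T) *m (cL *m Y *m cL^T).
  by rewrite !mulmxA -[_ *m cL^T *m cL]mulmxA ccL' mulmx1.
move=> H; suff [l [h1 h2]] : exists l, (cL *m X *m cL^T) a l != 0 /\ (cL *m Y *m cL^T) l a' != 0.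
  by rewrite -(HX (a, l) h1) -(HY (l, a') h2) /dwt /= addrA subrK.
apply: contrapT => HN; move: H; rewrite mxE big1 ?eqxx // => l _.
apply/eqP; rewrite mulf_eq0; apply: contraT; rewrite negb_or => /andP[h1 h2].
by case: HN; exists l.
Qed.

Lemma has_weight_tr b X : has_weight b X -> has_weight (- b) X^T.
Proof.
move=> HX [a a'] /=; have -> : cL *m X^T *m cL^T = (cL *m X *m cL^T)^T.
  by rewrite !trmx_mul trmxK mulmxA.
by rewrite mxE => /(HX (a', a)) <-; rewrite /dwt opprB.
Qed.

(** At a nonzero entry the pairing of the row index with b exceeds that of the column index by the
    positive number b . b, so ranking the indices by this pairing makes the matrix strictly
    triangular. *)
Lemma has_weight_nilpotent b X : b != 0 -> has_weight b X -> X ^+ n = 0.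
Proof.
move=> b0 HX; pose lam a : int := (row a W *m b^T) 0 0.
have bb : 0 < (b *m b^T) 0 0.
  rewrite lt_def; apply/andP; split.
    apply: contra_neq b0 => /eqP; rewrite mxE psumr_eq0 => [/allP H|j _]; last by rewrite mxE -expr2 sqr_ge0.
    by apply/rowP => j; have := H j (mem_index_enum j); rewrite !mxE mulf_eq0 orbb => /eqP.
  by rewrite mxE sumr_ge0 // => j _; rewrite mxE -expr2 sqr_ge0.
pose r a := #|[pred a' | lam a' < lam a]|.
have rn a : (r a < n)%N.
  have := cardC [pred a' | lam a' < lam a]; rewrite card_ord => <-.
  rewrite -addn1 leq_add2l; apply/card_gt0P; exists a.
  by rewrite !inE /= ltxx.
have Yn : (cL *m X *m cL^T) ^+ n = 0.
  apply: (ranked_nilpotent rn) => a a' /(HX (a, a')) E.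
  have lt : lam a' < lam a.
    rewrite -subr_gt0; move: bb; rewrite -{1}E mulmxBl mxE [X in _ + X]mxE.
    by [].
  apply: proper_card; apply/properP; split.
    by apply/fintype.subsetP => l; rewrite !inE => /lt_trans; apply.
  by exists a'; rewrite !inE ?ltxx.
have cu : cL \in unitmx by case: (mulmx1_unit ccL).
have cV : cL^T = invmx cL by rewrite -[LHS]mul1mx -(mulVmx cu) -mulmxA ccL mulmx1.
have := expmx_conj X n cu; rewrite -cV Yn => E.
by rewrite -(conjcKV (X ^+ n)) -E mulmx0 mul0mx.
Qed.

Lemma weight_torus b X : has_weight b X -> forall x, nz x ->
  tmat c i (tw W x) *m X = mon x b *: (X *m tmat c i (tw W x)).
Proof.
move=> HX x nzx.
have E : cL *m (tmat c i (tw W x) *m X) *m cL^T =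
    cL *m (mon x b *: (X *m tmat c i (tw W x))) *m cL^T.
  rewrite -scalemxAr -scalemxAl tmatE.
  have -> : cL *m (cL^T *m diag_mx (tw W x) *m cL *m X) *m cL^T =
      diag_mx (tw W x) *m (cL *m X *m cL^T) by rewrite !mulmxA ccL mul1mx.
  have -> : cL *m (X *m (cL^T *m diag_mx (tw W x) *m cL)) *m cL^T =
      (cL *m X *m cL^T) *m diag_mx (tw W x).
    by rewrite -!mulmxA ccL mulmx1 !mulmxA.
  apply/matrixP => a a'; rewrite mul_diag_mx mul_mx_diag [LHS]mxE [RHS]mxE.
  rewrite [X in _ = _ * X]mxE !twE.
  have [->|H] := eqVneq ((cL *m X *m cL^T) a a') 0.
    by rewrite ?(mulr0, mul0r).
  rewrite -(HX (a, a') H) /dwt /= (monB _ _ nzx).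
  by rewrite mulrCA divfK ?mon_neq0 // mulrC.
by rewrite -(conjcKV (_ *m X)) E conjcKV.
Qed.

Definition wts : seq 'rV[int]_d := undup [seq dwt ab | ab <- enum [set: 'I_n * 'I_n]%SET].

Lemma sum_wcomp X : \sum_(b <- wts) wcomp b X = X.
Proof.
rewrite -mulmx_suml -mulmx_sumr -[RHS]conjcKV; congr (_ *m _ *m _).
apply/matrixP => a a'; rewrite summxE (bigD1_seq (dwt (a, a'))) ?undup_uniq //=; last first.
  by rewrite mem_undup map_f // mem_enum inE.
rewrite mxE eqxx big1_seq ?addr0 // => b /andP[bne _].
by rewrite mxE eq_sym (negPf bne).
Qed.

Variable GG : set 'M[L]_n.
Hypothesis G_one : GG 1%:M.
Hypothesis G_mul : forall g h, GG g -> GG h -> GG (g *m h).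
Hypothesis G_unit : forall g, GG g -> g \in unitmx.
Hypothesis G_inv : forall g, GG g -> GG (invmx g).
Hypothesis G_torus : forall x : 'rV[K]_d, pos_row x -> GG (tmat c i (tw W (map_mx i x))).

(** Conjugating [X] by positive torus points over [K] and applying the derivation to [p] at [y]
    gives a vanishing combination of characters; independence isolates each weight. *)
Lemma dlie_wcomp b X : dlie GG X -> dlie GG (wcomp b X).
Proof.
move=> HX p Hp y Gy.
pose E (ab : 'I_n * 'I_n) : 'M[L]_n := cL^T *m delta_mx ab.1 ab.2 *m cL.
pose ell (Z : 'M[L]_n) : L := pev (idfun : {rmorphism L -> L}) y (dop Z p).
have ellD Z Z' : ell (Z + Z') = ell Z + ell Z' by exact: pev_dopDl.
have ellZ a Z : ell (a *: Z) = a * ell Z by exact: pev_dopZl.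
have ell0 : ell 0 = 0 by rewrite -(scale0r (0 : 'M[L]_n)) ellZ mul0r.
have ellE (M : 'M[L]_n) : ell (cL^T *m M *m cL) = \sum_ab M ab.1 ab.2 * ell (E ab).
  rewrite {1}(matrix_sum_delta M) pair_bigA /= mulmx_sumr mulmx_suml.
  rewrite (big_morph ell ellD ell0); apply: eq_bigr => ab _.
  by rewrite -scalemxAr -scalemxAl ellZ.
pose Y := cL *m X *m cL^T.
have H (x : 'rV[K]_d) : pos_row x -> \sum_ab Y ab.1 ab.2 * ell (E ab) * i (mon x (dwt ab)) = 0.
  move=> x0; have Gx := G_torus x0.
  set t := tmat c i _ in Gx; have := dlie_Ad G_mul G_unit G_inv (G_inv Gx) HX.
  rewrite invmxK => /dlieP -/(_ p y Hp Gy) h; rewrite -[RHS]h.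
  have nzx : nz (map_mx i x) by move=> j; rewrite mxE fmorph_eq0 gt_eqF.
  have nzt := tw_nz W nzx.
  rewrite -[RHS]/(ell _) /t (tmatV cc i nzt) -(conjcKV (_ *m _ *m _)) ellE; apply: eq_bigr => -[a a'] _ /=.
  rewrite mulrAC; congr (_ * _).
  have -> : cL *m (tmat c i (tw W (map_mx i x)) *m X *m
      tmat c i (\row_l (tw W (map_mx i x) 0 l)^-1)) *m cL^T =
      diag_mx (tw W (map_mx i x)) *m Y *m diag_mx (\row_l (tw W (map_mx i x) 0 l)^-1).
    rewrite !tmatE /Y !mulmxA ccL mul1mx -!mulmxA ccL mulmx1 !mulmxA.
    by [].
  rewrite mul_mx_diag mul_diag_mx [RHS]mxE [X in _ = X * _]mxE [X in _ = _ * X]mxE !twE.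
  rewrite !mon_map /dwt /= (monB _ _ (gt0_nz x0)) rmorphM fmorphV.
  by rewrite mulrCA mulrA.
pose T := {t : 'rV[K]_d | pos_row t}.
pose op (x z : T) : T := exist _ _ (pos_hmul (svalP x) (svalP z)).
have := @characters_independent_key T op L _ (index_enum ('I_n * 'I_n)%type) _ dwt
  (fun e x => i (mon (sval x) e)) (fun ab => Y ab.1 ab.2 * ell (E ab)).
move=> /(_ _ _ _ _ b) IND; rewrite -pevE -[LHS]/(ell _) ellE -[RHS]IND.
- rewrite [RHS]big_mkcond; apply: eq_bigr => -[a a'] _ /=; rewrite mxE.
  by case: ifP => // _; rewrite mul0r.
- by move=> e x z; rewrite /= mon_hmul rmorphM.
- by move=> e; exists (exist _ _ (@pos1 K d)); rewrite /= mon_const1 rmorph1 oner_eq0.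
- move=> e f _ _ Eef; apply: (@mon_inj K) => t t0.
  by have := congr1 (fun u => u (exist _ t t0)) Eef => /= /fmorph_inj.
- by move=> [x x0]; apply: H.
Qed.

End Weights.

(** * The matrix exponential *)

Section MatrixExponential.
Variables (R : realType) (n : nat).
Implicit Types (M N X Z : 'M[R]_n).

Lemma cvg_big_sum (I : Type) (s : seq I) (f : I -> R^nat) (l : I -> R) :
  (forall j, f j @ \oo --> l j) -> (fun k => \sum_(j <- s) f j k) @ \oo --> \sum_(j <- s) l j.
Proof.
move=> H; elim: s => [|j s IHs].
  by rewrite big_nil; under eq_fun do rewrite big_nil; apply: cvg_cst.
by rewrite big_cons; under eq_fun do rewrite big_cons; apply: cvgD.
Qed.

Section FixedMatrix.
Variable X : 'M[R]_n.
Let Bd : R := 1 + \sum_a \sum_b `|X a b|.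

Let Bd0 : 0 <= Bd.
Proof. by rewrite addr_ge0 // sumr_ge0 // => a _; rewrite sumr_ge0. Qed.

Let row_bound a : \sum_b `|X a b| <= Bd.
Proof.
rewrite /Bd [X in _ <= _ + X](bigD1 a) //= addrCA lerDl addr_ge0 // sumr_ge0 // => a' _.
by rewrite sumr_ge0.
Qed.

Lemma pow_bound k a b : `|(X ^+ k) a b| <= Bd ^+ k.
Proof.
elim: k a b => [|k IHk] a b.
  by rewrite !expr0 -[(1 : 'M[R]_n)]/(1%:M) mxE; case: (eqVneq a b); rewrite ?normr1 ?normr0.
rewrite !exprS -mulmxE mxE (le_trans (ler_norm_sum _ _ _)) //.
apply: (@le_trans _ _ (\sum_l `|X a l| * Bd ^+ k)).
  by apply: ler_sum => l _; rewrite normrM ler_wpM2l.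
by rewrite -mulr_suml ler_wpM2r ?exprn_ge0.
Qed.

Let cst M N a b : R := \sum_l (\sum_l' `|M a l'|) * `|N l b|.

Let cst0 M N a b : 0 <= cst M N a b.
Proof. by rewrite sumr_ge0 // => l _; rewrite mulr_ge0 // sumr_ge0. Qed.

Let pow_bound2 M N a b k : `|(M *m X ^+ k *m N) a b| <= cst M N a b * Bd ^+ k.
Proof.
rewrite mxE (le_trans (ler_norm_sum _ _ _)) // /cst mulr_suml; apply: ler_sum => l _.
rewrite normrM mulrAC ler_wpM2r // mxE (le_trans (ler_norm_sum _ _ _)) //.
rewrite mulr_suml; apply: ler_sum => l' _; rewrite normrM ler_wpM2l //; exact: pow_bound.
Qed.

(** The outer factors [M] and [N] make the class of series stable under derivation, multiplication
    and change of basis. *)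
Definition mexp_coeff M N a b : R^nat := fun k => (M *m X ^+ k *m N) a b / k`!%:R.

Let coeff_bound M N a b s k :
  `|mexp_coeff M N a b k * s ^+ k| <= cst M N a b * exp_coeff (Bd * `|s|) k.
Proof.
rewrite /mexp_coeff /exp_coeff /= !normrM normfV normrX [`|k`!%:R|]ger0_norm //.
by rewrite exprMn !mulrA mulrAC ler_wpM2r ?invr_ge0 // ler_wpM2r ?exprn_ge0 // pow_bound2.
Qed.

Let cvg_cst_exp M N a b (s : R) :
  cvgn (series (fun k => cst M N a b * exp_coeff (Bd * `|s|) k)).
Proof.
have E : series (fun k => cst M N a b * exp_coeff (Bd * `|s|) k) =
    (fun m => cst M N a b * series (exp_coeff (Bd * `|s|)) m).
  by apply/funext => m; rewrite /series /= mulr_sumr.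
by rewrite E; apply: is_cvgMr; apply: is_cvg_series_exp_coeff.
Qed.

Lemma mexp_coeff_ncvg M N a b s :
  cvgn [normed series (fun k => mexp_coeff M N a b k * s ^+ k)].
Proof.
apply: (@series_le_cvg R (fun k => `|mexp_coeff M N a b k * s ^+ k|)
  (fun k => cst M N a b * exp_coeff (Bd * `|s|) k)); last exact: cvg_cst_exp.
- by move=> k; apply: normr_ge0.
- by move=> k; rewrite mulr_ge0 // exp_coeff_ge0 // mulr_ge0.
- by move=> k; apply: coeff_bound.
Qed.

Lemma mexp_coeff_cvg M N a b s : cvgn (pseries (mexp_coeff M N a b) s).
Proof. by apply: normed_cvg; apply: mexp_coeff_ncvg. Qed.

Lemma mexpE s a b : mexp (s *: X) a b = limn (pseries (mexp_coeff 1%:M 1%:M a b) s).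
Proof.
rewrite mxE /pseries; congr (limn _); congr (series _); apply/funext => k.
have -> : ((s *: X) ^+ k) a b = s ^+ k * (X ^+ k) a b by rewrite expmxZ mxE.
by rewrite /= /mexp_coeff mul1mx mulmx1 -mulrA [LHS]mulrC.
Qed.

Lemma mexp_mulE M N s a b :
  (M *m mexp (s *: X) *m N) a b = limn (pseries (mexp_coeff M N a b) s).
Proof.
apply/esym/cvg_lim => //.
have -> : pseries (mexp_coeff M N a b) s = (fun k => \sum_l
    (\sum_l' M a l' * pseries (mexp_coeff 1%:M 1%:M l' l) s k) * N l b).
  apply/funext => k; rewrite /pseries /series /=.
  under [RHS]eq_bigr do (under eq_bigr do rewrite mulr_sumr; rewrite exchange_big /= mulr_suml).
  rewrite exchange_big /=; apply: eq_bigr => m _.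
  rewrite /mexp_coeff mxE !mulr_suml; apply: eq_bigr => l _.
  rewrite [(M *m _) _ _]mxE !mulr_suml; apply: eq_bigr => l' _.
  by rewrite mul1mx mulmx1; ring.
rewrite mxE; apply: cvg_big_sum => l; apply: cvgMl; rewrite mxE.
apply: cvg_big_sum => l'; apply: cvgMr; rewrite mexpE.
exact: mexp_coeff_cvg.
Qed.

Lemma is_derive_mexp M N s a b :
  is_derive s (1 : R) (fun t => (M *m mexp (t *: X) *m N) a b)
    ((M *m X *m mexp (s *: X) *m N) a b).
Proof.
have dE M' : pseries_diffs (mexp_coeff M' N a b) = mexp_coeff (M' *m X) N a b.
  apply/funext => k; rewrite /pseries_diffs /mexp_coeff exprS -mulmxE !mulmxA.
  by rewrite mulrCA; congr (_ * _); rewrite factS natrM invfM mulrA mulfV ?mul1r ?pnatr_eq0.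
rewrite mexp_mulE -dE.
have -> : (fun t => (M *m mexp (t *: X) *m N) a b) =
    (fun t => limn (pseries (mexp_coeff M N a b) t)).
  by apply/funext => t; rewrite mexp_mulE.
apply: (@pseries_snd_diffs _ _ (`|s| + 1)); rewrite ?dE; try exact: mexp_coeff_cvg.
by rewrite [ltRHS]ger0_norm ?addr_ge0 // ltrDl.
Qed.

Lemma mexp_comm s : X *m mexp (s *: X) = mexp (s *: X) *m X.
Proof.
apply/matrixP => a b; have := mexp_mulE X 1%:M s a b; rewrite mulmx1 => ->.
have := mexp_mulE 1%:M X s a b; rewrite mul1mx => ->; congr (limn (pseries _ _)).
apply/funext => k; rewrite /mexp_coeff mulmx1 mul1mx -[X *m _]/(X * _) -exprS exprSr.
by [].
Qed.

Lemma mexp_entry_bound S a b : exists2 M, 0 <= M &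
  forall s, `|s| <= S -> `|mexp (s *: X) a b| <= M.
Proof.
pose u (s : R) : R^nat := fun k => cst 1%:M 1%:M a b * exp_coeff (Bd * `|s|) k.
exists (limn (series (u S))).
  apply: limr_ge; first exact: cvg_cst_exp.
  by apply: nearW => k; apply: sumr_ge0 => j _; rewrite /u mulr_ge0 // exp_coeff_ge0 // mulr_ge0.
move=> s sS; rewrite mexpE (le_trans (lim_series_norm (@mexp_coeff_ncvg 1%:M 1%:M a b s))) //.
apply: lim_series_le; [exact: mexp_coeff_ncvg|exact: cvg_cst_exp|move=> k].
rewrite (le_trans (coeff_bound _ _ _ _ _ _)) // /u ler_wpM2l // /exp_coeff /=.
rewrite ler_wpM2r ?invr_ge0 // lerXn2r ?nnegrE ?mulr_ge0 ?ler_wpM2l //.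
by rewrite (le_trans sS) // ler_norm.
Qed.

End FixedMatrix.

Lemma mexp0 : mexp (0 : 'M[R]_n) = 1%:M.
Proof.
apply/matrixP => a b; rewrite mxE.
apply/cvg_lim => //; apply: cvg_near_cst; exists 1%N => //= m /= m0; rewrite /series /= -(prednK m0) big_nat_recl //=.
rewrite big1 ?addr0 => [|k _]; first by rewrite expr0 fact0 divr1.
by rewrite expmx0n // mxE mul0r.
Qed.

Lemma mexp_nilpotent X : X ^+ n = 0 -> mexp X = nexp X.
Proof.
move=> Xn; apply/matrixP => a b; rewrite mxE summxE.
apply/cvg_lim => //; apply: cvg_near_cst; exists n => //= m /= nm; rewrite /series /=.
rewrite (big_cat_nat (leq0n n) nm) //= big_mkord [X in _ + X]big_nat_cond.
rewrite [X in _ + X]big1 ?addr0 => [|k /andP[/andP[nk _] _]]; last first.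
  by rewrite -(subnK nk) exprD Xn mulr0 mxE mul0r.
by apply: eq_bigr => k _; rewrite mxE mulrC.
Qed.

Lemma mexp_diag (c : 'M[R]_n) (xi : 'rV[R]_n) : c *m c^T = 1%:M ->
  mexp (c^T *m diag_mx xi *m c) = c^T *m diag_mx (\row_a expR (xi 0 a)) *m c.
Proof.
move=> cc; apply/matrixP => a b; rewrite mxE; apply/cvg_lim => //.
have pw k : (c^T *m diag_mx xi *m c) ^+ k = c^T *m diag_mx (\row_a xi 0 a ^+ k) *m c.
  elim: k => [|k IHk].
    have -> : diag_mx (\row_a xi 0 a ^+ 0) = 1%:M.
      by apply/matrixP => l l'; rewrite !mxE.
    by rewrite mulmx1 (mulmx1C cc).
  rewrite exprS IHk -mulmxE -!mulmxA (mulmxA c) cc mul1mx; congr (_ *m _).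
  rewrite !mulmxA; congr (_ *m _); apply/matrixP => l l'; rewrite mul_diag_mx !mxE.
  by rewrite mulrnAr exprS.
have -> : series (fun k => ((c^T *m diag_mx xi *m c) ^+ k) a b / k`!%:R) =
    (fun m => \sum_l (c l a * series (exp_coeff (xi 0 l)) m) * c l b).
  apply/funext => m; rewrite /series /=.
  under [RHS]eq_bigr do rewrite mulr_sumr mulr_suml.
  rewrite exchange_big /=; apply: eq_bigr => k _; rewrite pw mul_mx_diag mxE mulr_suml.
  apply: eq_bigr => l _; rewrite !mxE /exp_coeff /=; ring.
rewrite mul_mx_diag mxE; apply: cvg_big_sum => l; apply: cvgMl; rewrite !mxE; apply: cvgMr.
exact: is_cvg_series_exp_coeff.
Qed.

(** The product has derivative 0 by skew symmetry. *)
Lemma mexp_skew_orth Z s : Z^T = - Z -> mexp (s *: Z) *m (mexp (s *: Z))^T = 1%:M.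
Proof.
move=> ZT; apply/matrixP => a b.
pose f t := (mexp (t *: Z) *m (mexp (t *: Z))^T) a b.
suff : f s = f 0 by rewrite /f scale0r mexp0 trmx1 mulmx1.
apply: is_derive_0_is_cst => {}s; rewrite /f.
have -> : (fun t => (mexp (t *: Z) *m (mexp (t *: Z))^T) a b) =
    \sum_l ((fun t => (1%:M *m mexp (t *: Z) *m 1%:M) a l) *
            (fun t => (1%:M *m mexp (t *: Z) *m 1%:M) b l)).
  apply/funext => t; rewrite fct_sumE mxE; apply: eq_bigr => l _.
  rewrite -[RHS]/((1%:M *m mexp (t *: Z) *m 1%:M) a l * (1%:M *m mexp (t *: Z) *m 1%:M) b l).
  by rewrite mul1mx mulmx1 [(_^T) _ _]mxE.
apply: (@is_derive_eq _ _ _ _ _ _ _ _ (is_derive_sum (fun l => is_deriveM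
  (is_derive_mexp Z 1%:M 1%:M s a l) (is_derive_mexp Z 1%:M 1%:M s b l)))).
rewrite !mul1mx !mulmx1; set M := mexp _; rewrite mexp_comm -/M.
transitivity ((M *m (M *m Z)^T + M *m Z *m M^T) a b).
  rewrite mxE [X in _ = X + _]mxE [X in _ = _ + X]mxE -big_split; apply: eq_bigr => l _ /=.
  by rewrite ![(_^T) _ _]mxE /GRing.scale /=; congr (_ + _); rewrite mulrC.
by rewrite trmx_mul ZT mulmxA mulmxN mulNmx addNr mxE.
Qed.

End MatrixExponential.

(** * One-parameter subgroups and the algebraic Lie algebra over the reals *)

Section LieOfGroup.
Opaque pev dop pcomp.
Variables (R : realType) (n : nat).
Local Notation EP := (entry_poly R n).
Local Notation pv y p := (pev (idfun : {rmorphism R -> R}) y p).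
Implicit Types (X y : 'M[R]_n) (p q : EP).

Lemma is_derive_congr (f g : R -> R) (s d d' : R) : f =1 g ->
  is_derive s 1 g d -> d = d' -> is_derive s 1 f d'.
Proof. by move=> /funext -> H <-. Qed.

Lemma leibniz_comm (a b c d : R) : a * d + b * c = c * b + a * d.
Proof. by rewrite addrC [b * c]mulrC. Qed.

Lemma is_derive_pev X y p s :
  is_derive s (1 : R) (fun t => pv (y *m mexp (t *: X)) p)
    (pv (y *m mexp (s *: X)) (dop X p)).
Proof.
elim/mpoly_alg_ind: p => [a|j|p q Hp Hq|p q Hp Hq].
- apply: (is_derive_congr (g := cst a) _ (is_derive_cst _ _ _)) => [t|].
    exact: pev_const.
  exact/esym/pev_dop_const.
- case: (mxvec_indexP j) => a b.
  apply: (is_derive_congr _ (is_derive_mexp X y 1%:M s a b)) => [t|].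
    by rewrite mulmx1; exact: (etrans (pev_var _ _ _) (mxvecE _ _ _)).
  rewrite mulmx1 -[_ *m X *m _]mulmxA mexp_comm mulmxA; exact/esym/pev_dop_var.
- apply: (is_derive_congr _ (is_deriveD Hp Hq)) => [t|]; first exact: rmorphD.
  exact/esym/pev_dopD.
- apply: (is_derive_congr _ (is_deriveM Hp Hq)) => [t|]; first exact: rmorphM.
  exact: (etrans (leibniz_comm _ _ _ _) (esym (pev_dopM _ _ _ _))).
Qed.

Variable GG : set 'M[R]_n.
Hypothesis G_one : GG 1%:M.

Lemma lie_dlie X : (forall y t, GG y -> GG (y *m mexp (t *: X))) -> dlie GG X.
Proof.
move=> HX p Hp y Gy; rewrite -pevE.
have E : (fun t => pv (y *m mexp (t *: X)) p) = cst 0.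
  by apply/funext => t; rewrite pevE; apply: Hp; apply: HX.
have := is_derive_pev X y p 0; rewrite E scale0r mexp0 mulmx1 => D.
by rewrite -(@derive_val _ _ _ _ _ _ _ D) derive_cst.
Qed.

(** Geometric growth of all iterated derivatives on [D], a quantitative form of analyticity. *)
Let geo X (D : set 'M[R]_n) C B p :=
  forall k z, D z -> `|pv z (iter k (dop X) p)| <= C * B ^+ k.

Let geoS X D C B p : geo X D C B p -> geo X D (C * B) B (dop X p).
Proof. by move=> H k z Dz; rewrite -iterSr -mulrA -exprS; apply: H. Qed.

Let iter_dopD X k p q : iter k (dop X) (p + q) = iter k (dop X) p + iter k (dop X) q.
Proof. by elim: k => //= k ->; rewrite dopD. Qed.

(** By the Leibniz rule the constants multiply and the ratios add, as in the binomial formula. *)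
Let geoM X D k : forall C B C' B' p q, 0 <= C -> 0 <= C' -> 0 <= B -> 0 <= B' ->
  geo X D C B p -> geo X D C' B' q ->
  forall z, D z -> `|pv z (iter k (dop X) (p * q))| <= C * C' * (B + B') ^+ k.
Proof.
elim: k => [|k IHk] C B C' B' p q C0 C'0 B0 B'0 Hp Hq z Dz.
  rewrite /= expr0 mulr1 rmorphM normrM; apply: ler_pM => //.
    by have := Hp 0%N z Dz; rewrite expr0 mulr1.
  by have := Hq 0%N z Dz; rewrite expr0 mulr1.
rewrite iterSr dopM iter_dopD rmorphD (le_trans (ler_normD _ _)) //.
have -> : C * C' * (B + B') ^+ k.+1 =
    (C * B) * C' * (B + B') ^+ k + C * (C' * B') * (B + B') ^+ k.
  by rewrite exprS; ring.
apply: lerD; apply: IHk => //; try exact: mulr_ge0.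
  exact: geoS.
exact: geoS.
Qed.

Let geo_exists X M p : exists CB : R * R, [/\ 0 <= CB.1, 0 <= CB.2 &
  geo X [set z | forall a b, `|z a b| <= M] CB.1 CB.2 p].
Proof.
elim/mpoly_alg_ind: p => [x|j|p q [[C B] /= [C0 B0 Hp]] [[C' B'] /= [C'0 B'0 Hq]]|
  p q [[C B] /= [C0 B0 Hp]] [[C' B'] /= [C'0 B'0 Hq]]].
- exists (`|x|, 1); split=> /= [||k z _]; [exact: normr_ge0|exact: ler01|rewrite expr1n mulr1].
  case: k => [|k]; first by rewrite /= pev_const.
  rewrite iterSr dop_const.
  have -> : iter k (dop X) 0 = 0 by elim: k => //= k ->; rewrite dop0.
  by rewrite rmorph0 normr0.
- case: (mxvec_indexP j) => a b.
  pose B := 1 + \sum_l \sum_l' `|X l l'|; pose C := \sum_(l < n) `|M|.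
  have C0 : 0 <= C by rewrite sumr_ge0.
  have B0 : 0 <= B by rewrite addr_ge0 // sumr_ge0 // => l _; rewrite sumr_ge0.
  exists (C, B); split=> //= k z Dz.
  have -> : pv z (iter k (dop X) (mX R (mxvec_index a b))) = (z *m X ^+ k) a b.
    have H m (Y : 'M[R]_n) : pv z (iter m (dop X) ((genmx R n *m constmx n Y) a b)) =
        (z *m (X ^+ m *m Y)) a b.
      elim: m Y => [|m IHm] Y; first by rewrite /= pev_genC expr0 mul1mx.
      by rewrite iterSr (dop_genC X Y) IHm exprSr -mulmxE !mulmxA.
    case: k => [|k]; first by rewrite /= pev_var mxvecE expr0 mulmx1.
    by rewrite iterSr dop_varE H exprSr -mulmxE.
  rewrite mxE (le_trans (ler_norm_sum _ _ _)) // mulr_suml; apply: ler_sum => l _.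
  rewrite normrM; apply: ler_pM => //; first by rewrite (le_trans (Dz a l)) // ler_norm.
  exact: pow_bound.
- exists (C + C', B + B'); split=> /=; rewrite ?addr_ge0 // => k z Dz.
  rewrite iter_dopD rmorphD (le_trans (ler_normD _ _)) // mulrDl; apply: lerD.
    rewrite (le_trans (Hp k z Dz)) // ler_wpM2l // lerXn2r ?nnegrE ?addr_ge0 //.
    by rewrite lerDl.
  rewrite (le_trans (Hq k z Dz)) // ler_wpM2l // lerXn2r ?nnegrE ?addr_ge0 //.
  by rewrite lerDr.
- exists (C * C', B + B'); split=> /=; rewrite ?addr_ge0 ?mulr_ge0 // => k z Dz.
  exact: (@geoM X _ k C B C' B' p q C0 C'0 B0 B'0 Hp Hq z Dz).
Qed.

Let geometric_zero (a C x : R) : 0 <= a -> 0 <= C -> 0 <= x <= 2^-1 ->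
  (forall k, a <= C * x ^+ k) -> a = 0.
Proof.
move=> a0 C0 /andP[x0 x1] H; apply/eqP; rewrite eq_le a0 andbT leNgt; apply/negP => a1.
have Hk (k : nat) : a * k%:R <= C.
  have : a * 2 ^+ k <= C.
    rewrite -ler_pdivlMr ?exprn_gt0 // -exprVn (le_trans (H k)) // ler_wpM2l //.
    by rewrite lerXn2r ?nnegrE ?invr_ge0.
  apply: le_trans; rewrite ler_wpM2l // -natrX ler_nat.
  by apply: ltnW; apply: ltn_expl.
have := Hk (Num.bound (C / a)); rewrite -ler_pdivlMl // mulrC leNgt => /negP; apply.
by apply: archi_boundP; rewrite mulr_ge0 ?invr_ge0 // ltW.
Qed.

Lemma norm_step (a b d h M : R) :
  b = 0 -> a - b = d * h -> 0 <= h -> `|d| <= M -> `|a| <= M * h.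
Proof. by move=> ->; rewrite subr0 => -> h0 dM; rewrite normrM (ger0_norm h0) ler_wpM2r. Qed.

(** Let f(s) = p(y exp(sX)). If all derivatives of f vanish at s1, the mean value theorem used k
    times bounds f(s) by C (B (s - s1))^k for every k. So f vanishes on an interval of fixed length
    after s1, and finitely many such intervals reach [t]. *)
Lemma dlie_mexp_pos X : dlie GG X -> forall y p, GG y -> vanish GG p ->
  forall t, 0 <= t -> pv (y *m mexp (t *: X)) p = 0.
Proof.
move=> HX y p Gy Hp t t0.
have [M HM] : exists M, forall s, `|s| <= t -> forall a b, `|(y *m mexp (s *: X)) a b| <= M.
  have /choice[f Hf] (ab : 'I_n * 'I_n) : exists Mab, 0 <= Mab /\ forall s, `|s| <= t ->
      `|mexp (s *: X) ab.1 ab.2| <= Mab.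
    by have [Mab ? ?] := mexp_entry_bound X t ab.1 ab.2; exists Mab.
  exists (\sum_a \sum_b \sum_l `|y a l| * f (l, b)) => s st a b.
  have nn a' b' : 0 <= \sum_l `|y a' l| * f (l, b').
    by apply: sumr_ge0 => l _; rewrite mulr_ge0 //; case: (Hf (l, b')).
  rewrite (bigD1 a) //= (bigD1 b) //= -addrA ler_wpDr //.
    by rewrite addr_ge0 ?sumr_ge0 // => a' _; rewrite sumr_ge0.
  rewrite mxE (le_trans (ler_norm_sum _ _ _)) //; apply: ler_sum => l _.
  by rewrite normrM ler_wpM2l //; case: (Hf (l, b)) => _; apply.
have [[C B] /= [C0 B0 Hgeo]] := geo_exists X M p.
(* Keeps B (s - s1) at most 1/2 on each step; adding 1 avoids a zero denominator. *)
pose s0 := (2 * (B + 1))^-1.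
have B1 : 0 < B + 1 by rewrite ltr_wpDl.
have s00 : 0 < s0 by rewrite invr_gt0 mulr_gt0.
have Dmem s : 0 <= s <= t -> forall a b, `|(y *m mexp (s *: X)) a b| <= M.
  by move=> /andP[s1 s2]; apply: HM; rewrite ger0_norm.
have vD q : vanish GG q -> vanish GG (dop X q) by move=> Hq; apply: HX.
have step s1 : 0 <= s1 -> (forall j, pv (y *m mexp (s1 *: X)) (iter j (dop X) p) = 0) ->
    forall s, s1 <= s <= s1 + s0 -> s <= t ->
    forall j, pv (y *m mexp (s *: X)) (iter j (dop X) p) = 0.
  move=> s10 Hs1.
  have est k : forall j s, s1 <= s <= s1 + s0 -> s <= t ->
      `|pv (y *m mexp (s *: X)) (iter j (dop X) p)| <= C * B ^+ j * (B * (s - s1)) ^+ k.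
    elim: k => [|k IHk] j s /andP[s1s ss0] st.
      rewrite expr0 mulr1; apply: Hgeo; apply: Dmem.
      by rewrite st (le_trans s10 s1s).
    have [||u /[!in_itv] /= /andP[s1u us]] := @MVT_segment R
      (fun t => pv (y *m mexp (t *: X)) (iter j (dop X) p))
      (fun t => pv (y *m mexp (t *: X)) (iter j.+1 (dop X) p)) s1 s s1s.
    - by move=> x _; apply: is_derive_pev.
    - apply: derivable_within_continuous => x _.
      by have := is_derive_pev X y (iter j (dop X) p) x; case.
    move=> MVTs.
    have hu : `|pv (y *m mexp (u *: X)) (iter j.+1 (dop X) p)| <=
        C * B ^+ j.+1 * (B * (s - s1)) ^+ k.
      apply: (le_trans (IHk j.+1 u _ _)).
      - by rewrite s1u (le_trans us ss0).
      - exact: le_trans us st.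
      rewrite ler_wpM2l ?mulr_ge0 ?exprn_ge0 // lerXn2r ?nnegrE ?mulr_ge0 ?subr_ge0 //.
      by rewrite ler_wpM2l // lerD2r.
    have ss1 : 0 <= s - s1 by rewrite subr_ge0.
    apply: (le_trans (norm_step (Hs1 j) MVTs ss1 hu)).
    by rewrite !exprS; set x := _ ^+ k; set z := B ^+ j; rewrite le_eqVlt; apply/orP; left; apply/eqP; ring.
  move=> s /andP[s1s ss0] st j; apply/eqP; rewrite -normr_eq0; apply/eqP.
  apply: (@geometric_zero _ (C * B ^+ j) (B * (s - s1))) => //.
  - by rewrite mulr_ge0 ?exprn_ge0.
  - rewrite mulr_ge0 ?subr_ge0 //=.
    have h1 : s - s1 <= s0 by rewrite lerBlDl.
    apply: (le_trans (ler_wpM2l B0 h1)).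
    rewrite /s0 invfM mulrCA -[leRHS]mulr1 ler_wpM2l ?invr_ge0 //.
    by rewrite ler_pdivrMr // mul1r lerDl.
  by move=> k; apply: est; rewrite ?s1s.
have all m : forall s, 0 <= s <= m%:R * s0 -> s <= t ->
    forall j, pv (y *m mexp (s *: X)) (iter j (dop X) p) = 0.
  elim: m => [|m IHm] s /andP[sp sm] st j.
    have -> : s = 0 by apply/eqP; rewrite eq_le sp andbT; rewrite mul0r in sm.
    rewrite scale0r mexp0 mulmx1 pevE.
    have : vanish GG (iter j (dop X) p) by elim: j => //= j; apply: vD.
    exact.
  have [sm'|sm'] := leP s (m%:R * s0); first by apply: IHm => //; rewrite sp.
  apply: (step (m%:R * s0)) => //.
  - by rewrite mulr_ge0 // ltW.
  - move=> j'; apply: IHm; first by rewrite lexx andbT mulr_ge0 // ltW.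
    exact: le_trans (ltW sm') st.
  - by rewrite (ltW sm') /= -[X in _ + X]mul1r -mulrDl natr1.
have := all (Num.bound (t / s0)) t _ (lexx _) 0%N; apply; rewrite t0 /=.
by rewrite -ler_pdivrMr // ltW // archi_boundP // divr_ge0 // ltW.
Qed.

Lemma dlie_mexp X : dlie GG X -> forall y p t, GG y -> vanish GG p ->
  pval idfun p (y *m mexp (t *: X)) = 0.
Proof.
move=> HX y p t Gy Hp; rewrite -pevE; have [t0|t0] := leP 0 t.
  exact: (dlie_mexp_pos HX).
rewrite -[t]opprK scaleNr -scalerN; apply: (dlie_mexp_pos (dlieN HX) Gy Hp).
by rewrite oppr_ge0 ltW.
Qed.

End LieOfGroup.

(** * Rank one *)

Section Sl2.
Variables (L : rcfType) (n : nat) (X h : 'M[L]_n) (cL : 'M[L]_n) (eta : 'rV[L]_n).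
Hypothesis cc : cL *m cL^T = 1%:M.
Hypothesis Xn : X ^+ n = 0.
Hypothesis XXt : X *m X^T - X^T *m X = h.
Hypothesis hX : h *m X - X *m h = 2 *: X.
Hypothesis hE : h = cL^T *m diag_mx eta *m cL.

Let Y := X^T.
Let Yn : Y ^+ n = 0. Proof. by rewrite /Y -expmx_tr Xn trmx0. Qed.
Let hT : h^T = h.
Proof. by rewrite -XXt linearB /= !trmx_mul trmxK. Qed.
Let hY : h *m Y - Y *m h = (-2) *: Y.
Proof.
rewrite /Y -{1 2}hT -!trmx_mul -linearB /= -opprB hX linearN /= linearZ /= scaleNr.
by [].
Qed.

Lemma nexp_scale_n t : (t *: X) ^+ n = 0 /\ (t *: Y) ^+ n = 0.
Proof. by rewrite !expmxZ Xn Yn !scaler0. Qed.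

(** The usual representative of the reflection in the group of the triple (X, h, X^T). *)
Definition wmat t := nexp (t *: X) *m nexp ((- t^-1) *: Y) *m nexp (t *: X).

Let eX t : nexp (t *: X) *m X = X *m nexp (t *: X).
Proof. by apply: nexp_comm; rewrite -scalemxAr -scalemxAl. Qed.

Let fY t : nexp (t *: Y) *m Y = Y *m nexp (t *: Y).
Proof. by apply: nexp_comm; rewrite -scalemxAr -scalemxAl. Qed.

Let Xh : X *m h - h *m X = (-2) *: X.
Proof. by rewrite -opprB hX scaleNr. Qed.

Let Yh : Y *m h - h *m Y = 2 *: Y.
Proof. by rewrite -opprB hY scaleNr opprK. Qed.

Let half2 (t : L) : t ^+ 2 / 2 * (-2) = - t ^+ 2.
Proof. by rewrite mulrN divfK // pnatr_eq0. Qed.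

Let ZZ (a : L) (Z : 'M[L]_n) : Z *m (a *: Z) - (a *: Z) *m Z = 0.
Proof. by rewrite -scalemxAr -scalemxAl subrr. Qed.

Let eh t : nexp (t *: X) *m h = (h - (2 * t) *: X) *m nexp (t *: X).
Proof.
rewrite (nexp_Ad t Xn Xh (ZZ _ _)) ?mulmx0 ?mul0mx // scaler0 addr0 scalerA mulrN mulrC.
by rewrite scaleNr.
Qed.

Let fh t : nexp (t *: Y) *m h = (h + (2 * t) *: Y) *m nexp (t *: Y).
Proof.
by rewrite (nexp_Ad t Yn Yh (ZZ _ _)) ?mulmx0 ?mul0mx // scaler0 addr0 scalerA mulrC.
Qed.

Let eY t : nexp (t *: X) *m Y = (Y + t *: h - t ^+ 2 *: X) *m nexp (t *: X).
Proof.
rewrite (nexp_Ad t Xn XXt Xh) ?scalerA ?half2 ?scaleNr //.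
by rewrite mulmxN mulNmx -scalemxAr -scalemxAl.
Qed.

Let fX t : nexp (t *: Y) *m X = (X - t *: h - t ^+ 2 *: Y) *m nexp (t *: Y).
Proof.
have Z1 : Y *m X - X *m Y = - h by rewrite -XXt opprB.
have Z2 : Y *m (- h) - (- h) *m Y = (-2) *: Y.
  by rewrite mulmxN mulNmx opprK addrC hY.
rewrite (nexp_Ad t Yn Z1 Z2) ?scalerA ?half2 ?scaleNr ?scalerN //.
by rewrite mulmxN mulNmx -scalemxAr -scalemxAl.
Qed.

Section FixedT.
Variable t : L.
Hypothesis t0 : t != 0.
Let s := t^-1.
Let ts : t * s = 1. Proof. exact: mulfV. Qed.
Let e := nexp (t *: X).
Let f := nexp ((- s) *: Y).

Let fX' : f *m X = (X + s *: h - s ^+ 2 *: Y) *m f.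
Proof. by rewrite /f fX scaleNr opprK sqrrN. Qed.
Let fh' : f *m h = (h - (2 * s) *: Y) *m f.
Proof. by rewrite /f fh mulrN scaleNr. Qed.

Lemma wmat_h : wmat t *m h = - (h *m wmat t).
Proof.
rewrite /wmat -/e -/s -/f -!mulmxA eh -/e [f *m _]mulmxA mulmxBr -scalemxAr fh' fX'.
rewrite scalemxAl -mulmxBl.
have -> : h - (2 * s) *: Y - (2 * t) *: (X + s *: h - s ^+ 2 *: Y) = - h - (2 * t) *: X.
  rewrite !scalerBr !scalerDr !scalerA -[2 * t * s]mulrA ts mulr1.
  have -> : 2 * t * s ^+ 2 = 2 * s by rewrite expr2 mulrA -[2 * t * s]mulrA ts mulr1.
  by rewrite scaler_nat mulr2n; apply/matrixP => a b; rewrite !mxE; ring.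
have eH : e *m (- h - (2 * t) *: X) = - (h *m e).
  rewrite mulmxBr mulmxN -scalemxAr /e eh eX mulmxBl opprB -scalemxAl.
  by rewrite addrAC subrr add0r.
by rewrite -[_ *m f *m e]mulmxA [LHS]mulmxA eH mulNmx -!mulmxA.
Qed.

Lemma wmat_X : wmat t *m X = (- t ^- 2) *: (Y *m wmat t).
Proof.
rewrite /wmat -/e -/s -/f -!mulmxA eX -/e [f *m _]mulmxA fX' !mulmxA scalemxAl scalemxAl.
congr (_ *m _ *m _); rewrite mulmxBr mulmxDr -!scalemxAr eX eh eY -/e !scalemxAl -mulmxDl -mulmxBl.
congr (_ *m _); move: Y => Y'; apply/matrixP => a b; rewrite !mxE /s; by field.
Qed.

Lemma wmat_Y : wmat t *m Y = (- t ^+ 2) *: (X *m wmat t).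
Proof.
rewrite /wmat -/e -/s -/f -!mulmxA eY -/e [f *m _]mulmxA mulmxBr mulmxDr -!scalemxAr.
rewrite fY fh' fX' -/f !scalemxAl -mulmxDl -mulmxBl.
have -> : Y + t *: (h - (2 * s) *: Y) - t ^+ 2 *: (X + s *: h - s ^+ 2 *: Y) = (- t ^+ 2) *: X.
  rewrite !scalerBr !scalerDr !scalerA [t * _]mulrCA ts mulr1 -exprMn ts expr1n scale1r.
  have -> : t ^+ 2 * s = t by rewrite expr2 -mulrA ts mulr1.
  by rewrite scaleNr scaler_nat; apply/matrixP => a b; rewrite !mxE; ring.
have eA : e *m ((- t ^+ 2) *: X) = ((- t ^+ 2) *: X) *m e.
  by rewrite -scalemxAr -scalemxAl eX.
by rewrite -[_ *m f *m e]mulmxA [LHS]mulmxA eA -!mulmxA.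
Qed.

End FixedT.

Lemma wmat_unit t : wmat t \in unitmx.
Proof.
have [h1 h2] := nexp_scale_n t; have [_ h3] := nexp_scale_n (- t^-1).
by rewrite !unitmx_mul !nexp_unit.
Qed.

(** Conjugation by w sends X to -Y and -Y to X, so w is also exp(-Y) exp(X) exp(-Y). Since Y is X^T,
    the product of w and its transpose telescopes. *)
Lemma wmat1_orth : wmat 1 *m (wmat 1)^T = 1%:M.
Proof.
pose w := wmat 1; have wu : w \in unitmx := wmat_unit 1.
have wX : w *m X *m invmx w = - Y.
  by rewrite wmat_X ?oner_eq0 // expr1n invr1 scaleN1r mulNmx mulmxK.
have wY : w *m (- Y) *m invmx w = X.
  by rewrite mulmxN wmat_Y ?oner_eq0 // expr1n scaleN1r opprK mulmxK.
have Ew : w = nexp X *m nexp (- Y) *m nexp X.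
  by rewrite /w /wmat scale1r invr1 scaleN1r.
have E : w = nexp (- Y) *m nexp X *m nexp (- Y).
  have e1 : w *m nexp X = nexp (- Y) *m w by rewrite -wX -nexp_conj // mulmxKV.
  have e2 : w *m nexp (- Y) = nexp X *m w by rewrite -[in RHS]wY -nexp_conj // mulmxKV.
  have H : nexp (- Y) *m nexp X *m nexp (- Y) *m w = w *m w.
    rewrite -[LHS]mulmxA -e1 [LHS]mulmxA -[_ *m nexp X *m w]mulmxA -e2.
    by rewrite [_ *m (w *m _)]mulmxA -e1 -!(mulmxA w) -Ew.
  by rewrite -[LHS](mulmxK wu) -H mulmxK.
rewrite -/w {1}E /w /wmat scale1r invr1 scaleN1r !trmx_mul !nexp_tr linearN /= trmxK.
have XV := nexpV Xn; have YV := nexpV Yn.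
have NX : nexp X *m nexp (- X) = 1%:M := XV.
have NY : nexp (- Y) *m nexp Y = 1%:M by rewrite (mulmx1C YV).
rewrite -/Y !mulmxA -[_ *m nexp (- Y) *m nexp Y]mulmxA NY mulmx1.
by rewrite -[_ *m nexp X *m nexp (- X)]mulmxA NX mulmx1.
Qed.

(* [x^n] times [wmat x], a polynomial in [x]. *)
Let rterm k : 'M[{poly L}]_n := ((-1) ^+ k / k`!%:R *: 'X^(n - k)) *: cmx (Y ^+ k).
Let rexp : 'M[{poly L}]_n := \sum_(k < n) rterm k.
Let pw := pexp X *m rexp *m pexp X.

Let emx_rexp t : t != 0 -> emx t rexp = t ^+ n *: nexp ((- t^-1) *: Y).
Proof.
move=> t0; rewrite /emx raddf_sum scaler_sumr; apply: eq_bigr => k _.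
rewrite -[LHS]/(emx t _) emxZ emx_cmx expmxZ !scalerA hornerZ hornerXn; congr (_ *: _).
have -> : t ^+ n = t ^+ (n - k) * t ^+ k by rewrite -exprD subnK // ltnW.
have tk : t ^+ k != 0 by rewrite expf_neq0.
rewrite -[- t^-1]mulN1r exprMn exprVn.
move: tk (k`!%:R^-1 : L) => tk fk; by field.
Qed.

Let dmx_rexp : 'X^2 *: dmx rexp = (n%:R *: 'X) *: rexp + cmx Y *m rexp.
Proof.
have rE : rexp = \sum_(k < n.+1) rterm k.
  by rewrite big_ord_recr /= /rterm Yn /cmx map_mx0 scaler0 addr0.
have dr k : (k <= n)%N -> 'X^2 *: dmx (rterm k) =
    (n%:R *: 'X) *: rterm k - (k%:R *: 'X) *: rterm k.
  move=> kn; rewrite /rterm dmxZ dmx_cmx scaler0 addr0 !scalerA -scalerBl; congr (_ *: _).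
  rewrite -[in n%:R](subnK kn); move: (n - k)%N (_ / _) => m a.
  rewrite derivZ derivXn -!mul_polyC natrD rmorphD /= !rmorph_nat.
  case: m => [|m]; first by rewrite mulr0n mulr0 mulr0 add0r subrr.
  by rewrite /= -mulr_natr (exprS _ m); move: ('X^m) => q; ring.
have nr k : (k < n)%N -> - ((k.+1%:R *: 'X) *: rterm k.+1) = cmx Y *m rterm k.
  move=> kn; rewrite /rterm -scalemxAr (exprS Y) -mulmxE cmxM -scaleNr scalerA.
  congr (_ *: _); rewrite -!mul_polyC -(subnSK kn) (exprS _ (n - k.+1)).
  have AB : (-1) ^+ k / k`!%:R = - (k.+1%:R * ((-1) ^+ k.+1 / (k.+1)`!%:R)) :> L.
    rewrite exprS factS natrM invfM; move: ((-1) ^+ k) (k`!%:R^-1) => y z.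
    by rewrite mulN1r mulNr mulrN opprK [RHS]mulrCA mulVKf ?pnatr_eq0.
  by rewrite AB polyCN polyCM; move: ('X^ _) => q; ring.
rewrite {1 2}rE; have -> : dmx (\sum_(k < n.+1) rterm k) = \sum_(k < n.+1) dmx (rterm k).
  by rewrite /dmx raddf_sum.
rewrite !scaler_sumr (eq_bigr (fun k : 'I_n.+1 => (n%:R *: 'X) *: rterm k -
  (k%:R *: 'X) *: rterm k)); last by move=> k _; apply: dr; rewrite -ltnS.
rewrite sumrB; congr (_ + _); rewrite big_ord_recl /= scale0r scale0r add0r -sumrN.
by rewrite mulmx_sumr; apply: eq_bigr => k _; rewrite nr.
Qed.

Let emx_pw t : t != 0 -> emx t pw = t ^+ n *: wmat t.
Proof.
move=> t0; rewrite !emxM emx_rexp // !emx_pexp -scalemxAr -scalemxAl.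
by rewrite /wmat.
Qed.

Let pw_ode t : t != 0 -> t ^+ 2 *: emx t (dmx pw) = t *: (n%:R *: emx t pw + h *m emx t pw).
Proof.
move=> t0; rewrite (emx_pw t0); set e := nexp (t *: X); set f := nexp ((- t^-1) *: Y).
have dr : t ^+ 2 *: emx t (dmx rexp) = t ^+ n *: ((n%:R * t) *: f + Y *m f).
  have := congr1 (emx t) dmx_rexp; rewrite emxZ hornerXn => ->.
  rewrite emxD emxZ emxM emx_cmx emx_rexp // hornerZ hornerX -scalemxAr scalerDr.
  by rewrite !scalerA [t ^+ n * _]mulrC.
pose w := wmat t; have wE : w = e *m f *m e by [].
have T1 : X *m e *m (t ^+ n *: f) *m e = t ^+ n *: (X *m w).
  by rewrite wE -scalemxAr -scalemxAl !mulmxA.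
have T2 : t ^+ 2 *: (e *m emx t (dmx rexp) *m e) =
    t ^+ n *: ((n%:R * t) *: w + (Y + t *: h - t ^+ 2 *: X) *m w).
  rewrite scalemxAl scalemxAr dr -scalemxAr -scalemxAl mulmxDr mulmxDl -scalemxAr -scalemxAl.
  by rewrite [e *m (Y *m f)]mulmxA /e eY -/e wE !mulmxA.
have T3 : t ^+ 2 *: (e *m (t ^+ n *: f) *m (X *m e)) = - (t ^+ n *: (Y *m w)).
  rewrite -eX -/e -scalemxAr -scalemxAl mulmxA -wE (wmat_X t0) -/w !scalerA.
  by rewrite -scaleNr; congr (_ *: _); move: (t ^+ n) => q; field.
rewrite /pw !dmxM !dmx_pexp // !emxD !emxM !emxD !emxM !emx_pexp !emx_cmx emx_rexp // -/e -/f.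
rewrite mulmxDl !scalerDr T1 T2 T3 mulmxBl mulmxDl -!scalemxAl -scalemxAr.
move: (Y *m w) (X *m w) (h *m w) => u1 u2 u3.
by apply/matrixP => a b; rewrite !mxE; ring.
Qed.

Let v (a b : 'I_n) : {poly L} := (cmx cL *m pw *m cmx cL^T) a b.

Let v_horner t a b : t != 0 -> (v a b).[t] = t ^+ n * (cL *m wmat t *m cL^T) a b.
Proof.
move=> t0; have -> : (v a b).[t] = emx t (cmx cL *m pw *m cmx cL^T) a b by rewrite [RHS]mxE.
rewrite (emxM t (cmx cL *m pw)) (emxM t (cmx cL)) !emx_cmx (emx_pw t0).
by rewrite -scalemxAr -scalemxAl mxE.
Qed.

Let v_ode a b t : t != 0 -> t ^+ 2 * ((v a b)^`()).[t] = t * ((n%:R + eta 0 a) * (v a b).[t]).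
Proof.
move=> t0; pose V := cmx cL *m pw *m cmx cL^T.
have -> : ((v a b)^`()).[t] = emx t (dmx V) a b by rewrite [RHS]mxE [X in horner_eval _ X]mxE.
have -> : (v a b).[t] = emx t V a b by rewrite [RHS]mxE.
rewrite /V (dmxM (cmx cL *m pw)) (dmxM (cmx cL)) !dmx_cmx mul0mx add0r mulmx0 addr0.
rewrite (emxM t (cmx cL *m dmx pw)) (emxM t (cmx cL) (dmx pw)).
rewrite (emxM t (cmx cL *m pw)) (emxM t (cmx cL) pw) !emx_cmx.
have -> : t ^+ 2 * (cL *m emx t (dmx pw) *m cL^T) a b =
    (cL *m (t ^+ 2 *: emx t (dmx pw)) *m cL^T) a b by rewrite -scalemxAr -scalemxAl [RHS]mxE.
rewrite (pw_ode t0) -scalemxAr -scalemxAl mulmxDr mulmxDl -scalemxAr -scalemxAl.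
have -> : cL *m (h *m emx t pw) *m cL^T = diag_mx eta *m (cL *m emx t pw *m cL^T).
  by rewrite hE !mulmxA cc mul1mx.
by rewrite mul_diag_mx; move: (cL *m _ *m _) => U; rewrite !mxE; ring.
Qed.

(** The equation t v' = (n + eta) v admits a single degree; the factor t^n in [pw] has cleared the
    negative powers. *)
Let v_monomial a b k : (v a b)`_k != 0 -> k%:R = n%:R + eta 0 a.
Proof.
move=> vk; pose g : {poly L} := 'X^2 * (v a b)^`() - (n%:R + eta 0 a) *: ('X * v a b).
have g0 : g = 0.
  apply: poly_nat_roots => m; rewrite /g hornerD hornerN hornerZ (hornerM 'X^2) hornerXn (hornerM 'X) hornerX.
  case: m => [|m]; first by rewrite expr0n !mul0r mulr0 subrr.
  have m0 : (m.+1%:R : L) != 0 by rewrite pnatr_eq0.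
  by rewrite (v_ode a b m0) mulrCA subrr.
have := congr1 (fun p : {poly L} => p`_k.+1) g0.
rewrite /g coefB coefZ coefXM /= coefXnM coef0.
case: k vk => [|k] vk /=.
  by rewrite sub0r => /eqP; rewrite oppr_eq0 mulf_eq0 (negPf vk) orbF => /eqP->.
rewrite subn2 /= coef_deriv -[_ *+ k.+1]mulr_natl => /eqP; rewrite subr_eq0 => /eqP H.
exact: (mulIf vk H).
Qed.

(* The entries of [wmat] are Laurent polynomials that solve [t w' = h w]. *)
Lemma wmat_torus : exists2 kk : 'I_n -> int, (forall a, eta 0 a = (kk a)%:~R) &
  forall t, t != 0 -> wmat t = cL^T *m diag_mx (\row_a t ^ kk a) *m cL *m wmat 1.
Proof.
have cu : cL \in unitmx by case: (mulmx1_unit cc).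
have cTu : cL^T \in unitmx by rewrite unitmx_tr.
have Uu : cL *m wmat 1 *m cL^T \in unitmx by rewrite unitmx_mul unitmx_mul cu (wmat_unit 1).
(* No row of an invertible matrix vanishes, so in each row some entry has a nonzero monomial, whose
   degree shows that [eta 0 a] is an integer. *)
have /choice[k Hk] a : exists k : nat, k%:R = n%:R + eta 0 a.
  apply: contrapT => HN; suff Z : row a (cL *m wmat 1 *m cL^T) = 0.
    have : (delta_mx 0 a : 'rV[L]_n) *m (cL *m wmat 1 *m cL^T) *m invmx (cL *m wmat 1 *m cL^T) = 0.
      by rewrite -rowE Z mul0mx.
    rewrite mulmxK // => /matrixP/(_ 0 a); rewrite !mxE !eqxx => /eqP.
    by rewrite oner_eq0.
  apply/rowP => b; rewrite [LHS]mxE [RHS]mxE.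
  have := v_horner a b (oner_neq0 L); rewrite expr1n mul1r => <-.
  have -> : v a b = 0; last by rewrite horner0.
  apply/polyP => m; rewrite coef0; apply/eqP; apply: contraT => /v_monomial H.
  by case: HN; exists m.
exists (fun a => (k a)%:Z - n%:Z) => [a|t t0].
  by rewrite rmorphB /= -!pmulrn Hk addrAC subrr add0r.
have E : cL *m wmat t *m cL^T = diag_mx (\row_a t ^ ((k a)%:Z - n%:Z)) *m (cL *m wmat 1 *m cL^T).
  apply/matrixP => a b; rewrite mul_diag_mx [RHS]mxE [X in _ = X * _]mxE.
  have := v_horner a b (oner_neq0 L); rewrite expr1n mul1r => <-.
  have -> : (cL *m wmat t *m cL^T) a b = (v a b).[t] / t ^+ n.
    by rewrite v_horner // mulrAC mulfV ?mul1r // expf_neq0.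
  have -> : v a b = (v a b)`_(k a) *: 'X^(k a).
    apply/polyP => m; rewrite coefZ coefXn; case: eqVneq => [->|mk]; first by rewrite mulr1.
    rewrite mulr0; apply/eqP; apply: contraT => /v_monomial; rewrite -Hk => /eqP.
    by rewrite eqr_nat (negPf mk).
  by rewrite !hornerZ !hornerXn expr1n mulr1 expfzDr // -exprnN -exprnP [RHS]mulrC mulrA.
have -> : wmat t = cL^T *m (cL *m wmat t *m cL^T) *m cL.
  by rewrite !mulmxA (mulmx1C cc) mul1mx -mulmxA (mulmx1C cc) mulmx1.
rewrite E !mulmxA -[_ *m cL^T *m cL]mulmxA (mulmx1C cc) mulmx1.
by [].
Qed.

End Sl2.

Lemma nexp_conjV (L : rcfType) n (g X : 'M[L]_n) : g \in unitmx ->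
  nexp X *m g = g *m nexp (invmx g *m X *m invmx (invmx g)).
Proof. by move=> gu; rewrite -nexp_conj ?unitmx_inv // invmxK !mulmxA mulmxV // mul1mx. Qed.

Lemma conj_eq0 (L : fieldType) n (g Z : 'M[L]_n) : g \in unitmx ->
  g *m Z *m invmx g = 0 -> Z = 0.
Proof.
move=> gu /(congr1 (fun M => invmx g *m M *m g)).
by rewrite !mulmxA mulVmx // mul1mx -mulmxA mulVmx // mulmx1 mulmx0 mul0mx.
Qed.

(** * The group generated by two opposite root groups *)

Section RankOneGroup.
Variables (K L : rcfType) (i : {rmorphism K -> L}) (n d : nat).
Variables (c : 'M[K]_n) (W : 'M[int]_(n, d)) (B : 'M[int]_(d, n)).
Hypothesis D : torus_data c W B.
Local Notation cL := (map_mx i c).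
(** Locked, so that associativity rewriting does not reach the factors of the torus element. *)
Definition torus (x : 'rV[L]_d) : 'M[L]_n := locked (tmat c i (tw W x)).
Local Notation T := torus.
Let cc : c *m c^T = 1%:M. Proof. by case: D. Qed.
Let ccL : cL *m cL^T = 1%:M. Proof. exact: tmat_orth. Qed.

Lemma torusE x : T x = tmat c i (tw W x).
Proof. by rewrite /torus -lock. Qed.

Lemma torus_unit x : nz x -> T x \in unitmx.
Proof. by move=> nzx; rewrite torusE; apply: (tmat_unit cc i (tw_nz W nzx)). Qed.

Lemma torus_has_weight b X x : has_weight i c W b X -> nz x ->
  T x *m X = mon x b *: (X *m T x).
Proof. by move=> HX nzx; rewrite torusE; apply: (weight_torus cc HX nzx). Qed.

Lemma torus_weight b (X : 'M[L]_n) :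
  (forall x : 'rV[L]_d, pos_row x -> T x *m X = mon x b *: (X *m T x)) -> has_weight i c W b X.
Proof.
move=> H [a a'] /= ne0; apply: (@mon_inj L) => x x0.
have E : cL *m (T x *m X) *m cL^T = diag_mx (tw W x) *m (cL *m X *m cL^T).
  by rewrite torusE tmatE !mulmxA ccL mul1mx.
have E' : cL *m (X *m T x) *m cL^T = (cL *m X *m cL^T) *m diag_mx (tw W x).
  by rewrite torusE tmatE -!mulmxA ccL mulmx1 !mulmxA.
have := congr1 (fun M => (cL *m M *m cL^T) a a') (H x x0).
rewrite E -scalemxAr -scalemxAl E' mul_diag_mx mul_mx_diag [LHS]mxE [RHS]mxE.
rewrite [X in _ = _ * X]mxE !twE mulrCA mulrC => /(mulfI ne0) Ex.
by rewrite /dwt /= (monB _ _ (gt0_nz x0)) Ex mulfK // mon_neq0 //; apply: gt0_nz.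
Qed.

Variables (b : 'rV[int]_d) (nu : 'cV[int]_d).
Hypothesis bnu : (b *m nu) 0 0 = 2.

Lemma b_neq0 : b != 0.
Proof. by apply/eqP => b0; move: bnu; rewrite b0 mul0mx mxE. Qed.

(** The coroot [nu], normalized by [bnu], as a one-parameter subgroup of the torus. *)
Definition tpow (t : L) : 'rV[L]_d := \row_j t ^ nu j 0.
Definition av (t : L) : 'M[L]_n := T (tpow t).
Definition hmat : 'M[L]_n := cL^T *m diag_mx (\row_a ((W *m nu) a 0)%:~R) *m cL.

Lemma mon_tpow t e : t != 0 -> mon (tpow t) e = t ^ ((e *m nu) 0 0).
Proof.
move=> t0; rewrite monE mxE.
rewrite (big_morph (fun z : int => t ^ z) (fun x y => expfzDr x y t0) (expr0z t)).
by apply: eq_bigr => j _; rewrite mxE exprz_exp mulrC.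
Qed.

Lemma tpow_pos t : 0 < t -> pos_row (tpow t).
Proof. by move=> t0 j; rewrite mxE exprz_gt0. Qed.

Lemma mon_tpow_b t : t != 0 -> mon (tpow t) b = t ^+ 2.
Proof. by move=> t0; rewrite mon_tpow // bnu. Qed.

Lemma avE t : t != 0 -> av t = cL^T *m diag_mx (\row_a t ^ ((W *m nu) a 0)) *m cL.
Proof.
move=> t0; rewrite /av torusE tmatE; congr (_ *m diag_mx _ *m _); apply/rowP => a.
rewrite twE [RHS]mxE mon_tpow //; congr (t ^ _).
by rewrite -row_mul [LHS]mxE.
Qed.

Lemma TM x y : T x *m T y = T (hmul x y).
Proof. by rewrite !torusE (tmatM cc) tw_hmul. Qed.

Lemma TC x y : T x *m T y = T y *m T x.
Proof. rewrite !torusE; exact: (tmat_comm cc). Qed.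

Lemma tpowM s t : hmul (tpow s) (tpow t) = tpow (s * t).
Proof. by apply/rowP => j; rewrite hmulE ![tpow _ _ _]mxE expfzMl. Qed.

Lemma avM s t : av s *m av t = av (s * t).
Proof. by rewrite /av TM tpowM. Qed.

Lemma av1 : av 1 = 1%:M.
Proof.
rewrite /av; have -> : tpow 1 = const_mx 1 by apply/rowP => j; rewrite !mxE exp1rz.
by rewrite torusE tw_const1 (tmat1 cc).
Qed.

Lemma avV t : t != 0 -> av t *m av t^-1 = 1%:M.
Proof. by move=> t0; rewrite avM mulfV // av1. Qed.

Lemma av_sym t : (av t)^T = av t.
Proof. rewrite /av torusE; exact: tmat_sym. Qed.

Lemma hmat_weight (X : 'M[L]_n) : has_weight i c W b X -> hmat *m X - X *m hmat = 2 *: X.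
Proof.
move=> HX; pose eta : 'rV[L]_n := \row_a ((W *m nu) a 0)%:~R.
have E : cL *m (hmat *m X - X *m hmat) *m cL^T = cL *m (2 *: X) *m cL^T.
  have E1 : cL *m (hmat *m X) *m cL^T = diag_mx eta *m (cL *m X *m cL^T).
    by rewrite /hmat !mulmxA ccL mul1mx.
  have E2 : cL *m (X *m hmat) *m cL^T = (cL *m X *m cL^T) *m diag_mx eta.
    by rewrite /hmat -!mulmxA ccL mulmx1 !mulmxA.
  rewrite mulmxBr mulmxBl E1 E2 -scalemxAr -scalemxAl.
  apply/matrixP => a a'; have := HX (a, a') => /=; move: (cL *m X *m cL^T) => Y HY.
  rewrite mul_diag_mx mul_mx_diag !mxE.
  have [->|Y0] := eqVneq (Y a a') 0; first by rewrite !(mulr0, mul0r) subrr.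
  rewrite [X in _ - X]mulrC -mulrBl; congr (_ * _); rewrite -rmorphB /=.
  have -> : \sum_j W a j * nu j 0 - \sum_j W a' j * nu j 0 = (b *m nu) 0 0.
    rewrite -(HY Y0) /dwt /= mulmxBl [RHS]mxE [X in _ = _ + X]mxE -!row_mul.
    by rewrite !mxE.
  by rewrite bnu.
by rewrite -(conjcKV i cc (_ - _)) E (conjcKV i cc).
Qed.

Variables (G : set 'M[L]_n) (gV : set 'M[L]_n) (qq : 'M[L]_n -> L).
Hypothesis G_one : G 1%:M.
Hypothesis G_mul : forall g h, G g -> G h -> G (g *m h).
Hypothesis G_unit : forall g, G g -> g \in unitmx.
Hypothesis G_inv : forall g, G g -> G (invmx g).
Hypothesis G_tr : forall g, G g -> G g^T.
Hypothesis G_torus : forall x : 'rV[L]_d, nz x -> G (T x).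
Hypothesis gV_weight : forall X, gV X -> has_weight i c W b X.
Hypothesis gVD : forall X Y, gV X -> gV Y -> gV (X + Y).
Hypothesis gVZ : forall t X, gV X -> gV (t *: X).
Hypothesis gV_comm : forall X Y, gV X -> gV Y -> X *m Y = Y *m X.
Hypothesis gV_G : forall X, gV X -> G (nexp X).
Hypothesis gV_Ad : forall g X, G g -> gV X \/ gV X^T ->
  has_weight i c W b (g *m X *m invmx g) -> gV (g *m X *m invmx g).
Hypothesis gV_AdT : forall g X, G g -> gV X \/ gV X^T ->
  has_weight i c W (- b) (g *m X *m invmx g) -> gV (g *m X *m invmx g)^T.
Hypothesis qq_pos : forall X, gV X -> X != 0 -> 0 < qq X.
Hypothesis qqZ : forall t X, qq (t *: X) = t ^+ 2 * qq X.
Hypothesis gV_bracket : forall X, gV X -> X *m X^T - X^T *m X = qq X *: hmat.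

Lemma gV_nil X : gV X -> X ^+ n = 0.
Proof. by move=> gX; apply: (has_weight_nilpotent cc b_neq0 (gV_weight gX)). Qed.

Lemma gV_nilT X : gV X -> X^T ^+ n = 0.
Proof. by move=> gX; rewrite -expmx_tr gV_nil // trmx0. Qed.

Lemma gV0 X : gV X -> gV 0.
Proof. by move=> gX; rewrite -(scale0r X); apply: gVZ. Qed.

Lemma gVN X : gV X -> gV (- X).
Proof. by move=> gX; rewrite -scaleN1r; apply: gVZ. Qed.

Lemma nexp_gVD X Y : gV X -> gV Y -> nexp (X + Y) = nexp X *m nexp Y.
Proof.
by move=> gX gY; rewrite nexpD ?gV_nil //; [exact: gVD|exact: gV_comm].
Qed.

Lemma nexp_gVDT X Y : gV X -> gV Y -> nexp (X + Y)^T = nexp X^T *m nexp Y^T.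
Proof.
by move=> gX gY; rewrite -!nexp_tr addrC nexp_gVD // trmx_mul.
Qed.

Lemma gV_GT X : gV X -> G (nexp X^T).
Proof. by move=> gX; rewrite -nexp_tr; apply/G_tr/gV_G. Qed.

(** Elements that normalize the torus: [e] tells whether [m] acts on it by the reflection or
    trivially, and [t] records the factor a(t) of [m] modulo orthogonal matrices. The reflection
    multiplies [T x] by the coroot element at the inverse root value. *)
Definition refl (e : bool) (t : L) (m : 'M[L]_n) :=
  [/\ G m, 0 < t, m *m m^T = av (t ^+ 2) & forall x, pos_row x ->
    m *m T x = T x *m (if e then av (mon x b)^-1 else 1%:M) *m m].

Lemma mon_pos (x : 'rV[L]_d) e : pos_row x -> 0 < mon x e.
Proof. exact: mon_gt0. Qed.

Definition flip (e : bool) (x : 'rV[L]_d) := if e then hmul x (tpow (mon x b)^-1) else x.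

Lemma flip_pos e x : pos_row x -> pos_row (flip e x).
Proof.
by case: e => // x0; apply: pos_hmul => //; apply: tpow_pos; rewrite invr_gt0 mon_pos.
Qed.

Lemma mon_flip e x : pos_row x -> mon (flip e x) b = if e then (mon x b)^-1 else mon x b.
Proof.
case: e => // x0; have m0 := mon_pos b x0.
rewrite mon_hmul mon_tpow_b ?invr_eq0 ?gt_eqF // expr2 mulrA mulfV ?gt_eqF // mul1r.
by [].
Qed.

Lemma refl_T e t m x : refl e t m -> pos_row x -> m *m T x = T (flip e x) *m m.
Proof.
move=> [_ _ _ H] x0; rewrite H //; case: e {H} => /=; last by rewrite mulmx1.
by rewrite /av TM.
Qed.

Lemma flipK e x : pos_row x -> flip e (flip e x) = x.
Proof.
case: e => // x0; have m0 := mon_pos b x0; rewrite {1}/flip mon_flip //= invrK; apply/rowP => j; rewrite !hmulE ![tpow _ _ _]mxE -mulrA -expfzMl mulVf ?gt_eqF //.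
by rewrite exp1rz mulr1.
Qed.

Lemma refl_T' e t m x : refl e t m -> pos_row x -> T x *m m = m *m T (flip e x).
Proof. by move=> Hm x0; rewrite (refl_T Hm (flip_pos e x0)) flipK. Qed.

Lemma refl_unit e t m : refl e t m -> m \in unitmx.
Proof. by case=> /G_unit. Qed.

Definition tflip (e : bool) (t : L) : L := if e then t^-1 else t.

Lemma flip_tpow e t : 0 < t -> flip e (tpow (t ^+ 2)) = tpow (tflip e t ^+ 2).
Proof.
case: e => // t0; have tn : t != 0 by rewrite gt_eqF.
rewrite /flip mon_tpow_b ?expf_neq0 // tpowM /tflip; congr (tpow _).
by field.
Qed.

(** Moving a(t) across a reflecting element inverts it, which is the role of [tflip]. *)
Lemma refl_mul e s m e' t m' : refl e s m -> refl e' t m' ->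
  refl (e (+) e') (s * tflip e t) (m *m m').
Proof.
move=> Hm Hm'; case: (Hm) => [Gm s0 mm _]; case: (Hm') => [Gm' t0 mm' _]; split.
- exact: G_mul.
- by rewrite mulr_gt0 //; case: e {Hm} => //=; rewrite invr_gt0.
- rewrite trmx_mul -!mulmxA [m' *m _]mulmxA mm' [m *m _]mulmxA.
  rewrite /av (refl_T Hm (tpow_pos _)) ?exprn_gt0 // flip_tpow // -!mulmxA mm TM tpowM.
  by rewrite exprMn mulrC.
- move=> x x0; rewrite -mulmxA (refl_T Hm') // mulmxA (refl_T Hm (flip_pos _ x0)).
  rewrite -mulmxA; congr (_ *m _).
  case: e Hm; case: e' Hm' => Hm' Hm /=; rewrite ?mulmx1 //; last by rewrite /av TM.
    by have := flipK true x0; rewrite /= => ->.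
  by rewrite /av TM.
Qed.

Lemma refl1 : refl false 1 1%:M.
Proof. by split=> //; [rewrite expr1n av1 mul1mx trmx1|move=> x _; rewrite mul1mx !mulmx1]. Qed.

Lemma refl_inv e t m : refl e t m -> refl e (tflip (~~ e) t) (invmx m).
Proof.
move=> Hm; case: (Hm) => [Gm t0 mm _]; have mu := G_unit Gm.
have t'0 : 0 < tflip (~~ e) t by case: e {Hm} => //=; rewrite invr_gt0.
split=> //; first exact: G_inv.
- have mtm : m^T *m m = av (tflip e t ^+ 2).
    have : m *m (m^T *m m) = m *m av (tflip e t ^+ 2).
      rewrite mulmxA mm /av (refl_T' Hm) ?flip_tpow //.
      by apply: tpow_pos; rewrite exprn_gt0.
    by move=> /(congr1 (mulmx (invmx m))); rewrite !mulKmx.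
  have H1 : invmx m *m (invmx m)^T *m (m^T *m m) = 1%:M.
    rewrite mulmxA -[_ *m _ *m m^T]mulmxA -trmx_mul mulmxV // trmx1 mulmx1.
    by rewrite mulVmx.
  have sn0 : tflip e t ^+ 2 != 0.
    by rewrite expf_neq0 //; case: e {Hm mtm H1 t'0}; rewrite /= ?invr_eq0 gt_eqF.
  rewrite mtm in H1; rewrite -[LHS]mulmx1 -(avV sn0) mulmxA H1 mul1mx; congr av.
  by case: e {Hm mtm H1 sn0 t'0} => /=; rewrite -exprVn ?invrK.
- move=> x x0; have := refl_T' Hm x0.
  move=> /(congr1 (fun M => invmx m *m M *m invmx m)).
  rewrite !mulmxA mulVmx // mul1mx -!mulmxA mulmxV // mulmx1 => ->.
  case: e Hm t'0 => /= Hm t'0; rewrite ?mul1mx //.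
  by rewrite !mulmxA /av TM.
Qed.

Lemma refl_weight e t m (s : bool) (X : 'M[L]_n) : refl e t m ->
  has_weight i c W (if s then - b else b) X ->
  has_weight i c W (if e (+) s then - b else b) (m *m X *m invmx m).
Proof.
move=> Hm HX; apply: torus_weight => x x0; have mu := refl_unit Hm.
have mT : T (flip e x) *m invmx m = invmx m *m T x.
  have := refl_T' Hm x0 => /(congr1 (fun M => invmx m *m M *m invmx m)).
  by rewrite !mulmxA mulVmx // mul1mx -!mulmxA mulmxV // mulmx1.
rewrite 2!mulmxA (refl_T' Hm x0) -[m *m _ *m X]mulmxA.
rewrite (torus_has_weight HX (gt0_nz (flip_pos e x0))) -scalemxAr -scalemxAl.
rewrite -!mulmxA mT; congr (_ *: _).
case: e {mT} Hm => Hm; case: s {HX}; rewrite ?monN ?(mon_flip true x0) ?invrK //.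
Qed.

Lemma refl_conj e t m (s : bool) X : refl e t m -> gV (if s then X^T else X) ->
  gV (if e (+) s then (m *m X *m invmx m)^T else m *m X *m invmx m).
Proof.
move=> Hm gX; have HX : has_weight i c W (if s then - b else b) X.
  case: s gX => gX; last exact: gV_weight.
  by rewrite -[X]trmxK; apply/has_weight_tr/gV_weight.
have := refl_weight Hm HX; have gX' : gV X \/ gV X^T by case: s gX {HX}; [right|left].
have Gm : G m by case: Hm.
by case: (e (+) s) => H; [apply: gV_AdT|apply: gV_Ad].
Qed.

Lemma T_nexp x X : nz x -> has_weight i c W b X ->
  T x *m nexp X = nexp (mon x b *: X) *m T x.
Proof.
move=> nzx HX; have Tu := torus_unit nzx.
have := nexp_conj X Tu; rewrite (torus_has_weight HX nzx) -scalemxAl mulmxK // => <-.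
by rewrite mulmxKV.
Qed.

Lemma T_nexpT x X : nz x -> has_weight i c W b X ->
  T x *m nexp X^T = nexp ((mon x b)^-1 *: X^T) *m T x.
Proof.
move=> nzx HX; have Tu := torus_unit nzx.
have := nexp_conj X^T Tu; rewrite (torus_has_weight (has_weight_tr HX) nzx) monN.
by rewrite -scalemxAl mulmxK // => <-; rewrite mulmxKV.
Qed.

Definition wX X := locked (nexp X *m nexp (- (qq X)^-1 *: X^T) *m nexp X).

Lemma wX_def X : wX X = nexp X *m nexp (- (qq X)^-1 *: X^T) *m nexp X.
Proof. by rewrite /wX -lock. Qed.

(** Rescaled to q = 1, the matrix [X1] and its transpose form a triple with [hmat]. By [wmat_torus],
    [wX] at a multiple of [X1] is the coroot element at the scaling factor times one fixed
    orthogonal matrix; this gives the torus part, and also the action on the torus, because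
    conjugation by [T x] rescales [X] by the root value. *)
Lemma wX_refl X : gV X -> X != 0 -> refl true (Num.sqrt (qq X)) (wX X).
Proof.
move=> gX X0; have q0 := qq_pos gX X0; set s := Num.sqrt (qq X).
have s0 : 0 < s by rewrite sqrtr_gt0.
have sn0 : s != 0 by rewrite gt_eqF.
have s2 : s ^+ 2 = qq X by rewrite sqr_sqrtr // ltW.
have [X1 [gX1 q1 sX1]] : exists X1, [/\ gV X1, qq X1 = 1 & s *: X1 = X].
  exists (s^-1 *: X); split; first exact: gVZ.
    by rewrite qqZ exprVn s2 mulVf // gt_eqF.
  by rewrite scalerA mulfV // scale1r.
have br : X1 *m X1^T - X1^T *m X1 = hmat by rewrite gV_bracket // q1 scale1r.
have wE t : t != 0 -> wX ((t * s) *: X1) = wmat X1 (t * s).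
  move=> t0; rewrite wX_def /wmat qqZ q1 mulr1; congr (_ *m nexp _ *m _).
  by rewrite linearZ /= scalerA; congr (_ *: _); field; rewrite sn0 t0.
have [kk Hkk HW] := wmat_torus ccL (gV_nil gX1) br (hmat_weight (gV_weight gX1)) erefl.
have kE a : kk a = (W *m nu) a 0.
  by apply: (@intr_inj L); rewrite -Hkk mxE.
have {}HW t : t != 0 -> wmat X1 t = av t *m wmat X1 1.
  move=> t0; rewrite HW // avE //; congr (_ *m diag_mx _ *m _ *m _).
  by apply/rowP => a; rewrite [LHS]mxE [RHS]mxE kE.
have orth := wmat1_orth (gV_nil gX1) br (hmat_weight (gV_weight gX1)).
have wXE : wX X = av s *m wmat X1 1.
  by rewrite -HW // -[s]mul1r -wE ?oner_eq0 // mul1r sX1.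
split=> //.
- rewrite wX_def; have GXT : G (nexp (- (qq X)^-1 *: X^T)).
    by rewrite -[_ *: X^T](linearZ _) /=; apply/gV_GT/gVZ.
  by apply: G_mul; [apply: G_mul => //; apply: gV_G|apply: gV_G].
- rewrite wXE; move: (wmat X1 1) orth => w1 orth.
  by rewrite trmx_mul -!mulmxA [w1 *m _]mulmxA orth mul1mx av_sym avM -expr2.
- move=> x x0; have nzx := gt0_nz x0; set y := mon x b.
  have y0 : y != 0 by rewrite gt_eqF // mon_pos.
  have E : T x *m wX X = wX (y *: X) *m T x.
    have HX := gV_weight gX; rewrite wX_def mulmxA mulmxA (T_nexp nzx HX) -!mulmxA.
    rewrite [T x *m _]mulmxA -{1}[_ *: X^T](linearZ _) /=.
    rewrite (T_nexpT nzx (gV_weight (gVZ _ gX))) -!mulmxA (T_nexp nzx HX) -/y.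
    rewrite [in RHS]wX_def qqZ -!mulmxA; congr (_ *m (nexp _ *m _)).
    rewrite !linearZ /= !scalerA; congr (_ *: _); move: (qq X) q0 => q q0.
    by field; rewrite y0 gt_eqF.
  have E2 : wX (y *: X) = av y *m wX X.
    by rewrite -{1}sX1 scalerA wE // HW ?mulf_neq0 // wXE mulmxA avM.
  have : av y^-1 *m (T x *m wX X) = av y^-1 *m (av y *m wX X *m T x) by rewrite E E2.
  have avVy : av y^-1 *m av y = 1%:M by rewrite avM mulVf // av1.
  rewrite !mulmxA avVy mul1mx => <-.
  by rewrite /av TC.
Qed.

(** This is the definition of [wX] at -Z, with Z = Y / q(Y), solved for its middle factor; q(Z) = 1
    / q(Y) makes this factor exp(Y^T). *)
Lemma lower_split Y : gV Y -> Y != 0 ->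
  nexp Y^T = nexp ((qq Y)^-1 *: Y) *m wX (- ((qq Y)^-1 *: Y)) *m nexp ((qq Y)^-1 *: Y).
Proof.
move=> gY Y0; have q0 := qq_pos gY Y0; set X := _ *: Y; have gX : gV X by apply: gVZ.
have qX : qq (- X) = (qq Y)^-1.
  by rewrite -scaleN1r !qqZ; field; rewrite gt_eqF.
rewrite wX_def qX invrK linearN /= scaleNr scalerN opprK.
have -> : qq Y *: X^T = Y^T by rewrite /X linearZ /= scalerA mulfV ?scale1r // gt_eqF.
have XV := nexpV (gV_nil gX).
by rewrite !mulmxA XV mul1mx -mulmxA (mulmx1C XV) mulmx1.
Qed.

Definition bruhat g := exists2 X, gV X &
  (exists t m Y, [/\ refl false t m, gV Y & g = nexp X *m m *m nexp Y^T]) \/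
  (exists t m, refl true t m /\ g = nexp X *m m).

Lemma refl_nexp e t m (s : bool) X : refl e t m -> gV (if s then X^T else X) ->
  m *m nexp X = nexp (m *m X *m invmx m) *m m.
Proof.
by move=> Hm gX; rewrite -nexp_conj ?mulmxKV //; apply: (refl_unit Hm).
Qed.

Lemma bruhat_left e t m X g : gV X -> refl e t m -> bruhat g -> e = false ->
  bruhat (nexp X *m m *m g).
Proof.
move=> gX Hm [X1 gX1 H] e0; rewrite e0 in Hm.
have gX2 : gV (m *m X1 *m invmx m) := refl_conj (s := false) Hm gX1.
exists (X + m *m X1 *m invmx m); first exact: gVD.
have E : nexp X *m m *m nexp X1 = nexp (X + m *m X1 *m invmx m) *m m.
  by rewrite nexp_gVD // -mulmxA (refl_nexp (s := false) Hm gX1) mulmxA.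
case: H => [[t1 [m1 [Y [H1 gY ->]]]]|[t1 [m1 [H1 ->]]]]; [left|right].
  exists (t * t1), (m *m m1), Y; split=> //; first exact: (refl_mul Hm H1).
  by rewrite !mulmxA E.
exists (t * t1), (m *m m1); split; first exact: (refl_mul Hm H1).
by rewrite !mulmxA E.
Qed.

(** Split the lower factor; the upper factors to the right of the reflection become lower when
    pushed through it and can be split again, and two reflections act trivially on the torus. If
    those upper factors cancel, the element is in the reflecting cell. *)
Lemma bruhat_lower_upper X Y : gV X -> gV Y -> bruhat (nexp Y^T *m nexp X).
Proof.
move=> gX gY; have g0 := gV0 gX.
have [->|Y0] := eqVneq Y 0.
  exists X => //; left; exists 1, 1%:M, 0; split=> //; first exact: refl1.
  by rewrite trmx0 nexp0 mul1mx !mulmx1.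
rewrite (lower_split gY Y0); set X1 := _ *: Y; have gX1 : gV X1 by apply: gVZ.
have X10 : X1 != 0 by rewrite scaler_eq0 invr_eq0 negb_or Y0 gt_eqF // qq_pos.
have NX10 : - X1 != 0 by rewrite oppr_eq0.
have Hw := wX_refl (gVN gX1) NX10; set w := wX _ in Hw *.
rewrite -[_ *m nexp X1 *m nexp X]mulmxA -nexp_gVD //.
have gZ : gV (X1 + X) by apply: gVD.
have [->|Z0] := eqVneq (X1 + X) 0.
  by exists X1 => //; right; eexists; exists w; split; [exact: Hw|rewrite nexp0 mulmx1].
rewrite -mulmxA (refl_nexp (s := false) Hw gZ).
have gY2 : gV (w *m (X1 + X) *m invmx w)^T := refl_conj (s := false) Hw gZ.
set Y2 := (_ *m invmx w) in gY2 *.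
have Y20 : Y2^T != 0.
  rewrite trmx_eq0; apply: contra_neq Z0; exact: conj_eq0 (refl_unit Hw).
rewrite -[Y2]trmxK (lower_split gY2 Y20); set X2 := _ *: _.
have gX2 : gV X2 by apply: gVZ.
have NX20 : - X2 != 0.
  by rewrite oppr_eq0 scaler_eq0 invr_eq0 negb_or Y20 gt_eqF // qq_pos.
have Hw2 := wX_refl (gVN gX2) NX20; set w2 := wX _ in Hw2 *.
have Hwi := refl_inv Hw.
have gY3 : gV (invmx w *m X2 *m invmx (invmx w))^T := refl_conj (s := false) Hwi gX2.
exists (X1 + X2); first exact: gVD.
left; eexists; exists (w2 *m w), (invmx w *m X2 *m invmx (invmx w))^T; split=> //.
  exact: (refl_mul Hw2 Hw).
rewrite trmxK nexp_gVD // -(mulmxA _ (w2 *m w)) -[w2 *m w *m _]mulmxA.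
by rewrite -(nexp_conjV _ (refl_unit Hw)) !mulmxA.
Qed.

Lemma bruhat_upper g X : bruhat g -> gV X -> bruhat (g *m nexp X).
Proof.
move=> [X1 gX1 [[t [m [Y [Hm gY ->]]]]|[t [m [Hm ->]]]]] gX.
  by rewrite -mulmxA; apply: (bruhat_left gX1 Hm) => //; apply: bruhat_lower_upper.
rewrite -mulmxA (refl_nexp (s := false) Hm gX).
have gY : gV (m *m X *m invmx m)^T := refl_conj (s := false) Hm gX.
set Y := (m *m X *m invmx m) in gY *.
have [Y0|Y0] := eqVneq Y^T 0.
  exists X1 => //; right; exists t, m; split=> //.
  by rewrite -[Y]trmxK Y0 trmx0 nexp0 mul1mx.
rewrite -[Y]trmxK (lower_split gY Y0); set X2 := _ *: _.
have gX2 : gV X2 by apply: gVZ.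
have NX20 : - X2 != 0.
  by rewrite oppr_eq0 scaler_eq0 invr_eq0 negb_or Y0 gt_eqF // qq_pos.
have Hw2 := wX_refl (gVN gX2) NX20; set w2 := wX _ in Hw2 *.
have Hmi := refl_inv Hm.
have gY3 : gV (invmx m *m X2 *m invmx (invmx m))^T := refl_conj (s := false) Hmi gX2.
exists (X1 + X2); first exact: gVD.
left; eexists; exists (w2 *m m), (invmx m *m X2 *m invmx (invmx m))^T; split=> //.
  exact: (refl_mul Hw2 Hm).
rewrite trmxK nexp_gVD // -(mulmxA _ (w2 *m m)) -[w2 *m m *m _]mulmxA.
by rewrite -(nexp_conjV _ (refl_unit Hm)) !mulmxA.
Qed.

Lemma bruhat_lower g Y : bruhat g -> gV Y -> bruhat (g *m nexp Y^T).
Proof.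
move=> [X1 gX1 [[t [m [Z [Hm gZ ->]]]]|[t [m [Hm ->]]]]] gY.
  exists X1 => //; left; exists t, m, (Z + Y); split=> //; first exact: gVD.
  by rewrite nexp_gVDT // !mulmxA.
have gYT : gV (Y^T)^T by rewrite trmxK.
have gX2 : gV (m *m Y^T *m invmx m) := refl_conj (s := true) Hm gYT.
exists (X1 + m *m Y^T *m invmx m); first exact: gVD.
right; exists t, m; split=> //.
by rewrite nexp_gVD // -mulmxA (refl_nexp (s := true) Hm gYT) mulmxA.
Qed.

(** The elements such that right multiplication by them and by their inverses preserves the union of
    the two cells form a group, and the generators belong to it. *)
Lemma bruhat_generated X0 : gV X0 -> forall g,
  generated_mx ([set nexp X | X in gV] `|` [set nexp X^T | X in gV]) g -> bruhat g.
Proof.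
move=> gX0 g Hg; have g0 := gV0 gX0.
pose H := [set g : 'M[L]_n | g \in unitmx /\ forall l, bruhat l ->
  bruhat (l *m g) /\ bruhat (l *m invmx g)].
have b1 : bruhat 1%:M.
  exists 0 => //; left; exists 1, 1%:M, 0; split=> //; first exact: refl1.
  by rewrite trmx0 nexp0 !mulmx1.
have /(_ H) [||_ /(_ _ b1)[+ _]] := Hg; last by rewrite mul1mx.
- split=> [h []//||h1 h2 [u1 H1] [u2 H2]|h [u1 H1]].
  + by split=> [|l bl]; [exact: unitmx1|rewrite invmx1 mulmx1].
  + split=> [|l bl]; first by rewrite unitmx_mul u1.
    have IV : invmx (h1 *m h2) = invmx h2 *m invmx h1.
      have u12 : h1 *m h2 \in unitmx by rewrite unitmx_mul u1.
      have E : invmx h2 *m invmx h1 *m (h1 *m h2) = 1%:M by rewrite mulmxA mulmxKV ?mulVmx.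
      by rewrite -[LHS]mul1mx -E mulmxK.
    rewrite IV !mulmxA; split.
      by have [b1' _] := H1 _ bl; have [] := H2 _ b1'.
    by have [_ b2'] := H2 _ bl; have [] := H1 _ b2'.
  + split=> [|l bl]; first by rewrite unitmx_inv.
    by have [] := H1 _ bl; rewrite invmxK.
- move=> _ [[X gX <-]|[X gX <-]].
    split=> [|l bl]; first exact: nexp_unit (gV_nil gX).
    rewrite (nexp_inv (gV_nil gX)); split; apply: bruhat_upper => //.
    exact: gVN.
  split=> [|l bl]; first exact: nexp_unit (gV_nilT gX).
  rewrite (nexp_inv (gV_nilT gX)) -linearN; split; apply: bruhat_lower => //.
  exact: gVN.
Qed.

(** * Pointwise stabilizers of finitely many points of the apartment *)

Section Stabilizer.
Variable O : {pred L}.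
Hypothesis O_subring : GRing.subring_closed O.
Hypothesis O_convex : order_convex O.

Lemma O_one : 1 \in O. Proof. by case: O_subring. Qed.
Lemma O_sub : {in O &, forall x y, x - y \in O}. Proof. by case: O_subring. Qed.
Lemma O_mul : {in O &, forall x y, x * y \in O}. Proof. by case: O_subring. Qed.
Lemma O_zero : 0 \in O. Proof. by rewrite -(subrr 1) O_sub ?O_one. Qed.
Lemma O_opp x : x \in O -> - x \in O. Proof. by move=> Ox; rewrite -sub0r O_sub ?O_zero. Qed.
Lemma O_add : {in O &, forall x y, x + y \in O}.
Proof. by move=> x y Ox Oy; rewrite -[y]opprK O_sub ?O_opp. Qed.

Lemma O_le x y : 0 <= x -> x <= y -> y \in O -> x \in O.
Proof. by move=> x0 xy Oy; apply: (O_convex O_zero Oy); rewrite x0. Qed.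

(** Convexity and x <= 1 + x^2. *)
Lemma O_sqr x : 0 <= x -> x ^+ 2 \in O -> x \in O.
Proof.
move=> x0 Ox; apply: (@O_le x (1 + x ^+ 2)) => //; last by rewrite O_add ?O_one.
by have := sqr_ge0 (x - 1); lra.
Qed.

Lemma O_exp x k : x \in O -> x ^+ k \in O.
Proof. by move=> Ox; elim: k => [|k IHk]; rewrite ?O_one // exprS O_mul. Qed.

Lemma O_expz x (z : int) : x \in O -> x^-1 \in O -> x ^ z \in O.
Proof. by case: z => k Ox Ox'; rewrite ?NegzE -?exprnN -?exprVn; apply: O_exp. Qed.

Lemma O_inv x : 0 < x -> x \notin O -> x^-1 \in O.
Proof.
move=> x0 Ox; apply: (@O_le _ 1); [by rewrite invr_ge0 ltW| |exact: O_one].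
rewrite invf_le1 //.
by rewrite leNgt; apply: contra Ox => x1; apply: (@O_le _ 1); rewrite ?O_one // ltW.
Qed.

(** An abstract stabilizer of the base point, given by the properties that follow. *)
Variable bdd : set 'M[L]_n.
Hypothesis bddM : forall g h, G g -> G h -> bdd g -> bdd h -> bdd (g *m h).
Hypothesis bddV : forall g, G g -> bdd g -> bdd (invmx g).
Hypothesis bdd_orth : forall k, G k -> k *m k^T = 1%:M -> bdd k.
Hypothesis bdd_av : forall t, 0 < t -> t \in O -> t^-1 \in O -> bdd (av t).
Hypothesis bdd_nexp : forall X, gV X -> qq X \in O -> bdd (nexp X).
Hypothesis bdd_nexpT : forall X, gV X -> qq X \in O -> bdd (nexp X^T).
Hypothesis bdd_nexp_av : forall X t, gV X -> 0 < t -> bdd (nexp X *m av t) ->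
  t ^+ 2 \in O /\ t ^- 2 \in O.

Lemma G_av t : 0 < t -> G (av t).
Proof. by move=> t0; apply: G_torus; apply: gt0_nz => j; apply: tpow_pos. Qed.

(** The matrix a(t)^-1 m is orthogonal, hence bounded, so exp(X) m is bounded together with exp(X)
    a(t), and this forces t to be a unit. *)
Lemma bdd_split e t m X : refl e t m -> gV X -> bdd (nexp X *m m) ->
  [/\ t \in O, t^-1 \in O, bdd m & bdd (nexp X)].
Proof.
move=> [Gm t0 mm _] gX bg; pose k := av t^-1 *m m.
have ti0 : 0 < t^-1 by rewrite invr_gt0.
have Gk : G k by apply: G_mul => //; apply: G_av.
have t1 : t != 0 by rewrite gt_eqF.
have kk : k *m k^T = 1%:M.
  rewrite /k trmx_mul av_sym -mulmxA (mulmxA m) mm mulmxA !avM.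
  by rewrite expr2 mulrA mulVf // mul1r mulfV // av1.
have mE : m = av t *m k by rewrite /k mulmxA avV // mul1mx.
have GX := gV_G gX.
have kV : m *m invmx k = av t by rewrite mE mulmxK // G_unit.
have [Ot2 Ot2'] : (t ^+ 2 \in O) /\ (t ^- 2 \in O).
  apply: (bdd_nexp_av gX t0); rewrite -kV mulmxA; apply: bddM => //.
  - exact: G_mul.
  - exact: G_inv.
  - by apply: bddV => //; apply: bdd_orth.
have Ot : t \in O by apply: O_sqr => //; apply: ltW.
have Ot' : t^-1 \in O by apply: O_sqr; rewrite ?exprVn // ltW.
have bm : bdd m by rewrite mE; apply: bddM; [exact: G_av|exact: Gk|exact: bdd_av|exact: bdd_orth].
split=> //; rewrite -(mulmxK (G_unit Gm) (nexp X)); apply: bddM => //.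
- exact: G_mul.
- exact: G_inv.
exact: bddV.
Qed.

(** The condition that [g] fixes the translate of the base point by [T x]. *)
Definition fixes (x : 'rV[L]_d) g := bdd (invmx (T x) *m g *m T x).

Lemma conjT_nexp x X : pos_row x -> gV X ->
  invmx (T x) *m nexp X *m T x = nexp ((mon x b)^-1 *: X).
Proof.
move=> x0 gX; have nzx := gt0_nz x0; have b0 : mon x b != 0 := mon_neq0 _ nzx.
rewrite -mulmxA -[X in nexp X *m _]scale1r -(mulfV b0) -scalerA.
by rewrite -(T_nexp nzx) ?mulKmx ?torus_unit //; apply: gV_weight; apply: gVZ.
Qed.

Lemma conjT_nexpT x X : pos_row x -> gV X ->
  invmx (T x) *m nexp X^T *m T x = nexp (mon x b *: X)^T.
Proof.
move=> x0 gX; have nzx := gt0_nz x0; have b0 : mon x b != 0 := mon_neq0 _ nzx.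
rewrite -mulmxA -[X in nexp X^T *m _]scale1r -(mulVf b0) -scalerA linearZ /=.
by rewrite -(T_nexpT nzx) ?mulKmx ?torus_unit //; apply: gV_weight; apply: gVZ.
Qed.

Lemma refl_av e s t m : 0 < s -> refl e t m -> refl e (s * t) (av s *m m).
Proof.
move=> s0 [Gm t0 mm mT]; split.
- by apply: G_mul => //; apply: G_av.
- exact: mulr_gt0.
- rewrite trmx_mul av_sym -mulmxA (mulmxA m) mm mulmxA !avM.
  by congr av; ring.
move=> x x0; rewrite -mulmxA mT // !mulmxA; congr (_ *m _).
have C : av s *m T x = T x *m av s by rewrite /av TC.
rewrite C -(mulmxA (T x) (av s)) -(mulmxA (T x) _ (av s)); congr (_ *m _); case: e {mT} => //; last by rewrite mulmx1 mul1mx.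
by rewrite /av TC.
Qed.

Lemma conjT_refl e t m x : pos_row x -> refl e t m ->
  refl e (if e then (mon x b)^-1 * t else t) (invmx (T x) *m m *m T x).
Proof.
move=> x0 Hm; have [Gm t0 mm mT] := Hm; rewrite -mulmxA mT // !mulmxA.
rewrite mulVmx ?torus_unit //; last exact: gt0_nz.
rewrite mul1mx; case: e Hm {mT} => Hm; last by rewrite mul1mx.
by apply: refl_av => //; rewrite invr_gt0 mon_pos.
Qed.

Lemma conjTM x g h : pos_row x -> invmx (T x) *m (g *m h) *m T x =
  (invmx (T x) *m g *m T x) *m (invmx (T x) *m h *m T x).
Proof. by move=> x0; rewrite !mulmxA mulmxK // torus_unit //; apply: gt0_nz. Qed.

Lemma G_T x : pos_row x -> G (T x).
Proof. by move=> x0; apply: G_torus; apply: gt0_nz. Qed.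

Lemma G_conjT x g : pos_row x -> G g -> G (invmx (T x) *m g *m T x).
Proof.
move=> x0 Gg; have GT := G_T x0.
by apply: G_mul => //; apply: G_mul => //; apply: G_inv.
Qed.

Lemma fixesM x g h : pos_row x -> G g -> G h -> fixes x g -> fixes x h -> fixes x (g *m h).
Proof. by move=> x0 Gg Gh; rewrite /fixes conjTM //; apply: bddM; apply: G_conjT. Qed.

Lemma fixesV x g : pos_row x -> G g -> fixes x g -> fixes x (invmx g).
Proof.
move=> x0 Gg /(bddV (G_conjT x0 Gg)); rewrite /fixes.
have TU : T x \in unitmx by apply: torus_unit; apply: gt0_nz.
suff -> : invmx (invmx (T x) *m g *m T x) = invmx (T x) *m invmx g *m T x by [].
have gU := G_unit Gg; have MU : invmx (T x) *m g *m T x \in unitmx.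
  by rewrite !unitmx_mul unitmx_inv TU gU.
have E : (invmx (T x) *m g *m T x) *m (invmx (T x) *m invmx g *m T x) = 1%:M.
  by rewrite -conjTM // mulmxV // mulmx1 mulVmx.
by rewrite -[LHS]mulmx1 -E mulKmx.
Qed.

Lemma fixes_split e t m X x : pos_row x -> refl e t m -> gV X -> fixes x (nexp X *m m) ->
  [/\ fixes x (nexp X), fixes x m & let s := if e then (mon x b)^-1 * t else t in
    s \in O /\ s^-1 \in O].
Proof.
move=> x0 Hm gX; rewrite /fixes conjTM // conjT_nexp // => H.
by have [] := bdd_split (conjT_refl x0 Hm) (gVZ _ gX) H.
Qed.

Lemma fixes_nexp x X : pos_row x -> gV X -> mon x b ^- 2 * qq X \in O -> fixes x (nexp X).
Proof.
move=> x0 gX H; rewrite /fixes conjT_nexp //; apply: bdd_nexp; first exact: gVZ.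
by rewrite qqZ exprVn.
Qed.

Lemma fixes_nexpT x X : pos_row x -> gV X -> mon x b ^+ 2 * qq X \in O -> fixes x (nexp X^T).
Proof.
move=> x0 gX H; rewrite /fixes conjT_nexpT //; apply: bdd_nexpT; first exact: gVZ.
by rewrite qqZ.
Qed.

Lemma seq_argmin (T' : eqType) (f : T' -> L) x0 (s : seq T') :
  exists2 x, x \in x0 :: s & forall y, y \in x0 :: s -> f x <= f y.
Proof.
elim: s x0 => [|y s IHs] x0.
  by exists x0; rewrite ?inE // => y; rewrite inE => /eqP ->.
have [x xs Hx] := IHs y; have [le|lt] := leP (f x0) (f x).
  exists x0; first by rewrite mem_head.
  by move=> z; rewrite inE => /orP[/eqP->//|/Hx]; apply: le_trans.
exists x; first by rewrite inE xs orbT.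
by move=> z; rewrite inE => /orP[/eqP->|/Hx//]; apply: ltW.
Qed.

Variables (p0 : 'rV[L]_d) (pts : seq 'rV[L]_d).
Hypothesis pts_pos : forall x, x \in p0 :: pts -> pos_row x.
Let fixall g := forall x, x \in p0 :: pts -> fixes x g.

Let fixallM g h : G g -> G h -> fixall g -> fixall h -> fixall (g *m h).
Proof. by move=> Gg Gh fg fh x xs; apply: fixesM; auto. Qed.

Let fixallV g : G g -> fixall g -> fixall (invmx g).
Proof. by move=> Gg fg x xs; apply: fixesV; auto. Qed.

Let fixall_split e t m X : refl e t m -> gV X -> fixall (nexp X *m m) ->
  fixall (nexp X) /\ fixall m.
Proof.
move=> Hm gX H; split=> x xs; have x0 := pts_pos xs;
  by have [] := fixes_split x0 Hm gX (H x xs).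
Qed.

(* Two points of the apartment with the extreme values of the root decide in
   which of the three big cells the stabilizer elements are decomposed. *)
Lemma stabilizer_decomposition g : bruhat g -> fixall g -> exists X Y e t m,
  [/\ gV X, gV Y, refl e t m, g = nexp X *m nexp Y^T *m m &
    [/\ fixall (nexp X), fixall (nexp Y^T) & fixall m]].
Proof.
have fix1 : fixall (nexp (0 : 'M[L]_n)^T).
  move=> x xs; rewrite /fixes trmx0 nexp0 mulmx1 mulVmx.
    by apply: bdd_orth; rewrite ?trmx1 ?mulmx1.
  by apply: torus_unit; apply: gt0_nz; apply: pts_pos.
have noY e t m X : refl e t m -> gV X -> fixall (nexp X *m m) -> exists X' Y e t m',
  [/\ gV X', gV Y, refl e t m', nexp X *m m = nexp X' *m nexp Y^T *m m' &
    [/\ fixall (nexp X'), fixall (nexp Y^T) & fixall m']].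
  move=> Hm gX /(fixall_split Hm gX)[fX fm]; exists X, 0, e, t, m; split=> //.
  - exact: gV0 gX.
  - by rewrite trmx0 nexp0 mulmx1.
move=> [X gX [[t [m [Y [Hm gY ->]]]]|[t [m [Hm ->]]]]] Hg; last exact: noY Hm gX Hg.
have [Y0|Y0] := eqVneq Y 0.
  by move: Hg; rewrite Y0 trmx0 nexp0 mulmx1 => Hg; apply: noY Hm gX Hg.
have [Gm t0 _ _] := Hm; have mU := G_unit Gm.
have GX := gV_G gX; have GY := gV_GT gY; have GXm := G_mul GX Gm.
have q0 := qq_pos gY Y0; set q := qq Y in q0.
have chi0 x : x \in p0 :: pts -> 0 < mon x b by move=> /pts_pos x0; apply: mon_pos.
have [xm xms Hmin] := seq_argmin (fun x => mon x b) p0 pts.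
have [xM xMs HM] := seq_argmin (fun x => - mon x b) p0 pts.
have Hmax y : y \in p0 :: pts -> mon y b <= mon xM b.
  by move=> ys; have := HM y ys; rewrite lerN2.
have sqle (u w : L) : 0 < u -> u <= w -> u ^+ 2 <= w ^+ 2.
  by move=> u0 uw; rewrite ler_pXn2r ?nnegrE // ltW // (lt_le_trans u0).
pose Z := q^-1 *: Y; have gZ : gV Z := gVZ _ gY.
have qZ : qq Z = q^-1 by rewrite qqZ -/q; field; rewrite gt_eqF.
have GZ := gV_G gZ.
have split_m V : gV V -> m *m nexp V = nexp (m *m V *m invmx m) *m m.
  by move=> gW; apply: (refl_nexp (s := false) Hm).
have gmZ : gV (m *m Z *m invmx m) by apply: (refl_conj (s := false) Hm).
pose w := wX (- Z).
have Z0 : - Z != 0 by rewrite oppr_eq0 scaler_eq0 negb_or invr_eq0 gt_eqF.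
have Hw := wX_refl (gVN gZ) Z0; rewrite -/w in Hw.
have qNZ : qq (- Z) = q^-1 by rewrite -scaleN1r qqZ sqrrN expr1n mul1r.
have Hmw := refl_mul Hm Hw; rewrite /= qNZ in Hmw.
have YE : nexp Y^T = nexp Z *m w *m nexp Z by rewrite lower_split.
have gE : nexp X *m m *m nexp Y^T =
    nexp (X + m *m Z *m invmx m) *m (m *m w) *m nexp Z.
  rewrite YE (nexp_gVD gX gmZ) !mulmxA; congr (_ *m _ *m _).
  by rewrite -mulmxA split_m // mulmxA.
have gXZ := gVD gX gmZ.
have Gmw : G (m *m w) by case: Hmw.
(* Conjugation by [T x] multiplies q by the squared root value. If the largest root value keeps it
   in [O], then exp(Y^T) fixes all points and is moved to the left of [m]. *)
have [OM|OM] := boolP (mon xM b ^+ 2 * q \in O).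
  have fY : fixall (nexp Y^T).
    move=> x xs; apply: (fixes_nexpT (pts_pos xs) gY); apply: O_le OM.
      by rewrite mulr_ge0 ?sqr_ge0 // ltW.
    by rewrite ler_pM2r // sqle ?chi0 // Hmax.
  have fXm : fixall (nexp X *m m).
    rewrite -(mulmxK (G_unit GY) (nexp X *m m)); apply: fixallM (fixallV GY fY) => //.
      exact: G_mul.
    exact: G_inv.
  have [fX fm] := fixall_split Hm gX fXm.
  have gmY : gV (m *m Y^T *m invmx m)^T.
    by apply: (refl_conj (s := true) Hm); rewrite trmxK.
  have mY : m *m nexp Y^T = nexp (m *m Y^T *m invmx m) *m m.
    by apply: (refl_nexp (s := true) Hm); rewrite trmxK.
  exists X, (m *m Y^T *m invmx m)^T, false, t, m; rewrite trmxK; split=> //.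
    by rewrite -mulmxA mY mulmxA.
  split=> //; have -> : nexp (m *m Y^T *m invmx m) = m *m nexp Y^T *m invmx m.
    by rewrite mY mulmxK.
  by apply: fixallM (fixallV Gm fm) => //; [exact: G_mul|exact: G_inv|exact: fixallM].
(* If the inverse is integral at the smallest root value, then exp(Z), where q(Z) = 1 / q, fixes all
   points, and [gE] reduces the claim to the reflecting element [m *m w]. *)
have [Om|Om] := boolP ((mon xm b ^+ 2 * q)^-1 \in O).
  have fZ : fixall (nexp Z).
    move=> x xs; apply: (fixes_nexp (pts_pos xs) gZ); rewrite qZ -invfM; apply: O_le Om.
      by rewrite invr_ge0 mulr_ge0 ?sqr_ge0 // ltW.
    rewrite lef_pV2 ?posrE ?mulr_gt0 ?exprn_gt0 ?chi0 //.
    by rewrite ler_pM2r // sqle ?chi0 // Hmin.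
  have fXm : fixall (nexp (X + m *m Z *m invmx m) *m (m *m w)).
    rewrite -(mulmxK (G_unit GZ) (nexp (X + m *m Z *m invmx m) *m (m *m w))) -gE.
    by apply: fixallM (fixallV GZ fZ) => //; [exact: G_mul|exact: G_inv].
  have [fX fm] := fixall_split Hmw gXZ fXm.
  have mwU := G_unit Gmw.
  have gmw : gV ((m *m w) *m Z *m invmx (m *m w))^T.
    by apply: (refl_conj (s := false) Hmw).
  have mwZ : (m *m w) *m nexp Z = nexp ((m *m w) *m Z *m invmx (m *m w)) *m (m *m w).
    by apply: (refl_nexp (s := false) Hmw).
  exists (X + m *m Z *m invmx m), ((m *m w) *m Z *m invmx (m *m w))^T, true,
    (t * Num.sqrt q^-1), (m *m w); rewrite trmxK; split=> //.
    by rewrite gE -mulmxA mwZ mulmxA.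
  split=> //; have -> : nexp ((m *m w) *m Z *m invmx (m *m w)) =
      (m *m w) *m nexp Z *m invmx (m *m w) by rewrite mwZ mulmxK.
  apply: fixallM (fixallV Gmw fm) => //; [|exact: G_inv|exact: fixallM].
  exact: G_mul.
(* Now exp(Y^T) fixes [xm], so t is in [O], and exp(Z) fixes [xM], so t divided by the root value
   and by the root of q is a unit. The squared inverse of this unit times t^2 is
   [mon xM b ^+ 2 * q], which contradicts [OM]. *)
exfalso; have q1 : q != 0 by rewrite gt_eqF.
have xM0 := pts_pos xMs; have xm0 := pts_pos xms.
have cM : mon xM b != 0 by rewrite gt_eqF ?chi0.
have Om' : mon xm b ^+ 2 * q \in O.
  have := O_inv _ Om; rewrite invrK; apply.
  by rewrite invr_gt0 mulr_gt0 ?exprn_gt0 ?chi0.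
have OM' : (mon xM b ^+ 2 * q)^-1 \in O.
  by apply: O_inv OM; rewrite mulr_gt0 ?exprn_gt0 ?chi0.
have fYm : fixes xm (nexp Y^T) := fixes_nexpT xm0 gY Om'.
have fXm : fixes xm (nexp X *m m).
  rewrite -(mulmxK (G_unit GY) (nexp X *m m)).
  apply: (fixesM xm0 _ _ (Hg _ xms) (fixesV xm0 GY fYm)); last exact: G_inv.
  exact: G_mul.
have [_ _ [Ot _]] := fixes_split xm0 Hm gX fXm.
have fZM : fixes xM (nexp Z) by apply: fixes_nexp => //; rewrite qZ -invfM.
have fXM : fixes xM (nexp (X + m *m Z *m invmx m) *m (m *m w)).
  rewrite -(mulmxK (G_unit GZ) (nexp (X + m *m Z *m invmx m) *m (m *m w))) -gE.
  apply: (fixesM xM0 _ _ (Hg _ xMs) (fixesV xM0 GZ fZM)); last exact: G_inv.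
  exact: G_mul.
have [_ _ [_ Os]] := fixes_split xM0 Hmw gXZ fXM.
case/negP: OM; move: Os => /(O_exp 2) Os.
have := O_mul Os (O_exp 2 Ot); congr (_ \in O).
have s0 : Num.sqrt q^-1 ^+ 2 = q^-1 by rewrite sqr_sqrtr // invr_ge0 ltW.
rewrite exprVn !exprMn exprVn s0; field.
by rewrite q1 cM gt_eqF.
Qed.

End Stabilizer.

End RankOneGroup.

(** * Root spaces *)

Section RootSpaceData.
Variables (K : rcfType) (n d : nat) (P : seq (entry_poly K n)).
Variables (c : 'M[K]_n) (W : 'M[int]_(n, d)).
Hypothesis cc : c *m c^T = 1%:M.
Implicit Type b : 'rV[int]_d.

(** Root spaces in a form that transfers: for a nilpotent matrix a single finite exponential
    replaces the one-parameter group, so the set is algebraic with the same equations over all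
    fields. *)
Definition gb (L : rcfType) (i : {rmorphism K -> L}) b : set 'M[L]_n :=
  [set X | has_weight i c W b X /\ zeros i P (nexp X)].

Fixpoint genpow k : 'M[entry_poly K n]_n :=
  if k is k'.+1 then genmx K n *m genpow k' else 1%:M.

Definition gennexp : 'M[entry_poly K n]_n :=
  \sum_(k < n) (mpoly.mpolyC (n * n) (k`!%:R^-1)) *: genpow k.

Definition weight_mx : 'M[entry_poly K n]_n :=
  constmx n c *m genmx K n *m constmx n c^T.

Definition gb_data b : sa_data K n :=
  [:: ([seq weight_mx ab.1 ab.2 | ab <- enum [set: 'I_n * 'I_n]%SET & dwt W ab != b] ++
       [seq pcomp p gennexp | p <- P], [::])].

Definition zero_data : sa_data K n :=
  [:: ([seq genmx K n ab.1 ab.2 | ab <- enum [set: 'I_n * 'I_n]%SET], [::])].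

Section Values.
Variables (L : rcfType) (i : {rmorphism K -> L}).

Lemma pev_gennexp X : map_mx (pev i X) gennexp = nexp X.
Proof.
have E k : map_mx (pev i X) (genpow k) = X ^+ k.
  elim: k => [|k IHk] /=; first by rewrite map_mx1 expr0.
  by rewrite map_mxM IHk pev_genmx exprS.
rewrite raddf_sum /=; apply: eq_bigr => k _; rewrite map_mxZ /= E; congr (_ *: _).
by rewrite pev_const fmorphV rmorph_nat.
Qed.

Lemma pev_weight_mx X a a' : pev i X (weight_mx a a') = (map_mx i c *m X *m (map_mx i c)^T) a a'.
Proof.
have -> : pev i X (weight_mx a a') = (map_mx (pev i X) weight_mx) a a' by rewrite [RHS]mxE.
by rewrite !map_mxM pev_genmx !pev_constmx map_trmx.
Qed.

Lemma gb_dataE b : sa_set i (gb_data b) = gb i b.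
Proof.
apply/seteqP; split=> X.
  move=> [B]; rewrite inE => /eqP-> [/= H _]; split.
    move=> ab ne0; apply/eqP; apply: contraT => wab; move: ne0.
    rewrite -pev_weight_mx pevE H ?eqxx // mem_cat; apply/orP; left.
    by apply: map_f; rewrite mem_filter wab mem_enum inE.
  move=> p pP; have := H (pcomp p gennexp); rewrite -pevE pev_comp pev_gennexp pevE.
  by apply; rewrite mem_cat; apply/orP; right; apply: (map_f (fun p => pcomp p gennexp)).
move=> [HX GX]; eexists; first exact: mem_head.
split=> // f /=; rewrite mem_cat => /orP[/mapP[ab]|/mapP[p pP ->]].
  rewrite mem_filter => /andP[wab _] ->; rewrite -pevE pev_weight_mx.
  by apply/eqP; apply: contraNT wab => /HX ->.
by rewrite -pevE pev_comp pev_gennexp pevE; apply: GX.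
Qed.

Lemma zero_dataE : sa_set i zero_data = [set 0].
Proof.
apply/seteqP; split=> X.
  move=> [B]; rewrite inE => /eqP-> [/= H _]; apply/matrixP => a b.
  have E : pval i (genmx K n a b) X = 0.
    by apply: H; apply/mapP; exists (a, b); rewrite ?mem_enum ?inE.
  have := congr1 (fun M : 'M[L]_n => M a b) (pev_genmx i X); rewrite [LHS]mxE pevE E => <-.
  by rewrite [RHS]mxE.
move=> ->; eexists; first exact: mem_head.
split=> // f /= /mapP[ab _ ->]; rewrite -pevE.
have -> : pev i 0 (genmx K n ab.1 ab.2) = (map_mx (pev i 0) (genmx K n)) ab.1 ab.2.
  by rewrite [RHS]mxE.
by rewrite pev_genmx mxE.
Qed.

Let G := zeros i P.
Hypothesis G1 : G 1%:M.
Hypothesis GM : forall g h, G g -> G h -> G (g *m h).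
Hypothesis GU : forall g, G g -> g \in unitmx.
Hypothesis GI : forall g, G g -> G (invmx g).
Hypothesis GT : forall g, G g -> G g^T.

Lemma nexp_zeros X : X ^+ n = 0 -> dlie G X -> G (nexp X).
Proof.
move=> Xn HX; apply: zeros_vanish => p Hp.
by have := dlie_nexp Xn HX 1 Hp G1; rewrite mul1mx scale1r.
Qed.

(** Replaces membership of one exponential by a linear condition, from which stability under sums,
    multiples, conjugation and brackets follows. *)
Lemma gb_dlie b X : b != 0 -> gb i b X <-> has_weight i c W b X /\ dlie G X.
Proof.
move=> b0; split=> -[HX GX]; have Xn := has_weight_nilpotent cc b0 HX.
  by split; [exact: HX|exact: (nexp_dlie G1 GM Xn GX)].
by split; [exact: HX|exact: (nexp_zeros Xn GX)].
Qed.

Lemma gbD b X Y : b != 0 -> gb i b X -> gb i b Y -> gb i b (X + Y).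
Proof.
move=> b0 /(gb_dlie _ b0)[wX dX] /(gb_dlie _ b0)[wY dY]; apply/(gb_dlie _ b0).
split; [exact: has_weightD|exact: (dlieD dX dY)].
Qed.

Lemma gbZ b t X : b != 0 -> gb i b X -> gb i b (t *: X).
Proof.
move=> b0 /(gb_dlie _ b0)[wX dX]; apply/(gb_dlie _ b0).
split; [exact: has_weightZ|exact: (dlieZ t dX)].
Qed.

Lemma gbT b X : gb i b X -> gb i (- b) X^T.
Proof.
by move=> [wX GX]; split; [exact: has_weight_tr|rewrite -nexp_tr; apply: GT].
Qed.

Lemma gbTK b X : gb i (- b) X -> gb i b X^T.
Proof. by move=> /gbT; rewrite opprK. Qed.

Lemma gb_conj b b' g X : b' != 0 -> G g -> gb i b X -> b != 0 ->
  has_weight i c W b' (g *m X *m invmx g) -> gb i b' (g *m X *m invmx g).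
Proof.
move=> b'0 Gg /gb_dlie gX b0 H; have [_ dX] := gX b0; apply/(gb_dlie _ b'0).
split; first exact: H.
by have := dlie_Ad GM GU GI (GI Gg) dX; rewrite invmxK.
Qed.

Lemma gb_bracket b b' X Y : b != 0 -> b' != 0 -> b + b' != 0 -> gb i b X -> gb i b' Y ->
  gb i (b + b') (X *m Y - Y *m X).
Proof.
move=> b0 b'0 bb' /(gb_dlie _ b0)[wX dX] /(gb_dlie _ b'0)[wY dY]; apply/(gb_dlie _ bb').
split; last exact: (dlie_bracket dX dY).
apply: has_weightD; first exact: (has_weightM cc wX wY).
by apply: has_weightN; rewrite addrC; apply: (has_weightM cc wY wX).
Qed.

End Values.
End RootSpaceData.

Lemma mxtr_sq (L : comNzRingType) m m' (X : 'M[L]_(m, m')) :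
  \tr (X *m X^T) = \sum_a \sum_b X a b ^+ 2.
Proof.
by apply: eq_bigr => a _; rewrite mxE; apply: eq_bigr => b _; rewrite mxE expr2.
Qed.

Lemma mxtr_sq_gt0 (L : realDomainType) m m' (X : 'M[L]_(m, m')) :
  X != 0 -> 0 < \tr (X *m X^T).
Proof.
move=> X0; have ge0 : 0 <= \tr (X *m X^T).
  by rewrite mxtr_sq; do 2![apply: sumr_ge0 => ? _]; rewrite sqr_ge0.
rewrite lt_def ge0 andbT; apply: contra X0; rewrite mxtr_sq psumr_eq0; last first.
  by move=> a _; apply: sumr_ge0 => b _; rewrite sqr_ge0.
move=> /allP H; apply/eqP/matrixP => a b; rewrite [RHS]mxE; apply/eqP.
have := H a (mem_index_enum _); rewrite /= psumr_eq0 => [/allP/(_ b)|b' _].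
  by rewrite mem_index_enum /= sqrf_eq0 => /(_ isT).
by rewrite sqr_ge0.
Qed.

(** * Roots and coroots over the reals *)

Section RealRoots.
Variables (K : rcfType) (C : numClosedFieldType) (toC : {rmorphism K -> C}).
Variables (n : nat) (P Q : seq (entry_poly K n)).
Hypothesis G_group : cgroup toC P.
Hypothesis G_self_adjoint : forall g, zeros toC P g -> zeros toC P g^T.
Hypothesis S_torus : cmaximal toC P Q.
Hypothesis S_symmetric : forall s, zeros toC Q s -> s = s^T.
Variables (d : nat) (c : 'M[K]_n) (W : 'M[int]_(n, d)) (B : 'M[int]_(d, n)).
Hypothesis D : torus_data c W B.
Hypothesis QT : zeros toC Q = zeros toC (torus_eqs c W B).
Variables (R : realType) (iR : {rmorphism K -> R}).
Local Notation cR := (map_mx iR c).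
Local Notation GR := (zeros iR P).
Local Notation T x := (tmat c iR (tw W x)).
Let cc : c *m c^T = 1%:M. Proof. by case: D. Qed.
Let BW : B *m W = 1%:M. Proof. by case: D. Qed.
Let ccR : cR *m cR^T = 1%:M. Proof. exact: tmat_orth. Qed.
Let G1 := G_one G_group iR.
Let GM := @G_mul _ _ _ toC P G_group _ iR.
Let GU := @G_unit _ _ _ toC P G_group _ iR.
Let GI := @G_inv _ _ _ toC P G_group _ iR.
Let GT := @G_tr _ _ _ toC P G_self_adjoint _ iR.

Definition Wr (v : 'cV[R]_d) : 'rV[R]_n := (map_mx intr W *m v)^T.
Definition Hm (v : 'cV[R]_d) : 'M[R]_n := cR^T *m diag_mx (Wr v) *m cR.

Lemma Hm_linear : linear Hm.
Proof.
move=> a u v; rewrite /Hm /Wr mulmxDr -scalemxAr !linearP /= mulmxDl.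
by rewrite -scalemxAl.
Qed.

Lemma Hm0 : Hm 0 = 0.
Proof. by rewrite /Hm /Wr mulmx0 trmx0 linear0 mulmx0 mul0mx. Qed.

Lemma HmZ a v : Hm (a *: v) = a *: Hm v.
Proof. by have := Hm_linear a v 0; rewrite Hm0 !addr0. Qed.

Lemma HmB u v : Hm (u - v) = Hm u - Hm v.
Proof. by rewrite addrC -scaleN1r Hm_linear scaleN1r addrC. Qed.

Lemma Hm_sym v : (Hm v)^T = Hm v.
Proof. by rewrite /Hm !trmx_mul trmxK tr_diag_mx mulmxA. Qed.

Definition expv (v : 'cV[R]_d) : 'rV[R]_d := \row_j expR (v j 0).

Lemma expv_pos v : pos_row (expv v).
Proof. by move=> j; rewrite mxE expR_gt0. Qed.

Lemma expR_int (x : R) (z : int) : expR x ^ z = expR (z%:~R * x).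
Proof.
case: z => m; first by rewrite -exprnP -expRM_natl pmulrn.
by rewrite NegzE -exprnN -expRM_natl -expRN mulrNz mulNr pmulrn.
Qed.

Lemma mon_expv v e : mon (expv v) e = expR ((map_mx intr e *m v) 0 0).
Proof.
rewrite monE mxE expR_sum; apply: eq_bigr => j _.
by rewrite !mxE expR_int.
Qed.

Lemma tw_expv v : tw W (expv v) = \row_a expR (Wr v 0 a).
Proof.
apply/rowP => a; rewrite twE mon_expv [RHS]mxE /Wr; congr expR.
by rewrite map_row -row_mul [LHS]mxE [RHS]mxE.
Qed.

Lemma mexp_Hm v : mexp (Hm v) = T (expv v).
Proof. by rewrite /Hm mexp_diag // tmatE tw_expv. Qed.

Lemma pos_expv (x : 'rV[R]_d) : pos_row x -> exists v, x = expv v.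
Proof.
move=> x0; exists (\col_j ln (x 0 j)); apply/rowP => j; rewrite !mxE lnK //.
exact: x0.
Qed.

(** A one-parameter group in [A] is diagonal in the basis [c], hence so is its derivative at 0; the
    value at t = 1 and injectivity of the exponential determine the diagonal. *)
Lemma lie_A H : Lie (A_points Q iR) H <-> exists v, H = Hm v.
Proof.
split=> [HL|[v ->] t]; last first.
  apply/(A_pointsP D QT iR); exists (expv (t *: v)); first exact: expv_pos.
  by rewrite -HmZ mexp_Hm.
have offdiag a b : a != b -> (cR *m H *m cR^T) a b = 0.
  move=> ab; have := is_derive_mexp H cR cR^T 0 a b; rewrite scale0r mexp0 mulmx1.
  have -> : (fun t => (cR *m mexp (t *: H) *m cR^T) a b) = cst 0.
    apply/funext => t; have /(A_pointsP D QT iR)[x _ ->] := HL t.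
    by rewrite (tmatK cc) mxE (negPf ab).
  by move=> DH; rewrite -(@derive_val _ _ _ _ _ _ _ DH) derive_cst.
pose xi : 'rV[R]_n := \row_a (cR *m H *m cR^T) a a.
have HE : H = cR^T *m diag_mx xi *m cR.
  rewrite -(conjcKV iR cc H); congr (_ *m _ *m _); apply/matrixP => a b.
  by rewrite [RHS]mxE; case: eqVneq => [->|/offdiag]; rewrite ?mxE.
have /(A_pointsP D QT iR)[x x0 Ex] := HL 1; have [v xv] := pos_expv x0.
exists v; rewrite HE /Hm; congr (_ *m diag_mx _ *m _); apply/rowP => a.
rewrite scale1r HE mexp_diag // xv -tmatE in Ex.
move: Ex => /(tmat_inj cc); rewrite tw_expv => /rowP/(_ a).
by rewrite [LHS]mxE [RHS]mxE => /expR_inj.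
Qed.

HB.instance Definition _ := GRing.isLinear.Build R _ _ _ Hm Hm_linear.

Lemma lie_aP H : H \in lie_a iR Q <-> exists v, H = Hm v.
Proof.
have ex : exists U : {vspace 'M[R]_n}, [set` U] = Lie (A_points Q iR).
  exists (limg (linfun Hm)); apply/seteqP; split=> X /=.
    by move=> /memv_imgP[v _ ->]; rewrite lfunE; apply/lie_A; exists v.
  by move=> /lie_A[v ->]; rewrite -(lfunE Hm) memv_img ?memvf.
have [U HU] := ex; have := @xgetPex _ 0%VS [set U : {vspace 'M[R]_n} | [set` U] =
  Lie (A_points Q iR)] ex; rewrite -/(lie_a iR Q) /= => HL.
by rewrite -lie_A -HL.
Qed.

Lemma Hm_in v : Hm v \in lie_a iR Q. Proof. by apply/lie_aP; exists v. Qed.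

Definition pair (b : 'rV[int]_d) (v : 'cV[R]_d) : R := (map_mx intr b *m v) 0 0.

Lemma pairZ b t v : pair b (t *: v) = t * pair b v.
Proof. by rewrite /pair -scalemxAr mxE. Qed.

Lemma pair_delta b j : pair b (delta_mx j 0) = (b 0 j)%:~R.
Proof. by rewrite /pair -colE !mxE. Qed.

Lemma pairB b b' v : pair (b - b') v = pair b v - pair b' v.
Proof. by rewrite /pair map_mxB mulmxBl [LHS]mxE [X in _ + X]mxE. Qed.

Lemma Hm_bracket_entry v X a a' :
  (cR *m (Hm v *m X - X *m Hm v) *m cR^T) a a' =
  pair (dwt W (a, a')) v * (cR *m X *m cR^T) a a'.
Proof.
have E1 : cR *m (Hm v *m X) *m cR^T = diag_mx (Wr v) *m (cR *m X *m cR^T).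
  by rewrite /Hm !mulmxA ccR mul1mx.
have E2 : cR *m (X *m Hm v) *m cR^T = (cR *m X *m cR^T) *m diag_mx (Wr v).
  by rewrite /Hm -!mulmxA ccR mulmx1 !mulmxA.
rewrite mulmxBr mulmxBl E1 E2 mxE [X in _ + X]mxE mul_diag_mx mul_mx_diag.
rewrite [X in X - _]mxE [X in _ - X]mxE [X in _ - X]mulrC -mulrBl; congr (_ * _).
rewrite pairB; congr (_ - _); rewrite /Wr [LHS]mxE /pair map_row -row_mul.
  by rewrite [RHS]mxE.
by rewrite [RHS]mxE.
Qed.

Lemma conj_inj (X Y : 'M[R]_n) : cR *m X *m cR^T = cR *m Y *m cR^T -> X = Y.
Proof. by move=> E; rewrite -(conjcKV iR cc X) E (conjcKV iR cc). Qed.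

Lemma has_weight_bracket b X : has_weight iR c W b X <->
  forall v, Hm v *m X - X *m Hm v = pair b v *: X.
Proof.
split=> [HX v|H [a a'] /= ne0].
  apply: conj_inj; apply/matrixP => a a'; rewrite Hm_bracket_entry.
  rewrite -scalemxAr -scalemxAl [RHS]mxE.
  have [->|/(HX (a, a'))->//] := eqVneq ((cR *m X *m cR^T) a a') 0.
  by rewrite !mulr0.
apply/rowP => j; apply: (@intr_inj R); rewrite -!pair_delta.
have := congr1 (fun M => (cR *m M *m cR^T) a a') (H (delta_mx j 0)).
rewrite Hm_bracket_entry -scalemxAr -scalemxAl [RHS]mxE.
exact: (mulIf ne0).
Qed.

(** [b] is the coordinate vector of [alpha]; unlike the linear form, it makes sense over every
    field. *)
Definition rep (alpha : dual_a iR Q) b :=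
  forall v, alpha (vsproj (lie_a iR Q) (Hm v)) = pair b v.

Lemma root_space_rep alpha b : rep alpha b -> b != 0 ->
  root_space P alpha = gb P c W iR b.
Proof.
move=> Hr b0; apply/seteqP; split=> X.
  move=> [lX HX]; have wX : has_weight iR c W b X.
    by apply/has_weight_bracket => v; rewrite HX ?Hm_in // Hr.
  split=> //; have := lX 1; rewrite scale1r mexp_nilpotent //.
  exact: (has_weight_nilpotent cc b0 wX).
move=> gX; split=> [t|H /lie_aP[v ->]].
  have [wX GX] := gbZ cc G1 GM t b0 gX.
  by rewrite /= mexp_nilpotent //; apply: (has_weight_nilpotent cc b0 wX).
by case: gX => /has_weight_bracket wX _; rewrite Hr wX.
Qed.

Lemma rep_eq0 alpha b : rep alpha b -> (alpha == 0) = (b == 0).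
Proof.
move=> Hr; apply/eqP/eqP => [a0|b0].
  apply/rowP => j; apply: (@intr_inj R); rewrite -pair_delta -Hr a0 lfunE /=.
  by rewrite mxE.
apply/lfunP => u; rewrite lfunE /= -[u]vsvalK; have /lie_aP[v ->] := subvsP u.
by rewrite Hr b0 /pair map_mx0 mul0mx mxE.
Qed.

Lemma rep_uniq alpha alpha' b : rep alpha b -> rep alpha' b -> alpha = alpha'.
Proof.
move=> Hr Hr'; apply/lfunP => u; rewrite -[u]vsvalK; have /lie_aP[v ->] := subvsP u.
by rewrite Hr Hr'.
Qed.

Lemma root_rep alpha : root_system P alpha ->
  exists b, [/\ b \in wts W, b != 0, rep alpha b & exists2 X, gb P c W iR b X & X != 0].
Proof.
move=> [a0 /eqP rs0]; have [X HX X0] : exists2 X, root_space P alpha X & X != 0.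
  apply: contrapT => HN; apply: rs0; apply/seteqP; split=> X.
    by move=> HX; apply: contrapT => /eqP X0; apply: HN; exists X.
  move=> ->; split=> [t|H _]; last by rewrite mulmx0 mul0mx subrr scaler0.
  by rewrite scaler0 /= mexp0.
have [ab ne0] : exists ab, (cR *m X *m cR^T) ab.1 ab.2 != 0.
  apply: contrapT => HN; move/eqP: X0; apply; apply: conj_inj.
  rewrite mulmx0 mul0mx; apply/matrixP => a a'; rewrite [RHS]mxE; apply/eqP.
  by apply: contraT => H; case: HN; exists (a, a').
have Hr : rep alpha (dwt W ab).
  move=> v; have [_ /(_ _ (Hm_in v))] := HX.
  move=> /(congr1 (fun M => (cR *m M *m cR^T) ab.1 ab.2)).
  rewrite Hm_bracket_entry -scalemxAr -scalemxAl [RHS]mxE => /(mulIf ne0) <-.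
  by case: ab {ne0}.
have b0 : dwt W ab != 0 by rewrite -(rep_eq0 Hr).
exists (dwt W ab); split=> //.
  by rewrite mem_undup map_f // mem_enum inE.
by exists X => //; rewrite -(root_space_rep Hr b0).
Qed.

Lemma rep_root alpha b X : rep alpha b -> b != 0 -> gb P c W iR b X -> X != 0 ->
  root_system P alpha.
Proof.
move=> Hr b0 gX X0; split; first by rewrite (rep_eq0 Hr).
apply/eqP => E; move: gX; rewrite -(root_space_rep Hr b0) E => /= X0'.
by rewrite X0' eqxx in X0.
Qed.

(** The left inverse [B] reads v off the diagonal of [Hm v], so b defines a linear form. *)
Lemma rep_exists b : exists alpha, rep alpha b.
Proof.
pose V (u : subvs_of (lie_a iR Q)) : 'cV[R]_d := map_mx intr B *m
  \col_a (cR *m vsval u *m cR^T) a a.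
pose f (u : subvs_of (lie_a iR Q)) : R^o := pair b (V u).
have flin : linear f.
  move=> a u v; have vE : vsval (a *: u + v) = a *: vsval u + vsval v by rewrite linearP.
  have E : \col_l (cR *m vsval (a *: u + v) *m cR^T) l l =
      a *: (\col_l (cR *m vsval u *m cR^T) l l) + \col_l (cR *m vsval v *m cR^T) l l.
    apply/colP => l; rewrite vE mulmxDr mulmxDl -scalemxAr -scalemxAl.
    by move: (cR *m vsval u *m _) (cR *m vsval v *m _) => M N; rewrite !mxE.
  by rewrite /f /V E /pair !mulmxDr -!scalemxAr [LHS]mxE [X in X + _]mxE.
pose fl := GRing.isLinear.Build R _ _ _ f flin.
pose F : {linear subvs_of (lie_a iR Q) -> R^o} := HB.pack f fl.
exists (linfun F) => v; rewrite lfunE /= /f /V vsprojK ?Hm_in //.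
congr (pair b _); apply/colP => j; have -> : \col_a (cR *m Hm v *m cR^T) a a =
    map_mx intr W *m v.
  apply/colP => a; rewrite [LHS]mxE /Hm (conjcK iR cc) mxE eqxx mulr1n /Wr [LHS]mxE.
  by [].
by rewrite mulmxA -map_mxM BW map_mx1 mul1mx.
Qed.

Lemma repN alpha b : rep alpha b -> rep (- alpha) (- b).
Proof. by move=> Hr v; rewrite lfunE /= Hr /pair map_mxN mulNmx [RHS]mxE. Qed.

Lemma repMn alpha b m : rep alpha b -> rep (alpha *+ m) (b *+ m).
Proof.
move=> Hr v; elim: m => [|m IHm]; first by rewrite !mulr0n lfunE /= /pair map_mx0 mul0mx mxE.
by rewrite !mulrSr lfunE /= IHm Hr /pair map_mxD mulmxDl [RHS]mxE.
Qed.

Lemma finite_roots : finite_set (root_system (iR := iR) (Q := Q) P).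
Proof.
pose g b : dual_a iR Q := xget 0 [set alpha | rep alpha b].
apply: (@sub_finite_set _ _ (g @` [set` wts W])).
  move=> alpha /root_rep[b [bw _ Hr _]]; exists b => //=.
  apply: (rep_uniq _ Hr); apply: (@xgetPex _ 0 [set alpha | rep alpha b]).
  by exists alpha.
exact: finite_image (finite_seq _).
Qed.

Lemma mexp_commute (A X : 'M[R]_n) s : A *m X = X *m A ->
  A *m mexp (s *: X) = mexp (s *: X) *m A.
Proof.
move=> AX; have pw k : A *m X ^+ k *m 1%:M = 1%:M *m X ^+ k *m A.
  by rewrite mul1mx mulmx1; apply: (@commrX 'M[R]_n A X k).
have E : A *m mexp (s *: X) *m 1%:M = 1%:M *m mexp (s *: X) *m A.
  apply/matrixP => a b; rewrite !mexp_mulE; congr (limn (pseries _ _)).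
  by apply/funext => k; rewrite /mexp_coeff pw.
by rewrite -[LHS]mulmx1 E mul1mx.
Qed.

Lemma mexp_zeros Z t : dlie GR Z -> GR (mexp (t *: Z)).
Proof.
move=> HZ; apply: zeros_vanish => p Hp; rewrite -(mul1mx (mexp _)).
exact: (dlie_mexp HZ t G1 Hp).
Qed.

Lemma mexp_sym_half (Z : 'M[R]_n) t : Z^T = Z ->
  mexp ((t / 2) *: Z) *m (mexp ((t / 2) *: Z))^T = mexp (t *: Z).
Proof.
move=> ZT; have [] := @sym_simultaneous_diag R n [set Z]; rewrite //=.
- by move=> s ->.
- by move=> s s' -> ->.
move=> c0 cc0 /(_ _ erefl)[e ->].
have E s : mexp (s *: (c0^T *m diag_mx e *m c0)) =
    c0^T *m diag_mx (\row_a expR (s * e 0 a)) *m c0.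
  rewrite scalemxAl scalemxAr -linearZ mexp_diag //; congr (_ *m diag_mx _ *m _).
  by apply/rowP => a; rewrite !mxE.
rewrite !E !trmx_mul trmxK tr_diag_mx !mulmxA.
rewrite -(mulmxA (c0^T *m _) c0) cc0 mulmx1 -(mulmxA c0^T) -diag_hmul.
congr (_ *m diag_mx _ *m _); apply/rowP => a; rewrite hmulE !mxE -expRD.
by congr expR; field.
Qed.

(** exp(tZ) is h h^T for h = exp(tZ/2) in [G], and it commutes with the torus; maximality puts it in
    [A] for every t. *)
Lemma dlie_sym_torus Z : dlie GR Z -> Z^T = Z ->
  (forall x : 'rV[R]_d, pos_row x -> Z *m T x = T x *m Z) -> exists v, Z = Hm v.
Proof.
move=> HZ ZT ZC; apply/lie_A => t; rewrite /= -(mexp_sym_half t ZT).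
apply/(A_pointsP D QT iR).
apply: (torus_maximality_ext G_group G_self_adjoint S_torus S_symmetric D QT).
  exact: (mexp_zeros (t / 2) HZ).
move=> x x0; rewrite mexp_sym_half //; apply/esym/mexp_commute/esym.
exact: ZC.
Qed.

Definition dotW (u v : 'cV[R]_d) : R := \sum_a Wr u 0 a * Wr v 0 a.

Lemma tr_Hm u v : \tr (Hm u *m Hm v) = dotW u v.
Proof.
rewrite /Hm !mulmxA -(mulmxA (cR^T *m _) cR) ccR mulmx1 -(mulmxA cR^T) mulmx_diag.
rewrite -mulmxA mxtrace_mulC -mulmxA ccR mulmx1 mxtrace_diag.
by apply: eq_bigr => a _; rewrite mxE.
Qed.

Lemma WrK v : map_mx intr B *m (Wr v)^T = v.
Proof. by rewrite /Wr trmxK mulmxA -map_mxM BW map_mx1 mul1mx. Qed.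

Lemma dotW_eq0 u : dotW u u = 0 -> u = 0.
Proof.
move=> /eqP; rewrite psumr_eq0 => [/allP H|a _]; last by rewrite -expr2 sqr_ge0.
rewrite -(WrK u); suff -> : Wr u = 0 by rewrite trmx0 mulmx0.
apply/rowP => a; have := H a (mem_index_enum _).
by rewrite -expr2 sqrf_eq0 [RHS]mxE => /eqP.
Qed.

Lemma dotW_ge0 u : 0 <= dotW u u.
Proof. by apply: sumr_ge0 => a _; rewrite -expr2 sqr_ge0. Qed.

Lemma dotWZBl t u v w : dotW (u - t *: v) w = dotW u w - t * dotW v w.
Proof.
by rewrite -!tr_Hm HmB HmZ mulmxBl -scalemxAl linearB linearZ.
Qed.

(** The bracket is symmetric of weight 0, so it lies in the Lie algebra of the torus, and invariance
    of the trace form computes its products with that algebra. *)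
Lemma bracket_torus b X : b != 0 -> gb P c W iR b X ->
  exists2 v, X *m X^T - X^T *m X = Hm v &
    forall u, dotW v u = pair b u * \tr (X *m X^T).
Proof.
move=> b0 gX; have [wX dX] := (gb_dlie W cc G1 GM X b0).1 gX.
have wXT : has_weight iR c W (- b) X^T by apply: has_weight_tr.
have w0 : has_weight iR c W 0 (X *m X^T - X^T *m X).
  apply: has_weightD; first by rewrite -(subrr b); apply: (has_weightM cc).
  by apply: has_weightN; rewrite -(subrr b) addrC; apply: (has_weightM cc).
have dXT := dlie_tr GM GU GI GT dX.
have [] := @dlie_sym_torus (X *m X^T - X^T *m X) (dlie_bracket dX dXT).
- by rewrite linearB /= !trmx_mul trmxK.
- move=> x x0; have := weight_torus cc w0 (gt0_nz x0).
  by rewrite mon0 scale1r.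
move=> v E; exists v => // u; rewrite -tr_Hm -E.
have /has_weight_bracket Hb := wX.
have : \tr ((Hm u *m X - X *m Hm u) *m X^T) = pair b u * \tr (X *m X^T).
  by rewrite Hb -scalemxAl mxtraceZ.
move=> <-; rewrite !mulmxBl !linearB /=; congr (_ - _).
  by rewrite [LHS]mxtrace_mulC mulmxA.
by rewrite -[X in \tr X = _]mulmxA [LHS]mxtrace_mulC.
Qed.

(** By [bracket_torus] all brackets are multiples of one vector v1, normalized by b(v1) = 2, which
    has integral eigenvalues by [wmat_torus]. Since the trace form pairs v1 with u to b(u) |v1|^2 /
    2, the multiple is 2 |X|^2 / |v1|^2. *)
Lemma coroot b X0 : b != 0 -> gb P c W iR b X0 -> X0 != 0 ->
  exists nu : 'cV[int]_d, [/\ (b *m nu) 0 0 = 2, 0 < \sum_a ((W *m nu) a 0) ^+ 2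
    & forall X, gb P c W iR b X -> X *m X^T - X^T *m X =
      (2 / (\sum_a ((W *m nu) a 0) ^+ 2)%:~R * \tr (X *m X^T)) *: hmat iR c W nu].
Proof.
move=> b0 gX0 X00; have [v0 Ev0 dv0] := bracket_torus b0 gX0.
have q0 := mxtr_sq_gt0 X00.
have pv0 : 0 < pair b v0.
  have := dotW_ge0 v0; rewrite dv0 pmulr_lge0 // le_eqVlt => /orP[/eqP p0|//].
  have v00 : v0 = 0 by apply: dotW_eq0; rewrite dv0 -p0 mul0r.
  case/eqP: b0; apply/rowP => j; apply: (@intr_inj R); rewrite -pair_delta.
  apply: (mulIf (lt0r_neq0 q0)); rewrite -dv0 v00 -tr_Hm Hm0 mul0mx mxtrace0.
  by rewrite [in RHS]mxE mul0r.
pose s := Num.sqrt (2 / pair b v0); have s2 : s ^+ 2 = 2 / pair b v0.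
  by rewrite sqr_sqrtr // divr_ge0 // ltW.
have [Xw _] := gX0; have gX1 := gbZ cc G1 GM s b0 gX0.
pose X1 := s *: X0; pose v1 := s ^+ 2 *: v0.
have E1 : X1 *m X1^T - X1^T *m X1 = Hm v1.
  rewrite /X1 linearZ /= -!scalemxAl -!scalemxAr !scalerA -expr2 -scalerBr Ev0.
  by rewrite -HmZ.
have p1 : pair b v1 = 2 by rewrite pairZ s2 divfK // gt_eqF.
have w1 : has_weight iR c W b X1 by case: gX1.
have /has_weight_bracket hX1 := w1.
have Xn := has_weight_nilpotent cc b0 w1.
have [kk Hkk _] := @wmat_torus R n X1 (Hm v1) cR (Wr v1) ccR Xn E1
  (etrans (hX1 v1) (congr1 (fun z => z *: X1) p1)) erefl.
pose nu : 'cV[int]_d := B *m \col_a kk a.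
have Wk : Wr v1 = (map_mx intr (\col_a kk a))^T.
  by apply/rowP => a; rewrite Hkk !mxE.
have nuE : map_mx intr nu = v1 by rewrite map_mxM -[RHS]WrK Wk trmxK.
have WE a : (((W *m nu) a 0)%:~R : R) = Wr v1 0 a.
  by rewrite /Wr -nuE -map_mxM [RHS]mxE [RHS]mxE.
have hE : hmat iR c W nu = Hm v1.
  by rewrite /hmat /Hm; congr (_ *m diag_mx _ *m _); apply/rowP => a; rewrite mxE WE.
have mE : (\sum_a ((W *m nu) a 0) ^+ 2)%:~R = dotW v1 v1.
  by rewrite rmorph_sum; apply: eq_bigr => a _; rewrite /= rmorphXn /= WE.
have [v1' Ev1 dv1] := bracket_torus b0 gX1.
have v1E : v1' = v1.
  have : Hm v1' = Hm v1 by rewrite -Ev1 -E1.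
  move=> Eh; apply/eqP; rewrite -subr_eq0; apply/eqP/dotW_eq0.
  by rewrite -tr_Hm HmB Eh subrr mul0mx mxtrace0.
rewrite {}v1E {v1' Ev1} in dv1.
have q1 : 0 < \tr (X1 *m X1^T).
  rewrite /X1 linearZ /= -scalemxAl -scalemxAr !scalerA mxtraceZ -expr2 s2.
  by rewrite mulr_gt0 // divr_gt0.
have m0 : 0 < dotW v1 v1 by rewrite dv1 p1 mulr_gt0.
exists nu; split.
- apply: (@intr_inj R); rewrite -[RHS]p1 /pair -nuE -map_mxM.
  by rewrite [RHS]mxE.
- by rewrite -(ltr0z R) mE.
move=> X gX; have [v -> dv] := bracket_torus b0 gX.
rewrite mE hE -HmZ; congr Hm; apply/eqP; rewrite -subr_eq0; apply/eqP/dotW_eq0.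
rewrite dotWZBl dv dv1 dv1 p1; field.
by rewrite gt_eqF.
Qed.

End RealRoots.

(** * The Cartan decomposition *)

Lemma orth_entry_le1 (L : realDomainType) n (X : 'M[L]_n) a b :
  X *m X^T = 1%:M -> `|X a b| <= 1.
Proof.
move=> XX; rewrite -(@ler_pXn2r _ 2) ?nnegrE // expr1n real_normK ?num_real //.
have := congr1 (fun M : 'M[L]_n => M a a) XX; rewrite mxE [RHS]mxE eqxx mulr1n => <-.
rewrite (bigD1 b) //= mxE -expr2 lerDl; apply: sumr_ge0 => l _.
by rewrite mxE -expr2 sqr_ge0.
Qed.

(** * Maxima on the orthogonal part and symmetric logarithms *)

Section Extremum.
Variables (R : realType) (n : nat).
Local Notation EP := (entry_poly R n).
Local Notation pv y p := (pev (idfun : {rmorphism R -> R}) y p).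

Lemma pev_continuous (k : fieldType) (i : {rmorphism k -> R}) (p : entry_poly k n) :
  continuous (fun v : 'rV[R]_(n * n) => pev i (vec_mx v) p).
Proof.
elim/mpoly_alg_ind: p => [a|j|p q Hp Hq|p q Hp Hq] v.
- have -> : (fun v : 'rV[R]_(n * n) => pev i (vec_mx v) (mpoly.mpolyC _ a)) = fun=> i a.
    by apply/funext => w; rewrite pev_const.
  exact: cst_continuous.
- have -> : (fun v : 'rV[R]_(n * n) => pev i (vec_mx v) (mX k j)) = fun w => w 0 j.
    by apply/funext => w; rewrite pev_var vec_mxK.
  exact: coord_continuous.
- have -> : (fun v : 'rV[R]_(n * n) => pev i (vec_mx v) (p + q)) =
      (fun w => pev i (vec_mx w) p + pev i (vec_mx w) q).
    by apply/funext => w; rewrite rmorphD.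
  by apply: continuousD; [exact: Hp|exact: Hq].
have -> : (fun v : 'rV[R]_(n * n) => pev i (vec_mx v) (p * q)) =
    (fun w => pev i (vec_mx w) p * pev i (vec_mx w) q).
  by apply/funext => w; rewrite rmorphM.
by apply: continuousM; [exact: Hp|exact: Hq].
Qed.

Lemma orth_polyE (y : 'M[R]_n) a b :
  pv y ((genmx R n *m (genmx R n)^T) a b) = (y *m y^T) a b.
Proof.
rewrite [in LHS]mxE rmorph_sum [RHS]mxE; apply: eq_bigr => l _.
have E u w : pv y (genmx R n u w) = y u w.
  by have := congr1 (fun M : 'M[R]_n => M u w) (pev_genmx idfun y) => <-; rewrite [RHS]mxE.
by rewrite rmorphM [(genmx R n)^T l b]mxE [y^T l b]mxE !E.
Qed.

(** The orthogonal elements of the group form a closed set with entries bounded by 1, hence a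
    compact one. *)
Lemma orth_max (k : fieldType) (i : {rmorphism k -> R}) (P : seq (entry_poly k n)) (q : EP) :
  zeros i P 1%:M -> exists2 y, zeros i P y /\ y *m y^T = 1%:M &
  forall z, zeros i P z -> z *m z^T = 1%:M -> pv z q <= pv y q.
Proof.
move=> P1; pose A : set 'rV[R]_(n * n) :=
  [set v | zeros i P (vec_mx v) /\ vec_mx v *m (vec_mx v)^T = 1%:M].
have AE : A = (\bigcap_(p in [set` P]) (fun v => pev i (vec_mx v) p) @^-1` [set x | x = 0]) `&`
   (\bigcap_(ab in [set: 'I_n * 'I_n])
     (fun v => pv (vec_mx v) ((genmx R n *m (genmx R n)^T) ab.1 ab.2)) @^-1`
       [set x | x = (1%:M : 'M[R]_n) ab.1 ab.2]).
  apply/seteqP; split=> v [H1 H2]; split.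
  - by move=> p pP; apply: H1.
  - by move=> ab _; rewrite /= orth_polyE H2.
  - by move=> p pP; apply: H1.
  - by apply/matrixP => a b; have := H2 (a, b) I; rewrite /= orth_polyE.
have Aclosed : closed A.
  rewrite AE; apply: closedI; apply: closed_bigI => p _.
    by apply: preimage_closed; [move=> v _; exact: pev_continuous|exact: closed_eq].
  by apply: preimage_closed; [move=> v _; exact: pev_continuous|exact: closed_eq].
have Abounded : bounded_set A.
  exists 1; split=> // M M1 v [_ Hv]; apply: le_trans (ltW M1).
  rewrite /Num.Def.normr /= mx_normrE; apply: bigmax_le => // -[u j] _ /=.
  rewrite (ord1 u); case/mxvec_indexP: j => a b.
  by have := orth_entry_le1 a b Hv; rewrite mxE.
have A0 : A !=set0 by exists (mxvec 1%:M); rewrite /A /= mxvecK trmx1 mulmx1.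
have [v] := compact_EVT_max A0 (bounded_closed_compact Abounded Aclosed)
  (continuous_subspaceT (@pev_continuous R idfun q)).
rewrite inE => Av Hv; exists (vec_mx v) => // z Pz zz.
by have := Hv (mxvec z); rewrite mxvecK; apply; rewrite inE /A /= mxvecK.
Qed.

(** For symmetric [H], the function y -> tr (y X y^T H) as a polynomial, so that [dop]
    differentiates it along the group. *)
Definition trace_poly (X H : 'M[R]_n) : EP :=
  \sum_a \sum_b (genmx R n *m constmx n X) a b * (constmx n H *m genmx R n) a b.

Lemma pev_genC' (y H : 'M[R]_n) a b : pv y ((constmx n H *m genmx R n) a b) = (H *m y) a b.
Proof.
have := congr1 (fun M : 'M[R]_n => M a b) (map_mxM (pev idfun y) (constmx n H) (genmx R n)).
rewrite mxE => ->; rewrite pev_genmx pev_constmx.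
by congr ((_ *m _) a b); apply/matrixP => u w; rewrite mxE.
Qed.

Lemma pev_trace_poly y X H : H^T = H -> pv y (trace_poly X H) = \tr (y *m X *m y^T *m H).
Proof.
move=> HT; rewrite rmorph_sum -mulmxA -{2}HT -trmx_mul; apply: eq_bigr => a _.
rewrite rmorph_sum [RHS]mxE; apply: eq_bigr => b _.
by rewrite rmorphM pev_genC pev_genC' [(H *m y)^T b a]mxE.
Qed.

Lemma dop_genC' (Z H : 'M[R]_n) a b : dop Z ((constmx n H *m genmx R n) a b) =
  (constmx n H *m (genmx R n *m constmx n Z)) a b.
Proof.
rewrite [X in dop Z X]mxE dop_sum [RHS]mxE; apply: eq_bigr => l _.
by rewrite dopM [constmx n H a l]mxE dop_const mul0r add0r dop_gen.
Qed.

Lemma pev_dop_trace_poly Z X H : H^T = H ->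
  pv 1%:M (dop Z (trace_poly X H)) = \tr (Z *m X *m H) + \tr (X *m Z^T *m H).
Proof.
move=> HT; have -> : Z *m X *m H = Z *m X *m H^T by rewrite HT.
have -> : X *m Z^T *m H = X *m (H *m Z)^T by rewrite trmx_mul HT mulmxA.
have E a b : pv 1%:M (dop Z ((genmx R n *m constmx n X) a b *
    (constmx n H *m genmx R n) a b)) =
    (Z *m X) a b * H^T b a + X a b * (H *m Z)^T b a.
  have HZ : pv 1%:M ((constmx n H *m (genmx R n *m constmx n Z)) a b) = (H *m Z)^T b a.
    rewrite [RHS]mxE; have := congr1 (fun M : 'M[R]_n => M a b)
      (map_mxM (pev idfun 1%:M) (constmx n H) (genmx R n *m constmx n Z)).
    rewrite mxE => ->; rewrite map_mxM pev_genmx !pev_constmx mul1mx.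
    by congr ((_ *m _) a b); apply/matrixP => u w; rewrite mxE.
  have E1 Y : pv 1%:M ((genmx R n *m constmx n Y) a b) = Y a b by rewrite pev_genC mul1mx.
  have E2 : pv 1%:M ((constmx n H *m genmx R n) a b) = H^T b a.
    by rewrite pev_genC' mulmx1 [RHS]mxE.
  rewrite pev_dopM dop_genC dop_genC'.
  exact: (congr2 +%R (congr2 *%R (E1 (Z *m X)) E2) (congr2 *%R (E1 X) HZ)).
have Ea a : pv 1%:M (dop Z (\sum_b (genmx R n *m constmx n X) a b *
    (constmx n H *m genmx R n) a b)) = (Z *m X *m H^T) a a + (X *m (H *m Z)^T) a a.
  rewrite dop_sum rmorph_sum (eq_bigr _ (fun b _ => E a b)) big_split.
  by rewrite [(Z *m X *m H^T) a a]mxE [(X *m (H *m Z)^T) a a]mxE.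
by rewrite /trace_poly dop_sum rmorph_sum (eq_bigr _ (fun a _ => Ea a)) big_split.
Qed.

Lemma mexp_sym_conj (X k : 'M[R]_n) : X^T = X -> k *m k^T = 1%:M ->
  mexp (k *m X *m k^T) = k *m mexp X *m k^T.
Proof.
move=> XT kk; have [] := @sym_simultaneous_diag R n [set X]; rewrite //=.
- by move=> s ->.
- by move=> s s' -> ->.
move=> c0 cc0 /(_ _ erefl)[e ->].
have kk' : k^T *m k = 1%:M by apply: mulmx1C.
have cck : (c0 *m k^T) *m (c0 *m k^T)^T = 1%:M.
  by rewrite trmx_mul trmxK -mulmxA (mulmxA k^T) kk' mul1mx.
have E z : k *m (c0^T *m diag_mx z *m c0) *m k^T =
    (c0 *m k^T)^T *m diag_mx z *m (c0 *m k^T) by rewrite trmx_mul trmxK !mulmxA.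
by rewrite E !mexp_diag // E.
Qed.

(* A one-parameter subgroup that meets an algebraic group in all its natural
   powers is contained in it, exponentials with different exponents being
   independent. *)
Lemma sym_log (k : fieldType) (i : {rmorphism k -> R}) (P : seq (entry_poly k n)) h :
  zeros i P 1%:M -> (forall g g', zeros i P g -> zeros i P g' -> zeros i P (g *m g')) ->
  h \in unitmx -> zeros i P (h *m h^T) ->
  exists X, [/\ dlie (zeros i P) X, X^T = X & mexp X = h *m h^T].
Proof.
move=> P1 PM hU Ph; have [] := @sym_simultaneous_diag R n [set h *m h^T]; rewrite //=.
- by move=> s ->; rewrite trmx_mul trmxK.
- by move=> s s' -> ->.
move=> c0 cc0 /(_ _ erefl)[e E].
have cU : c0 \in unitmx by case/mulmx1_unit: cc0.
have De : diag_mx e = (c0 *m h) *m (c0 *m h)^T.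
  by rewrite trmx_mul !mulmxA -(mulmxA c0 h) E !mulmxA cc0 mul1mx -mulmxA cc0 mulmx1.
have e0 a : 0 < e 0 a.
  have -> : e 0 a = \tr (row a (c0 *m h) *m (row a (c0 *m h))^T).
    have := congr1 (fun M : 'M[R]_n => M a a) De; rewrite mxE eqxx mulr1n => ->.
    by rewrite mxtr_sq big_ord1 mxE; apply: eq_bigr => l _; rewrite !mxE expr2.
  apply: mxtr_sq_gt0; apply/negP => /eqP r0.
  have : c0 *m h \in unitmx by rewrite unitmx_mul cU.
  rewrite -row_free_unit => /row_freeP[M HM].
  have := congr1 (row a) HM.
  rewrite row_mul r0 mul0mx => /rowP/(_ a); rewrite !mxE eqxx => /esym/eqP.
  by rewrite oner_eq0.
pose l : 'cV[R]_n := \col_a ln (e 0 a).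
pose X := c0^T *m diag_mx l^T *m c0.
have mX t : mexp (t *: X) = tmat c0 (idfun : {rmorphism R -> R}) (expv (t *: l)).
  rewrite /X scalemxAl scalemxAr -linearZ mexp_diag // tmatE.
  have -> : map_mx (idfun : {rmorphism R -> R}) c0 = c0 by apply/matrixP => u w; rewrite mxE.
  by congr (_ *m diag_mx _ *m _); apply/rowP => a; rewrite !mxE.
have X1 : mexp X = h *m h^T.
  rewrite -[X]scale1r mX tmatE E.
  have -> : map_mx (idfun : {rmorphism R -> R}) c0 = c0 by apply/matrixP => u w; rewrite mxE.
  by congr (_ *m diag_mx _ *m _); apply/rowP => a; rewrite !mxE mul1r lnK ?posrE ?e0.
have XN (m : nat) : zeros i P (mexp (m%:R *: X)).
  elim: m => [|m IHm]; first by rewrite scale0r mexp0.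
  have -> : mexp (m.+1%:R *: X) = mexp (m%:R *: X) *m mexp X.
    rewrite -{3}[X]scale1r !mX tmatM //; congr tmat; apply/rowP => a.
    by rewrite hmulE !mxE -expRD -mulrDl natr1.
  by apply: PM; rewrite ?X1.
exists X; split=> //; last by rewrite /X !trmx_mul trmxK tr_diag_mx mulmxA.
apply: lie_dlie => y t Gy; apply: zeros_vanish => p Hp.
pose q : EP := pcomp p (constmx n y *m genmx R n).
have qE A : pv A q = pval idfun p (y *m A).
  rewrite /q pev_comp map_mxM pev_constmx pev_genmx pevE.
  by congr (pval _ _ (_ *m _)); apply/matrixP => u w; rewrite mxE.
rewrite -qE mX pev_diag_restr.
set D := diag_restr c0 q; pose kap (m : mpoly.multinom n) : R := (map_mx intr (mrow m) *m l) 0 0.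
have monE' s m : mon (expv (s *: l)) (mrow m) = expR (s * kap m).
  by rewrite mon_expv -scalemxAr [in LHS]mxE.
have Z : forall kp : R, \sum_(m <- mpoly.msupp D | kap m == kp) mpoly.mcoeff m D = 0.
  apply: (@characters_independent_key nat addn R _ _ R kap
    (fun kp (j : nat) => expR (j%:R * kp))).
  - by move=> kp u w; rewrite natrD mulrDl expRD.
  - by move=> kp; exists 0; rewrite gt_eqF // expR_gt0.
  - by move=> u w _ _ /(congr1 (fun f => f 1%N)); rewrite !mul1r => /expR_inj.
  move=> j; have := Hp _ (PM _ _ Gy (XN j)); rewrite -qE mX pev_diag_restr -/D => Ej.
  by rewrite -[RHS]Ej; apply: eq_bigr => m _; rewrite monE'.
rewrite (sum_by_key _ kap) big1 // => kp _.
rewrite (eq_bigr (fun m => mpoly.mcoeff m D * expR (t * val kp))).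
  by rewrite -mulr_suml Z mul0r.
by move=> m /eqP <-; rewrite monE'.
Qed.

End Extremum.

(** * Critical points and maxima of the trace function *)

Section RealCartan.
Variables (K : rcfType) (C : numClosedFieldType) (toC : {rmorphism K -> C}).
Variables (n : nat) (P Q : seq (entry_poly K n)).
Hypothesis G_group : cgroup toC P.
Hypothesis G_self_adjoint : forall g, zeros toC P g -> zeros toC P g^T.
Hypothesis S_torus : cmaximal toC P Q.
Hypothesis S_symmetric : forall s, zeros toC Q s -> s = s^T.
Variables (d : nat) (c : 'M[K]_n) (W : 'M[int]_(n, d)) (B : 'M[int]_(d, n)).
Hypothesis D : torus_data c W B.
Hypothesis QT : zeros toC Q = zeros toC (torus_eqs c W B).
Variables (R : realType) (iR : {rmorphism K -> R}).
Local Notation cR := (map_mx iR c).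
Local Notation GR := (zeros iR P).
Local Notation T x := (tmat c iR (tw W x)).
Let cc : c *m c^T = 1%:M. Proof. by case: D. Qed.
Let G1 := G_one G_group iR.
Let GM := @G_mul _ _ _ toC P G_group _ iR.
Let GU := @G_unit _ _ _ toC P G_group _ iR.
Let GI := @G_inv _ _ _ toC P G_group _ iR.
Let GT := @G_tr _ _ _ toC P G_self_adjoint _ iR.

Local Notation Hm := (Hm c W iR).
Local Notation Hms := (Hm_sym c W iR).
Local Notation rep := (rep (Q := Q) (iR := iR) c W).
Local Notation gbR := (gb P c W iR).

Lemma orth_unit (L : fieldType) (k : 'M[L]_n) : k *m k^T = 1%:M -> invmx k = k^T.
Proof.
move=> kk; have [kU _] := mulmx1_unit kk.
by rewrite -[LHS]mulmx1 -kk mulKmx.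
Qed.

Variable (v0 : 'cV[R]_d).

Let GA (x : 'rV[R]_d) : nz x -> GR (T x).
Proof. by move=> nzx; apply: (A_sub_G S_torus D QT). Qed.

(* The derivative of [y |-> tr (y X y^T (Hm v0))] in the direction of the bracket
   [Z] of [X] and [Hm v0] is [tr (Z Z)], which is negative unless [Z = 0]. *)
Lemma critical_bracket X : dlie GR X -> X^T = X ->
  (forall y, GR y -> y *m y^T = 1%:M ->
     \tr (y *m X *m y^T *m Hm v0) <= \tr (X *m Hm v0)) ->
  X *m Hm v0 = Hm v0 *m X.
Proof.
move=> dX XT Hmax; pose H := Hm v0; have HT : H^T = H := Hms v0.
pose Z := X *m H - H *m X.
have dH : dlie GR H.
  apply: lie_dlie => y t Gy; apply: GM => //.
  by rewrite -HmZ (mexp_Hm D); apply: GA; apply: gt0_nz => j; apply: expv_pos.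
have dZ : dlie GR Z := dlie_bracket dX dH.
have ZT : Z^T = - Z.
  have E1 : (X *m H)^T = H *m X by rewrite trmx_mul HT XT.
  have E2 : (H *m X)^T = X *m H by rewrite trmx_mul HT XT.
  by rewrite /Z linearB /= E1 E2 opprB.
pose g (t : R) := pev (idfun : {rmorphism R -> R}) (1%:M *m mexp (t *: Z)) (trace_poly X H).
have gE t : g t = \tr (mexp (t *: Z) *m X *m (mexp (t *: Z))^T *m H).
  by rewrite /g mul1mx; apply: pev_trace_poly.
have g0 : g 0 = \tr (X *m H) by rewrite gE scale0r mexp0 trmx1 mul1mx mulmx1.
have Dg t := is_derive_pev Z 1%:M (trace_poly X H) t.
have D0 : is_derive (0 : R) 1 g 0.
  apply: (@derive1_at_max R g (-1) 1 0); first lra.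
  - by move=> t _; case: (Dg t).
  - by rewrite in_itv /=; lra.
  move=> t _; rewrite g0 gE; apply: Hmax; last exact: mexp_skew_orth.
  exact: (mexp_zeros G_group).
have trZ : \tr (Z *m Z) = 0.
  have := @derive_val _ _ _ _ _ _ _ (Dg 0).
  rewrite (@derive_val _ _ _ _ _ _ _ D0) scale0r mexp0 mulmx1 pev_dop_trace_poly //.
  move=> ->; rewrite ZT mulmxN mulNmx linearN /=.
  rewrite [X in _ = _ - X](_ : _ = \tr (Z *m H *m X)); last first.
    by rewrite -mulmxA [LHS]mxtrace_mulC.
  by rewrite {2}/Z mulmxBr !mulmxA linearB.
apply/eqP; rewrite -subr_eq0 -/Z; apply: contraT => Z0.
by have := mxtr_sq_gt0 Z0; rewrite ZT mulmxN linearN /= trZ oppr0 ltxx.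
Qed.

(** A nonzero component of weight b other than 0 is a root vector, so b(v0) is nonzero by
    regularity; but commutation with [Hm v0] forces b(v0) to vanish on the support of that
    component. *)
Lemma centralizer_regular X :
  (forall b X, b != 0 -> gbR b X -> X != 0 -> pair b v0 != 0) -> dlie GR X -> X *m Hm v0 = Hm v0 *m X ->
  has_weight iR c W 0 X.
Proof.
move=> v0_regular dX XC [a a'] /= ne0; have [->//|b0] := eqVneq (dwt W (a, a')) 0.
set b := dwt W (a, a') in b0 *.
have Hw : wcomp iR c W b X != 0.
  apply: contraNneq ne0 => w0; have := congr1 (fun M => (cR *m M *m cR^T) a a') w0.
  by rewrite /wcomp conjcK // mulmx0 mul0mx mxE eqxx [RHS]mxE => ->.
have dw : dlie GR (wcomp iR c W b X).
  apply: (dlie_wcomp cc GM GU GI _ b dX) => x x0; apply: GA.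
  by move=> j; rewrite mxE fmorph_eq0; apply: lt0r_neq0; apply: x0.
have gw : gbR b (wcomp iR c W b X).
  by apply/(gb_dlie W cc G1 GM _ b0); split; [exact: wcomp_weight|exact: dw].
have := Hm_bracket_entry D iR v0 X a a'; rewrite XC subrr mulmx0 mul0mx mxE => /esym/eqP.
by rewrite mulf_eq0 (negPf ne0) orbF (negPf (v0_regular _ _ b0 gw Hw)).
Qed.

(** Compare with conjugation by the orthogonal reflection w, which negates the coroot part of v: up
    to a positive factor, the difference of the two traces is b(v) b(v0). *)
Lemma max_dominant v b X : b != 0 -> gbR b X -> X != 0 -> 0 < pair b v0 ->
  (forall y, GR y -> y *m y^T = 1%:M ->
     \tr (y *m Hm v *m y^T *m Hm v0) <= \tr (Hm v *m Hm v0)) -> 0 <= pair b v.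
Proof.
move=> b0 gX X0 pb0 Hmax.
have [nu [bnu m0 Hq]] := coroot G_group G_self_adjoint S_torus S_symmetric D QT b0 gX X0.
set m := _%:~R in Hq; have m0' : 0 < m by rewrite ltr0z.
have q0 := mxtr_sq_gt0 X0.
pose s := Num.sqrt (m / (2 * \tr (X *m X^T))).
have s2 : s ^+ 2 = m / (2 * \tr (X *m X^T)).
  by rewrite sqr_sqrtr // divr_ge0 ?mulr_ge0 // ltW.
pose X1 := s *: X; have gX1 : gbR b X1 := gbZ cc G1 GM s b0 gX.
have X10 : X1 != 0.
  by rewrite scaler_eq0 negb_or X0 andbT -sqrf_eq0 s2 gt_eqF // divr_gt0 // mulr_gt0.
have E1 : X1 *m X1^T - X1^T *m X1 = hmat iR c W nu.
  rewrite /X1 linearZ /= -!scalemxAl -!scalemxAr !scalerA -expr2 -scalerBr Hq //.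
  rewrite scalerA s2 [X in X *: _](_ : _ = 1) ?scale1r //.
  by field; rewrite !gt_eqF.
have w1 : has_weight iR c W b X1 by case: gX1.
have hX1 := hmat_weight D bnu w1.
have [v1 Ev1 dv1] := bracket_torus G_group G_self_adjoint S_torus S_symmetric D QT b0 gX1.
have hE : hmat iR c W nu = Hm v1 by rewrite -E1.
have pv1 : pair b v1 = 2.
  have /(has_weight_bracket D)/(_ v1) := w1; rewrite -hE hX1.
  move=> /eqP; rewrite -subr_eq0 -scalerBl scaler_eq0 (negPf X10) orbF subr_eq0.
  by move=> /eqP <-.
have Xn := has_weight_nilpotent cc b0 w1.
pose w := wmat X1 1.
have Gw : GR w.
  have GX1 t : GR (nexp (t *: X1)) by case: (gbZ cc G1 GM t b0 gX1).
  have GY : GR (nexp ((- 1^-1) *: X1^T)).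
    by have := GT (GX1 (- 1^-1)); rewrite nexp_tr linearZ.
  exact: (GM (GM (GX1 1) GY) (GX1 1)).
have wwT : w *m w^T = 1%:M by apply: (wmat1_orth Xn E1 hX1).
(* Splits v into a multiple of the coroot and a vector [u] killed by b; the latter commutes with
   [X1] and its transpose, hence with w. *)
pose p := pair b v; pose u := v - (p / 2) *: v1.
have pu : pair b u = 0.
  have -> : pair b u = pair b v - (p / 2) * pair b v1.
    rewrite /pair /u mulmxBr -scalemxAr [LHS]mxE; congr (_ + _).
    by rewrite [LHS]mxE [X in - X]mxE.
  by rewrite pv1 /p; field.
have vE : Hm v = Hm u + (p / 2) *: Hm v1 by rewrite /u HmB HmZ subrK.
have uX : Hm u *m X1 = X1 *m Hm u.
  apply/eqP; rewrite -subr_eq0; have /(has_weight_bracket D)/(_ u) -> := w1.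
  by rewrite pu scale0r.
have uXT : Hm u *m X1^T = X1^T *m Hm u.
  have F1 : (Hm u *m X1)^T = X1^T *m Hm u by rewrite trmx_mul Hms.
  have F2 : (X1 *m Hm u)^T = Hm u *m X1^T by rewrite trmx_mul Hms.
  by rewrite -F1 -F2 uX.
have uw : w *m Hm u = Hm u *m w.
  have e1 t : nexp (t *: X1) *m Hm u = Hm u *m nexp (t *: X1).
    by apply: nexp_comm; rewrite -scalemxAl -scalemxAr uX.
  have e2 t : nexp (t *: X1^T) *m Hm u = Hm u *m nexp (t *: X1^T).
    by apply: nexp_comm; rewrite -scalemxAl -scalemxAr uXT.
  have CC (A1 A2 h : 'M[R]_n) : A1 *m h = h *m A1 -> A2 *m h = h *m A2 ->
      (A1 *m A2 *m A1) *m h = h *m (A1 *m A2 *m A1).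
    by move=> h1 h2; rewrite -!mulmxA h1 (mulmxA A2) h2 !mulmxA h1.
  exact: CC (e1 _) (e2 _).
have wh : w *m Hm v1 = - (Hm v1 *m w).
  by rewrite -hE; apply: (wmat_h Xn E1 hX1); rewrite oner_eq0.
have wv : w *m Hm v *m w^T = Hm u - (p / 2) *: Hm v1.
  have KK (h : 'M[R]_n) : h *m w *m w^T = h by rewrite -mulmxA wwT mulmx1.
  by rewrite vE mulmxDr mulmxDl uw -scalemxAr wh scalerN mulNmx -scalemxAl !KK.
have T1 t : \tr ((Hm u + t *: Hm v1) *m Hm v0) =
    \tr (Hm u *m Hm v0) + t * \tr (Hm v1 *m Hm v0).
  by rewrite mulmxDl -scalemxAl mxtraceD mxtraceZ.
have := Hmax w Gw wwT; rewrite wv vE -scaleNr !T1 lerD2l (tr_Hm D iR v1 v0) dv1 => Hle.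
have K0 : 0 < pair b v0 * \tr (X1 *m X1^T) by rewrite mulr_gt0 // mxtr_sq_gt0.
have : 0 <= p / 2 * (pair b v0 * \tr (X1 *m X1^T)) by lra.
by rewrite pmulr_lge0 // pmulr_lge0 // invr_gt0.
Qed.

End RealCartan.

(** * The Cartan decomposition with values in the closed chamber *)

Section RealKAK.
Variables (K : rcfType) (C : numClosedFieldType) (toC : {rmorphism K -> C}).
Variables (n : nat) (P Q : seq (entry_poly K n)).
Hypothesis G_group : cgroup toC P.
Hypothesis G_self_adjoint : forall g, zeros toC P g -> zeros toC P g^T.
Hypothesis S_torus : cmaximal toC P Q.
Hypothesis S_symmetric : forall s, zeros toC Q s -> s = s^T.
Variables (d : nat) (c : 'M[K]_n) (W : 'M[int]_(n, d)) (B : 'M[int]_(d, n)).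
Hypothesis D : torus_data c W B.
Hypothesis QT : zeros toC Q = zeros toC (torus_eqs c W B).
Variables (R : realType) (iR : {rmorphism K -> R}).
Local Notation cR := (map_mx iR c).
Local Notation GR := (zeros iR P).
Local Notation T x := (tmat c iR (tw W x)).
Let cc : c *m c^T = 1%:M. Proof. by case: D. Qed.
Let G1 := G_one G_group iR.
Let GM := @G_mul _ _ _ toC P G_group _ iR.
Let GU := @G_unit _ _ _ toC P G_group _ iR.
Let GI := @G_inv _ _ _ toC P G_group _ iR.
Let GT := @G_tr _ _ _ toC P G_self_adjoint _ iR.

Local Notation Hm := (Hm c W iR).
Local Notation rep := (rep (Q := Q) (iR := iR) c W).
Local Notation gbR := (gb P c W iR).
Variable Delta : seq (dual_a iR Q).
Hypothesis Delta_basis : root_basis P Delta.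

(** The simple roots are independent, so all of them can be given the value 1; a root then takes
    plus or minus a sum of naturals that are not all zero. *)
Lemma regular_vector : exists v0 : 'cV[R]_d,
  (forall beta b, beta \in Delta -> rep beta b -> pair b v0 = 1) /\
  (forall b X, b != 0 -> gbR b X -> X != 0 -> pair b v0 != 0).
Proof.
have [Dfree Droot Dspan] := Delta_basis.
have ex (j : 'I_(size Delta)) : exists b : 'rV[int]_d, rep Delta`_j b.
  by have /(root_rep G_group D QT)[b [_ _ Hb _]] := Droot _ (mem_nth 0 (ltn_ord j)); exists b.
have [bb Hbb] := choice ex.
pose M : 'M[R]_(size Delta, d) := \matrix_(j, l) (bb j 0 l)%:~R.
have rM j v : (M *m v) j 0 = pair (bb j) v.
  by rewrite [LHS]mxE /pair [RHS]mxE; apply: eq_bigr => l _; rewrite !mxE.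
have freeM : row_free M.
  apply: inj_row_free => z Hz; apply/rowP => j; rewrite [RHS]mxE.
  have /(@freeP _ _ _ (in_tuple Delta))/(_ (fun j => z 0 j)) := Dfree; apply.
  apply/lfunP => t; rewrite -[t]vsvalK; have /(lie_aP D QT iR)[v ->] := subvsP t.
  rewrite sum_lfunE [RHS]lfunE /=.
  have := congr1 (fun N : 'rV[R]_d => (N *m v) 0 0) Hz.
  rewrite -mulmxA [LHS]mxE mul0mx [RHS]mxE => E0; rewrite -[RHS]E0; apply: eq_bigr => l _.
  by rewrite lfunE /= Hbb rM.
have [M' MM'] := row_freeP freeM.
pose v0 : 'cV[R]_d := M' *m const_mx 1.
have p1 j : pair (bb j) v0 = 1 by rewrite -rM /v0 mulmxA MM' mul1mx mxE.
exists v0; split.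
  move=> beta b /(nthP 0)[j jD <-] Hb.
  by rewrite -Hb (Hbb (Ordinal jD)) p1.
move=> b X b0 gX X0; have [alpha Hr] := rep_exists D QT iR b.
have ra := rep_root G_group D QT Hr b0 gX X0.
have [cf Hcf] := Dspan _ ra.
have sumE : (\sum_(j < size Delta) Delta`_j *+ cf j) (vsproj (lie_a iR Q) (Hm v0)) =
    (\sum_j cf j)%:R.
  rewrite sum_lfunE natr_sum; apply: eq_bigr => j _.
  by rewrite (repMn (cf j) (Hbb j)) -[bb j *+ _]scaler_nat /pair map_mxZ /= -scalemxAl mxE -/(pair _ _) p1 mulr1 rmorph_nat.
have sum0 : (\sum_j cf j)%N != 0%N.
  apply: contraNneq (b0) => /eqP; rewrite sum_nat_eq0 => /forallP z.
  rewrite -(rep_eq0 D QT Hr); case: Hcf => ->; rewrite big1 ?oppr0 // => j _.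
    by have /eqP -> := z j; rewrite mulr0n.
  by have /eqP -> := z j; rewrite mulr0n.
rewrite -Hr; case: Hcf => ->; last rewrite lfunE /= oppr_eq0.
  by rewrite sumE pnatr_eq0.
by rewrite sumE pnatr_eq0.
Qed.

(** Write h h^T = exp(X) and let k in K_R maximize tr (k X k^T Hm v0). Then the conjugate of X
    commutes with a regular element, so it lies in the Lie algebra of the torus, and it is dominant
    by [max_dominant]. *)
Lemma kak_real h : GR h -> exists2 k, GR k /\ k *m k^T = 1%:M &
  exists x : 'rV[R]_d, [/\ pos_row x, k *m (h *m h^T) *m k^T = T x &
    forall beta b, beta \in Delta -> rep beta b -> 1 <= mon x b].
Proof.
move=> Gh; have [v0 [v0D v0r]] := regular_vector.
have [X [dX XT Xh]] := sym_log G1 GM (GU Gh) (GM Gh (GT Gh)).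
have [k [Gk kk] Hk] := orth_max (trace_poly X (Hm v0)) G1.
have HE y := pev_trace_poly y X (Hm_sym c W iR v0).
exists k => //; pose X' := k *m X *m k^T.
have kU : invmx k^T = k.
  have kk' : k^T *m k^T^T = 1%:M by rewrite trmxK; apply: mulmx1C.
  by rewrite (orth_unit kk') trmxK.
have dX' : dlie GR X'.
  by have := dlie_Ad GM GU GI (GT Gk) dX; rewrite kU.
have X'T : X'^T = X' by rewrite /X' !trmx_mul trmxK XT mulmxA.
have Hmax y : GR y -> y *m y^T = 1%:M ->
    \tr (y *m X' *m y^T *m Hm v0) <= \tr (X' *m Hm v0).
  move=> Gy yy; have yk : (y *m k) *m (y *m k)^T = 1%:M.
    by rewrite trmx_mul -mulmxA (mulmxA k) kk mul1mx.
  have := Hk _ (GM Gy Gk) yk; rewrite !HE trmx_mul.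
  by rewrite /X' !mulmxA.
have XC := critical_bracket G_group S_torus D QT dX' X'T Hmax.
have w0 := centralizer_regular G_group S_torus D QT v0r dX' XC.
have [v Ev] : exists v, X' = Hm v.
  apply: (dlie_sym_torus G_group G_self_adjoint S_torus S_symmetric D QT dX' X'T) => x x0.
  by have := weight_torus cc w0 (gt0_nz x0); rewrite mon0 scale1r => ->.
exists (expv v); split; first exact: expv_pos.
  by rewrite -Xh -mexp_sym_conj // -/X' Ev (mexp_Hm D).
move=> beta b bD Hb; have [_ Droot _] := Delta_basis.
have [b' [_ b'0 Hb' [e ge e0]]] := root_rep G_group D QT (Droot _ bD).
have bb' : b' = b.
  by apply/rowP => j; apply: (@intr_inj R); rewrite -!pair_delta -Hb -Hb'.
rewrite {}bb' {Hb'} in b'0 ge.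
rewrite mon_expv -/(pair b v) -[1]expR0 ler_expR.
have pb : 0 < pair b v0 by rewrite (v0D _ _ bD Hb).
apply: (max_dominant G_group G_self_adjoint S_torus S_symmetric D QT b'0 ge e0 pb).
by rewrite -Ev.
Qed.

End RealKAK.

(** * Extension to F *)

Section CharacterPolynomials.
Variables (K : rcfType) (n d : nat) (c : 'M[K]_n) (W : 'M[int]_(n, d)) (B : 'M[int]_(d, n)).
Hypothesis D : torus_data c W B.

(** Extends the character b from the torus to a polynomial on matrices, through the splitting
    [B]. *)
Definition char_poly (b : 'rV[int]_d) : entry_poly K n := torus_mon c (b *m B).

Lemma char_polyE (L : fieldType) (i : {rmorphism K -> L}) b (x : 'rV[L]_d) : nz x ->
  pval i (char_poly b) (tmat c i (tw W x)) = mon x b.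
Proof.
case: D => cc BW W0 nzx; rewrite -pevE (pev_torus_mon cc); last 2 first.
- exact: tw_nz.
- exact: prod_tw.
by rewrite mon_tw // -mulmxA BW mulmx1.
Qed.

Lemma char_polyM (C : numClosedFieldType) (toC : {rmorphism K -> C}) b :
  (forall s, zeros toC (torus_eqs c W B) s -> pval toC (char_poly b) s != 0) /\
  (forall s s', zeros toC (torus_eqs c W B) s -> zeros toC (torus_eqs c W B) s' ->
     pval toC (char_poly b) (s *m s') = pval toC (char_poly b) s * pval toC (char_poly b) s').
Proof.
have [cc _ _] := D.
split=> [s /(geom_torus toC D)[x nzx ->]|s s' /(geom_torus toC D)[x nzx ->]].
  by rewrite char_polyE // mon_neq0.
move=> /(geom_torus toC D)[y nzy ->]; rewrite tmatM // -tw_hmul !char_polyE //.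
  exact: mon_hmul.
exact: nz_hmul.
Qed.

Lemma pev_gen (L : fieldType) (i : {rmorphism K -> L}) (X : 'M[L]_n) a b :
  pev i X (genmx K n a b) = X a b.
Proof.
by have := congr1 (fun M : 'M[L]_n => M a b) (pev_genmx i X) => <-; rewrite [RHS]mxE.
Qed.

Definition norm_poly (u : K) : entry_poly K n :=
  mpoly.mpolyC _ u * \sum_a \sum_b genmx K n a b * genmx K n a b.

Lemma norm_polyE (L : fieldType) (i : {rmorphism K -> L}) u (X : 'M[L]_n) :
  pval i (norm_poly u) X = i u * \tr (X *m X^T).
Proof.
rewrite -pevE /norm_poly rmorphM pev_const; congr (_ * _); rewrite mxtr_sq rmorph_sum.
apply: eq_bigr => a _; rewrite rmorph_sum; apply: eq_bigr => b _.
by rewrite rmorphM !pev_gen expr2.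
Qed.

End CharacterPolynomials.

Section Extension.
Variables (K : rcfType) (C : numClosedFieldType) (toC : {rmorphism K -> C}).
Variables (n : nat) (P Q : seq (entry_poly K n)).
Hypothesis G_group : cgroup toC P.
Hypothesis G_self_adjoint : forall g, zeros toC P g -> zeros toC P g^T.
Hypothesis S_torus : cmaximal toC P Q.
Hypothesis S_symmetric : forall s, zeros toC Q s -> s = s^T.
Variables (d : nat) (c : 'M[K]_n) (W : 'M[int]_(n, d)) (B : 'M[int]_(d, n)).
Hypothesis D : torus_data c W B.
Hypothesis QT : zeros toC Q = zeros toC (torus_eqs c W B).
Variables (R : realType) (iR : {rmorphism K -> R}).
Let cc : c *m c^T = 1%:M. Proof. by case: D. Qed.

Local Notation rep := (rep (Q := Q) (iR := iR) c W).
Local Notation gbL := (gb P c W).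
Variables (F : rcfType) (iF : {rmorphism K -> F}).
Local Notation GF := (zeros iF P).
Local Notation TF x := (tmat c iF (tw W x)).

Lemma gb0 (L : rcfType) (i : {rmorphism K -> L}) b : gbL i b 0.
Proof.
by split; [exact: has_weight0|rewrite nexp0; apply: (G_one G_group)].
Qed.

(** Triviality of a root space is a sentence over [K], so the same integer vectors are roots over
    [R] and [F]. *)
Lemma gb_zero b : gbL iR b = [set 0] <-> gbL iF b = [set 0].
Proof.
rewrite -!(gb_dataE P c W) -(@zero_dataE K n R iR) -(@zero_dataE K n F iF).
by split=> /sa_set_transfer H; apply: H.
Qed.

Lemma gb_rootF b X : b != 0 -> gbL iF b X -> X != 0 ->
  exists2 alpha, root_system P alpha & rep alpha b.
Proof.
move=> b0 gX X0; have [alpha Hr] := rep_exists D QT iR b; exists alpha => //.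
have [Y gY Y0] : exists2 Y, gbL iR b Y & Y != 0.
  apply: contrapT => HN; have /gb_zero E : gbL iR b = [set 0].
    apply/seteqP; split=> Y => [gY|->]; last exact: gb0.
    by apply: contrapT => /eqP Y0; apply: HN; exists Y.
  by move: gX; rewrite E => /= X0'; rewrite X0' eqxx in X0.
exact: (rep_root G_group D QT Hr b0 gY Y0).
Qed.

Lemma gb_nonzero b X : gbL iR b X -> X != 0 -> exists2 Y, gbL iF b Y & Y != 0.
Proof.
move=> gX X0; apply: contrapT => HN; have /gb_zero E : gbL iF b = [set 0].
  apply/seteqP; split=> Y => [gY|->]; last exact: gb0.
  by apply: contrapT => /eqP Y0; apply: HN; exists Y.
by move: gX; rewrite E => /= X0'; rewrite X0' eqxx in X0.
Qed.

Hypothesis reduced : reduced_roots iR P Q.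

Lemma Mn2_neq0 (b : 'rV[int]_d) : b != 0 -> b *+ 2 != 0.
Proof.
move=> b0; apply: contraNneq b0 => E; apply/eqP/rowP => j; have := congr1 (fun M : 'rV[int]_d => M 0 j) E.
by rewrite mulmxnE !mxE => /eqP; rewrite mulrn_eq0 /= => /eqP.
Qed.

Lemma gb_double alpha b : root_system P alpha -> rep alpha b -> gbL iR (b *+ 2) = [set 0].
Proof.
move=> ra Hr; have b0 : b != 0 by rewrite -(rep_eq0 D QT Hr); case: ra.
apply/seteqP; split=> Y => [gY|->]; last exact: gb0.
apply: contrapT => /eqP Y0; apply: (reduced ra).
exact: (rep_root G_group D QT (repMn 2 Hr) (Mn2_neq0 b0) gY Y0).
Qed.

Lemma gb_doubleF alpha b : root_system P alpha -> rep alpha b -> gbL iF (b *+ 2) = [set 0].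
Proof. by move=> ra Hr; apply/gb_zero; apply: gb_double ra Hr. Qed.

(** Reducedness removes the summand of weight 2b, and the extension of a root space is given by the
    same equations. *)
Lemma root_groupE alpha b : root_system P alpha -> rep alpha b ->
  root_group iF P alpha = [set nexp X | X in gbL iF b].
Proof.
move=> ra Hr; have b0 : b != 0 by rewrite -(rep_eq0 D QT Hr); case: ra.
have E1 : sa_ext iR iF (root_space P alpha) = gbL iF b.
  rewrite (root_space_rep G_group D QT Hr b0) -!(gb_dataE P c W).
  exact: sa_extE.
have E2 : sa_ext iR iF (root_space P (alpha *+ 2)) = [set 0].
  rewrite (root_space_rep G_group D QT (repMn 2 Hr) (Mn2_neq0 b0)) (gb_double ra Hr).
  rewrite -(@zero_dataE K n R iR) -(@zero_dataE K n F iF); exact: sa_extE.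
rewrite /root_group E1 E2; apply/seteqP; split=> g.
  by move=> [X gX [Y -> <-]]; exists X; rewrite ?addr0.
by move=> [X gX <-]; exists X => //; exists 0; rewrite ?addr0.
Qed.

(** The bracket has weight 2b, where the root space is zero. *)
Lemma gb_commF alpha b X Y : root_system P alpha -> rep alpha b ->
  gbL iF b X -> gbL iF b Y -> X *m Y = Y *m X.
Proof.
move=> ra Hr gX gY; have b0 : b != 0 by rewrite -(rep_eq0 D QT Hr); case: ra.
have := gb_bracket cc (G_one G_group iF) (@G_mul _ _ _ _ _ G_group _ iF) b0 b0 (Mn2_neq0 b0) gX gY.
by rewrite (gb_doubleF ra Hr) => /eqP; rewrite subr_eq0 => /eqP.
Qed.

(** Two polynomials that represent the character agree on [A] over [R], where every point is an
    exponential, and hence over [F] by transfer; so the description has a single value. [RC]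
    abstracts [root_character alpha]. *)
Lemma chiE alpha b (RC : entry_poly K n -> Prop) (x : 'rV[F]_d) : rep alpha b ->
  RC (char_poly c B b) ->
  (forall p, RC p -> forall H, H \in lie_a iR Q ->
     pval iR p (mexp H) = expR (alpha (vsproj (lie_a iR Q) H))) ->
  pos_row x ->
  xget 0 [set u | exists2 p, RC p & u = pval iF p (TF x)] = mon x b.
Proof.
move=> Hr Hp HRC x0; set S := [set u | _].
have Su u : S u -> u = mon x b.
  move=> [p Rp ->]; rewrite -(char_polyE D iF b (gt0_nz x0)).
  pose X := QE.MVar K n 0.
  pose f := QE.FImp (Fsa (torus_pos c W B) X) (Fzero (p - char_poly c B b) X).
  have /(transfer1 iF) H : forall A, QE.mhold iR (QE.upd (fun=> 0) 0 A) f.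
    move=> A; rewrite Fimp_hold => /Fsa_hold/(torus_posE D)[y y0 EA].
    apply/Fzero_hold; rewrite -pevE rmorphB !pevE EA.
    have [v Ev] := pos_expv y0.
    rewrite (char_polyE D iR b (gt0_nz y0)) Ev -(mexp_Hm D) (HRC _ Rp) ?(Hm_in D QT) //.
    by rewrite Hr mon_expv subrr.
  have := H (TF x); rewrite Fimp_hold => Hf.
  have /Fzero_hold : QE.mhold iF (QE.upd (fun=> 0) 0 (TF x)) (Fzero (p - char_poly c B b) X).
    by apply: Hf; apply/Fsa_hold/(torus_posE D); exists x.
  by rewrite /= -pevE rmorphB !pevE => /eqP; rewrite subr_eq0 => /eqP.
apply: Su; apply: (@xgetPex _ 0 S); exists (mon x b).
by exists (char_poly c B b) => //; rewrite (char_polyE D iF b (gt0_nz x0)).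
Qed.

Lemma corootF alpha b : root_system P alpha -> rep alpha b ->
  exists nu : 'cV[int]_d, [/\ (b *m nu) 0 0 = 2, 0 < \sum_a ((W *m nu) a 0) ^+ 2
    & forall X, gbL iF b X -> X *m X^T - X^T *m X =
      (2 / (\sum_a ((W *m nu) a 0) ^+ 2)%:~R * \tr (X *m X^T)) *: hmat iF c W nu].
Proof.
move=> ra Hr; have [b' [_ b'0 Hr' [X0 gX0 X00]]] := root_rep G_group D QT ra.
have bb' : b' = b.
  by apply/rowP => j; apply: (@intr_inj R); rewrite -!pair_delta -Hr -Hr'.
rewrite {}bb' {Hr'} in b'0 gX0.
have [nu [bnu m0 Hq]] := coroot G_group G_self_adjoint S_torus S_symmetric D QT b'0 gX0 X00.
exists nu; split=> // X gX; pose m : K := (\sum_a ((W *m nu) a 0) ^+ 2)%:~R.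
pose hK : 'M[K]_n := c^T *m diag_mx (\row_a ((W *m nu) a 0)%:~R) *m c.
have hE (L : rcfType) (i : {rmorphism K -> L}) : map_mx i hK = hmat i c W nu.
  rewrite /hmat /hK !map_mxM map_trmx map_diag_mx; congr (_ *m diag_mx _ *m _).
  by apply/rowP => a; rewrite !mxE rmorph_int.
have mE (L : rcfType) (i : {rmorphism K -> L}) Y : pval i (norm_poly n (2 / m)) Y =
    2 / (\sum_a ((W *m nu) a 0) ^+ 2)%:~R * \tr (Y *m Y^T).
  by rewrite norm_polyE fmorph_div rmorph_nat rmorph_int.
pose x := QE.MVar K n 0.
pose t1 := QE.MAdd (QE.MMul x (QE.MTr x)) (QE.MOpp (QE.MMul (QE.MTr x) x)).
pose t2 := QE.MMul (QE.MPol (norm_poly n (2 / m)) x) (QE.MConst hK).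
pose f := QE.FImp (Fsa (gb_data P c W b) x) (QE.FEq t1 t2).
have /(transfer1 iF) H : forall A, QE.mhold iR (QE.upd (fun=> 0) 0 A) f.
  move=> A; rewrite Fimp_hold => /Fsa_hold; rewrite (gb_dataE P c W) => gA.
  have := Hq A gA; rewrite -(hE _ iR) -(mE _ iR A) => EA.
  by change (A *m A^T - A^T *m A = (pval iR (norm_poly n (2 / m)) A)%:M *m map_mx iR hK);
    rewrite mul_scalar_mx EA.
have := H X; rewrite Fimp_hold => Hf.
have : QE.mhold iF (QE.upd (fun=> 0) 0 X) (QE.FEq t1 t2).
  by apply: Hf; apply/Fsa_hold; rewrite (gb_dataE P c W).
change (X *m X^T - X^T *m X = (pval iF (norm_poly n (2 / m)) X)%:M *m map_mx iF hK ->
  X *m X^T - X^T *m X =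
      (2 / (\sum_a ((W *m nu) a 0) ^+ 2)%:~R * \tr (X *m X^T)) *: hmat iF c W nu).
by rewrite mul_scalar_mx hE mE.
Qed.

Variable Delta : seq (dual_a iR Q).
Hypothesis Delta_basis : root_basis P Delta.

(** The simple roots enter through a finite list of integer vectors, so that the decomposition is a
    formula over [K]. *)
Lemma kakF : exists bs : seq 'rV[int]_d,
  (forall beta, beta \in Delta -> exists2 b, b \in bs & rep beta b) /\
  forall h, GF h -> exists2 k, GF k /\ k *m k^T = 1%:M &
    exists x : 'rV[F]_d, [/\ pos_row x, k *m (h *m h^T) *m k^T = TF x &
      forall b, b \in bs -> 1 <= mon x b].
Proof.
pose bs := [seq b <- wts W | `[< exists2 beta, beta \in Delta & rep beta b >]].
have [_ Droot _] := Delta_basis.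
exists bs; split=> [beta bD|h].
  have [b [bw _ Hb _]] := root_rep G_group D QT (Droot _ bD); exists b => //.
  by rewrite mem_filter bw andbT; apply/asboolP; exists beta.
pose x := QE.MVar K n 0; pose y := QE.MVar K n 1.
pose t := QE.MMul (QE.MMul y (QE.MMul x (QE.MTr x))) (QE.MTr y).
(* The inequality 1 <= character is the negation of a strict one. *)
pose f2 := QE.FAnd (Fsa (torus_pos c W B) t)
  (Fall bs (fun b => QE.FNot (QE.FPos (1 - char_poly c B b) t))).
pose f1 := QE.FAnd (Fzeros P y) (QE.FAnd (QE.FEq (QE.MMul y (QE.MTr y)) (QE.MConst 1%:M)) f2).
pose f := QE.FImp (Fzeros P x) (QE.FEx 1 f1).
have posE (L : rcfType) (i : {rmorphism K -> L}) (z : 'rV[L]_d) b : pos_row z ->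
    ~ (0 < pval i (1 - char_poly c B b) (tmat c i (tw W z))) <-> 1 <= mon z b.
  move=> z0; rewrite -pevE rmorphB rmorph1 pevE (char_polyE D i b (gt0_nz z0)) subr_gt0.
  by split=> [/negP|H]; [rewrite -leNgt|apply/negP; rewrite -leNgt].
have /(transfer1 iF) H : forall A, QE.mhold iR (QE.upd (fun=> 0) 0 A) f.
  move=> A; rewrite Fimp_hold => /Fzeros_hold GA.
  have [k [Gk kk] [z [z0 Ez Hz]]] :=
    kak_real G_group G_self_adjoint S_torus S_symmetric D QT Delta_basis GA.
  exists k; split; first by apply/Fzeros_hold.
  split; first by change (k *m k^T = map_mx iR 1%:M); rewrite map_mx1.
  have Et : QE.mval iR (QE.upd (QE.upd (fun=> 0) 0 A) 1 k) t = tmat c iR (tw W z) by exact: Ez.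
  split; first by apply/Fsa_hold; rewrite Et; apply/(torus_posE D); exists z.
  apply/Fall_hold => b; rewrite mem_filter => /andP[/asboolP[beta bD Hb] _].
  have := (posE _ iR z b z0).2 (Hz _ _ bD Hb); rewrite -Et; exact.
move=> Gh; have := H h; rewrite Fimp_hold => Hf.
have [|k [/Fzeros_hold Gk [kk [Hs Hb]]]] := Hf; first by apply/Fzeros_hold.
have [z z0 Et] := (torus_posE D iF _).1 ((Fsa_hold iF (torus_pos c W B) t _).1 Hs).
have Hz := (@Fall_hold K n F iF _ bs (fun b => QE.FNot (QE.FPos (1 - char_poly c B b) t)) _).1 Hb.
have kk' : k *m k^T = map_mx iF 1%:M by exact: kk.
exists k; first by split=> //; rewrite kk' map_mx1.
exists z; split; [exact: z0|exact: Et|].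
move=> b /Hz Hzb; apply/(posE _ iF z b z0); rewrite -Et; exact: Hzb.
Qed.

End Extension.

(** * Bounded elements *)

Lemma mx_entry_sq_le (L : realDomainType) n m (X : 'M[L]_(n, m)) a b :
  X a b ^+ 2 <= \tr (X *m X^T).
Proof.
rewrite mxtr_sq (bigD1 a) //= (bigD1 b) //= -addrA lerDl addr_ge0 //.
  by apply: sumr_ge0 => l _; rewrite sqr_ge0.
by do 2![apply: sumr_ge0 => ? _]; rewrite sqr_ge0.
Qed.

Section Bounded.
Variables (K : rcfType) (C : numClosedFieldType) (toC : {rmorphism K -> C}).
Variables (n : nat) (P Q : seq (entry_poly K n)).
Hypothesis G_group : cgroup toC P.
Hypothesis G_self_adjoint : forall g, zeros toC P g -> zeros toC P g^T.
Hypothesis S_torus : cmaximal toC P Q.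
Hypothesis S_symmetric : forall s, zeros toC Q s -> s = s^T.
Variables (d : nat) (c : 'M[K]_n) (W : 'M[int]_(n, d)) (B : 'M[int]_(d, n)).
Hypothesis D : torus_data c W B.
Hypothesis QT : zeros toC Q = zeros toC (torus_eqs c W B).

Variables (F : rcfType) (iF : {rmorphism K -> F}).
Local Notation GF := (zeros iF P).
Local Notation cF := (map_mx iF c).
Local Notation T := (torus iF c W).
Local Notation gbF := (gb P c W iF).
Let cc : c *m c^T = 1%:M. Proof. by case: D. Qed.
Let ccF : cF *m cF^T = 1%:M. Proof. exact: tmat_orth. Qed.
Let G1 := G_one G_group iF.
Let GM := @G_mul _ _ _ toC P G_group _ iF.
Let GU := @G_unit _ _ _ toC P G_group _ iF.
Let GI := @G_inv _ _ _ toC P G_group _ iF.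
Let GT := @G_tr _ _ _ toC P G_self_adjoint _ iF.
Let GA (x : 'rV[F]_d) : nz x -> GF (T x).
Proof. by move=> nzx; rewrite torusE; apply: (A_sub_G S_torus D QT). Qed.

Let TUx (x : 'rV[F]_d) : nz x -> T x \in unitmx.
Proof. by move=> nzx; exact: (GU (GA nzx)). Qed.

Variable O : {pred F}.
Hypothesis O_subring : GRing.subring_closed O.
Hypothesis O_convex : order_convex O.

Lemma O_norm_le x y : `|x| <= y -> y \in O -> x \in O.
Proof.
rewrite ler_norml => xy Oy; apply: (O_convex _ Oy xy).
exact: (O_opp O_subring).
Qed.

Lemma O_natV k : (k.+1%:R)^-1 \in O.
Proof.
apply: (O_le O_subring O_convex _ _ (O_one O_subring)); first by rewrite invr_ge0.
by rewrite invf_le1 // ler1n.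
Qed.

Lemma O_nat k : k%:R \in O.
Proof.
elim: k => [|k IHk]; first exact: (O_zero O_subring).
by rewrite -natr1; apply: (O_add O_subring) => //; apply: (O_one O_subring).
Qed.

Lemma O_sum (I : Type) (s : seq I) (f : I -> F) :
  (forall j, f j \in O) -> \sum_(j <- s) f j \in O.
Proof.
move=> Of; elim/big_ind: _ => // [|x y]; first exact: (O_zero O_subring).
exact: (O_add O_subring).
Qed.

Definition inO (X : 'M[F]_n) := forall a b, X a b \in O.

Lemma inO_mul X Y : inO X -> inO Y -> inO (X *m Y).
Proof.
move=> OX OY a b; rewrite mxE; apply: O_sum => l; exact: (O_mul O_subring).
Qed.

Lemma inO_orth k : k *m k^T = 1%:M -> inO k.
Proof. by move=> kk a b; apply: (O_norm_le (orth_entry_le1 a b kk)); apply: (O_one O_subring). Qed.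

Lemma inO_tr X : inO X -> inO X^T.
Proof. by move=> OX a b; rewrite mxE. Qed.

Lemma inO_c : inO cF. Proof. exact: inO_orth. Qed.

Lemma inO_wcomp b X : inO X -> inO (wcomp iF c W b X).
Proof.
move=> OX; apply: inO_mul inO_c; apply: inO_mul; first exact: inO_tr inO_c.
move=> a a'; rewrite mxE; case: ifP => _; last exact: (O_zero O_subring).
by apply: inO_mul; [apply: inO_mul => //; exact: inO_c|exact: inO_tr inO_c].
Qed.

Lemma inO_nexp X : inO X -> inO (nexp X).
Proof.
move=> OX a b; rewrite /nexp summxE; apply: O_sum => k; rewrite mxE.
apply: (O_mul O_subring); first by have := fact_gt0 k; case: (k`!) => // m _; apply: O_natV.
elim: (val k) a b => [|m IHm] a b.
  by rewrite expr0 mxE; case: eqP => _; [exact: (O_one O_subring)|exact: (O_zero O_subring)].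
by rewrite exprS; apply: inO_mul.
Qed.

(* The elements that act on the lattice of integral points of the Lie algebra.
   The adjoint action is used, rather than the given one, because the distance
   only involves the roots. *)
Definition bdd (g : 'M[F]_n) :=
  forall X, dlie GF X -> inO X -> inO (g *m X *m invmx g).

Lemma dlie_conj g X : GF g -> dlie GF X -> dlie GF (g *m X *m invmx g).
Proof. by move=> Gg dX; have := dlie_Ad GM GU GI (GI Gg) dX; rewrite invmxK. Qed.

Lemma invmxM (g h : 'M[F]_n) : g \in unitmx -> h \in unitmx ->
  invmx (g *m h) = invmx h *m invmx g.
Proof.
move=> gU hU; have E : (g *m h) *m (invmx h *m invmx g) = 1%:M.
  by rewrite mulmxA mulmxK // mulmxV.
by rewrite -[LHS]mulmx1 -E mulKmx // unitmx_mul gU.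
Qed.

Lemma bddM g h : GF g -> GF h -> bdd g -> bdd h -> bdd (g *m h).
Proof.
move=> Gg Gh bg bh X dX OX; rewrite (invmxM (GU Gg) (GU Gh)) !mulmxA.
have -> : g *m h *m X *m invmx h *m invmx g = g *m (h *m X *m invmx h) *m invmx g.
  by rewrite !mulmxA.
by apply: bg; [exact: (dlie_conj Gh dX)|exact: bh].
Qed.

Lemma bdd_orth k : k *m k^T = 1%:M -> bdd k.
Proof.
move=> kk X _ OX; rewrite (orth_unit kk).
by apply: inO_mul; [apply: inO_mul => //; exact: inO_orth|apply/inO_tr/inO_orth].
Qed.

Definition rootF b := b != 0 /\ exists2 X, gbF b X & X != 0.

Lemma rootFN b : rootF b -> rootF (- b).
Proof.
move=> [b0 [X gX X0]]; split; first by rewrite oppr_eq0.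
by exists X^T; [exact: gbT gX|rewrite trmx_eq0].
Qed.

(** Weight components of integral matrices are integral because [c] is orthogonal. [T x] fixes the
    component of weight 0 and scales the others, which are root vectors when nonzero, by root
    values. *)
Lemma bdd_torus x : pos_row x -> (forall b, rootF b -> mon x b \in O) -> bdd (T x).
Proof.
move=> x0 Hx X dX OX; have nzx := gt0_nz x0.
have E : T x *m X = (\sum_(b <- wts W) mon x b *: wcomp iF c W b X) *m T x.
  rewrite -{1}(sum_wcomp iF W cc X) mulmx_sumr mulmx_suml; apply: eq_bigr => b _.
  have ww : has_weight iF c W b (wcomp iF c W b X) by exact: wcomp_weight.
  by rewrite (torus_has_weight D ww nzx) scalemxAl.
rewrite E (mulmxK (TUx nzx)).
move=> a a'; rewrite summxE; apply: O_sum => b; rewrite mxE.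
have Ow : inO (wcomp iF c W b X) by apply: inO_wcomp.
have [->|b0] := eqVneq b 0.
  by rewrite mon0 mul1r; apply: inO_wcomp.
have [->|w0] := eqVneq (wcomp iF c W b X) 0.
  by rewrite mxE mulr0; apply: (O_zero O_subring).
apply: (O_mul O_subring) => //; apply: Hx; split=> //; exists (wcomp iF c W b X) => //.
apply/(gb_dlie W cc G1 GM _ b0); split; first exact: wcomp_weight.
apply: (dlie_wcomp cc GM GU GI _ b dX) => y y0; rewrite -torusE; apply: GA.
by move=> j; rewrite mxE fmorph_eq0; apply: lt0r_neq0; apply: y0.
Qed.

(** Normalized to |X| = 1, the matrix X is integral, hence so is its image s X, and s^2 is the sum
    of the squared entries of s X. *)
Lemma bdd_scale g X s : GF g -> bdd g -> dlie GF X -> X != 0 -> 0 <= s ->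
  g *m X = s *: (X *m g) -> s \in O.
Proof.
move=> Gg bg dX X0 s0 E; have q0 := mxtr_sq_gt0 X0; set q := \tr _ in q0.
pose t := (Num.sqrt q)^-1; pose X' := t *: X.
have t2 : t ^+ 2 * q = 1 by rewrite exprVn sqr_sqrtr ?ltW // mulVf // gt_eqF.
have trX' : \tr (X' *m X'^T) = 1.
  by rewrite /X' linearZ /= -scalemxAl -scalemxAr scalerA mxtraceZ -expr2.
have OX' : inO X'.
  move=> a b; apply: (@O_norm_le _ 1); last exact: (O_one O_subring).
  rewrite -(@ler_pXn2r _ 2) ?nnegrE // expr1n real_normK ?num_real // -trX'.
  exact: mx_entry_sq_le.
have OgX : inO (s *: X').
  have <- : g *m X' *m invmx g = s *: X'.
    by rewrite /X' -scalemxAr E scalerA mulrC -scalerA -!scalemxAl mulmxK // GU.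
  by apply: bg; [exact: (dlieZ t dX)|exact: OX'].
apply: (O_sqr O_subring O_convex s0).
have <- : \tr ((s *: X') *m (s *: X')^T) = s ^+ 2.
  have -> : (s *: X')^T = s *: X'^T by rewrite linearZ.
  by rewrite -scalemxAl -scalemxAr scalerA mxtraceZ trX' mulr1.
rewrite mxtr_sq; apply: O_sum => a; apply: O_sum => b.
exact: (O_exp O_subring).
Qed.

Lemma bdd_torus_mon x b : pos_row x -> bdd (T x) -> rootF b -> mon x b \in O.
Proof.
move=> x0 bx [b0 [X gX X0]]; have nzx := gt0_nz x0.
have [wX dX] := (gb_dlie W cc G1 GM X b0).1 gX.
apply: (bdd_scale (GA nzx) bx dX X0); first by rewrite ltW // mon_pos.
exact: (torus_has_weight D wX nzx).
Qed.

Definition xinv (x : 'rV[F]_d) : 'rV[F]_d := \row_j (x 0 j)^-1.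

Lemma xinv_pos x : pos_row x -> pos_row (xinv x).
Proof. by move=> x0 j; rewrite mxE invr_gt0. Qed.

Lemma hmul_xinv x : pos_row x -> hmul x (xinv x) = const_mx 1.
Proof. by move=> x0; apply/rowP => j; rewrite hmulE !mxE mulfV // gt_eqF. Qed.

Lemma mon_xinv x e : pos_row x -> mon (xinv x) e = (mon x e)^-1.
Proof.
move=> x0; have := congr1 (fun y => mon y e) (hmul_xinv x0).
rewrite mon_hmul mon_const1 => E; apply: (mulfI (mon_neq0 e (gt0_nz x0))).
by rewrite E mulfV // mon_neq0 //; apply: gt0_nz.
Qed.

Lemma torus_xinv x : pos_row x -> invmx (T x) = T (xinv x).
Proof.
move=> x0; have E : T x *m T (xinv x) = 1%:M.
  by rewrite (TM iF D) hmul_xinv // torusE tw_const1 tmat1.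
by rewrite -[LHS]mulmx1 -E mulKmx //; apply: TUx; apply: gt0_nz.
Qed.

Lemma torus_sym x : (T x)^T = T x. Proof. by rewrite torusE tmat_sym. Qed.

Variable bs : seq 'rV[int]_d.
Hypothesis kak : forall h, GF h -> exists2 k, GF k /\ k *m k^T = 1%:M &
  exists x : 'rV[F]_d, [/\ pos_row x, k *m (h *m h^T) *m k^T = tmat c iF (tw W x) &
    forall b, b \in bs -> 1 <= mon x b].

(** With [T x] the square root of k h h^T k^T, the remaining factor is orthogonal. *)
Lemma kak_decomposition h : GF h -> exists k k' x,
  [/\ GF k /\ k *m k^T = 1%:M, GF k' /\ k' *m k'^T = 1%:M, pos_row x,
    h = k^T *m T x *m k' & forall b, b \in bs -> 1 <= mon x b].
Proof.
move=> Gh; have [k [Gk kk] [z [z0 Ez Hz]]] := kak Gh.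
pose x : 'rV[F]_d := \row_j Num.sqrt (z 0 j).
have x0 : pos_row x by move=> j; rewrite mxE sqrtr_gt0.
have zE : z = hmul x x by apply: sqrt_row_sq.
have TU : T x \in unitmx := TUx (gt0_nz x0).
have Tz : k *m (h *m h^T) *m k^T = T x *m T x by rewrite Ez (TM iF D) -zE torusE.
have kU : k^T *m k = 1%:M by apply: mulmx1C.
exists k, (invmx (T x) *m k *m h), x; split=> //.
- split; first exact: (GM (GM (GI (GA (gt0_nz x0))) Gk) Gh).
  rewrite !trmx_mul trmx_inv torus_sym.
  have -> : invmx (T x) *m k *m h *m (h^T *m (k^T *m invmx (T x))) =
    invmx (T x) *m (k *m (h *m h^T) *m k^T) *m invmx (T x) by rewrite !mulmxA.
  by rewrite Tz mulmxA mulVmx // mul1mx mulmxV.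
- by rewrite !mulmxA mulmxK // kU mul1mx.
move=> b /Hz; rewrite {1}zE mon_hmul -expr2 -[X in X <= _ -> _](expr1n _ 2).
by rewrite ler_pXn2r // nnegrE ltW // mon_pos.
Qed.

Lemma orth_bdd_mid (k k' h a : 'M[F]_n) : GF k -> GF k' -> GF a -> k *m k^T = 1%:M ->
  k' *m k'^T = 1%:M -> h = k^T *m a *m k' -> bdd h <-> bdd a.
Proof.
move=> Gk Gk' Ga kk kk' ->; have kT : k^T *m k^T^T = 1%:M by rewrite trmxK; apply: mulmx1C.
have kT' : k'^T *m k'^T^T = 1%:M by rewrite trmxK; apply: mulmx1C.
have bM (g1 g2 g3 : 'M[F]_n) : GF g1 -> GF g2 -> GF g3 -> g1 *m g1^T = 1%:M ->
    g3 *m g3^T = 1%:M -> bdd g2 -> bdd (g1 *m g2 *m g3).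
  move=> H1 H2 H3 o1 o3 b2.
  exact: (bddM (GM H1 H2) H3 (bddM H1 H2 (bdd_orth o1) b2) (bdd_orth o3)).
split=> [bh|ba]; last exact: (bM _ _ _ (GT Gk) Ga Gk' kT kk' ba).
have -> : a = k *m (k^T *m a *m k') *m k'^T.
  by rewrite !mulmxA kk mul1mx -mulmxA kk' mulmx1.
exact: (bM _ _ _ Gk (GM (GM (GT Gk) Ga) Gk') (GT Gk') kk kT' bh).
Qed.

(** Mapping a lattice into itself does not by itself pass to inverses. The Cartan decomposition
    reduces to [T x], where it does because opposites of roots are roots. *)
Lemma bddV g : GF g -> bdd g -> bdd (invmx g).
Proof.
move=> Gg bg; have [k [k' [x [[Gk kk] [Gk' kk'] x0 E _]]]] := kak_decomposition Gg.
have GTx : GF (T x) by apply: GA; apply: gt0_nz.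
have bx : bdd (T x) by apply/(orth_bdd_mid Gk Gk' GTx kk kk' E).
have TU := GU GTx; have kT : k^T \in unitmx by apply: GU; apply: GT.
have Ei : invmx g = k'^T *m invmx (T x) *m k.
  rewrite E (invmxM _ (GU Gk')) ?unitmx_mul ?kT // (invmxM kT TU) (orth_unit kk').
  have kT' : k^T *m k^T^T = 1%:M by rewrite trmxK; apply: mulmx1C.
  by rewrite (orth_unit kT') trmxK mulmxA.
apply/(orth_bdd_mid Gk' Gk (GI GTx) kk' kk Ei).
rewrite torus_xinv //; apply: bdd_torus; first exact: xinv_pos.
by move=> b rb; rewrite mon_xinv // -monN; exact: (bdd_torus_mon x0 bx (rootFN rb)).
Qed.

Lemma bdd_nexp b X : b != 0 -> gbF b X -> inO X -> bdd (nexp X).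
Proof.
move=> b0 [wX _] OX Y _ OY; have Xn := has_weight_nilpotent cc b0 wX.
rewrite nexp_inv //; apply: inO_mul; last first.
  by apply: inO_nexp => a a'; rewrite mxE; apply: (O_opp O_subring).
by apply: inO_mul => //; apply: inO_nexp.
Qed.

Section Root.
Variables (b : 'rV[int]_d) (nu : 'cV[int]_d).
Hypothesis bnu : (b *m nu) 0 0 = 2.
Let m : F := (\sum_a ((W *m nu) a 0) ^+ 2)%:~R.
Hypothesis m0 : 0 < \sum_a ((W *m nu) a 0) ^+ 2.
Let b0 : b != 0 := b_neq0 bnu.
(** The form q of the bracket relation; [m] is the squared length of the coroot. *)
Definition qnorm (X : 'M[F]_n) : F := 2 / m * \tr (X *m X^T).

Lemma m_gt0 : 0 < m. Proof. by rewrite ltr0z. Qed.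

Lemma qnorm_gt0 X : X != 0 -> 0 < qnorm X.
Proof. by move=> /mxtr_sq_gt0 q0; rewrite mulr_gt0 // divr_gt0 // m_gt0. Qed.

Lemma qnormZ t X : qnorm (t *: X) = t ^+ 2 * qnorm X.
Proof.
rewrite /qnorm linearZ /= -scalemxAl -scalemxAr scalerA mxtraceZ -expr2.
by rewrite mulrCA.
Qed.

Lemma qnorm_inO X : qnorm X \in O -> inO X.
Proof.
move=> Oq a a'; have Om : m \in O.
  by rewrite /m -(gez0_abs (ltW m0)) -pmulrn; apply: O_nat.
have Ot : \tr (X *m X^T) \in O.
  have -> : \tr (X *m X^T) = m * 2^-1 * qnorm X.
    by rewrite /qnorm; field; rewrite gt_eqF // m_gt0.
  by do 2!apply: (O_mul O_subring) => //; apply: (O_natV 1).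
apply: (@O_norm_le _ `|X a a'|) => //; apply: (O_sqr O_subring O_convex) => //.
rewrite real_normK ?num_real //; apply: (O_le O_subring O_convex _ (mx_entry_sq_le X a a') Ot).
exact: sqr_ge0.
Qed.

Lemma bdd_nexp_q X : gbF b X -> qnorm X \in O -> bdd (nexp X).
Proof. by move=> gX /qnorm_inO OX; apply: bdd_nexp gX OX. Qed.

Lemma bdd_nexpT_q X : gbF b X -> qnorm X \in O -> bdd (nexp X^T).
Proof.
move=> gX /qnorm_inO OX; apply: (@bdd_nexp (- b)); rewrite ?oppr_eq0 //.
  exact: gbT gX.
exact: inO_tr.
Qed.

Lemma bdd_av t : 0 < t -> t \in O -> t^-1 \in O -> bdd (av iF c W nu t).
Proof.
move=> t0 Ot Ot'; apply: bdd_torus; first exact: tpow_pos.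
move=> b' _; rewrite mon_tpow ?gt_eqF //; exact: (O_expz O_subring).
Qed.

Hypothesis gb_comm : forall X Y, gbF b X -> gbF b Y -> X *m Y = Y *m X.
Hypothesis root_b : exists2 X, gbF b X & X != 0.

(** A root vector Y of the same root commutes with X, so exp(X) a(t) multiplies it by t^2 whatever X
    is, and the inverse multiplies it by t^-2. *)
Lemma bdd_nexp_av X t : gbF b X -> 0 < t -> bdd (nexp X *m av iF c W nu t) ->
  t ^+ 2 \in O /\ t ^- 2 \in O.
Proof.
move=> gX t0 bg; have [Y gY Y0] := root_b; have tn0 : t != 0 by rewrite gt_eqF.
have [wY dY] := (gb_dlie W cc G1 GM Y b0).1 gY.
set g := nexp X *m _ in bg.
have Gg : GF g by apply: GM; [case: gX|apply: G_av].
have E : g *m Y = t ^+ 2 *: (Y *m g).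
  rewrite /g -mulmxA /av (torus_has_weight D wY (gt0_nz (tpow_pos nu t0))).
  rewrite mon_tpow_b // -scalemxAr; congr (_ *: _).
  by rewrite !mulmxA (nexp_comm (gb_comm gY gX)).
have E' : invmx g *m Y = t ^- 2 *: (Y *m invmx g).
  have gU := GU Gg; have t2 : t ^+ 2 != 0 by rewrite expf_neq0.
  have Yg : Y *m g = t ^- 2 *: (g *m Y) by rewrite E scalerA mulVf // scale1r.
  have -> : invmx g *m Y = invmx g *m (Y *m g) *m invmx g.
    by rewrite (mulmxA (invmx g) Y g) mulmxK.
  by rewrite Yg -scalemxAr -scalemxAl mulKmx.
split; first by apply: (bdd_scale Gg bg dY Y0 _ E); rewrite sqr_ge0.
apply: (bdd_scale (GI Gg) (bddV Gg bg) dY Y0 _ E').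
by rewrite invr_ge0 sqr_ge0.
Qed.

End Root.
End Bounded.

(** * Points of the building *)

Section MatrixGroupsTheory.
Variables (L : fieldType) (n : nat).

Lemma generated_group (A H : set 'M[L]_n) : mx_group H -> A `<=` H ->
  mx_group (generated_mx A) /\ generated_mx A `<=` H.
Proof.
move=> gH AH; have sub : generated_mx A `<=` H by move=> g; apply.
split=> //; have [HU _ _ _] := gH; split.
- by move=> g /sub; apply: HU.
- by move=> H' [_ H'1 _ _] _.
- move=> g h Gg Gh H' gH' AH'; have [_ _ HM _] := gH'.
  by apply: HM; [apply: Gg|apply: Gh].
by move=> g Gg H' gH' AH'; have [_ _ _ HV] := gH'; apply: HV; apply: Gg.
Qed.

Lemma bactM (g h : 'M[L]_n) p :
  [set g *m x *m g^T | x in [set h *m x *m h^T | x in p]] =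
  [set (g *m h) *m x *m (g *m h)^T | x in p].
Proof.
apply/seteqP; split=> y.
  by move=> [_ [x px <-] <-]; exists x => //; rewrite trmx_mul !mulmxA.
move=> [x px <-]; exists (h *m x *m h^T); first by exists x.
by rewrite trmx_mul !mulmxA.
Qed.

Lemma orth_quotient (g h : 'M[L]_n) : h \in unitmx -> g *m g^T = h *m h^T ->
  (invmx h *m g) *m (invmx h *m g)^T = 1%:M.
Proof.
move=> hU E; rewrite trmx_mul -mulmxA (mulmxA g) E !mulmxA mulVmx // mul1mx.
by rewrite -trmx_mul mulVmx // trmx1.
Qed.

End MatrixGroupsTheory.

(** Each factor is between 1 and the product, so convexity passes boundedness from the product to
    the factors. *)
Lemma prod_ge1_bounded (F : rcfType) (O : {pred F}) (O_subring : GRing.subring_closed O)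
    (O_convex : order_convex O) (I : eqType) (s : seq I) (f : I -> F) :
  (forall j, j \in s -> 1 <= f j) ->
  1 <= \prod_(j <- s) f j /\
  (\prod_(j <- s) f j \in O <-> forall j, j \in s -> f j \in O).
Proof.
elim: s => [|j s IHs] Hf.
  by rewrite big_nil lexx; split=> //; split=> // _; apply: (O_one O_subring).
have [Hp IH] := IHs (fun l ls => Hf l (@mem_behead _ (j :: s) l ls)).
have fj : 1 <= f j by apply: Hf; rewrite mem_head.
have f0 : 0 <= f j by apply: le_trans fj.
have p0 : 0 <= \prod_(l <- s) f l by apply: le_trans Hp.
rewrite big_cons; split; first exact: le_trans fj (ler_peMr f0 Hp).
split=> [Op l|H]; last first.
  apply: (O_mul O_subring); first by apply: H; rewrite mem_head.
  by apply/IH => l ls; apply: H; rewrite inE ls orbT.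
rewrite inE => /orP[/eqP->|ls].
  by apply: (O_le O_subring O_convex f0 _ Op); apply: ler_peMr.
have /IH -> // : \prod_(l <- s) f l \in O.
by apply: (O_le O_subring O_convex p0 _ Op); apply: ler_peMl.
Qed.

(** The inverse of x lies in [O] since it is at most 1, so x is a unit as soon as it is in [O]. *)
Lemma neg_val_unit (F : rcfType) (O : {pred F}) (O_subring : GRing.subring_closed O)
    (O_convex : order_convex O) x : 1 <= x ->
  neg_val_O O x = Lambda0 O <-> x \in O.
Proof.
move=> x1; have x0 : 0 < x by apply: lt_le_trans x1.
have xV : x^-1 \in O.
  apply: (O_le O_subring O_convex _ _ (O_one O_subring)).
    by rewrite invr_ge0 ltW.
  by rewrite invf_le1.
have u1 : unit_set O 1 by split; rewrite ?invr1 ?oner_eq0 //; apply: (O_one O_subring).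
split=> [E|Ox].
  have : neg_val_O O x x^-1 by exists 1; rewrite ?mulr1.
  by rewrite E => -[u [_ Ou _]]; rewrite mul1r => Eu; rewrite Eu invrK in Ou.
have xn0 : x != 0 by rewrite gt_eqF.
apply/seteqP; split=> _ [u [Ou Ou' u0] <-].
  exists (x^-1 * u); last by rewrite mul1r.
  split; [exact: (O_mul O_subring)|rewrite invfM invrK; exact: (O_mul O_subring)|].
  by rewrite mulf_neq0 ?invr_eq0.
exists (x * u); last by rewrite mulKf // mul1r.
by split; [exact: (O_mul O_subring)|rewrite invfM; exact: (O_mul O_subring)|rewrite mulf_neq0].
Qed.

(** * Stabilizers in the building *)

Section Building.
Variables (K : rcfType) (C : numClosedFieldType) (toC : {rmorphism K -> C}).
Variables (n : nat) (P Q : seq (entry_poly K n)).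
Hypothesis G_group : cgroup toC P.
Hypothesis G_self_adjoint : forall g, zeros toC P g -> zeros toC P g^T.
Hypothesis S_torus : cmaximal toC P Q.
Hypothesis S_symmetric : forall s, zeros toC Q s -> s = s^T.
Variables (d : nat) (c : 'M[K]_n) (W : 'M[int]_(n, d)) (B : 'M[int]_(d, n)).
Hypothesis D : torus_data c W B.
Hypothesis QT : zeros toC Q = zeros toC (torus_eqs c W B).
Variables (R : realType) (iR : {rmorphism K -> R}).

Variables (F : rcfType) (iF : {rmorphism K -> F}).
Local Notation rep := (rep (Q := Q) (iR := iR) c W).
Local Notation GF := (zeros iF P).
Local Notation T := (torus iF c W).
Local Notation gbF := (gb P c W iF).
Let cc : c *m c^T = 1%:M. Proof. by case: D. Qed.
Let G1 := G_one G_group iF.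
Let GM := @G_mul _ _ _ toC P G_group _ iF.
Let GU := @G_unit _ _ _ toC P G_group _ iF.
Let GI := @G_inv _ _ _ toC P G_group _ iF.
Let GT := @G_tr _ _ _ toC P G_self_adjoint _ iF.
Let GA (x : 'rV[F]_d) : nz x -> GF (T x).
Proof. by move=> nzx; rewrite torusE; apply: (A_sub_G S_torus D QT). Qed.
Let GTx (x : 'rV[F]_d) : pos_row x -> GF (T x).
Proof. by move=> x0; apply: GA; apply: gt0_nz. Qed.

Variable O : {pred F}.
Hypothesis O_subring : GRing.subring_closed O.
Hypothesis O_convex : order_convex O.
Local Notation bdd := (bdd P iF O).
Variable Delta : seq (dual_a iR Q).
Hypothesis reduced : reduced_roots iR P Q.
Hypothesis chi_torus : forall (alpha : dual_a iR Q) b x, rep alpha b -> pos_row x ->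
  chi iF alpha (T x) = mon x b.

Variable bs : seq 'rV[int]_d.
Hypothesis bs_Delta : forall beta, beta \in Delta -> exists2 b, b \in bs & rep beta b.
Hypothesis kak : forall h, GF h -> exists2 k, GF k /\ k *m k^T = 1%:M &
  exists x : 'rV[F]_d, [/\ pos_row x, k *m (h *m h^T) *m k^T = tmat c iF (tw W x) &
    forall b, b \in bs -> 1 <= mon x b].

Let bdM g h (Gg : GF g) (Gh : GF h) (bg : bdd g) (bh : bdd h) : bdd (g *m h) :=
  bddM G_group Gg Gh bg bh.
Let bdV g (Gg : GF g) (bg : bdd g) : bdd (invmx g) :=
  bddV G_group G_self_adjoint S_torus D QT O_subring O_convex kak Gg bg.
Let bdO k (kk : k *m k^T = 1%:M) : bdd k := bdd_orth O_subring O_convex kk.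
Let mid := @orth_bdd_mid _ _ _ _ _ G_group G_self_adjoint F iF O O_subring O_convex.

(** All factors are at least 1, so N is a unit exactly when every root value and its inverse lie in
    [O], that is, when [T x] preserves the integral Lie algebra. *)
Lemma N_torus x : pos_row x ->
  neg_val_O O (N_F iR iF P Q (T x)) = Lambda0 O <-> bdd (T x).
Proof.
move=> x0; have fin := finite_roots G_group D QT iR.
pose s := fset_set (root_system (iR := iR) (Q := Q) P).
pose f (beta : dual_a iR Q) := Num.max (chi iF beta (T x)) (chi iF beta (T x))^-1.
have NE : N_F iR iF P Q (T x) = \prod_(beta <- finmap.enum_fset s) f beta.
  by rewrite /N_F (fsbig_finite _ _ fin).
have rE beta : beta \in finmap.enum_fset s -> root_system P beta.
  by move=> bs'; apply: set_mem; rewrite -(in_fset_set fin).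
have fE beta b : rep beta b -> f beta = Num.max (mon x b) (mon x b)^-1.
  by move=> Hr; rewrite /f (chi_torus Hr x0).
have [] := @prod_ge1_bounded F O O_subring O_convex _ (finmap.enum_fset s) f.
  move=> beta /rE/(root_rep G_group D QT)[b [_ _ Hr _]]; rewrite (fE _ _ Hr) le_max.
  have [//|m1] := leP 1 (mon x b); rewrite /= invf_ge1 ?(ltW m1) //.
  exact: mon_pos.
move=> N1 NO; rewrite NE (neg_val_unit O_subring O_convex N1) NO; split=> [H|bT beta /rE rb].
  apply: (bdd_torus G_group S_torus D QT O_subring O_convex x0) => b [b0 [X gX X0]].
  have [beta rb Hr] := gb_rootF G_group D QT iR b0 gX X0.
  have bs' : beta \in finmap.enum_fset s := etrans (in_fset_set fin beta) (mem_set rb).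
  have := H _ bs'; rewrite (fE _ _ Hr); apply: (O_le O_subring O_convex).
    by rewrite ltW // mon_pos.
  by rewrite le_max lexx.
have [b [_ b0 Hr [X gX X0]]] := root_rep G_group D QT rb.
have [Y gY Y0] := gb_nonzero G_group iF gX X0.
have rF : rootF P c W iF b by split=> //; exists Y.
have H1 := bdd_torus_mon G_group S_torus D QT O_subring O_convex x0 bT rF.
have H2 := bdd_torus_mon G_group S_torus D QT O_subring O_convex x0 bT
  (rootFN G_self_adjoint rF).
by rewrite (fE _ _ Hr) maxEle; case: ifP => _ //; rewrite -monN.
Qed.

(** The Cartan decomposition shows that the description of [delta_F] is satisfied. Every a that
    satisfies it is bounded together with h, orthogonal factors being bounded, and [N_torus] turns
    this into distance 0. *)
Lemma base_pointE : base_point iF P O Delta = [set h *m h^T | h in [set h | GF h /\ bdd h]].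
Proof.
have key h : GF h -> dist_F iF P O Delta 1%:M (h *m h^T) = Lambda0 O <-> bdd h.
  move=> Gh; rewrite /dist_F /delta_F; set S := [set a | _].
  have [k [k' [x [[Gk kk] [Gk' kk'] x0 E Hx]]]] :=
    kak_decomposition G_group S_torus D QT kak Gh.
  have SE : exists a, S a.
    exists (T x); split.
      split; first by apply/(A_pointsP D QT iF); exists x => //; rewrite torusE.
      by move=> beta /bs_Delta[b bb Hr]; rewrite (chi_torus Hr x0); apply: Hx.
    have kT : k^T *m k^T^T = 1%:M by rewrite trmxK; apply: mulmx1C.
    exists 1%:M, h; split; [exact: G1|exact: Gh|by rewrite trmx1 mulmx1|by []|].
    have -> : invmx 1%:M *m h = h by rewrite -[invmx _]mul1mx mulmxV ?unitmx1 // mul1mx.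
    exists (k^T *m T x); last first.
      exists k'; last by rewrite E.
      by split; [exact: Gk'|split; [exact: kk'|exact: (G_det G_group Gk')]].
    exists k^T; last by exists (T x).
    by split; [exact: GT|split; [exact: kT|exact: (G_det G_group (GT Gk))]].
  have := @xgetPex _ 1%:M S SE; move: (xget _ _) => a.
  move=> [[/(A_pointsP D QT iF)[y y0 Ea] _] [g [h' [Gg Gh' Eg Eh Hm]]]].
  rewrite -torusE in Ea; rewrite {a}Ea in Hm *.
  case: Hm => _ [k1 [Gk1 [kk1 _]] [_ -> <-]] [k2 [Gk2 [kk2 _]] Ek].
  rewrite (N_torus y0); apply: iff_sym.
  (* The representatives in the description may differ from 1 and h, but only by orthogonal factors
     on the right. *)
  have o := orth_quotient (GU Gh') Eh.
  have gk : (g *m k1)^T *m (g *m k1)^T^T = 1%:M.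
    apply: mulmx1C; rewrite trmxK trmx_mul -mulmxA (mulmxA k1) kk1 mul1mx.
    by rewrite -Eg.
  have ko : (k2 *m (invmx h' *m h)) *m (k2 *m (invmx h' *m h))^T = 1%:M.
    by rewrite trmx_mul -mulmxA (mulmxA (invmx h' *m h)) o mul1mx.
  apply: (mid (GT (GM Gg Gk1)) (GM Gk2 (GM (GI Gh') Gh)) (GTx y0) gk ko).
  rewrite trmxK -(mulmxA g) !(mulmxA _ k2) -(mulmxA g).
  rewrite (_ : g *m (k1 *m T y *m k2) = h') ?mulKVmx ?GU //.
  by rewrite Ek mulKVmx // GU.
apply/seteqP; split=> y.
  by move=> [[h Gh <-] /(key h Gh) bh]; exists h.
by move=> [h [Gh bh] <-]; split; [exists h|apply/(key h Gh)].
Qed.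

(** If h fixes the base point, then h h^T = u u^T for a bounded u, and h differs from u by an
    orthogonal factor. *)
Lemma bact_base h : GF h ->
  bact h (base_point iF P O Delta) = base_point iF P O Delta <-> bdd h.
Proof.
move=> Gh; rewrite base_pointE /bact; split=> [E|bh].
  have : [set h *m x *m h^T | x in [set h *m h^T | h in [set h | GF h /\ bdd h]]]
      (h *m h^T).
    exists 1%:M; last by rewrite mulmx1.
    exists 1%:M; last by rewrite trmx1 mulmx1.
    by split; [exact: G1|apply: bdO; rewrite trmx1 mulmx1].
  rewrite E => -[u [Gu bu] Eu]; have o := orth_quotient (GU Gu) (esym Eu).
  rewrite -(mulKVmx (GU Gu) h).
  exact: (bdM Gu (GM (GI Gu) Gh) bu (bdO o)).
have sub g : GF g -> bdd g -> [set g *m x *m g^T |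
    x in [set h *m h^T | h in [set h | GF h /\ bdd h]]] `<=`
    [set h *m h^T | h in [set h | GF h /\ bdd h]].
  move=> Gg bg _ [_ [u [Gu bu] <-] <-]; exists (g *m u).
    by split; [exact: GM|exact: (bdM Gg Gu bg bu)].
  by rewrite trmx_mul !mulmxA.
apply/seteqP; split; first exact: sub.
move=> y Hy; have := sub _ (GI Gh) (bdV Gh bh); move=> /(_ (invmx h *m y *m (invmx h)^T)).
move=> H; exists (invmx h *m y *m (invmx h)^T); first by apply: H; exists y.
rewrite !mulmxA mulmxV ?GU // mul1mx -mulmxA -trmx_mul mulmxV ?GU //.
by rewrite trmx1 mulmx1.
Qed.

Lemma bact_point g x : GF g -> pos_row x ->
  bact g (bact (T x) (base_point iF P O Delta)) = bact (T x) (base_point iF P O Delta) <->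
  fixes iF c W bdd x g.
Proof.
move=> Gg x0; have TU := GU (GTx x0); rewrite /fixes.
rewrite -(bact_base (GM (GM (GI (GTx x0)) Gg) (GTx x0))).
have can p : bact (invmx (T x)) (bact (T x) p) = p.
  rewrite /bact bactM mulVmx //; apply/seteqP; split=> y.
    by move=> [z pz <-]; rewrite trmx1 mulmx1 mul1mx.
  by move=> py; exists y => //; rewrite trmx1 mulmx1 mul1mx.
have E : bact (invmx (T x) *m g *m T x) (base_point iF P O Delta) =
    bact (invmx (T x)) (bact g (bact (T x) (base_point iF P O Delta))).
  by rewrite /bact !bactM.
rewrite E; split=> [->|H]; first exact: can.
have : bact (T x) (bact (invmx (T x)) (bact g (bact (T x) (base_point iF P O Delta)))) =
    bact (T x) (base_point iF P O Delta) by rewrite H.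
by rewrite /bact !bactM mulmxV // mul1mx.
Qed.

(** The abstract rank one datum is realized by the root space over [F], the form [qnorm] and the
    stabilizer [bdd] of the base point; a cycle of three inclusions gives both equalities. *)
Lemma stabilizer_product (alpha : dual_a iR Q) (alpha_root : root_system P alpha)
    (Omega : set (set 'M[F]_n)) (Omega_sub : Omega `<=` std_apartment iF P O Delta)
    (Omega_nonempty : Omega !=set0) (Omega_finite : finite_set Omega) :
  let L := rank_one_group iF P alpha in
  let N := normalizer_mx (G_F iF P) (A_F iF Q) `&` L in
  let U_Omega := fun beta : dual_a iR Q =>
    pointwise_stab (root_group iF P beta) Omega in
  let N_Omega := pointwise_stab N Omega in
  pointwise_stab L Omega =
    generated_mx (U_Omega alpha `|` U_Omega (- alpha) `|` N_Omega) /\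
  generated_mx (U_Omega alpha `|` U_Omega (- alpha) `|` N_Omega) =
    mulset (mulset (U_Omega alpha) (U_Omega (- alpha))) N_Omega.
Proof.
move=> L N U_Omega N_Omega.
have [b [_ b0 Hr [X1 gX1 X10]]] := root_rep G_group D QT alpha_root.
have Nb0 : - b != 0 by rewrite oppr_eq0.
have [Xa gXa Xa0] := gb_nonzero G_group iF gX1 X10.
have [nu [bnu m0 Hq]] := corootF G_group G_self_adjoint S_torus S_symmetric D QT iF alpha_root Hr.
have alphaN : root_system P (- alpha).
  have X1T : X1^T != 0 by rewrite trmx_eq0.
  apply: (rep_root G_group D QT (repN Hr) Nb0 _ X1T).
  exact: (gbT (@G_tr _ _ _ toC P G_self_adjoint _ iR) gX1).
have UE := root_groupE G_group D QT iF reduced alpha_root Hr.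
have UNE : root_group iF P (- alpha) = [set nexp X^T | X in gbF b].
  rewrite (root_groupE G_group D QT iF reduced alphaN (repN Hr)); apply/seteqP.
  split=> _ [X gX <-]; exists X^T; rewrite ?trmxK //; [exact: (gbTK GT gX)|].
  exact: (gbT GT gX).
have comm X Y (gX : gbF b X) (gY : gbF b Y) := gb_commF G_group D QT reduced alpha_root Hr gX gY.
have wgt X : gbF b X -> has_weight iF c W b X by case.
have gG X : gbF b X -> GF (nexp X) by case.
have gTG X : gbF b X -> GF (nexp X^T) by move=> gX; rewrite -nexp_tr; apply: GT; apply: gG.
have gD X Y (gX : gbF b X) (gY : gbF b Y) := gbD cc G1 GM b0 gX gY.
have gZ t X (gX : gbF b X) := gbZ cc G1 GM t b0 gX.
have conj b' g X : b' != 0 -> GF g -> gbF b X \/ gbF b X^T ->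
    has_weight iF c W b' (g *m X *m invmx g) -> gbF b' (g *m X *m invmx g).
  move=> b'0 Gg [gX|gX] Hw; first exact: (gb_conj cc G1 GM GU GI b'0 Gg gX b0 Hw).
  have gX' : gbF (- b) X by rewrite -[X]trmxK; exact: (gbT GT gX).
  exact: (gb_conj cc G1 GM GU GI b'0 Gg gX' Nb0 Hw).
have Ad g X (Gg : GF g) (gX : gbF b X \/ gbF b X^T) Hw := conj b g X b0 Gg gX Hw.
have AdT g X : GF g -> gbF b X \/ gbF b X^T ->
    has_weight iF c W (- b) (g *m X *m invmx g) -> gbF b (g *m X *m invmx g)^T.
  by move=> Gg gX Hw; apply: (gbTK GT); exact: (conj _ g X Nb0 Gg gX Hw).
have qpos X (gX : gbF b X) (X0 : X != 0) := @qnorm_gt0 n d W F nu m0 X X0.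
have brk X : gbF b X -> X *m X^T - X^T *m X = qnorm W nu X *: hmat iF c W nu by exact: Hq.
have Ggroup : mx_group GF.
  by split; [exact: GU|exact: G1|exact: GM|exact: GI].
have genL : L = generated_mx ([set nexp X | X in gbF b] `|` [set nexp X^T | X in gbF b]).
  by rewrite /L /rank_one_group UE UNE.
have [Lgroup LG] : mx_group L /\ L `<=` GF.
  rewrite genL; apply: generated_group Ggroup _.
  by move=> _ [[X gX <-]|[X gX <-]]; [exact: gG|exact: gTG].
have [LU L1 LM LI] := Lgroup.
have UL X : gbF b X -> L (nexp X).
  by move=> gX; rewrite genL => H _; apply; left; exists X.
have UTL X : gbF b X -> L (nexp X^T).
  by move=> gX; rewrite genL => H _; apply; right; exists X.
have /finite_seqP[s Es] := Omega_finite.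
(* A torus parameter is chosen for each point of [Omega], with the default 0 elsewhere. *)
have [xi Hxi] : exists xi : set 'M[F]_n -> 'rV[F]_d, forall p, p \in s ->
    pos_row (xi p) /\ p = bact (T (xi p)) (base_point iF P O Delta).
  have ex p : exists x : 'rV[F]_d, p \in s -> pos_row x /\
      p = bact (T x) (base_point iF P O Delta).
    have [ps|nps] := boolP (p \in s); last by exists 0.
    have : Omega p by rewrite Es.
    move=> /Omega_sub[a /(A_pointsP D QT iF)[x x0 ->] <-]; exists x => _.
    by rewrite torusE.
  by have [xi Hxi] := choice ex; exists xi.
(* Nonemptiness supplies the head of the list, which the extreme root values require. *)
have [p0 [s' sE]] : exists p0 s', s = p0 :: s'.
  case: Omega_nonempty => p; rewrite Es /=; case: (s) => // p0 s' _.
  by exists p0, s'.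
have pts_pos x : x \in xi p0 :: map xi s' -> pos_row x.
  by rewrite -map_cons -sE => /mapP[p ps ->]; case: (Hxi p ps).
have fixP g : GF g -> (forall p, Omega p -> bact g p = p) <->
    (forall x, x \in xi p0 :: map xi s' -> fixes iF c W bdd x g).
  move=> Gg; rewrite -map_cons -sE; split=> [H x /mapP[p ps ->]|H p].
    have [x0 Ep] := Hxi p ps; apply/(bact_point Gg x0); rewrite -Ep; apply: H.
    by rewrite Es.
  rewrite Es => /= ps; have [x0 Ep] := Hxi p ps; rewrite Ep.
  by apply/(bact_point Gg x0); apply: H; apply: map_f.
have stab_group (H : set 'M[F]_n) : mx_group H -> mx_group (pointwise_stab H Omega).
  move=> [HU H1 HM HI]; split.
  - by move=> g [Hg _]; apply: HU.
  - split=> // p _; apply/seteqP; split=> y; rewrite /bact.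
      by move=> [z pz <-]; rewrite trmx1 mulmx1 mul1mx.
    by move=> py; exists y => //; rewrite trmx1 mulmx1 mul1mx.
  - move=> g h [Hg fg] [Hh fh]; split; first exact: HM.
    by move=> p Op; rewrite -[RHS](fg p Op) -[in RHS](fh p Op) /bact bactM.
  move=> g [Hg fg]; split; first exact: HI.
  move=> p Op; rewrite -[in LHS](fg p Op) /bact bactM mulVmx; last exact: HU.
  apply/seteqP; split=> y; first by move=> [z pz <-]; rewrite trmx1 mulmx1 mul1mx.
  by move=> py; exists y => //; rewrite trmx1 mulmx1 mul1mx.
have stabL := stab_group L Lgroup.
have reflN e t m : refl iF c W b nu GF e t m -> [set m *m a *m invmx m | a in A_F iF Q] = A_F iF Q.
  move=> Hm; have [Gm _ _ _] := Hm; apply/seteqP; split=> a.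
    move=> [_ /(A_pointsP D QT iF)[x x0 ->] <-]; rewrite -torusE (refl_T D Hm x0).
    rewrite mulmxK ?GU //; apply/(A_pointsP D QT iF); exists (flip b nu e x).
      exact: flip_pos.
    by rewrite torusE.
  move=> /(A_pointsP D QT iF)[x x0 ->]; exists (T (flip b nu e x)).
    apply/(A_pointsP D QT iF); exists (flip b nu e x); first exact: flip_pos.
    by rewrite torusE.
  by rewrite -torusE -(refl_T' D bnu Hm x0) mulmxK // GU.
have sub1 : pointwise_stab L Omega `<=`
    mulset (mulset (U_Omega alpha) (U_Omega (- alpha))) N_Omega.
  move=> g [Lg fg]; have Gg := LG _ Lg.
  have Bg : bruhat iF c W b nu GF (gbF b) g.
    rewrite genL in Lg.
    exact: (bruhat_generated D bnu G1 GM GU GI GT wgt gD gZ comm gG Ad AdT qpos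
      (qnormZ W nu) brk gXa Lg).
  have := stabilizer_decomposition D bnu G1 GM GU GI GT GA wgt gD gZ comm gG Ad AdT qpos
      (qnormZ W nu) brk O_subring O_convex bdM bdV (fun k _ kk => bdO kk)
      (bdd_av G_group S_torus D QT O_subring O_convex nu)
      (bdd_nexp_q D O_subring O_convex bnu m0)
      (bdd_nexpT_q G_self_adjoint D O_subring O_convex bnu m0)
      (bdd_nexp_av G_group G_self_adjoint S_torus D QT O_subring O_convex kak bnu comm
        (ex_intro2 _ _ Xa gXa Xa0)) pts_pos Bg ((fixP g Gg).1 fg).
  move=> [X [Y [e [t [m [gX gY Hm E [fX fY fm]]]]]]].
  have [Gm _ _ _] := Hm; have LX := UL _ gX; have LY := UTL _ gY.
  (* [m] is a quotient of elements of [L], so it belongs to N and not only to the normalizer. *)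
  have Lm : L m.
    have -> : m = invmx (nexp X *m nexp Y^T) *m g.
      by rewrite E mulKmx // LU //; apply: LM.
    exact: (LM _ _ (LI _ (LM _ _ LX LY)) Lg).
  exists (nexp X *m nexp Y^T); last first.
    exists m; last by rewrite E.
    split; last exact: ((fixP m Gm).2 fm).
    by split; [split; [exact: Gm|exact: reflN Hm]|exact: Lm].
  exists (nexp X).
    by split; [rewrite UE; exists X|exact: ((fixP _ (LG _ LX)).2 fX)].
  exists (nexp Y^T) => //.
  by split; [rewrite UNE; exists Y|exact: ((fixP _ (LG _ LY)).2 fY)].
have sub2 : mulset (mulset (U_Omega alpha) (U_Omega (- alpha))) N_Omega `<=`
    generated_mx (U_Omega alpha `|` U_Omega (- alpha) `|` N_Omega).
  move=> _ [_ [u Uu [v Uv <-]] [m Nm <-]] H [_ _ HM _] sub.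
  have Hu : H u by apply: sub; left; left.
  have Hv : H v by apply: sub; left; right.
  have Hm : H m by apply: sub; right.
  exact: (HM _ _ (HM _ _ Hu Hv) Hm).
have sub3 : generated_mx (U_Omega alpha `|` U_Omega (- alpha) `|` N_Omega) `<=`
    pointwise_stab L Omega.
  move=> g; apply=> // h [[[Uh fh]|[Uh fh]]|[[_ Lh] fh]]; split=> //.
    by move: Uh; rewrite UE => -[X gX <-]; apply: UL.
  by move: Uh; rewrite UNE => -[X gX <-]; apply: UTL.
by split; apply/seteqP; split=> //; [move=> g /sub1/sub2|move=> g /sub3/sub1].
Qed.

End Building.

(** * Polynomials that represent the root characters *)

Section RootCharacters.
Variables (K : rcfType) (C : numClosedFieldType) (toC : {rmorphism K -> C}).
Variables (n : nat) (P Q : seq (entry_poly K n)).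
Hypothesis G_group : cgroup toC P.
Hypothesis G_self_adjoint : forall g, zeros toC P g -> zeros toC P g^T.
Hypothesis S_torus : cmaximal toC P Q.
Hypothesis S_symmetric : forall s, zeros toC Q s -> s = s^T.
Variables (d : nat) (c : 'M[K]_n) (W : 'M[int]_(n, d)) (B : 'M[int]_(d, n)).
Hypothesis D : torus_data c W B.
Hypothesis QT : zeros toC Q = zeros toC (torus_eqs c W B).
Variables (R : realType) (iR : {rmorphism K -> R}).

Lemma char_poly_exp (alpha : dual_a iR Q) b : rep c W alpha b ->
  forall H, H \in lie_a iR Q ->
    pval iR (char_poly c B b) (mexp H) = expR (alpha (vsproj (lie_a iR Q) H)).
Proof.
move=> Hr H /(lie_aP D QT iR)[v ->]; rewrite Hr (mexp_Hm D) (char_polyE D) ?mon_expv //.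
by apply: gt0_nz => j; apply: expv_pos.
Qed.

End RootCharacters.

Theorem proposition5p39
    (K F : rcfType) (R : realType)
    (iR : {rmorphism K -> R}) (iF : {rmorphism K -> F})
    (O : {pred F})
    (O_subring : GRing.subring_closed O)
    (O_convex : order_convex O)
    (O_proper : exists a, a \notin O)
    (n : nat) (P Q : seq (entry_poly K n))
    (G_group : algebraic_subgroup_SL P)
    (G_connected : zariski_connected (geom P))
    (G_semisimple : semisimple_mx P)
    (G_self_adjoint : self_adjoint P)
    (S_torus : maximal_split_torus P Q)
    (S_symmetric : forall s, geom Q s -> s = s^T)
    (Delta : seq (dual_a iR Q))
    (Delta_basis : root_basis P Delta)
    (Sigma_reduced : reduced_roots iR P Q)
    (alpha : dual_a iR Q) (alpha_root : root_system P alpha)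
    (Omega : set (set 'M[F]_n))
    (Omega_sub : Omega `<=` std_apartment iF P O Delta)
    (Omega_nonempty : Omega !=set0)
    (Omega_finite : finite_set Omega) :
  let L := rank_one_group iF P alpha in
  let N := normalizer_mx (G_F iF P) (A_F iF Q) `&` L in
  let U_Omega := fun beta : dual_a iR Q =>
    pointwise_stab (root_group iF P beta) Omega in
  let N_Omega := pointwise_stab N Omega in
  pointwise_stab L Omega =
    generated_mx (U_Omega alpha `|` U_Omega (- alpha) `|` N_Omega) /\
  generated_mx (U_Omega alpha `|` U_Omega (- alpha) `|` N_Omega) =
    mulset (mulset (U_Omega alpha) (U_Omega (- alpha))) N_Omega.
Proof.
(* The hypotheses of the statement are the instances at [K[i]] of the notions used above, so they
   apply by conversion. *)
pose C : numClosedFieldType := K[i].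
pose toC : {rmorphism K -> C} := real_complex K.
have Gg : cgroup toC P := G_group.
have Gs : forall g, zeros toC P g -> zeros toC P g^T := G_self_adjoint.
have Sm : cmaximal toC P Q := S_torus.
have Ss : forall s, zeros toC Q s -> s = s^T := S_symmetric.
have [Sq _ _] := Sm.
have [d [c [W [B [D QT]]]]] := split_torus_exists Sq Ss.
have [bs [bsD kak]] := kakF Gg Gs Sm Ss D QT iF Delta_basis.
have chi_torus (gamma : dual_a iR Q) b x : rep c W gamma b -> pos_row x ->
    chi iF gamma (torus iF c W x) = mon x b.
  move=> Hr x0; rewrite torusE /chi.
  apply: (chiE D QT iF Hr _ _ x0) => [|p [_ Hp]]; last exact: Hp.
  have [ne0 mul] := char_polyM D toC b.
  split; last exact: (char_poly_exp D QT Hr).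
  by split=> [s|s s']; rewrite /geom -/toC QT; [exact: ne0|exact: mul].
refine (stabilizer_product Gg Gs Sm Ss D QT O_subring O_convex Sigma_reduced
  chi_torus bsD kak alpha_root Omega_sub Omega_nonempty Omega_finite).
Qed.
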